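(* Let $\mathbb{K}$ be a number field with ring of integers $\mathfrak{o}$, and let $f(X)\in\mathfrak{o}[X]$ be a polynomial with at least 3 distinct roots and for which $0$ is not periodic. Then there exists an effectively computable constant $c_6(\mathbb{K},f)>0$ such that, letting $$k(m,\alpha)=\left\lfloor c_6(\mathbb{K},f)\log\lambda\left(f^{(m)}(\alpha)\right)\right\rfloor,$$ for every integer $m>0$ and every $\alpha\in\mathfrak{o}$ with $f^{(m)}(\alpha)$ not a unit, there exists a prime ideal $\mathbf{p}$ of $\mathfrak{o}$ that divides $f^{(m)}(\alpha)$ but does not divide any element of the set $$\{f^{(\max(0,m-k(m,\alpha)))}(\alpha),\ f^{(\max(0,m-k(m,\alpha))+1)}(\alpha),\ \dots,\ f^{(m-1)}(\alpha)\}.$$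
   Context: $f^{(n)}$ is the $n$th iterate of $f$ ($f^{(0)}(X)=X$); ''$0$ is not periodic'' means $f^{(k)}(0)\ne0$ for all $k\ge1$. $h$ is the absolute logarithmic Weil height, $\log^*x=\max\{\log x,1\}$ and $\lambda(\beta)=\log^*h(\beta)$. *)

(* Defs.v *)
From HB Require Import structures.
From mathcomp Require Import all_boot all_order all_algebra all_field.
From mathcomp Require Import complex finmap.
From mathcomp Require Import all_classical all_reals.
From mathcomp Require Import exp.
Set Implicit Arguments.
Unset Strict Implicit.
Unset Printing Implicit Defensive.
Import Order.TTheory GRing.Theory Num.Theory.
Local Open Scope classical_set_scope.
Local Open Scope ring_scope.

(** * Ring of integers of a number field and its ideals

    A number field is a [K : fieldExtType rat]; its ring of integers and the
    ideals of that ring are represented as subsets of [K]. *)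

Section Integers.
Variable K : fieldExtType rat.
Implicit Types (P Q : set K) (x y : K).

Definition ring_of_integers : set K :=
  [set x | integralOver (intr : int -> K) x].

Local Notation "'𝔬'" := ring_of_integers.

Definition is_unit x := 𝔬 x /\ exists2 y, 𝔬 y & x * y = 1.

Definition is_ideal P :=
  [/\ P `<=` 𝔬, P 0, forall x y, P x -> P y -> P (x + y)
    & forall a x, 𝔬 a -> P x -> P (a * x)].

(* As usual in a Dedekind domain, prime ideals are nonzero. *)
Definition prime_ideal P :=
  [/\ is_ideal P, exists2 x, P x & x != 0, ~ P 1
    & forall x y, 𝔬 x -> 𝔬 y -> P (x * y) -> P x \/ P y].

Definition ideal_mul P Q : set K :=
  [set z | exists n (x y : 'I_n -> K),
     [/\ forall i, P (x i), forall i, Q (y i) & z = \sum_(i < n) x i * y i]].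

Definition principal_ideal x : set K := [set a * x | a in 𝔬].

Definition ideal_divides P x :=
  exists2 Q, is_ideal Q & principal_ideal x = ideal_mul P Q.

Definition ideal_exp P (n : nat) : set K := iter n (ideal_mul P) 𝔬.

(* The number of cosets of P in the ring of integers. *)
Definition ideal_norm P : nat :=
  #|` fset_set [set [set x | P (x - a)] | a in 𝔬]|.

Definition exactly_divides P (i : nat) x :=
  ideal_exp P i x /\ ~ ideal_exp P i.+1 x.

(* The P-adic valuation of a nonzero x, read off from any way of writing x as
   a quotient of integers; the default value 0 is only used for x = 0. *)
Definition valuation P x : int :=
  xget 0 [set v | exists a b (i j : nat),
    [/\ 𝔬 a, 𝔬 b, b != 0 & x = a / b] /\
    [/\ exactly_divides P i a, exactly_divides P j b & v = i%:Z - j%:Z]].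

(** * Absolute logarithmic Weil height *)

Variable R : realType.

(* |x|_v ^ [K_v : Q_v] for the place v of K attached to P. *)
Definition padic_abs P x : R :=
  if x == 0 then 0 else (ideal_norm P)%:R ^ (- valuation P x).

Definition embeddings : set (K -> R[i]) :=
  [set s | exists g : {rmorphism K -> R[i]}, s = g :> (K -> R[i])].

(* 1/[K:Q] * sum over the places v of [K_v : Q_v] log max(1, |x|_v).  The first
   sum ranges over all complex embeddings, so that a complex place is counted
   twice, i.e. with its local degree. *)
Definition height x : R :=
  (\dim {:K})%:R^-1 *
  (\sum_(s \in embeddings) ln (Num.max 1 (Normc.normc (s x))) +
   \sum_(P \in prime_ideal) ln (Num.max 1 (padic_abs P x))).

(* [ln 0 = 0] here, so that [log_star 0 = 1] as it should. *)
Definition log_star (t : R) : R := Num.max (ln t) 1.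

Definition lambda x : R := log_star (height x).

End Integers.

(** * Polynomials *)

Definition poly_iter (A : comNzRingType) (f : {poly A}) (n : nat) : {poly A} :=
  iter n (fun p => f \Po p) 'X.

Definition zero_not_periodic (A : comNzRingType) (f : {poly A}) :=
  forall k : nat, (0 < k)%N -> (poly_iter f k).[0] <> 0.

(* The roots are taken in an extension field. *)
Definition at_least_n_distinct_roots (n : nat) (F : fieldType) (f : {poly F}) :=
  exists (L : fieldExtType F) (rs : seq L),
    [/\ uniq rs, (n <= size rs)%N & all (root (map_poly (in_alg L) f)) rs].

Definition integral_coefs (K : fieldExtType rat) (f : {poly K}) :=
  forall i : nat, ring_of_integers f`_i.

Definition admissible (K : fieldExtType rat) (f : {poly K}) :=
  [/\ integral_coefs f, at_least_n_distinct_roots 3 f & zero_not_periodic f].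

(** * Effective computability

    Algorithms are partial recursive functions in Kleene's sense. *)

Inductive murec : Type :=
| mr_zero
| mr_succ
| mr_proj of nat
| mr_comp of murec & seq murec
| mr_rec of murec & murec
| mr_min of murec.

(* [mr_eval e v y] : the program e halts on the arguments v with output y. *)
Inductive mr_eval : murec -> seq nat -> nat -> Prop :=
| ev_zero v : mr_eval mr_zero v 0%N
| ev_succ v : mr_eval mr_succ v (head 0 v).+1
| ev_proj i v : mr_eval (mr_proj i) v (nth 0 v i)
| ev_comp g hs v w y :
    mr_evals hs v w -> mr_eval g w y -> mr_eval (mr_comp g hs) v y
| ev_rec0 g h v y : mr_eval g v y -> mr_eval (mr_rec g h) (0%N :: v) y
| ev_recS g h n v z y :
    mr_eval (mr_rec g h) (n :: v) z -> mr_eval h [:: n, z & v] y ->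
    mr_eval (mr_rec g h) (n.+1 :: v) y
| ev_min g v n :
    mr_eval g (n :: v) 0%N ->
    (forall i, (i < n)%N -> exists y, mr_eval g (i :: v) y.+1) ->
    mr_eval (mr_min g) v n
with mr_evals : seq murec -> seq nat -> seq nat -> Prop :=
| evs_nil v : mr_evals [::] v [::]
| evs_cons h hs v y w :
    mr_eval h v y -> mr_evals hs v w -> mr_evals (h :: hs) v (y :: w).

Definition code_int (z : int) : nat :=
  match z with Posz n => n.*2 | Negz n => n.*2.+1 end.

Definition code_rat (q : rat) : nat :=
  CodeSeq.code [:: code_int (numq q); code_int (denq q)].

Definition code_poly (p : {poly rat}) : nat := CodeSeq.code (map code_rat p).

Definition code_input (p : {poly rat}) (cs : seq {poly rat}) : nat :=
  CodeSeq.code [:: code_poly p; CodeSeq.code (map code_poly cs)].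

(* The finite data by which (K, f) is given to an algorithm: the minimal
   polynomial p over Q of a primitive element t of K, and polynomial expressions
   in t for the coefficients of f. *)
Definition presents (K : fieldExtType rat) (f : {poly K})
    (p : {poly rat}) (cs : seq {poly rat}) :=
  exists t : K,
    [/\ <<1; t>>%VS = fullv, minPoly 1 t = map_poly (in_alg K) p
      & f = Poly [seq (map_poly (in_alg K) c).[t] | c <- cs]].

(* c(K, f) is a nonnegative computable real, uniformly in (K, f) in the domain
   D: one algorithm outputs, from any presentation of (K, f) and any n, the
   numerator of a dyadic approximation of c(K, f) with error at most 2^-n. *)
Definition effectively_computable (R : realType)
    (D : forall K : fieldExtType rat, {poly K} -> Prop)
    (c : forall K : fieldExtType rat, {poly K} -> R) :=
  exists e : murec, forall (K : fieldExtType rat) (f : {poly K}), D K f ->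
  forall p cs, presents f p cs -> forall n : nat,
  exists2 a : nat, mr_eval e [:: code_input p cs; n] a
    & `|c K f - a%:R / 2 ^+ n| <= 2 ^- n.

(* Main.v *)
Require Import Defs.
From HB Require Import structures.
From mathcomp Require Import all_boot all_order all_algebra all_fingroup all_field.
From mathcomp Require Import complex.
From mathcomp Require Import all_classical all_reals.
From mathcomp Require Import exp.
From mathcomp Require Import zify ring lra.
Set Implicit Arguments.
Unset Strict Implicit.
Unset Printing Implicit Defensive.
Import Order.TTheory GRing.Theory Num.Theory.
Local Open Scope classical_set_scope.
Local Open Scope ring_scope.

(** If every prime dividing [gamma = f^(m)(alpha)] also divides one of the [k]
    preceding iterates, then, as [f^(i)(beta)] and [f^(i)(0)] are congruent
    modulo [beta], every such prime divides the nonzero number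
    [s = f(0) f^(2)(0) ... f^(k)(0)], so [gamma] divides a power of [s].  Up to
    bounded factors, the differences [y1] and [y2] of [f^(m-1)(alpha)] with two
    roots of [f] then divide powers of [s] too, while [y1 - y2] is bounded.
    The norm of [s] is at most doubly exponential in [k].  Rounding
    the exponents of the primes of [s], a power of [y1 / y2] of bounded exponent
    is, up to factors of small height, a large power of some [c], which the
    pigeonhole principle makes close to [1]; Siegel's lemma, a zero estimate
    and the product formula then bound the height of [y1] and [y2], which is
    the Thue-Siegel argument made effective.
    Hence the height of [gamma] is at most doubly exponential in [k].

    The constant only depends on the least [b] bounding the degrees of [K] and
    [f], the coefficients of an integral polynomial killing some generator of
    [K], and those of polynomials killing the coefficients of [f].  This [b] is
    found by search.  A relation between integral elements is decided modulo
    the integer [m = pt(B)], where [pt] is the minimal polynomial of an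
    integral generator [tt] and [B] is large: [B - tt] divides [m], so
    [rho(tt) = 0] if and only if [m] divides [rho(B)] once [B] exceeds the
    conjugates of [rho(tt)]. *)

(** The exponent [e] with which [gamma] divides [s^e] is unbounded, so no estimate may depend on it.
    Dividing the prime exponents of [y^q] by [N0] and rounding up costs at most one factor of each
    prime of [s], and a small element of the resulting ideal plays the part of the class group and
    of the units.

    At the place where [Y], the largest conjugate of [y1] and [y2], is attained, [u = y1 / y2] is
    within a constant times [1 / Y] of [1]. The auxiliary numbers combine the terms
    [c^(r (l + 1) - j) / u^(l + 1)]. As [c^N0] is about [u^d] and [N0] about [d r], the exponents
    nearly cancel in the [N0]-th powers of these terms, which involve [y1] and [y2] only to
    exponents at most [N0 / (8 (N + 1))]. In the product formula [Y] thus enters to a power at most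
    [N0 / 8], whereas the closeness to [1] enters to the power [N0]; this excludes a large [Y]. A
    single approximation suffices, whence the effectivity.

    The real number attached to [(K, f)] must be the same for all presentations, so the algorithm
    has to compute an invariant of [(K, f)]; this is why the least [b] is taken. *)

(** * Indices of subgroups *)

Section Index.
Variable V : zmodType.
Implicit Types (A B C : set V) (m : nat).

Definition subgroup A := A 0 /\ forall x y, A x -> A y -> A (x - y).

(** Indices are counted by families of elements of [A] in distinct cosets of [B]; no quotient is
    formed, and a family of maximal size is a system of representatives. *)
Definition separated A B (I : Type) (x : I -> V) :=
  (forall i, A (x i)) /\ (forall i j, B (x i - x j) -> i = j).

Definition index_le A B m :=
  forall (I : finType) (x : I -> V), separated A B x -> (#|I| <= m)%N.

Definition has_index A B m :=
  index_le A B m /\ exists (I : finType) (x : I -> V), separated A B x /\ #|I| = m.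

Lemma subgroup_opp A x : subgroup A -> A x -> A (- x).
Proof. by move=> [A0 AB] Ax; rewrite -sub0r; apply: AB. Qed.

Lemma subgroup_add A x y : subgroup A -> A x -> A y -> A (x + y).
Proof.
by move=> sA Ax Ay; rewrite -[y]opprK; apply: sA.2 => //; apply: subgroup_opp.
Qed.

Lemma subgroup_sum A (I : Type) (s : seq I) (F : I -> V) :
  subgroup A -> (forall i, A (F i)) -> A (\sum_(i <- s) F i).
Proof.
move=> sA AF; elim: s => [|i s IH]; first by rewrite big_nil; apply: sA.1.
by rewrite big_cons; apply: subgroup_add.
Qed.

Lemma subgroup_subC A x y : subgroup A -> A (x - y) -> A (y - x).
Proof. by move=> sA; rewrite -[y - x]opprB; apply: subgroup_opp. Qed.

Lemma has_index_uniq A B m m' : has_index A B m -> has_index A B m' -> m = m'.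
Proof.
move=> [le1 [I [x [sepx cI]]]] [le2 [J [y [sepy cJ]]]].
by apply/eqP; rewrite eqn_leq -{1}cI -{2}cJ (le2 _ _ sepx) (le1 _ _ sepy).
Qed.

Lemma has_index_exists A B M : index_le A B M -> exists2 m, (m <= M)%N & has_index A B m.
Proof.
move=> leM.
pose P m := `[< exists (I : finType) (x : I -> V), separated A B x /\ #|I| = m >].
have exP : exists m, P m.
  exists 0%N; apply/asboolP; exists 'I_0, (fun=> 0); split; last exact: card_ord.
  by split=> -[].
have leP m : P m -> (m <= M)%N by move=> /asboolP[I [x [sepx <-]]]; exact: leM sepx.
case: (ex_maxnP exP leP) => m Pm maxm; exists m; first exact: leP.
split; last exact/asboolP.
by move=> I x sepx; apply: maxm; apply/asboolP; exists I, x.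
Qed.

(** Otherwise the family could be enlarged by [a]. *)
Lemma separated_cover A B (I : finType) (x : I -> V) a :
  subgroup B -> index_le A B #|I| -> separated A B x -> A a ->
  exists i, B (a - x i).
Proof.
move=> sB leI [Ax sepx] Aa; apply: contrapT => nex.
have := leI (option I) (fun o => if o is Some i then x i else a).
rewrite card_option ltnn => H; suff: false by []; apply: H; split; first by case.
case=> [i|] [j|] //= Bxy; first by rewrite (sepx _ _ Bxy).
  by case: nex; exists i; apply: subgroup_subC.
by case: nex; exists j.
Qed.

Lemma has_index_gt0 A B m : A 0 -> has_index A B m -> (0 < m)%N.
Proof.
move=> A0 [leAB _].
have := leAB unit (fun=> 0); rewrite card_unit; apply.
by split=> // [] [] [].
Qed.

(** The sums of a representative of [A] modulo [B] and one of [B] modulo [C] represent [A] modulo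
    [C]. *)
Lemma has_index_mul A B C m1 m2 :
  subgroup A -> subgroup B -> subgroup C -> C `<=` B -> B `<=` A ->
  has_index A B m1 -> has_index B C m2 -> has_index A C (m1 * m2).
Proof.
move=> sA sB sC CB BA [le1 [I [x [sepx cI]]]] [le2 [J [y [sepy cJ]]]]; split; last first.
  exists (I * J)%type, (fun p => x p.1 + y p.2); split; last first.
    by rewrite card_prod cI cJ.
  split=> [p|p q Cpq].
    by apply: subgroup_add => //; [apply: sepx.1 | apply/BA/sepy.1].
  have xpq : p.1 = q.1.
    apply: sepx.2.
    have -> : x p.1 - x q.1 = (x p.1 + y p.2 - (x q.1 + y q.2)) - (y p.2 - y q.2).
      have key4 (a b c d : V) : a - c = a + b - (c + d) - (b - d).
        by rewrite opprD addrACA addrK.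
      exact: key4.
    apply: sB.2; first exact: CB.
    by apply: sB.2; apply: sepy.1.
  have ypq : p.2 = q.2.
    apply: sepy.2; move: Cpq; rewrite xpq.
    by rewrite opprD addrACA subrr add0r.
  by case: p q xpq ypq {Cpq} => [a b] [c d] /= -> ->.
move=> T z [Az sepz].
have cov t : exists p : I * J, C (z t - x p.1 - y p.2).
  have [i Bi] : exists i, B (z t - x i) by apply: separated_cover sepx (Az t) => //; rewrite cI.
  have [j Cj] : exists j, C (z t - x i - y j) by apply: separated_cover sepy Bi => //; rewrite cJ.
  by exists (i, j).
pose f t := xget (sval (cid (cov t))) [set p | C (z t - x p.1 - y p.2)].
have fP t : C (z t - x (f t).1 - y (f t).2).
  rewrite /f; case: xgetP => [p -> //|]; by move=> /(_ (sval (cid (cov t)))); case: cid.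
rewrite -cI -cJ -card_prod; apply: leq_card (f) _ => s t fst; apply: sepz.
have -> : z s - z t = (z s - x (f s).1 - y (f s).2) - (z t - x (f t).1 - y (f t).2).
  have key (p q a : V) : p - a - (q - a) = p - q by rewrite opprB addrA subrK.
  by rewrite fst !key.
exact: sC.2.
Qed.

Lemma index_le_sub A A' B B' m : A' `<=` A -> B `<=` B' -> index_le A B m -> index_le A' B' m.
Proof.
move=> sA sB leAB I x [Ax sepx]; apply: (leAB _ x); split=> [i|i j /sB/sepx//].
exact/sA/Ax.
Qed.

End Index.

Lemma index_le_inj (V W : zmodType) (f : V -> W) (A B : set V) (A' B' : set W) m :
  (forall x, A x -> A' (f x)) -> (forall x y, A x -> A y -> B' (f x - f y) -> B (x - y)) ->
  index_le A' B' m -> index_le A B m.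
Proof.
move=> fA fB leAB I x [Ax sepx]; apply: (leAB _ (fun i => f (x i))).
by split=> [i|i j /fB Bxy]; [apply: fA | apply: sepx; apply: Bxy].
Qed.

Lemma has_index_bij (V W : zmodType) (f : V -> W) (A B : set V) (A' B' : set W) m :
  (forall x, A x -> A' (f x)) -> (forall y, A' y -> exists2 x, A x & f x = y) ->
  (forall x y, A x -> A y -> B' (f x - f y) <-> B (x - y)) ->
  has_index A B m -> has_index A' B' m.
Proof.
move=> fA fsurj fB [leAB [I [x [[Ax sepx] cI]]]]; split; last first.
  exists I, (fun i => f (x i)); split=> //; split=> [i|i j /fB Bxy]; first exact: fA.
  by apply: sepx; apply: Bxy.
move=> J y [A'y sepy].
pose g j := sval (cid2 (fsurj _ (A'y j))).
have gP j : A (g j) /\ f (g j) = y j by rewrite /g; case: cid2.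
apply: (leAB _ g); split=> [j|i j Bxy]; first by have [] := gP j.
by apply: sepy; have [Ai <-] := gP i; have [Aj <-] := gP j; apply/fB.
Qed.

Lemma root_dvdp (F : fieldType) (p q : {poly F}) x : p %| q -> root p x -> root q x.
Proof. by rewrite -!dvdp_XsubCl => pq xp; apply: dvdp_trans pq. Qed.

(** * Algebraic integers *)

Section RingOfIntegers.
Variable K : fieldExtType rat.
Local Notation "'𝔬'" := (@ring_of_integers K).
Implicit Types x y t : K.

Lemma intr_numfield_inj : injective (intr : int -> K).
Proof.
move=> a b; rewrite -!(rmorph_int (in_alg K)) => /(fmorph_inj (in_alg K)); exact: intr_inj.
Qed.

Lemma size_map_intr (p : {poly int}) : size (map_poly intr p : {poly K}) = size p.
Proof. exact: size_map_inj_poly intr_numfield_inj (rmorph0 _) p. Qed.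

Lemma map_intr_eq0 (p : {poly int}) : (map_poly intr p == 0 :> {poly K}) = (p == 0).
Proof. by rewrite -!size_poly_eq0 size_map_intr. Qed.

Lemma natr_numfield_eq0 n : (n%:R == 0 :> K) = (n == 0%N).
Proof. by rewrite -(rmorph_nat (in_alg K)) fmorph_eq0 pnatr_eq0. Qed.

Lemma rint0 : 𝔬 0. Proof. exact: integral0. Qed.
Lemma rint1 : 𝔬 1. Proof. exact: integral1. Qed.
Lemma rint_int (z : int) : 𝔬 z%:~R. Proof. exact: integral_id. Qed.
Lemma rint_nat (n : nat) : 𝔬 n%:R. Proof. exact: integral_nat. Qed.
Lemma rintN x : 𝔬 x -> 𝔬 (- x). Proof. exact: integral_opp. Qed.
Lemma rintD x y : 𝔬 x -> 𝔬 y -> 𝔬 (x + y). Proof. exact: integral_add. Qed.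
Lemma rintB x y : 𝔬 x -> 𝔬 y -> 𝔬 (x - y). Proof. exact: integral_sub. Qed.
Lemma rintM x y : 𝔬 x -> 𝔬 y -> 𝔬 (x * y). Proof. exact: integral_mul. Qed.
Lemma rintX x n : 𝔬 x -> 𝔬 (x ^+ n).
Proof. by move=> Ox; elim: n => [|n IH]; [apply: rint1 | rewrite exprS; apply: rintM]. Qed.
Lemma subgroup_rint : subgroup 𝔬. Proof. by split; [apply: rint0 | apply: rintB]. Qed.
Lemma rint_sum (I : Type) (s : seq I) (F : I -> K) :
  (forall i, 𝔬 (F i)) -> 𝔬 (\sum_(i <- s) F i).
Proof. exact: (subgroup_sum s subgroup_rint). Qed.
Lemma rint_prod (I : Type) (s : seq I) (F : I -> K) :
  (forall i, 𝔬 (F i)) -> 𝔬 (\prod_(i <- s) F i).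
Proof. by move=> OF; elim/big_ind: _ => //; [apply: rint1 | apply: rintM]. Qed.

Lemma rint_horner (p : {poly int}) x : 𝔬 x -> 𝔬 (map_poly intr p).[x].
Proof.
move=> Ox; rewrite horner_coef; apply: rint_sum => i.
by rewrite coef_map; apply: rintM; [apply: rint_int | apply: rintX].
Qed.

Lemma rint_root_monic (p : {poly K}) x :
  p \is monic -> root p x -> (forall i, 𝔬 p`_i) -> 𝔬 x.
Proof.
move=> mp px Op; apply: (integral_root_monic mp px).
exact/integral_poly.
Qed.

(** The corresponding fact on algebraic integers in [algC] is transported by [ratr]. *)
Lemma rint_rat (q : rat) : 𝔬 (q%:A) -> exists z : int, q = z%:~R.
Proof.
move=> [p mp rp].
have rp1 : root (map_poly intr p : {poly rat}) q.
  rewrite -(fmorph_root (in_alg K)) -map_poly_comp.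
  by rewrite (eq_map_poly (g := intr)) // => z; rewrite /= alg_num_field ratr_int.
have : (ratr q : algC) \in Num.int.
  apply: Cint_rat_Aint; first exact: Crat_rat.
  apply: (@root_monic_Aint (map_poly intr p)); last by apply/polyOverP => i; rewrite coef_map /= intr_int.
    move: rp1; rewrite -(fmorph_root (@ratr algC)) -map_poly_comp.
    by rewrite (eq_map_poly (g := intr)) // => z /=; rewrite ratr_int.
  exact: monic_map.
case/intrP => z Ez; exists z.
by apply: (fmorph_inj (@ratr algC)); rewrite /= Ez ratr_int.
Qed.

End RingOfIntegers.

Lemma rint_rmorph (K L : fieldExtType rat) (f : {rmorphism K -> L}) x :
  ring_of_integers (f x) <-> ring_of_integers x.
Proof.
have E (p : {poly int}) : map_poly intr p = map_poly f (map_poly intr p).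
  by rewrite -map_poly_comp; apply: eq_map_poly => z /=; rewrite rmorph_int.
by split=> -[p mp rp]; exists p => //; move: rp; rewrite E fmorph_root.
Qed.

(** * Embeddings and minimal polynomials *)

Section Embeddings.
Variable (K : fieldExtType rat).

Lemma primitive_exists : exists t : K, <<1; t>>%VS = fullv.
Proof.
exists (separable_generator 1%AS {:K}).
rewrite -eq_adjoin_separable_generator ?sub1v //.
by apply/separableP => x _; apply: pcharf0_separable; by move=> p; rewrite pchar_lalg pchar_num.
Qed.

Lemma primitive_polyP (t : K) : <<1; t>>%VS = fullv ->
  forall x, exists p : {poly rat}, x = (map_poly (in_alg K) p).[t].
Proof.
move=> gt x; have /Fadjoin1_polyP[p ->] : x \in <<1; t>>%VS by rewrite gt memvf.
by exists p.
Qed.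

Lemma minPoly_ratP (t : K) : exists p : {poly rat},
  [/\ minPoly 1 t = map_poly (in_alg K) p, p \is monic
   & forall q : {poly rat}, root (map_poly (in_alg K) q) t = (p %| q)].
Proof.
have /polyOver1P[p Ep] := minPolyOver 1 t.
exists p; split=> //; first by rewrite -(map_monic (in_alg K)) -Ep monic_minPoly.
move=> q; rewrite -(dvdp_map (in_alg K)) -Ep; apply/idP/idP => [rq|].
  apply: minPoly_dvdp => //; by apply/polyOver1P; exists q.
by move=> d; apply: root_dvdp d _; apply: root_minPoly.
Qed.

(** Write [x] as a polynomial in [t] and evaluate it at [z]; the hypothesis on [z] makes the value
    independent of the polynomial chosen. *)
Lemma embedding_root (F : fieldType) (rho : {rmorphism rat -> F}) (t : K) (z : F) :
  <<1; t>>%VS = fullv ->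
  (forall q : {poly rat}, root (map_poly (in_alg K) q) t -> root (map_poly rho q) z) ->
  exists g : {rmorphism K -> F}, g t = z.
Proof.
move=> gt tz.
pose P x := sval (cid (primitive_polyP gt x)).
have PE x : x = (map_poly (in_alg K) (P x)).[t] by rewrite /P; case: cid.
pose g x := (map_poly rho (P x)).[z].
have gE (p : {poly rat}) x : (map_poly (in_alg K) p).[t] = x -> (map_poly rho p).[z] = g x.
  move=> px; apply/eqP; rewrite -subr_eq0 /g -hornerN -hornerD -[_ - _]rmorphB /=.
  by apply: tz; rewrite rootE [map_poly _ _]rmorphB /= hornerD hornerN px -PE subrr.
have ga : zmod_morphism g.
  by move=> x y; rewrite -(gE (P x - P y)) rmorphB /= hornerD hornerN // -!PE.
have gm : monoid_morphism g.
  split; first by rewrite -(gE 1) rmorph1 hornerE.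
  by move=> x y; rewrite -(gE (P x * P y)) rmorphM /= hornerM // -!PE.
pose g1 := GRing.isZmodMorphism.Build _ _ g ga.
pose g2 := GRing.isMonoidMorphism.Build _ _ g gm.
pose gr : {rmorphism K -> F} := HB.pack g g1 g2.
exists gr; rewrite /= -(gE 'X) ?map_polyX ?hornerX //.
Qed.

Lemma minPoly_root_embedding (F : numFieldType) (t : K) (z : F) (p : {poly rat}) :
  <<1; t>>%VS = fullv -> minPoly 1 t = map_poly (in_alg K) p -> root (map_poly ratr p) z ->
  exists g : {rmorphism K -> F}, g t = z.
Proof.
move=> gt Ep rz; apply: (@embedding_root F (@ratr F)) => // q.
have [p' [Ep' _ ->]] := minPoly_ratP t.
have -> : p' = p by apply: (map_poly_inj (in_alg K)); rewrite -Ep -Ep'.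
by rewrite -(dvdp_map (@ratr F)) => d; apply: root_dvdp d _.
Qed.

Lemma embedding_exists (F : numClosedFieldType) : exists g : {rmorphism K -> F}, True.
Proof.
have [t gt] := primitive_exists.
have [p [Ep mp _]] := minPoly_ratP t.
have : size (map_poly ratr p : {poly F}) != 1%N.
  by rewrite size_map_poly -(size_map_poly (in_alg K)) -Ep size_minPoly.
move/closed_rootP => [z rz].
by have [g _] := minPoly_root_embedding gt Ep rz; exists g.
Qed.

(** An embedding in [algC] identifies the minimal polynomial of [t] with [minCpoly], which has
    integer coefficients for an algebraic integer. *)
Lemma minPoly_rint (t : K) : ring_of_integers t ->
  exists2 p : {poly int}, p \is monic & minPoly 1 t = map_poly intr p.
Proof.
move=> [P mP rP]; have [f _] := embedding_exists algC.
have E (L : fieldType) (g : {rmorphism rat -> L}) (p : {poly int}) : map_poly g (map_poly intr p) = map_poly intr p.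
  by rewrite -map_poly_comp; apply: eq_map_poly => z /=; rewrite rmorph_int.
have [p [Ep mp rp]] := minPoly_ratP t.
have [q [Eq mq rq]] := minCpolyP (f t).
have Ef (r : {poly rat}) : map_poly (@ratr algC) r = map_poly f (map_poly (in_alg K) r).
  by rewrite -map_poly_comp; apply: eq_map_poly => z /=; rewrite rmorphZ_num rmorph1 mulr1.
have pq : p = q.
  apply/eqP; rewrite -eqp_monic // /eqp -rp -rq Ef fmorph_root.
  rewrite -Ep root_minPoly andbT -(fmorph_root f) -Ef -Eq; exact: root_minCpoly.
have At : f t \in Aint.
  apply: (@root_monic_Aint (map_poly intr P)); last by apply/polyOverP => i; rewrite coef_map /= intr_int.
    by rewrite -(E _ (@ratr algC)) Ef fmorph_root (E _ (in_alg K)).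
  exact: monic_map.
have /floorpP[r Er] : minCpoly (f t) \is a polyOver Num.int by [].
have pr : p = map_poly intr r.
  apply: (map_poly_inj (@ratr algC)).
  by rewrite E pq -Eq.
exists r; last by rewrite Ep pr E.
by move: mp; rewrite pr !monicE (lead_coef_map_inj (@intr_inj _)) // -[1 in X in X -> _]/(1%:~R) eqr_int.
Qed.

End Embeddings.

Lemma coef_prod_XsubC_le (F : numDomainType) (s : seq F) (X : F) i :
  0 <= X -> (forall z, z \in s -> `|z| <= X) ->
  `|(\prod_(z <- s) ('X - z%:P))`_i| <= (1 + X) ^+ size s.
Proof.
move=> X0; elim: s i => [|z s IH] i sX.
  by rewrite big_nil coef1 expr0; case: (i == 0%N); rewrite ?normr1 ?normr0 ?ler01.
rewrite big_cons mulrBl coefB coefXM coefCM exprS mulrDl mul1r.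
have sX' w : w \in s -> `|w| <= X by move=> ws; apply: sX; rewrite inE ws orbT.
apply: le_trans (ler_normB _ _) _; apply: lerD.
  case: i => [|i] /=; last exact: IH.
  by rewrite normr0 exprn_ge0 // addr_ge0 ?ler01.
by rewrite normrM; apply: ler_pM => //; [apply: sX; rewrite mem_head | apply: IH].
Qed.

(** Euler's formula: [R] is the sum over the roots [z] of [p] of [x_z p(X) / (X - z)], where [x_z]
    is the conjugate of [x] belonging to [z]. Its coefficients are rational, as [R] is a remainder
    modulo [p], and algebraic integers, hence integers. The explicit bound confines the integers
    with bounded conjugates to a finite set that can be searched. *)
Lemma lagrange_rint (K : fieldExtType rat) (t x : K) (p q : {poly int}) (X H : algC) :
  <<1; t>>%VS = fullv -> p \is monic -> minPoly 1 t = map_poly intr p ->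
  q \is monic -> root (map_poly intr q) x -> 0 <= X -> 0 <= H ->
  (forall z : algC, root (map_poly intr p) z -> `|z| <= X) ->
  (forall z : algC, root (map_poly intr q) z -> `|z| <= H) ->
  exists R : {poly int}, [/\ (size R < size p)%N,
    (map_poly intr p^`()).[t] * x = (map_poly intr R).[t]
    & forall i, `|(R`_i)%:~R| <= (size p)%:R * (H * (1 + X) ^+ size p)].
Proof.
move=> gt mp Ep mq rq X0 H0 pX qH.
have E (L : fieldType) (g : {rmorphism rat -> L}) (r : {poly int}) : map_poly g (map_poly intr r) = map_poly intr r.
  by rewrite -map_poly_comp; apply: eq_map_poly => z /=; rewrite rmorph_int.
have [S xS] := primitive_polyP gt x.
pose P := map_poly intr p : {poly rat}; pose R := (S * P^`()) %% P.
have mP : P \is monic by rewrite monic_map.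
have P0 : P != 0 by rewrite monic_neq0.
have EpP : minPoly 1 t = map_poly (in_alg K) P by rewrite E.
have szP : size P = size p by rewrite size_map_inj_poly //; apply: intr_inj.
pose PC := map_poly intr p : {poly algC}.
have PCE : PC = map_poly (@ratr algC) P by rewrite E.
have mPC : PC \is monic by rewrite monic_map.
have [rs Prs] := closed_field_poly_normal PC.
rewrite (monicP mPC) scale1r in Prs.
have urs : uniq rs.
  rewrite -separable_prod_XsubC -Prs PCE separable_map -(separable_map (in_alg K)) -EpP.
  by apply: pcharf0_separable => c; rewrite pchar_lalg pchar_num.
have szrs : size p = (size rs).+1 by rewrite -(size_prod_XsubC rs id) -Prs PCE size_map_poly szP.
have rsP z : z \in rs -> root PC z by rewrite Prs root_prod_XsubC.
pose Q (z : algC) := \prod_(w <- rem z rs) ('X - w%:P).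
have PQ z : z \in rs -> PC = ('X - z%:P) * Q z.
  by move=> zrs; rewrite Prs (perm_big _ (perm_to_rem zrs)) big_cons.
have Qz z w : z \in rs -> w \in rs -> z != w -> (Q z).[w] = 0.
  move=> zr wr zw; apply/eqP; rewrite -rootE root_prod_XsubC.
  by rewrite (mem_rem_uniq _ urs) inE wr andbT eq_sym.
have szR : (size R < size p)%N by rewrite -szP ltn_modp.
pose SC := map_poly (@ratr algC) S.
have emb z : z \in rs -> exists g : {rmorphism K -> algC}, g t = z.
  by move=> /rsP; rewrite PCE => rz; apply: minPoly_root_embedding gt EpP rz.
have SCx z : z \in rs -> root (map_poly intr q) SC.[z].
  move=> /emb[g gz]; have -> : SC.[z] = g x.
    rewrite xS -horner_map gz /SC -map_poly_comp; congr _.[_].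
    by apply: eq_map_poly => c /=; rewrite rmorphZ_num rmorph1 mulr1.
  rewrite -(fmorph_root g) -map_poly_comp in rq.
  by rewrite -(eq_map_poly (f := g \o intr)) // => c /=; rewrite rmorph_int.
(* Both sides have degree less than that of [p] and agree at its roots, which are distinct. *)
have RE : map_poly (@ratr algC) R = \sum_(z <- rs) SC.[z] *: Q z.
  apply/eqP; rewrite -subr_eq0; apply/eqP.
  apply: (roots_geq_poly_eq0 (rs := rs)); rewrite ?uniq_rootsE //.
  - apply/allP => z zrs; rewrite rootE hornerD hornerN subr_eq0; apply/eqP.
    have -> : (map_poly (@ratr algC) R).[z] = SC.[z] * (Q z).[z].
      have := congr1 (fun r => (map_poly (@ratr algC) r).[z]) (divp_eq (S * P^`()) P);
        move=> /=; rewrite rmorphD !rmorphM /= -deriv_map -!PCE !(hornerD, hornerM).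
      rewrite (rootP (rsP _ zrs)) mulr0 add0r -/R -/SC => <-.
      congr (_ * _); rewrite (PQ z zrs) derivM derivXsubC mul1r hornerD hornerM.
      by rewrite hornerXsubC subrr mul0r addr0.
    rewrite horner_sum (bigD1_seq z) //= hornerZ big_seq_cond big1 ?addr0 //.
    by move=> w /andP[wr wz]; rewrite hornerZ Qz // mulr0.
  - rewrite -ltnS; apply: leq_ltn_trans (size_polyD _ _) _.
    rewrite gtn_max size_polyN size_map_poly -szrs szR /=.
    apply: leq_ltn_trans (size_sum _ _ _) _.
    rewrite szrs ltnS; apply/bigmax_leqP_seq => z zr _.
    apply: leq_trans (size_scale_leq _ _) _.
    by rewrite size_prod_XsubC size_rem //; case: (rs) zr.
have QA z : z \in rs -> forall i, (Q z)`_i \in Aint.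
  move=> zr i; apply: (polyOverP _) => {i}; rewrite /Q big_seq rpred_prod // => w.
  rewrite (mem_rem_uniq _ urs) inE => /andP[_ wr]; rewrite polyOverXsubC.
  apply: root_monic_Aint (rsP _ wr) mPC _.
  by apply/polyOverP => j; rewrite coef_map /= intr_int.
have SA z : z \in rs -> SC.[z] \in Aint.
  move=> zr; apply: root_monic_Aint (SCx _ zr) _ _; first exact: monic_map.
  by apply/polyOverP => j; rewrite coef_map /= intr_int.
have Rint i : R`_i \in Num.int.
  have : (ratr R`_i : algC) \in Num.int.
    apply: Cint_rat_Aint; first exact: Crat_rat.
    rewrite -coef_map RE coef_sum big_seq rpred_sum // => z zr.
    by rewrite coefZ rpredM ?SA ?QA.
  case/intrP => z Ez; apply/intrP; exists z.
  by apply: (fmorph_inj (@ratr algC)); rewrite /= Ez ratr_int.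
have /floorpP[R0 ER] : R \is a polyOver Num.int by apply/polyOverP.
exists R0; split.
- by rewrite -(size_map_inj_poly (@intr_inj rat)) // -ER.
- rewrite -!(E _ (in_alg K)) -ER xS mulrC -hornerM -deriv_map -rmorphM /=.
  rewrite {1}(divp_eq (S * P^`()) P) rmorphD rmorphM /= hornerD hornerM.
  by rewrite -EpP minPolyxx mulr0 add0r.
- move=> i; have -> : (R0`_i)%:~R = ratr R`_i :> algC by rewrite ER coef_map /= ratr_int.
  rewrite -coef_map RE coef_sum; apply: le_trans (ler_norm_sum _ _ _) _.
  have B0 : 0 <= H * (1 + X) ^+ size p by rewrite mulr_ge0 // exprn_ge0 // addr_ge0.
  apply: (@le_trans _ _ (\sum_(z <- rs) H * (1 + X) ^+ size p)); last first.
    rewrite big_const_seq count_predT iter_addr_0 mulr_natl szrs mulrS lerDr -szrs //.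
  rewrite big_seq_cond [leRHS]big_seq_cond; apply: ler_sum => z; rewrite andbT => zr.
  rewrite coefZ normrM ler_pM //; first exact/qH/SCx.
  apply: le_trans (coef_prod_XsubC_le _ X0 _) _.
    by move=> w; rewrite (mem_rem_uniq _ urs) inE => /andP[_ wr]; exact/pX/rsP.
  by rewrite ler_weXn2l ?lerDl // size_rem // szrs; case: (rs) zr => //= *; lia.
Qed.

Lemma absz_sgz (z : int) : (absz z)%:Z = sgz z * z.
Proof. by rewrite abszE normrEsg sgrEz intz. Qed.

(** * Finiteness of the residue rings *)

Section Finiteness.
Variable K : fieldExtType rat.
Local Notation "'𝔬'" := (@ring_of_integers K).

(* [a ^ (n - 1) * f(X / a)], for [a] the leading coefficient and [n] the degree. *)
Definition monicized (f : {poly K}) : {poly K} :=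
  \poly_(i < size f) (if i == (size f).-1 then 1
                      else f`_i * lead_coef f ^+ ((size f).-2 - i)).

Lemma horner_monicized (f : {poly K}) x : (1 < size f)%N ->
  (monicized f).[lead_coef f * x] = lead_coef f ^+ (size f).-2 * f.[x].
Proof.
rewrite /monicized; move sf: (size f) => n; case: n sf => [|[|n]] // sf _ /=.
rewrite horner_poly horner_coef sf mulr_sumr; apply: eq_bigr => i _.
have [->|ni] := eqVneq (i : nat) n.+1.
  by rewrite exprMn exprS mul1r lead_coefE sf /=; ring.
have le_in : (i <= n)%N by have := ltn_ord i; lia.
have -> : lead_coef f ^+ n = lead_coef f ^+ (n - i) * lead_coef f ^+ i.
  by rewrite -exprD subnK.
by rewrite exprMn; ring.
Qed.

Lemma size_monicized (f : {poly K}) : (0 < size f)%N -> size (monicized f) = size f.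
Proof.
by move=> s0; rewrite /monicized; apply: size_poly_eq; rewrite eqxx oner_neq0.
Qed.

Lemma monicized_monic (f : {poly K}) : (0 < size f)%N -> monicized f \is monic.
Proof.
move=> s0; rewrite monicE lead_coefE size_monicized // coef_poly eqxx.
by rewrite prednK // leqnn.
Qed.

Lemma rint_monicized (f : {poly K}) : integral_coefs f -> forall i, 𝔬 (monicized f)`_i.
Proof.
move=> Of i; rewrite coef_poly; case: ifP => _; last exact: rint0.
case: ifP => _; first exact: rint1.
by apply: rintM; [apply: Of | apply/rintX/Of].
Qed.

Lemma rint_lead_root (f : {poly K}) x :
  f != 0 -> integral_coefs f -> root f x -> 𝔬 (lead_coef f * x).
Proof.
move=> f0 Of rx; have s1 := root_size_gt1 f0 rx.
apply: (rint_root_monic (monicized_monic (ltnW s1)) _ (rint_monicized Of)).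
by rewrite rootE horner_monicized // (rootP rx) mulr0.
Qed.

Lemma rint_scale (x : K) : exists2 m : nat, (0 < m)%N & 𝔬 (m%:R * x).
Proof.
have [p [Ep mp rp]] := minPoly_ratP x.
have [q [a a0 Eq]] := rat_poly_scale p.
have la : lead_coef q = a.
  apply/eqP; rewrite -(eqr_int rat) -(lead_coef_map_inj (@intr_inj rat)) //.
  have := congr1 lead_coef Eq; rewrite (monicP mp) lead_coefZ.
  move/(congr1 (fun y => a%:~R * y)).
  by rewrite mulr1 mulVKf ?intr_eq0 // => ->.
have rx : root (map_poly intr q : {poly K}) x.
  have -> : map_poly intr q = map_poly (in_alg K) (a%:~R *: p).
    rewrite Eq scalerA mulfV ?intr_eq0 // scale1r -map_poly_comp.
    by apply: eq_map_poly => z; rewrite /= alg_num_field ratr_int.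
  by rewrite map_polyZ rootE hornerZ -Ep minPolyxx mulr0.
have Oax : 𝔬 (a%:~R * x).
  rewrite -la -(lead_coef_map_inj (@intr_numfield_inj K)) //.
  apply: rint_lead_root => //; last by move=> i; rewrite coef_map; apply: rint_int.
  by rewrite map_intr_eq0 -lead_coef_eq0 la.
exists `|a|%N; first by rewrite absz_gt0.
have [e ->] : exists e : int, `|a|%N%:R = e%:~R * a%:~R :> K.
  by exists (sgz a); rewrite -intrM -absz_sgz.
by rewrite -mulrA; apply: rintM => //; apply: rint_int.
Qed.

Lemma primitive_rint_exists : exists2 t : K, 𝔬 t & <<1; t>>%VS = fullv.
Proof.
have [t gt] := primitive_exists K; have [m m0 Om] := rint_scale t.
exists (m%:R * t) => //; apply/vspaceP => x; rewrite memvf.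
have: x \in <<1; t>>%VS by rewrite gt memvf.
move: x; apply/subvP/FadjoinP; rewrite subv_adjoin; split=> //.
have Et : t = (m%:R : rat)^-1 *: (m%:R * t).
  by rewrite mulr_natl -scaler_nat scalerA mulVf ?scale1r // pnatr_eq0 -lt0n.
by rewrite [X in X \in _]Et memvZ // memv_adjoin.
Qed.

(** The constant term of the minimal polynomial of [a] is [a] times an element of [Z[a]]; it is not
    zero, since otherwise a polynomial of smaller degree would vanish at [a]. *)
Lemma rint_dvd_nat (a : K) : 𝔬 a -> a != 0 ->
  exists2 n : nat, (0 < n)%N & exists2 b, 𝔬 b & n%:R = a * b.
Proof.
move=> Oa a0; have [p mp Ep] := minPoly_rint Oa.
pose q := drop_poly 1 p.
have pq : p = (p`_0)%:P + q * 'X.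
  apply/polyP => i; rewrite coefD coefC coefMX coef_drop_poly.
  by case: i => [|i] /=; rewrite ?addr0 // add0r addn1.
have pa : (p`_0)%:~R = - (a * (map_poly intr q).[a]).
  have := minPolyxx 1 a; rewrite Ep {1}pq rmorphD rmorphM /= map_polyC map_polyX.
  by rewrite !hornerE => /eqP; rewrite addr_eq0 mulrC => /eqP.
have p0 : p`_0 != 0.
  apply/eqP => p00; move: pa; rewrite p00 => /eqP; rewrite eq_sym oppr_eq0 mulf_eq0 (negPf a0) /=.
  move=> qa; have q0 : q != 0.
    by apply: contraTneq mp => q0; rewrite pq q0 p00 mul0r addr0 monicE lead_coef0 eq_sym oner_eq0.
  have : minPoly 1 a %| map_poly intr q.
    apply: minPoly_dvdp => //; apply/polyOver1P; exists (map_poly intr q).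
    by rewrite -map_poly_comp; apply: eq_map_poly => z; rewrite /= alg_num_field ratr_int.
  have q0K : map_poly intr q != 0 :> {poly K}.
    by rewrite map_intr_eq0.
  move/(dvdp_leq q0K).
  rewrite Ep !size_map_inj_poly //; try exact: intr_numfield_inj.
  by rewrite {1}pq p00 add0r size_mulX // ltnn.
exists (absz p`_0); first by rewrite absz_gt0.
exists (- (sgz p`_0)%:~R * (map_poly intr q).[a]).
  by apply: rintM; [apply/rintN/rint_int | apply: rint_horner].
have -> : a * (- (sgz p`_0)%:~R * (map_poly intr q).[a]) =
  (sgz p`_0)%:~R * - (a * (map_poly intr q).[a]) by ring.
by rewrite -pa -intrM -absz_sgz.
Qed.

Lemma algC_roots_bounded (p : {poly algC}) : p \is monic ->
  exists2 X : algC, 0 <= X & forall z, root p z -> `|z| <= X.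
Proof.
move=> mp; have [rs Prs] := closed_field_poly_normal p.
exists (\sum_(z <- rs) `|z|); first by apply: sumr_ge0.
move=> z; rewrite Prs (monicP mp) scale1r root_prod_XsubC => zr.
by rewrite (perm_big _ (perm_to_rem zr)) big_cons lerDl sumr_ge0.
Qed.

(** By Euler's formula [p'(t)] times an integer lies in [Z[t]], and [p'(t)] divides a positive
    natural number [n0]. *)
Lemma rint_in_lattice : exists (t : K) (n0 : nat), [/\ (0 < n0)%N, 𝔬 t &
  forall x, 𝔬 x -> exists z : 'I_(\dim {:K}) -> int,
    n0%:R * x = \sum_i (z i)%:~R * t ^+ i].
Proof.
have [t Ot gt] := primitive_rint_exists.
have [p mp Ep] := minPoly_rint Ot.
have szp : size p = (\dim {:K}).+1.
  rewrite -(size_map_inj_poly (@intr_numfield_inj K)) // -Ep size_minPoly.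
  by rewrite -gt dim_Fadjoin dimv1 muln1.
have [X X0 pX] := algC_roots_bounded (monic_map intr mp).
pose a := (map_poly intr p^`() : {poly K}).[t].
have Oa : 𝔬 a by apply: rint_horner.
have a0 : a != 0.
  have : separable_element 1 t by apply: pcharf0_separable => c; rewrite pchar_lalg pchar_num.
  rewrite separable_nz_der => d0; apply/eqP => a00.
  have : minPoly 1 t %| (minPoly 1 t)^`().
    apply: minPoly_dvdp; last by rewrite Ep deriv_map rootE -a00.
    by rewrite polyOver_deriv // minPolyOver.
  move/(dvdp_leq d0); rewrite leqNgt lt_size_deriv //.
  by rewrite monic_neq0 // monic_minPoly.
have [n0 n00 [b Ob n0ab]] := rint_dvd_nat Oa a0.
exists t, n0; split=> // x Ox.
have [q mq rq] : 𝔬 (b * x) by apply: rintM.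
have [H H0 qH] := algC_roots_bounded (monic_map intr mq).
have [R [sR ER _]] := lagrange_rint gt mp Ep mq rq X0 H0 pX qH.
exists (fun i => R`_i); rewrite n0ab -mulrA ER.
rewrite (@horner_coef_wide _ (\dim {:K})); last by rewrite size_map_intr -ltnS -szp.
by apply: eq_bigr => i _; rewrite coef_map.
Qed.

(** By Bernoulli's inequality, [(a + 1)^k] outgrows [C a^k]. *)
Lemma expn_bound (a m C : nat) : (0 < a)%N ->
  (forall k, m ^ k <= a ^ k * C)%N -> (m <= a)%N.
Proof.
move=> a0 H; rewrite leqNgt; apply/negP => am.
have B k : (a ^ k * a + k * a ^ k <= a.+1 ^ k * a)%N.
  elim: k => [|k IH]; first by rewrite mul0n addn0.
  rewrite !expnS; nia.
set k := (a * C).+1.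
have H2 : (a.+1 ^ k <= a ^ k * C)%N by apply: leq_trans (H k); rewrite leq_exp2r.
have H3 : (a ^ k * (a + k) <= a ^ k * (C * a))%N.
  rewrite mulnDr [(a ^ k * k)%N]mulnC; apply: leq_trans (B k) _.
  by rewrite mulnA leq_mul2r (leq_trans H2) ?orbT.
by move: H3; rewrite leq_pmul2l ?expn_gt0 ?a0 // /k mulnC => H4; lia.
Qed.

(** The lattice only bounds the index of [D o] by [(D n0)^n]. For [D = d^k] this index is [m^k],
    where [m] is the index of [d o]; letting [k] grow in [m^k <= (d^k n0)^n] removes [n0]. *)
Lemma index_rint (d : nat) : (0 < d)%N ->
  index_le 𝔬 [set d%:R * x | x in 𝔬] (d ^ \dim {:K}).
Proof.
move=> d0; have [t [n0 [n00 Ot tP]]] := rint_in_lattice; set n := \dim {:K} in tP *.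
have main D : (0 < D)%N -> index_le 𝔬 [set D%:R * x | x in 𝔬] ((D * n0) ^ n).
  move=> D0 I x [Ax sepx].
  pose z i := sval (cid (tP _ (Ax i))).
  have zP i : n0%:R * x i = \sum_j (z i j)%:~R * t ^+ j by rewrite /z; case: cid.
  have M0 : (D * n0 > 0)%N by rewrite muln_gt0 D0.
  pose g i : {ffun 'I_n -> 'I_(D * n0)} :=
    [ffun j => Ordinal (ltn_pmod `|(z i j %% (D * n0)%N)%Z|%N M0)].
  rewrite -[n]card_ord -[X in (_ <= X ^ _)%N]card_ord -card_ffun; apply: leq_card (g) _.
  move=> i j gij; apply: sepx.
  have zij k : exists w : int, z i k - z j k = w * (D * n0)%N%:Z.
    exists ((z i k %/ (D * n0)%N)%Z - (z j k %/ (D * n0)%N)%Z).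
    have := congr1 (fun f : {ffun _ -> _} => nat_of_ord (f k)) gij.
    rewrite /= !ffunE /= => E.
    have zm (u : int) : (`|(u %% (D * n0)%N)%Z|%N %% (D * n0))%N = `|(u %% (D * n0)%N)%Z|%N.
      rewrite modn_small // -ltz_nat gez0_abs ?modz_ge0 ?ltz_pmod //; lia.
    rewrite !zm in E.
    have E' : (z i k %% (D * n0)%N)%Z = (z j k %% (D * n0)%N)%Z.
      by rewrite -[LHS]gez0_abs ?modz_ge0 -?lt0n // E gez0_abs // modz_ge0; lia.
    rewrite {1}(divz_eq (z i k) (D * n0)%N) {1}(divz_eq (z j k) (D * n0)%N) E'.
    ring.
  pose w k := sval (cid (zij k)).
  have wP k : z i k - z j k = w k * (D * n0)%N%:Z by rewrite /w; case: cid.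
  exists (\sum_k (w k)%:~R * t ^+ k).
    by apply: rint_sum => k; apply: rintM; [apply: rint_int | apply: rintX].
  have n00' : n0%:R != 0 :> K by rewrite natr_numfield_eq0 -lt0n.
  apply: (mulfI n00'); rewrite mulrBr !zP -sumrB mulrA -natrM mulnC mulr_sumr.
  apply: eq_bigr => k _; rewrite -mulrBl -intrB wP intrM; ring.
have [m _ Im] := has_index_exists (main d d0).
have sD (D : nat) : subgroup [set D%:R * x | x in 𝔬].
  split; first by exists 0; [apply: rint0 | rewrite mulr0].
  by move=> _ _ [x Ox <-] [y Oy <-]; exists (x - y); [apply: rintB | rewrite mulrBr].
have Ik k : has_index 𝔬 [set (d ^ k)%N%:R * x | x in 𝔬] (m ^ k).
  elim: k => [|k IH].
    split; last first.
      exists unit, (fun=> 0); split; last by rewrite card_unit.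
      by split=> [_|[] []//]; apply: rint0.
    move=> I x [Ax sepx]; rewrite leqNgt; apply/negP => /card_gt1P[i [j [_ _ /eqP ij]]].
    by apply/ij/sepx; exists (x i - x j); [apply: rintB | rewrite expn0 mul1r].
  rewrite [(m ^ _)%N]expnSr; apply: (has_index_mul _ _ _ _ _ IH); rewrite ?expnS //.
  - exact: subgroup_rint.
  - move=> _ [x Ox <-]; exists (d%:R * x); first by apply: rintM => //; apply: rint_nat.
    by rewrite mulrA -natrM mulnC.
  - by move=> _ [x Ox <-]; apply: rintM => //; apply: rint_nat.
  have dk0 : (d ^ k)%N%:R != 0 :> K by rewrite natr_numfield_eq0 -lt0n expn_gt0 d0.
  apply: (has_index_bij (f := fun x => (d ^ k)%N%:R * x)) Im.
  - by move=> x Ox; exists x.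
  - by move=> _ [x Ox <-]; exists x.
  - move=> x y Ox Oy; rewrite -mulrBr; split.
      move=> [v Ov E]; exists v => //; apply: (mulfI dk0); rewrite -E mulrA -natrM mulnC //.
    by move=> [v Ov E]; exists v => //; rewrite -E mulrA -natrM mulnC.
suff mle : (m <= d ^ n)%N by move=> I x sepx; apply: leq_trans mle; apply: Im.1 sepx.
apply: (@expn_bound _ _ (n0 ^ n)); first by rewrite expn_gt0 d0.
move=> k; have [_ [I [x [sepx <-]]]] := Ik k.
rewrite -expnM [(n * k)%N]mulnC expnM -expnMn; apply: main sepx.
by rewrite expn_gt0 d0.
Qed.

End Finiteness.

(** * Ideals and their norms *)

Section Ideals.
Variable K : fieldExtType rat.
Local Notation "'𝔬'" := (@ring_of_integers K).
Implicit Types (P Q I J : set K) (x y : K).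

Lemma ideal_sub I : is_ideal I -> I `<=` 𝔬. Proof. by case. Qed.
Lemma ideal0 I : is_ideal I -> I 0. Proof. by case. Qed.
Lemma idealD I x y : is_ideal I -> I x -> I y -> I (x + y). Proof. by case=> _ _ H _; apply: H. Qed.
Lemma idealMl I a x : is_ideal I -> 𝔬 a -> I x -> I (a * x). Proof. by case=> _ _ _; apply. Qed.
Lemma idealMr I a x : is_ideal I -> 𝔬 a -> I x -> I (x * a).
Proof. by move=> iI Oa Ix; rewrite mulrC; apply: idealMl. Qed.
Lemma idealN I x : is_ideal I -> I x -> I (- x).
Proof. by move=> iI Ix; rewrite -mulN1r; apply: idealMl => //; apply/rintN/rint1. Qed.
Lemma idealB I x y : is_ideal I -> I x -> I y -> I (x - y).
Proof. by move=> iI Ix Iy; apply: idealD => //; apply: idealN. Qed.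
Lemma subgroup_ideal I : is_ideal I -> subgroup I.
Proof. by move=> iI; split=> [|x y]; [apply: ideal0 | apply: idealB]. Qed.

Lemma ideal_rint : is_ideal 𝔬.
Proof. by split=> //; [apply: rint0 | apply: rintD | apply: rintM]. Qed.

Lemma ideal_one I : is_ideal I -> I 1 -> I = 𝔬.
Proof.
move=> iI I1; apply/seteqP; split=> [|x Ox]; first exact: ideal_sub.
by rewrite -[x]mulr1; apply: idealMl.
Qed.

Lemma principal_ideal_ideal x : 𝔬 x -> is_ideal (principal_ideal x).
Proof.
move=> Ox; split.
- by move=> _ [a Oa <-]; apply: rintM.
- by exists 0; [apply: rint0 | rewrite mul0r].
- by move=> _ _ [a Oa <-] [b Ob <-]; exists (a + b); [apply: rintD | rewrite mulrDl].
- by move=> a _ Oa [b Ob <-]; exists (a * b); [apply: rintM | rewrite mulrA].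
Qed.

Lemma principal_ideal_self x : principal_ideal x x.
Proof. by exists 1; [apply: rint1 | rewrite mul1r]. Qed.

Lemma mem_ideal_mul P Q x y : P x -> Q y -> ideal_mul P Q (x * y).
Proof. by exists 1%N, (fun=> x), (fun=> y); split=> //; rewrite big_ord1. Qed.

Lemma ideal_mul_ind P Q S : S 0 -> (forall x y, S x -> S y -> S (x + y)) ->
  (forall x y, P x -> Q y -> S (x * y)) -> ideal_mul P Q `<=` S.
Proof.
move=> S0 SD SM _ [n [x [y [Px Qy ->]]]].
by elim/big_ind: _ => // i _; apply: SM.
Qed.

Lemma ideal_mul0 P Q : ideal_mul P Q 0.
Proof. by exists 0%N, (fun=> 0), (fun=> 0); split=> [[]//|[]//|]; rewrite big_ord0. Qed.

Lemma ideal_mulD P Q x y : ideal_mul P Q x -> ideal_mul P Q y -> ideal_mul P Q (x + y).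
Proof.
move=> [n [a [b [Pa Qb ->]]]] [m [c [d [Pc Qd ->]]]].
exists (n + m)%N, (fun i => match fintype.split i with inl j => a j | inr j => c j end),
  (fun i => match fintype.split i with inl j => b j | inr j => d j end).
split; try by move=> i; case: (fintype.split i).
rewrite big_split_ord /=; congr (_ + _); apply: eq_bigr => i _.
  by rewrite (unsplitK (inl i)).
by rewrite (unsplitK (inr i)).
Qed.

Lemma ideal_mul_scale P Q a : (forall x, P x -> P (a * x)) ->
  forall z, ideal_mul P Q z -> ideal_mul P Q (a * z).
Proof.
move=> Pa z Pz; move: z Pz; apply: (ideal_mul_ind (S := fun z => ideal_mul P Q (a * z))).
- by rewrite mulr0; apply: ideal_mul0.
- by move=> x y; rewrite mulrDr; apply: ideal_mulD.
- by move=> x y Px Qy; rewrite mulrA; apply: mem_ideal_mul => //; apply: Pa.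
Qed.

Lemma is_ideal_mul P Q : is_ideal P -> is_ideal Q -> is_ideal (ideal_mul P Q).
Proof.
move=> iP iQ; split.
- apply: ideal_mul_ind; [exact: rint0 | exact: rintD |].
  by move=> x y /(ideal_sub iP) Ox /(ideal_sub iQ) Oy; apply: rintM.
- exact: ideal_mul0.
- by move=> x y; apply: ideal_mulD.
- by move=> a x Oa; apply: ideal_mul_scale => y; apply: idealMl.
Qed.

Lemma ideal_mulS P P' Q Q' : P `<=` P' -> Q `<=` Q' -> ideal_mul P Q `<=` ideal_mul P' Q'.
Proof.
move=> PP' QQ'; apply: ideal_mul_ind; [exact: ideal_mul0 | exact: ideal_mulD |].
by move=> x y /PP' Px /QQ' Qy; apply: mem_ideal_mul.
Qed.

Lemma ideal_mul_subl P Q : is_ideal P -> Q `<=` 𝔬 -> ideal_mul P Q `<=` P.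
Proof.
move=> iP QO; apply: ideal_mul_ind; [exact: ideal0 | by move=> x y; apply: idealD |].
by move=> x y Px /QO Oy; apply: idealMr.
Qed.

Lemma ideal_mulC P Q : ideal_mul P Q = ideal_mul Q P.
Proof.
have main (A B : set K) : ideal_mul A B `<=` ideal_mul B A.
  apply: ideal_mul_ind; [exact: ideal_mul0 | exact: ideal_mulD |].
  by move=> x y Px Qy; rewrite mulrC; apply: mem_ideal_mul.
by apply/seteqP; split.
Qed.

Lemma ideal_mul_subr P Q : is_ideal Q -> P `<=` 𝔬 -> ideal_mul P Q `<=` Q.
Proof. by rewrite ideal_mulC; apply: ideal_mul_subl. Qed.

Lemma ideal_mulA P Q J : ideal_mul P (ideal_mul Q J) = ideal_mul (ideal_mul P Q) J.
Proof.
have main (A B C : set K) : ideal_mul A (ideal_mul B C) `<=` ideal_mul (ideal_mul A B) C.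
  apply: ideal_mul_ind; [exact: ideal_mul0 | exact: ideal_mulD |].
  move=> x y Ax; apply: (ideal_mul_ind (S := fun y => ideal_mul (ideal_mul A B) C (x * y))).
  - by rewrite mulr0; apply: ideal_mul0.
  - by move=> u v; rewrite mulrDr; apply: ideal_mulD.
  - by move=> u v Bu Cv; rewrite mulrA; apply/mem_ideal_mul => //; apply: mem_ideal_mul.
apply/seteqP; split; first exact: main.
by rewrite [ideal_mul P Q]ideal_mulC ideal_mulC [ideal_mul P _]ideal_mulC [ideal_mul Q J]ideal_mulC; apply: main.
Qed.

Lemma ideal_mul1 P : is_ideal P -> ideal_mul P 𝔬 = P.
Proof.
move=> iP; apply/seteqP; split; first exact: ideal_mul_subl.
by move=> x Px; rewrite -[x]mulr1; apply: mem_ideal_mul => //; apply: rint1.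
Qed.

Definition nonzero_ideal I := is_ideal I /\ exists2 x, I x & x != 0.

Lemma nonzero_ideal_prime P : prime_ideal P -> nonzero_ideal P.
Proof. by case. Qed.

Lemma nonzero_ideal_rint : nonzero_ideal 𝔬.
Proof. by split; [exact: ideal_rint | exists 1; [exact: rint1 | exact: oner_neq0]]. Qed.

Lemma nonzero_ideal_principal x : 𝔬 x -> x != 0 -> nonzero_ideal (principal_ideal x).
Proof.
by move=> Ox x0; split; [exact: principal_ideal_ideal | exists x => //; exact: principal_ideal_self].
Qed.

Lemma nonzero_ideal_mul P Q : nonzero_ideal P -> nonzero_ideal Q -> nonzero_ideal (ideal_mul P Q).
Proof.
move=> [iP [x Px x0]] [iQ [y Qy y0]]; split; first exact: is_ideal_mul.
by exists (x * y); [apply: mem_ideal_mul | rewrite mulf_neq0].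
Qed.

Lemma nonzero_ideal_sub I J : nonzero_ideal I -> is_ideal J -> I `<=` J -> nonzero_ideal J.
Proof. by move=> [_ [x Ix x0]] iJ IJ; split=> //; exists x => //; apply: IJ. Qed.

Lemma ideal_nat I : nonzero_ideal I -> exists2 n : nat, (0 < n)%N & I n%:R.
Proof.
move=> [iI [x Ix x0]]; have [n n0 [b Ob Enb]] := rint_dvd_nat (ideal_sub iI Ix) x0.
by exists n => //; rewrite Enb; apply: idealMr.
Qed.

Lemma ideal_index_exists I : nonzero_ideal I -> exists m, has_index 𝔬 I m.
Proof.
move=> nI; have [n n0 In] := ideal_nat nI.
suff /has_index_exists[m _ Hm] : index_le 𝔬 I (n ^ \dim {:K}) by exists m.
apply: index_le_sub (index_rint n0) => //.
by move=> _ [x Ox <-]; apply: idealMr => //; case: nI.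
Qed.

(** The absolute norm; [0] is only a default, for subsets without a finite index. *)
Definition nm I : nat := xget 0%N [set m | has_index 𝔬 I m].

Lemma nmP I : nonzero_ideal I -> has_index 𝔬 I (nm I).
Proof. by move=> /ideal_index_exists[m Hm]; rewrite /nm; case: xgetP => [x -> //|/(_ m)]. Qed.

Lemma nm_eq I m : nonzero_ideal I -> has_index 𝔬 I m -> nm I = m.
Proof. by move=> nI; apply: has_index_uniq; apply: nmP. Qed.

Lemma nm_gt0 I : nonzero_ideal I -> (0 < nm I)%N.
Proof. by move=> /nmP; apply: has_index_gt0; apply: rint0. Qed.

(* Stated for subgroups, as it is used for the chain of [Z]-modules below. *)
Lemma index_lt (A B C : set K) b c x : subgroup A -> subgroup B -> subgroup C ->
  C `<=` B -> B `<=` A -> B x -> ~ C x -> has_index A B b -> has_index A C c -> (b < c)%N.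
Proof.
move=> sA sB sC CB BA Bx Cx Hb Hc.
have leBC : index_le B C c by apply: index_le_sub Hc.1.
have [m _ Hm] := has_index_exists leBC.
have m1 : (1 < m)%N.
  have := Hm.1 bool (fun e => if e then x else 0); rewrite card_bool; apply.
  split=> [[//|]|]; first by apply: sB.1.
  case=> -[] //=; first by rewrite subr0 => /Cx.
  by move=> /(subgroup_subC sC); rewrite subr0 => /Cx.
have <- := has_index_uniq (has_index_mul sA sB sC CB BA Hb Hm) Hc.
by rewrite -[X in (X < _)%N]muln1 ltn_pmul2l // (has_index_gt0 _ Hb) //; apply: sA.1.
Qed.

Lemma nm_lt I J x : nonzero_ideal I -> is_ideal J -> I `<=` J -> J x -> ~ I x -> (nm J < nm I)%N.
Proof.
move=> nI iJ IJ Jx Ix; have nJ := nonzero_ideal_sub nI iJ IJ.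
apply: index_lt Jx Ix (nmP nJ) (nmP nI) => //; try exact/subgroup_ideal; last exact: ideal_sub.
- exact: subgroup_rint.
- by apply: subgroup_ideal; case: nI.
Qed.

Lemma prime_ideal_mem P : prime_ideal P -> is_ideal P. Proof. by case. Qed.

Lemma prime_ideal_exp P x n : prime_ideal P -> 𝔬 x -> P (x ^+ n) -> P x.
Proof.
move=> pP Ox; have [iP _ P1 Pp] := pP; elim: n => [|n IH]; first by rewrite expr0.
by rewrite exprS => /Pp[] //; apply: rintX.
Qed.

(** There are finitely many classes modulo [P], so two powers of [a] agree; as [a] is not in the
    prime [P], their quotient [a^(k + 1)] is [1] modulo [P]. *)
Lemma prime_maximal P a : prime_ideal P -> 𝔬 a -> ~ P a ->
  exists r p, [/\ 𝔬 r, P p & 1 = r * a + p].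
Proof.
move=> pP Oa Pa; have [iP [w Pw w0] P1 Pp] := pP.
have [le _] := nmP (nonzero_ideal_prime pP).
have [i [j [ij Pij]]] : exists i j : nat, (i < j)%N /\ P (a ^+ i - a ^+ j).
  apply: contrapT => nex; have := le 'I_(nm P).+1 (fun i => a ^+ i).
  rewrite card_ord ltnn => H; suff: false by []; apply: H.
  split=> [i|i j Pij]; first exact: rintX.
  apply/val_inj; case: (ltngtP i j) => // lij; case: nex; first by exists i, j.
  by exists j, i; split=> //; apply: subgroup_subC Pij; apply: subgroup_ideal.
have [k Ejk] : exists k, j = (i + k.+1)%N by exists (j - i).-1; lia.
exists (a ^+ k), (1 - a ^+ k.+1); split; first exact: rintX; last by rewrite -exprSr addrC subrK.
have : P (a ^+ i * (1 - a ^+ k.+1)) by rewrite mulrBr mulr1 -exprD -Ejk.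
case/Pp => //; [exact: rintX | by apply: rintB; [exact: rint1 | exact: rintX] |].
by move=> /prime_ideal_exp H; case: Pa; apply: H.
Qed.

Definition ideal_adjoin I x : set K := [set y | exists r a, [/\ 𝔬 r, I a & y = a + r * x]].

Lemma is_ideal_adjoin I x : is_ideal I -> 𝔬 x -> is_ideal (ideal_adjoin I x).
Proof.
move=> iI Ox; split.
- move=> _ [r [a [Or Ia ->]]]; apply: rintD; first exact: ideal_sub Ia.
  exact: rintM.
- by exists 0, 0; split; [exact: rint0 | exact: ideal0 | rewrite mul0r addr0].
- move=> _ _ [r [a [Or Ia ->]]] [s [b [Os Ib ->]]]; exists (r + s), (a + b).
  by split; [exact: rintD | exact: idealD | ring].
- move=> c _ Oc [r [a [Or Ia ->]]]; exists (c * r), (c * a).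
  by split; [exact: rintM | exact: idealMl | ring].
Qed.

Lemma ideal_adjoin_sub I x : I `<=` ideal_adjoin I x.
Proof. by move=> y Iy; exists 0, y; split=> //; [exact: rint0 | rewrite mul0r addr0]. Qed.

Lemma ideal_adjoin_mem I x : is_ideal I -> ideal_adjoin I x x.
Proof. by move=> iI; exists 1, 0; split; [exact: rint1 | exact: ideal0 | rewrite add0r mul1r]. Qed.

(** Among the ideals that contain [I] and no power of [s], one of least norm is prime. If it
    contained [x y] but neither factor, adjoining [x] or [y] would bring in powers of [s], and the
    product of these powers would lie in the ideal itself. *)
Lemma prime_avoiding I s : nonzero_ideal I -> 𝔬 s -> (forall e, ~ I (s ^+ e)) ->
  exists P, [/\ prime_ideal P, I `<=` P & ~ P s].
Proof.
move=> nI Os Ise.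
pose good J := [/\ is_ideal J, I `<=` J & forall e, ~ J (s ^+ e)].
pose D m := `[< exists2 J, good J & nm J = m >].
have exD : exists m, D m by exists (nm I); apply/asboolP; exists I => //; split=> //; case: nI.
have [m /asboolP[P [iP IP Ps] Em] min] := ex_minnP exD.
have nP := nonzero_ideal_sub nI iP IP.
have bigger x : 𝔬 x -> ~ P x -> exists e r a, [/\ 𝔬 r, P a & s ^+ e = a + r * x].
  move=> Ox Px; apply: contrapT => nex.
  have lt := nm_lt nP (is_ideal_adjoin iP Ox) (@ideal_adjoin_sub _ x) (ideal_adjoin_mem _ iP) Px.
  have : D (nm (ideal_adjoin P x)).
    apply/asboolP; exists (ideal_adjoin P x) => //; split; first exact: is_ideal_adjoin.
      by move=> y /IP; apply: ideal_adjoin_sub.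
    by move=> e [r [a [Or Pa E]]]; apply: nex; exists e, r, a.
  by move/min; rewrite leqNgt -Em lt.
exists P; split=> //; last by have := Ps 1%N; rewrite expr1.
split=> //; first by case: nP.
  by have := Ps 0%N; rewrite expr0.
move=> x y Ox Oy Pxy; apply: contrapT => /not_orP[Px Py].
have [e [r [a [Or Pa E]]]] := bigger _ Ox Px.
have [e' [r' [a' [Or' Pa' E']]]] := bigger _ Oy Py.
apply: (Ps (e + e')%N); rewrite exprD E E'.
have -> : (a + r * x) * (a' + r' * y) = (a' + r' * y) * a + (r * x) * a' + (r * r') * (x * y) by ring.
have OP := ideal_sub iP.
apply: idealD => //; last by apply: idealMl => //; apply: rintM.
by apply: idealD => //; apply: idealMl => //; do ?apply: rintD; do ?apply: rintM => //; apply: OP.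
Qed.

(* The modules [n * (Z + Z x + ... + Z x^(k-1)) + n * o] form an increasing chain
   of subgroups containing [n * o], hence the chain is eventually constant. *)
Lemma rint_stable I x : nonzero_ideal I -> (forall y, I y -> I (x * y)) -> 𝔬 x.
Proof.
move=> nI Ix; have [n n0 In] := ideal_nat nI; have iI := nI.1.
have n0' : n%:R != 0 :> K by rewrite natr_numfield_eq0 -lt0n.
have Onx k : 𝔬 (n%:R * x ^+ k).
  apply: (ideal_sub iI); elim: k => [|k IH]; first by rewrite mulr1.
  by rewrite exprS mulrCA; apply: Ix.
pose S k : set K := [set y | exists (z : 'I_k -> int) w,
  𝔬 w /\ y = \sum_i (z i)%:~R * (n%:R * x ^+ i) + n%:R * w].
have sS k : subgroup (S k).
  split.
    exists (fun=> 0), 0; split; first exact: rint0.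
    by rewrite mulr0 addr0 big1 // => i _; rewrite mul0r.
  move=> _ _ [z [w [Ow ->]]] [z' [w' [Ow' ->]]].
  exists (fun i => z i - z' i), (w - w'); split; first exact: rintB.
  rewrite opprD addrACA -mulrBr -sumrB; congr (_ + _); apply: eq_bigr => i _.
  by rewrite intrB mulrBl.
have SO k : S k `<=` 𝔬.
  move=> _ [z [w [Ow ->]]]; apply: rintD; last by apply: rintM => //; apply: rint_nat.
  by apply: rint_sum => i; apply: rintM => //; apply: rint_int.
have SS k : S k `<=` S k.+1.
  move=> _ [z [w [Ow ->]]].
  exists (fun i => if unlift ord_max i is Some j then z j else 0), w; split=> //.
  rewrite big_ord_recr /= unlift_none mul0r addr0; congr (_ + _).
  apply: eq_bigr => i _; have -> : widen_ord (leqnSn k) i = lift ord_max i.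
    by apply/val_inj; rewrite /= /bump leqNgt ltn_ord.
  by rewrite liftK.
have noS k : [set n%:R * y | y in 𝔬] `<=` S k.
  move=> _ [y Oy <-]; exists (fun=> 0), y; split=> //.
  by rewrite big1 ?add0r // => i _; rewrite mul0r.
have idx k : exists m, has_index 𝔬 (S k) m.
  suff /has_index_exists[m _ Hm] : index_le 𝔬 (S k) (n ^ \dim {:K}) by exists m.
  by apply: index_le_sub (index_rint n0).
pose D m := `[< exists k, has_index 𝔬 (S k.+1) m >].
have exD : exists m, D m by have [m Hm] := idx 1%N; exists m; apply/asboolP; exists 0%N.
have [m /asboolP[k Hk] min] := ex_minnP exD.
have [z [w [Ow E]]] : S k.+1 (n%:R * x ^+ k.+1).
  apply: contrapT => nS; have [m' Hm'] := idx k.+2.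
  have : (m' < m)%N.
    apply: index_lt (SS k.+1) (SO _) _ nS Hm' Hk => //; first exact: subgroup_rint.
    exists (fun i => (i == ord_max)%:Z), 0; split; first exact: rint0.
    rewrite mulr0 addr0 big_ord_recr /= eqxx mul1r big1 ?add0r // => i _.
    by rewrite eqE /= ltn_eqF ?mul0r.
  by rewrite ltnNge min //; apply/asboolP; exists k.+1.
have Ek : x ^+ k.+1 = \sum_i (z i)%:~R * x ^+ i + w.
  apply: (mulfI n0'); rewrite E mulrDr mulr_sumr; congr (_ + _).
  by apply: eq_bigr => i _; rewrite mulrCA.
pose q : {poly K} := \poly_(i < k.+1) (if i == 0%N then w else 0) + \poly_(i < k.+1) (z (inord i))%:~R.
pose p : {poly K} := 'X^(k.+1) - q.
have szq : (size q < k.+2)%N.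
  by rewrite ltnS (leq_trans (size_polyD _ _)) // geq_max !size_poly.
have mp : p \is monic by rewrite monicE lead_coefDl ?size_opp ?size_polyXn ?lead_coefXn.
apply: (rint_root_monic mp).
  rewrite rootE !(hornerD, hornerN) hornerXn subr_eq0 Ek addrC !horner_poly; apply/eqP; congr (_ + _).
    rewrite (bigD1 ord0) //= expr0 mulr1 big1 ?addr0 // => i i0.
    by rewrite ifF ?mul0r //; apply: contraNF i0 => /eqP ?; apply/eqP/val_inj.
  by apply: eq_bigr => i _; rewrite inord_val.
move=> i; rewrite !(coefB, coefD) coefXn !coef_poly; apply: rintB.
  by apply: rint_nat.
by case: ifP => _; [apply: rintD; [case: ifP => _ //; exact: rint0 | exact: rint_int] | rewrite addr0; exact: rint0].
Qed.

End Ideals.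

(** * Unique factorization of ideals *)

Section Dedekind.
Variable K : fieldExtType rat.
Local Notation "'𝔬'" := (@ring_of_integers K).
Implicit Types (P Q I J : set K) (x y : K) (ps : seq (set K)).

Definition ideal_prod ps : set K := foldr (@ideal_mul K) 𝔬 ps.

Lemma is_ideal_prod ps : (forall P, P \in ps -> is_ideal P) -> is_ideal (ideal_prod ps).
Proof.
elim: ps => [|P ps IH] H; first exact: ideal_rint.
by apply: is_ideal_mul; [apply: H; rewrite mem_head | apply: IH => Q Qs; apply: H; rewrite inE Qs orbT].
Qed.

Lemma ideal_prod_cat ps ps' : (forall P, P \in ps' -> is_ideal P) ->
  ideal_prod (ps ++ ps') = ideal_mul (ideal_prod ps) (ideal_prod ps').
Proof.
move=> H; elim: ps => [|P ps IH] /=; last by rewrite /ideal_prod /= -/(ideal_prod _) IH ideal_mulA.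
by rewrite ideal_mulC ideal_mul1 //; apply: is_ideal_prod.
Qed.

Definition primes_in ps := forall P, P \in ps -> prime_ideal P.

Lemma primes_in_ideal ps : primes_in ps -> forall P, P \in ps -> is_ideal P.
Proof. by move=> H P /H/prime_ideal_mem. Qed.

Lemma nonzero_ideal_prod ps : primes_in ps -> nonzero_ideal (ideal_prod ps).
Proof.
elim: ps => [|P ps IH] H; first exact: nonzero_ideal_rint.
apply: nonzero_ideal_mul; first by apply/nonzero_ideal_prime/H; rewrite mem_head.
by apply: IH => Q Qs; apply: H; rewrite inE Qs orbT.
Qed.

Lemma ideal_prod_perm ps ps' : (forall P, P \in ps -> is_ideal P) ->
  perm_eq ps ps' -> ideal_prod ps = ideal_prod ps'.
Proof.
elim: ps ps' => [|P ps IH] ps' H; first by move/perm_size/esym/size0nil ->.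
move=> pp; have Ps' : P \in ps' by rewrite -(perm_mem pp) mem_head.
have [s1 [s2 E]] : exists s1 s2, ps' = s1 ++ P :: s2.
  by case/splitPr: Ps' => s1 s2; exists s1, s2.
have H' Q : Q \in ps' -> is_ideal Q by rewrite -(perm_mem pp); apply: H.
rewrite E in pp H' *.
have pp' : perm_eq ps (s1 ++ s2).
  by rewrite -(perm_cons P); apply: perm_trans pp _; rewrite perm_catC /= perm_cons perm_catC.
rewrite /= ideal_prod_cat; last by move=> Q Qs; apply: H'; rewrite mem_cat Qs orbT.
rewrite /ideal_prod /= -/(ideal_prod _) -/(ideal_prod _) (IH _ _ pp'); last first.
  by move=> Q Qs; apply: H; rewrite inE Qs orbT.
rewrite ideal_prod_cat; last by move=> Q Qs; apply: H'; rewrite mem_cat inE Qs !orbT.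
by rewrite !ideal_mulA [ideal_mul P _]ideal_mulC.
Qed.

(** Induction on the norm: if [I] contains [x y] but neither factor, then [I + (x)] and [I + (y)]
    have smaller norms, and their product lies in [I]. *)
Lemma contains_prime_product I : nonzero_ideal I -> exists2 ps, primes_in ps & ideal_prod ps `<=` I.
Proof.
have [n] := ubnP (nm I); elim: n I => // n IH I ltn nI.
have [I1|I1] := pselect (I 1).
  by exists [::] => //; rewrite (ideal_one nI.1 I1).
have [pI|npI] := pselect (prime_ideal I).
  exists [:: I]; first by move=> P; rewrite inE => /eqP->.
  by rewrite /ideal_prod /= ideal_mul1 //; case: nI.
have [x [y [Ox Oy Ixy Ix Iy]]] : exists x y, [/\ 𝔬 x, 𝔬 y, I (x * y), ~ I x & ~ I y].
  apply: contrapT => nex; apply: npI; split=> //; try by case: nI.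
  move=> x y Ox Oy Ixy; apply: contrapT => /not_orP[Ix Iy].
  by apply: nex; exists x, y.
have sub z : 𝔬 z -> ~ I z -> exists2 ps, primes_in ps & ideal_prod ps `<=` ideal_adjoin I z.
  move=> Oz Iz; have iz := is_ideal_adjoin nI.1 Oz.
  apply: IH; last by apply: nonzero_ideal_sub nI iz _; apply: ideal_adjoin_sub.
  rewrite -ltnS; apply: leq_trans ltn; rewrite ltnS.
  by apply: (nm_lt nI iz) Iz; [apply: ideal_adjoin_sub | apply: ideal_adjoin_mem; case: nI].
have [ps pps sps] := sub _ Ox Ix; have [qs pqs sqs] := sub _ Oy Iy.
exists (ps ++ qs); first by move=> P; rewrite mem_cat => /orP[/pps|/pqs].
rewrite ideal_prod_cat; last exact: primes_in_ideal.
apply: subset_trans (ideal_mulS sps sqs) _; have iI := nI.1; have OI := ideal_sub iI.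
apply: ideal_mul_ind; [exact: ideal0 | by move=> u v; apply: idealD |].
move=> _ _ [r [a [Or Ia ->]]] [s [b [Os Ib ->]]].
have -> : (a + r * x) * (b + s * y) = (b + s * y) * a + (r * x) * b + (r * s) * (x * y) by ring.
apply: idealD => //; last by apply: idealMl => //; apply: rintM.
by apply: idealD => //; apply: idealMl => //; do ?apply: rintD; do ?apply: rintM => //; apply: OI.
Qed.

Lemma prime_sub_mul P I J : prime_ideal P -> is_ideal I -> is_ideal J ->
  ideal_mul I J `<=` P -> I `<=` P \/ J `<=` P.
Proof.
move=> [iP _ P1 Pp] iI iJ IJP; apply: contrapT => /not_orP[].
move=> /existsNP[x /not_implyP[Ix Px]] /existsNP[y /not_implyP[Jy Py]].
by case: (Pp x y) => //; [exact: (ideal_sub iI) | exact: (ideal_sub iJ) | apply/IJP/mem_ideal_mul].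
Qed.

Lemma prime_sub_eq P Q : prime_ideal P -> prime_ideal Q -> P `<=` Q -> P = Q.
Proof.
move=> pP pQ PQ; apply/seteqP; split=> // x Qx; apply: contrapT => Px.
have [iQ _ Q1 _] := pQ; have Ox := ideal_sub iQ Qx.
have [r [p [Or Pp E]]] := prime_maximal pP Ox Px.
by apply: Q1; rewrite E; apply: idealD => //; [apply: idealMl | apply: PQ].
Qed.

Lemma prime_sub_prod P ps : prime_ideal P -> primes_in ps -> ideal_prod ps `<=` P -> P \in ps.
Proof.
move=> pP; elim: ps => [|Q ps IH] H.
  by case: pP => [_ _ P1 _] /(_ 1) /(_ (rint1 K)).
have Qs : primes_in ps by move=> J Js; apply: H; rewrite inE Js orbT.
have pQ : prime_ideal Q by apply: H; rewrite mem_head.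
rewrite /ideal_prod /= => /prime_sub_mul [] //.
- exact: prime_ideal_mem.
- exact/is_ideal_prod/primes_in_ideal.
- by move=> QP; rewrite inE (prime_sub_eq pQ pP QP) eqxx.
- by move=> QP; rewrite inE (IH Qs) ?orbT.
Qed.

(** The inverse of [P] as a fractional ideal; [P] is invertible when [1] lies in [P] times this
    inverse. *)
Definition ideal_quo P : set K := [set x | forall p, P p -> 𝔬 (x * p)].
Definition invertible_ideal P := ideal_mul P (ideal_quo P) 1.

Lemma rint_quo P x : is_ideal P -> 𝔬 x -> ideal_quo P x.
Proof. by move=> iP Ox p /(ideal_sub iP); apply: rintM. Qed.

Lemma ideal_prod_rem P ps : (forall Q, Q \in ps -> is_ideal Q) -> P \in ps ->
  ideal_prod ps = ideal_mul P (ideal_prod (rem P ps)).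
Proof. by move=> H Ps; rewrite (ideal_prod_perm H (perm_to_rem Ps)). Qed.

(** Let [g] be in [P]. A shortest product of primes contained in [(g)] has [P] as a factor, and the
    product of the other factors has an element [b] outside [(g)]. Then [x = b / g] lies in the
    inverse of [P] but is not integral, so that [x P] is not contained in [P], and the maximality of
    [P] gives [1]. *)
Lemma prime_invertible P : prime_ideal P -> invertible_ideal P.
Proof.
move=> pP; have [iP [g Pg g0] P1 _] := pP; have Og := ideal_sub iP Pg.
pose D n := `[< exists ps, [/\ primes_in ps, ideal_prod ps `<=` principal_ideal g & size ps = n] >].
have exD : exists n, D n.
  have [ps pps sps] := contains_prime_product (nonzero_ideal_principal Og g0).
  by exists (size ps); apply/asboolP; exists ps.
have [n /asboolP[ps [pps sps Esz]] min] := ex_minnP exD.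
have gP : principal_ideal g `<=` P by move=> _ [a Oa <-]; apply: idealMl.
have Ps : P \in ps by apply: prime_sub_prod pP pps _; apply: subset_trans gP.
have pps' : primes_in (rem P ps) by move=> Q /mem_rem; apply: pps.
have [b [psb gb]] : exists b, ideal_prod (rem P ps) b /\ ~ principal_ideal g b.
  apply: contrapT => nex; have : D (size ps).-1.
    apply/asboolP; exists (rem P ps); split=> //; last by rewrite size_rem.
    by move=> b psb; apply: contrapT => gb; apply: nex; exists b.
  by move/min; rewrite -Esz; case: (ps) Ps => //= *; lia.
have bP p : P p -> principal_ideal g (b * p).
  move=> Pp; apply: sps; rewrite (ideal_prod_rem (primes_in_ideal pps) Ps) mulrC.
  exact: mem_ideal_mul.
pose x := b / g.
have xP p : P p -> 𝔬 (x * p).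
  by move=> /bP[a Oa E]; rewrite /x mulrAC -E mulfK.
have xO : ~ 𝔬 x by move=> Ox; apply: gb; exists x => //; rewrite /x divfK.
have [p [Pp Pxp]] : exists p, P p /\ ~ P (x * p).
  apply: contrapT => nex; apply: xO; apply: (rint_stable (nonzero_ideal_prime pP)) => y Py.
  by apply: contrapT => Pxy; apply: nex; exists y.
have [r [p' [Or Pp' E]]] := prime_maximal pP (xP _ Pp) Pxp.
rewrite /invertible_ideal E; have -> : r * (x * p) + p' = p * (r * x) + p' * 1 by ring.
apply: ideal_mulD; apply: mem_ideal_mul => //; last by apply: rint_quo => //; apply: rint1.
by move=> q Pq; rewrite -mulrA; apply: rintM => //; apply: xP.
Qed.

Lemma invertible_mul P Q : is_ideal P -> is_ideal Q ->
  invertible_ideal P -> invertible_ideal Q -> invertible_ideal (ideal_mul P Q).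
Proof.
move=> iP iQ vP vQ; rewrite /invertible_ideal -[1]mulr1.
have : ideal_mul (ideal_mul P (ideal_quo P)) (ideal_mul Q (ideal_quo Q)) (1 * 1).
  exact: mem_ideal_mul.
rewrite ideal_mulA -[ideal_mul (ideal_mul P _) Q]ideal_mulA [ideal_mul (ideal_quo P) Q]ideal_mulC.
rewrite ideal_mulA -ideal_mulA; apply: ideal_mulS => //.
apply: ideal_mul_ind.
- by move=> p _; rewrite mul0r; apply: rint0.
- by move=> x y Hx Hy p Pp; rewrite mulrDl; apply: rintD; [apply: Hx | apply: Hy].
- move=> x y Hx Hy p Pp; move: p Pp.
  apply: (ideal_mul_ind (S := fun p => 𝔬 (x * y * p))).
  + by rewrite mulr0; apply: rint0.
  + by move=> u v; rewrite mulrDr; apply: rintD.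
  + by move=> u v Pu Qv; rewrite mulrACA; apply: rintM; [apply: Hx | apply: Hy].
Qed.

Lemma invertible_ind P (S : set K) : invertible_ideal P -> S 0 ->
  (forall x y, S x -> S y -> S (x + y)) -> (forall x y, P x -> ideal_quo P y -> S (x * y)) -> S 1.
Proof. by move=> vP S0 SD SM; apply: (ideal_mul_ind S0 SD SM vP). Qed.

(** To contain is to divide: the second factor is [I] times the inverse of [P]. *)
Lemma ideal_mul_quo I P : is_ideal P -> invertible_ideal P -> is_ideal I -> I `<=` P ->
  I = ideal_mul P [set x | 𝔬 x /\ forall p, P p -> I (x * p)].
Proof.
move=> iP vP iI IP; apply/seteqP; split=> [z Iz|]; last first.
  apply: ideal_mul_ind; [exact: ideal0 | by move=> x y; apply: idealD |].
  by move=> p x Pp [_ H]; rewrite mulrC; apply: H.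
rewrite -[z]mul1r; apply: (invertible_ind (S := fun u => ideal_mul P _ (u * z)) vP).
- by rewrite mul0r; apply: ideal_mul0.
- by move=> x y; rewrite mulrDl; apply: ideal_mulD.
- move=> p x Pp Hx; rewrite -mulrA; apply: mem_ideal_mul => //; split; first exact/Hx/IP.
  by move=> q Pq; rewrite mulrAC; apply: idealMl => //; apply: Hx.
Qed.

Lemma ideal_divides_mem P x : is_ideal P -> ideal_divides P x -> P x.
Proof.
move=> iP [Q iQ E]; have : principal_ideal x x by apply: principal_ideal_self.
rewrite E; apply: ideal_mul_subl => //; exact: ideal_sub.
Qed.

Lemma is_ideal_quo I P : is_ideal I -> is_ideal [set x | 𝔬 x /\ forall p, P p -> I (x * p)].
Proof.
move=> iI; split.
- by move=> x [].
- by split; [exact: rint0 | move=> p _; rewrite mul0r; apply: ideal0].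
- move=> x y [Ox Hx] [Oy Hy]; split; first exact: rintD.
  by move=> p Pp; rewrite mulrDl; apply: idealD => //; [apply: Hx | apply: Hy].
- move=> a x Oa [Ox Hx]; split; first exact: rintM.
  by move=> p Pp; rewrite -mulrA; apply: idealMl => //; apply: Hx.
Qed.

Lemma mem_ideal_divides P x : prime_ideal P -> P x -> ideal_divides P x.
Proof.
move=> pP Px; have iP := prime_ideal_mem pP; have Ox := ideal_sub iP Px.
have ix := principal_ideal_ideal Ox.
exists [set y | 𝔬 y /\ forall p, P p -> principal_ideal x (y * p)]; first exact: is_ideal_quo.
by apply: ideal_mul_quo => //; [exact: prime_invertible | move=> _ [a Oa <-]; apply: idealMl].
Qed.

(** Multiplication by an element [x] of [Q] outside [P Q] identifies [o / P] with [Q / P Q]. Its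
    inverse is multiplication by [r y], where [y] lies in the inverse of [Q] and [r y x] is [1]
    modulo [P]. *)
Lemma nm_mul_prime P Q : prime_ideal P -> nonzero_ideal Q -> invertible_ideal Q ->
  nm (ideal_mul P Q) = (nm P * nm Q)%N.
Proof.
move=> pP nQ vQ; have [iP _ P1 _] := pP; have [iQ _] := nQ.
have nP := nonzero_ideal_prime pP; have nPQ := nonzero_ideal_mul nP nQ; have iPQ := nPQ.1.
have PQQ : ideal_mul P Q `<=` Q by apply: ideal_mul_subr => //; exact: ideal_sub.
have [x [Qx PQx]] : exists x, Q x /\ ~ ideal_mul P Q x.
  apply: contrapT => nex; apply: P1.
  have QPQ : Q `<=` ideal_mul P Q.
    by move=> z Qz; apply: contrapT => Pz; apply: nex; exists z.
  have := ideal_mulS QPQ (@subset_refl _ (ideal_quo Q)) vQ.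
  rewrite -ideal_mulA; apply: ideal_mul_subl => //.
  apply: ideal_mul_ind; [exact: rint0 | exact: rintD |].
  by move=> u v Qu Hv; rewrite mulrC; apply: Hv.
have [y [Hy Pyx]] : exists y, ideal_quo Q y /\ ~ P (y * x).
  apply: contrapT => nex; apply: PQx; rewrite -[x]mul1r.
  apply: (invertible_ind (S := fun u => ideal_mul P Q (u * x)) vQ).
  - by rewrite mul0r; apply: ideal_mul0.
  - by move=> u v; rewrite mulrDl; apply: ideal_mulD.
  - move=> q y Qq Hy; rewrite -mulrA mulrC; apply: mem_ideal_mul => //.
    by apply: contrapT => Pyx; apply: nex; exists y.
have Oyx : 𝔬 (y * x) by apply: Hy.
have [r [p [Or Pp E]]] := prime_maximal pP Oyx Pyx.
have dec z : z = r * x * (y * z) + p * z by rewrite -{1}[z]mul1r E; ring.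
have Hidx : has_index Q (ideal_mul P Q) (nm P).
  have [leP [I [a [[Oa sepa] cI]]]] := nmP nP; split; last first.
    exists I, (fun i => a i * x); split=> //; split=> [i|i j].
      by apply: idealMl.
    rewrite -mulrBl => H; apply: sepa; apply: contrapT => Pij.
    have Oij : 𝔬 (a i - a j) by apply: rintB.
    have [s [q [Os Pq Eq]]] := prime_maximal pP Oij Pij.
    apply: PQx; rewrite -[x]mul1r Eq mulrDl -mulrA.
    by apply: idealD => //; [apply: idealMl | apply: mem_ideal_mul].
  apply: (index_le_inj (f := fun z => r * (y * z))) leP.
    by move=> z Qz; apply: rintM => //; apply: Hy.
  move=> z w Qz Qw; rewrite -mulrBr -mulrBr => H.
  rewrite [z - w]dec; apply: idealD => //.
    by rewrite mulrAC; apply: mem_ideal_mul => //.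
  by apply: mem_ideal_mul => //; apply: idealB.
apply: nm_eq => //; rewrite mulnC.
apply: (has_index_mul _ _ _ PQQ _ (nmP nQ) Hidx); try exact: subgroup_ideal.
- exact: subgroup_rint.
- exact: ideal_sub.
Qed.

Lemma invertible_prod ps : primes_in ps -> invertible_ideal (ideal_prod ps).
Proof.
elim: ps => [|P ps IH] H.
  rewrite /invertible_ideal -[1]mulr1; apply: mem_ideal_mul; first exact: rint1.
  by apply: rint_quo; [exact: ideal_rint | exact: rint1].
have Qs : primes_in ps by move=> J Js; apply: H; rewrite inE Js orbT.
have pP : prime_ideal P by apply: H; rewrite mem_head.
apply: invertible_mul; [exact: prime_ideal_mem | exact/is_ideal_prod/primes_in_ideal | |].
  exact: prime_invertible.
exact: IH.
Qed.

Lemma nm_prod ps : primes_in ps -> nm (ideal_prod ps) = (\prod_(P <- ps) nm P)%N.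
Proof.
elim: ps => [|P ps IH] H.
  rewrite big_nil; apply: nm_eq; first exact: nonzero_ideal_rint.
  split; last first.
    exists unit, (fun=> 0); split; last by rewrite card_unit.
    by split=> [_|[] []//]; apply: rint0.
  move=> I x [Ax sepx]; rewrite leqNgt; apply/negP => /card_gt1P[i [j [_ _ /eqP ij]]].
  by apply/ij/sepx; apply: rintB.
have Qs : primes_in ps by move=> J Js; apply: H; rewrite inE Js orbT.
have pP : prime_ideal P by apply: H; rewrite mem_head.
rewrite big_cons -IH // -nm_mul_prime //; first exact: nonzero_ideal_prod.
exact: invertible_prod.
Qed.

(** Induction on the norm, splitting off a prime [P] that contains [I]. The quotient is strictly
    larger than [I]: otherwise the inverse of [P] would map [I] into itself, hence consist of
    integers, and [P] would contain [1]. *)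
Lemma ideal_factorization I : nonzero_ideal I -> exists2 ps, primes_in ps & I = ideal_prod ps.
Proof.
have [n] := ubnP (nm I); elim: n I => // n IH I ltn nI; have [iI _] := nI.
have [I1|I1] := pselect (I 1).
  by exists [::] => //; rewrite (ideal_one iI I1).
have [|P [pP IP _]] := prime_avoiding nI (rint1 K); first by move=> e; rewrite expr1n.
have iP := prime_ideal_mem pP; have vP := prime_invertible pP.
have E := ideal_mul_quo iP vP iI IP; set Q := [set x | _] in E.
have iQ : is_ideal Q := is_ideal_quo P iI.
have IQ : I `<=` Q by rewrite {1}E; apply: ideal_mul_subr => //; exact: ideal_sub.
have nQ := nonzero_ideal_sub nI iQ IQ.
have ltQ : (nm Q < nm I)%N.
  have [QI|/existsNP[x /not_implyP[Qx Ix]]] := pselect (Q `<=` I); last exact: nm_lt IQ Qx Ix.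
  have EQ : Q = I by apply/seteqP; split.
  case: pP => [_ _ []]; move: vP; rewrite /invertible_ideal.
  suff H : ideal_quo P `<=` 𝔬 by apply: ideal_mul_subl.
  move=> x Hx; apply: (rint_stable nI) => y Iy; move: y Iy; rewrite {1}E.
  apply: ideal_mul_ind.
  - by rewrite mulr0; apply: ideal0.
  - by move=> u v; rewrite mulrDr; apply: idealD.
  - by move=> u v Pu; rewrite EQ => Iv; rewrite mulrA; apply: idealMl => //; apply: Hx.
have [|ps pps EQ] := IH Q _ nQ; first by rewrite -ltnS; apply: leq_trans ltn; rewrite ltnS.
exists (P :: ps); last by rewrite {1}E EQ.
by move=> J; rewrite inE => /orP[/eqP->|/pps].
Qed.

End Dedekind.

(** * Approximate roots of ideals *)

Lemma count_mem_flatten_nseq (T : eqType) (us : seq T) (k : T -> nat) (P : T) : uniq us ->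
  count_mem P (flatten [seq nseq (k Q) Q | Q <- us]) = if P \in us then k P else 0%N.
Proof.
elim: us => //= Q us IH /andP[Qus uus]; rewrite count_cat IH // count_nseq /= inE.
by rewrite [Q == P]eq_sym; case: eqP => [->|_] //=; rewrite mul1n (negPf Qus) addn0.
Qed.

Section RootIdeal.
Variable K : fieldExtType rat.
Local Notation "'𝔬'" := (@ring_of_integers K).
Implicit Types (P Q I J : set K) (x y : K) (ps : seq (set K)).

Lemma nm_mul P Q : nonzero_ideal P -> nonzero_ideal Q -> nm (ideal_mul P Q) = (nm P * nm Q)%N.
Proof.
move=> /ideal_factorization[ps pps ->] /ideal_factorization[qs pqs ->].
rewrite -ideal_prod_cat; last exact: primes_in_ideal.
by rewrite !nm_prod // ?big_cat // => J; rewrite mem_cat => /orP[/pps|/pqs].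
Qed.

Lemma principal_ideal_mul x I : is_ideal I ->
  ideal_mul (principal_ideal x) I = [set x * y | y in I].
Proof.
move=> iI; apply/seteqP; split; last first.
  by move=> _ [y Iy <-]; apply: mem_ideal_mul => //; apply: principal_ideal_self.
apply: ideal_mul_ind.
- by exists 0; [exact: ideal0 | rewrite mulr0].
- by move=> _ _ [a Ia <-] [b Ib <-]; exists (a + b); [exact: idealD | rewrite mulrDr].
- move=> _ z [a Oa <-] Iz; exists (a * z); first exact: idealMl.
  by rewrite mulrA [x * a]mulrC.
Qed.

Lemma nm_principalM x y : 𝔬 x -> 𝔬 y -> x != 0 -> y != 0 ->
  nm (principal_ideal (x * y)) = (nm (principal_ideal x) * nm (principal_ideal y))%N.
Proof.
move=> Ox Oy x0 y0; rewrite -nm_mul; try exact: nonzero_ideal_principal.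
rewrite principal_ideal_mul; last exact: principal_ideal_ideal.
congr nm; apply/seteqP; split=> z.
  by move=> [a Oa <-]; exists (a * y); [by exists a | ring].
by move=> [_ [a Oa <-] <-]; exists a => //; ring.
Qed.

Lemma ideal_prod_sub_count ps ps' : primes_in ps' ->
  (forall P, count_mem P ps <= count_mem P ps')%N -> ideal_prod ps' `<=` ideal_prod ps.
Proof.
move=> pps' /count_subseqP[s ss pp].
have pps : primes_in s by move=> P /(mem_subseq ss)/pps'.
rewrite (ideal_prod_perm (primes_in_ideal _) pp); last by move=> P; rewrite (perm_mem pp); apply: pps.
elim: ps' s ss pps' {pp pps} => [|P ps' IH] s; first by rewrite subseq0 => /eqP-> _ x.
move=> ss pps'; have Qs : primes_in ps' by move=> J Js; apply: pps'; rewrite inE Js orbT.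
have iP : is_ideal P by apply/prime_ideal_mem/pps'; rewrite mem_head.
case: s ss => [_|Q s /=].
  by apply: ideal_sub; apply/is_ideal_prod/primes_in_ideal.
case: eqP => [->|_] ss; first by apply: ideal_mulS => //; apply: IH.
apply: subset_trans (IH _ ss Qs); apply: ideal_mul_subr; last exact: ideal_sub.
exact/is_ideal_prod/primes_in_ideal.
Qed.

Lemma primes_in_nseq n ps : primes_in ps -> primes_in (flatten (nseq n ps)).
Proof. by move=> H P; elim: n => //= n IH; rewrite mem_cat => /orP[/H|/IH]. Qed.

Lemma ideal_prod_exp ps x n : primes_in ps -> ideal_prod ps x -> ideal_prod (flatten (nseq n ps)) (x ^+ n).
Proof.
move=> H psx; elim: n => [|n IH] /=; first exact: rint1.
rewrite ideal_prod_cat; last exact/primes_in_ideal/primes_in_nseq.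
by rewrite exprS; apply: mem_ideal_mul.
Qed.

Lemma ideal_prod_principal ps y n : primes_in ps -> 𝔬 y -> ideal_prod ps = principal_ideal y ->
  ideal_prod (flatten (nseq n ps)) `<=` principal_ideal (y ^+ n).
Proof.
move=> H Oy E; elim: n => [|n IH] /=.
  by move=> x Ox; exists x => //; rewrite mulr1.
rewrite ideal_prod_cat; last exact/primes_in_ideal/primes_in_nseq.
rewrite E; apply: subset_trans (ideal_mulS (@subset_refl _ _) IH) _.
have ip := principal_ideal_ideal (rintX n.+1 Oy).
apply: ideal_mul_ind; [exact: ideal0 | by move=> u v; apply: idealD |].
move=> _ _ [a Oa <-] [b Ob <-]; exists (a * b); first exact: rintM.
by rewrite exprS; ring.
Qed.

Lemma leq_prod_sub (us ps : seq (set K)) : uniq us -> {subset us <= ps} -> primes_in ps ->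
  (\prod_(P <- us) nm P <= \prod_(P <- ps) nm P)%N.
Proof.
elim: us ps => [|P us IH] ps uus sub pps.
  rewrite big_nil big_seq; elim/big_ind: _ => // [m n|Q /pps pQ]; first by rewrite muln_gt0 => -> ->.
  exact/nm_gt0/nonzero_ideal_prime.
have Pps : P \in ps by apply: sub; rewrite mem_head.
have [Pus uus'] := andP uus.
rewrite big_cons (perm_big _ (perm_to_rem Pps)) big_cons leq_mul2l IH ?orbT //; last by move=> Q /mem_rem/pps.
move=> Q Qus; have Qps : Q \in ps by apply: sub; rewrite inE Qus orbT.
have := Qps; rewrite (perm_mem (perm_to_rem Pps)) inE => /orP[/eqP QP|//].
by rewrite -QP Qus in Pus.
Qed.

(* The exponent of [P] in [I] is the one of [y], times [q / N0], rounded up. *)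
Lemma root_ideal y s (e N0 q : nat) : 𝔬 y -> y != 0 -> 𝔬 s -> s != 0 -> (0 < N0)%N ->
  principal_ideal y (s ^+ e) ->
  exists I, [/\ nonzero_ideal I, forall x, I x -> exists2 b, 𝔬 b & x ^+ N0 = y ^+ q * b
    & (nm I ^ N0 <= nm (principal_ideal y) ^ q * nm (principal_ideal s) ^ N0)%N].
Proof.
move=> Oy y0 Os s0 N00 yse.
have [ps pps Ey] := ideal_factorization (nonzero_ideal_principal Oy y0).
have [ps' pps' Es] := ideal_factorization (nonzero_ideal_principal Os s0).
pose us := undup ps; have uus : uniq us := undup_uniq ps.
have pus : primes_in us by move=> P; rewrite mem_undup => /pps.
pose k P := ((q * count_mem P ps + N0.-1) %/ N0)%N.
have kP P : (q * count_mem P ps <= k P * N0 <= q * count_mem P ps + N0)%N.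
  rewrite /k; set c := (q * _)%N; have := divn_eq (c + N0.-1) N0.
  have := ltn_pmod (c + N0.-1) N00; move: ((c + N0.-1) %/ N0 * N0)%N ((c + N0.-1) %% N0)%N; lia.
pose L := flatten [seq nseq (k P) P | P <- us].
have pL : primes_in L.
  by move=> P /flatten_mapP[Q Qus]; rewrite mem_nseq => /andP[_ /eqP->]; apply: pus.
have cnt (n : nat) ss P : count_mem P (flatten (nseq n ss)) = (n * count_mem P ss)%N.
  by elim: n => //= n IH; rewrite count_cat IH mulSn.
exists (ideal_prod L); split; first exact: nonzero_ideal_prod.
- move=> x Lx; have := ideal_prod_exp N0 pL Lx.
  have sub : ideal_prod (flatten (nseq N0 L)) `<=` ideal_prod (flatten (nseq q ps)).
    apply: ideal_prod_sub_count; first exact: primes_in_nseq.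
    move=> P; rewrite !cnt count_mem_flatten_nseq // mem_undup.
    case: ifP => [_|/negbT/count_memPn->]; last by rewrite !muln0.
    by rewrite [(N0 * _)%N]mulnC; case/andP: (kP P).
  move/sub/(ideal_prod_principal pps Oy (esym Ey)) => [b Ob <-].
  by exists b => //; rewrite mulrC.
have prodL : (\prod_(P <- L) nm P = \prod_(P <- us) nm P ^ k P)%N.
  rewrite /L; elim: (us) => [|P t IH] /=; first by rewrite !big_nil.
  rewrite big_cat big_cons -IH; congr (_ * _)%N.
  by rewrite big_nseq; elim: (k P) => //= n ->; rewrite expnS.
have prody : nm (principal_ideal y) = (\prod_(P <- us) nm P ^ count_mem P ps)%N.
  rewrite Ey nm_prod // -big_undup_iterop_count.
  by apply: eq_bigr => P _; rewrite expnE.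
(* Rounding up costs at most one factor [P] for each prime of [y], and all these primes contain
   [s]. *)
have prods : (\prod_(P <- us) nm P <= nm (principal_ideal s))%N.
  rewrite Es nm_prod //; apply: leq_prod_sub => // P Pus.
  have pP := pus _ Pus; apply: prime_sub_prod pps' _ => //; rewrite -Es => _ [a Oa <-].
  apply: idealMl => //; first exact: prime_ideal_mem.
  apply: (prime_ideal_exp (n := e) pP Os).
  rewrite mem_undup in Pus; move: yse; rewrite Ey (ideal_prod_rem (primes_in_ideal pps) Pus).
  apply: ideal_mul_subl; first exact: prime_ideal_mem.
  by apply/ideal_sub/is_ideal_prod => Q /mem_rem/pps/prime_ideal_mem.
rewrite nm_prod // prodL prody.
apply: (@leq_trans (\prod_(P <- us) (nm P ^ (q * count_mem P ps + N0)))%N).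
  have pe (F : set K -> nat) (n : nat) : ((\prod_(P <- us) F P) ^ n = \prod_(P <- us) F P ^ n)%N.
    by elim: (us) => [|P t IH]; rewrite ?big_nil ?exp1n // !big_cons expnMn IH.
  rewrite pe big_seq [leqRHS]big_seq; apply: leq_prod => P Pus.
  rewrite -expnM leq_pexp2l ?nm_gt0 //; first exact/nonzero_ideal_prime/pus.
  by case/andP: (kP P).
rewrite (eq_bigr (fun P => (nm P ^ count_mem P ps) ^ q * nm P ^ N0)%N); last first.
  by move=> P _; rewrite expnD -expnM [(q * _)%N]mulnC.
rewrite big_split /=.
have pe (F : set K -> nat) (n : nat) : (\prod_(P <- us) F P ^ n = (\prod_(P <- us) F P) ^ n)%N.
  by elim: (us) => [|P t IH]; rewrite ?big_nil ?exp1n // !big_cons expnMn IH.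
by rewrite !pe leq_mul2l leq_exp2r // prods orbT.
Qed.

End RootIdeal.

(** * Absolute values *)

Section AbsoluteValues.
Variables (R : realType) (F : fieldType).

Definition absval (v : F -> R) :=
  [/\ v 0 = 0, v 1 = 1, {morph v : x y / x * y}, forall x y, v (x + y) <= v x + v y
    & forall x, 0 <= v x].

Variable v : F -> R.
Hypothesis vP : absval v.

Lemma absval0 : v 0 = 0. Proof. by case: vP. Qed.
Lemma absval1 : v 1 = 1. Proof. by case: vP. Qed.
Lemma absvalM x y : v (x * y) = v x * v y. Proof. by case: vP. Qed.
Lemma absvalD x y : v (x + y) <= v x + v y. Proof. by case: vP. Qed.
Lemma absval_ge0 x : 0 <= v x. Proof. by case: vP. Qed.
Lemma absvalX x n : v (x ^+ n) = v x ^+ n.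
Proof. by elim: n => [|n IH]; rewrite ?expr0 ?absval1 // !exprS absvalM IH. Qed.
Lemma absval_gt0 x : x != 0 -> 0 < v x.
Proof.
move=> x0; rewrite lt_neqAle absval_ge0 andbT; apply/eqP => vx0.
by have := absvalM x x^-1; rewrite mulfV // absval1 -vx0 mul0r => /eqP; rewrite oner_eq0.
Qed.
Lemma absvalV x : v x^-1 = (v x)^-1.
Proof.
have [->|x0] := eqVneq x 0; first by rewrite invr0 absval0 invr0.
by apply: (mulfI (lt0r_neq0 (absval_gt0 x0))); rewrite -absvalM !mulfV ?absval1 // lt0r_neq0 // absval_gt0.
Qed.
Lemma absval_div x y : v (x / y) = v x / v y. Proof. by rewrite absvalM absvalV. Qed.
Lemma absvalN x : v (- x) = v x.
Proof.
have N1 : v (-1) = 1.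
  have : v (-1) ^+ 2 = 1 by rewrite -absvalX sqrrN expr1n absval1.
  by move/eqP; rewrite sqrf_eq1 => /orP[/eqP//|/eqP E]; have := absval_ge0 (-1); rewrite E; lra.
by rewrite -mulN1r absvalM N1 mul1r.
Qed.
Lemma absvalB x y : v (x - y) <= v x + v y.
Proof. by rewrite -[v y]absvalN; apply: absvalD. Qed.
Lemma absval_sum (I : Type) (s : seq I) (P : pred I) (f : I -> F) :
  v (\sum_(i <- s | P i) f i) <= \sum_(i <- s | P i) v (f i).
Proof.
elim/big_rec2: _ => [|i y x _ IH]; first by rewrite absval0.
by apply: le_trans (absvalD _ _) _; rewrite lerD2l.
Qed.
Lemma absval_prod (I : Type) (s : seq I) (P : pred I) (f : I -> F) :
  v (\prod_(i <- s | P i) f i) = \prod_(i <- s | P i) v (f i).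
Proof. by elim/big_rec2: _ => [|i y x _ <-]; rewrite ?absval1 ?absvalM. Qed.
Lemma absval_nat_le n : v n%:R <= n%:R.
Proof.
elim: n => [|n IH]; first by rewrite absval0.
rewrite -natr1 -[n.+1%:R]natr1; apply: le_trans (absvalD _ _) _.
by rewrite absval1 lerD2r.
Qed.
Lemma absval_int_le (z : int) : v z%:~R <= `|z|%:~R.
Proof.
case: z => n; first exact: absval_nat_le.
by rewrite NegzE mulrNz absvalN normrN; apply: absval_nat_le.
Qed.
Lemma absval_distl x y : v x - v y <= v (x - y).
Proof. by rewrite lerBlDr; have := absvalD (x - y) y; rewrite subrK. Qed.

(** Cauchy's bound for the roots of a monic polynomial. *)
Lemma absval_root_le (p : {poly F}) x M : p \is monic -> root p x ->
  (forall i, v p`_i <= M) -> v x <= 1 + M.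
Proof.
move=> mp /rootP rx pM; have M0 : 0 <= M by apply: le_trans (pM 0%N); apply: absval_ge0.
rewrite leNgt; apply/negP => lt.
have [n sp] : exists n, size p = n.+1.
  by exists (size p).-1; rewrite prednK // lt0n size_poly_eq0 monic_neq0.
have pn : p`_n = 1 by have /monicP := mp; rewrite lead_coefE sp.
have E : x ^+ n = - \sum_(i < n) p`_i * x ^+ i.
  by apply/eqP; move: rx; rewrite horner_coef sp big_ord_recr /= pn mul1r addrC => /eqP; rewrite addr_eq0.
have : v x ^+ n <= M * \sum_(i < n) v x ^+ i.
  rewrite -absvalX E absvalN; apply: le_trans (absval_sum _ _ _) _; rewrite mulr_sumr.
  by apply: ler_sum => i _; rewrite absvalM absvalX ler_wpM2r // exprn_ge0 // absval_ge0.
have geo := subrX1 (v x) n; set S := \sum_(i < n) _ in geo *.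
have S0 : 0 <= S by apply: sumr_ge0 => i _; rewrite exprn_ge0 // absval_ge0.
by nra.
Qed.

End AbsoluteValues.

(** * Conjugates in a Galois extension *)

Section GaloisField.
Variables (R : realType) (L : splittingFieldType rat).
Hypothesis galL : galois 1 {:L}.
Variable phi : {rmorphism L -> R[i]}.
Local Notation "'𝔬'" := (@ring_of_integers L).
Local Notation G := (gal_of {:L}).
Implicit Types (g h : G) (x y : L).

(** Every embedding of [L] is the fixed [phi] after an automorphism, so the Archimedean absolute
    values are indexed by the Galois group. *)
Definition av g x : R := Normc.normc (phi (g x)).

Lemma avP g : absval (av g).
Proof.
rewrite /av; split=> [|| x y | x y | x].
- by rewrite !rmorph0 Normc.normc0.
- by rewrite !rmorph1 Normc.normc1.
- by rewrite !rmorphM Normc.normcM.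
- by rewrite !rmorphD le_normcD.
- by case: (phi (g x)) => a b; apply: sqrtr_ge0.
Qed.

Lemma mem_gal g : g \in 'Gal({:L} / 1)%g.
Proof. by rewrite gal_kHom ?sub1v // k1HomE ahomWin. Qed.

Lemma card_gal : #|{: G}| = \dim {:L}.
Proof.
have := galois_dim galL; rewrite dimv1 divn1 => ->.
by apply: eq_card => g; rewrite mem_gal.
Qed.

Lemma gal_prod_rat x : exists q : rat, \prod_(g : G) g x = q%:A.
Proof.
have := mem_galNorm galL (memvf x); rewrite /galNorm => /vlineP[q Eq].
by exists q; rewrite -Eq; apply: eq_bigl => g; rewrite mem_gal.
Qed.

Lemma rint_gal g x : 𝔬 (g x) <-> 𝔬 x.
Proof. exact: rint_rmorph. Qed.

Lemma gal_prod_int x : 𝔬 x -> exists z : int, \prod_(g : G) g x = z%:~R.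
Proof.
move=> Ox; have [q Eq] := gal_prod_rat x.
have [|z Ez] := @rint_rat L q; first by rewrite -Eq; apply: rint_prod => g; apply/rint_gal.
by exists z; rewrite Eq Ez alg_num_field ratr_int.
Qed.

Lemma normc_absval : absval (@Normc.normc R).
Proof.
split; [exact: Normc.normc0 | exact: Normc.normc1 | exact: Normc.normcM | exact: le_normcD |].
by case=> a b; apply: sqrtr_ge0.
Qed.

Lemma normc_int (z : int) : Normc.normc (z%:~R : R[i]) = `|z|%:~R.
Proof.
have E (n : nat) : Normc.normc (n%:R : R[i]) = n%:R.
  by rewrite -(rmorph_nat (real_complex R)) /Normc.normc /= expr0n addr0 sqrtr_sqr ger0_norm.
case: z => n; first exact: E.
by rewrite NegzE mulrNz (absvalN normc_absval) normrN E.
Qed.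

Lemma prod_av x (z : int) : \prod_(g : G) g x = z%:~R -> \prod_(g : G) av g x = `|z|%:~R.
Proof.
move=> E; rewrite -normc_int -(rmorph_int phi) -E rmorph_prod.
by elim/big_rec2: _ => [|g a b _ ->]; rewrite ?Normc.normc1 ?Normc.normcM.
Qed.

Lemma prod_av_ge1 x : 𝔬 x -> x != 0 -> 1 <= \prod_(g : G) av g x.
Proof.
move=> Ox x0; have [z Ez] := gal_prod_int Ox; rewrite (prod_av Ez) -[1]/(1%:~R) ler_int.
have : z != 0.
  rewrite -(inj_eq (@intr_numfield_inj L)) -Ez; apply/prodf_neq0 => g _.
  by rewrite fmorph_eq0.
by rewrite -absz_gt0 -abszE lez_nat.
Qed.

(** The conjugates of [a] all have the same norm [m], so the norm of their product is [m^N], with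
    [N] the degree of [L]. This product is a rational integer [z], and the index of [z o] is at most
    [|z|^N]; hence [m <= |z|]. *)
Lemma nm_principal_le a : 𝔬 a -> a != 0 -> (nm (principal_ideal a))%:R <= \prod_(g : G) av g a.
Proof.
move=> Oa a0; have [z Ez] := gal_prod_int Oa; rewrite (prod_av Ez).
set m := nm _.
have ga0 g : g a != 0 by rewrite fmorph_eq0.
have nga g : nm (principal_ideal (g a)) = m.
  have Oga : 𝔬 (g a) by apply/rint_gal.
  apply: nm_eq; first exact: nonzero_ideal_principal.
  apply: (has_index_bij (f := g)) (nmP (nonzero_ideal_principal Oa a0)).
  - by move=> x Ox; apply/rint_gal.
  - move=> y Oy; exists ((g^-1)%g y); first exact/rint_gal.
    by rewrite -galM ?memvf // mulVg gal_id.
  - move=> x y Ox Oy; rewrite -rmorphB; split.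
      move=> [b Ob E]; exists ((g^-1)%g b); first exact/rint_gal.
      by apply: (fmorph_inj g); rewrite -E rmorphM /= -galM ?memvf // mulVg gal_id.
    by move=> [b Ob E]; exists (g b); [exact/rint_gal | rewrite -E rmorphM].
have [Oz z0] : 𝔬 (z%:~R) /\ (z%:~R != 0 :> L).
  by split; [exact: rint_int | rewrite -Ez; apply/prodf_neq0].
have E : nm (principal_ideal (\prod_(g : G) g a)) = (m ^ #|{: G}|)%N.
  have -> : (m ^ #|{: G}|)%N = \big[muln/1%N]_(g : G) m by rewrite prod_nat_const.
  have : forall s : seq G, [/\ 𝔬 (\prod_(g <- s) g a), \prod_(g <- s) g a != 0 &
     nm (principal_ideal (\prod_(g <- s) g a)) = \big[muln/1%N]_(g <- s) m].
    elim=> [|g s [O1 n1 E1]].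
      rewrite !big_nil; split; [exact: rint1 | exact: oner_neq0 |].
      have := nm_prod (K := L) (ps := [::]); rewrite big_nil /ideal_prod /= => <- //.
      congr nm; apply/seteqP; split=> x; first by move=> [b Ob <-]; rewrite mulr1.
      by move=> Ox; exists x => //; rewrite mulr1.
    rewrite !big_cons; split; first by apply: rintM => //; apply/rint_gal.
      by rewrite mulf_neq0.
    by rewrite nm_principalM // ?E1 ?nga //; apply/rint_gal.
  by move=> /(_ (index_enum _))[_ _].
rewrite Ez in E.
have : (nm (principal_ideal (z%:~R : L)) <= (absz z) ^ #|{: G}|)%N.
  have z0' : (0 < absz z)%N by rewrite absz_gt0; apply: contraNneq z0 => ->.
  have [_ [I [x [sepx <-]]]] := nmP (nonzero_ideal_principal Oz z0).
  rewrite card_gal; apply: (index_rint z0') (x) _.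
  case: sepx => Ox sepx; split=> // i j [y Oy Exy]; apply: sepx.
  exists ((sgz z)%:~R * y); first by apply: rintM => //; apply: rint_int.
  rewrite -Exy -[(absz z)%:R]/((absz z)%:~R) absz_sgz intrM; ring.
rewrite E leq_exp2r; last by rewrite card_gal -[X in (_ < X)%N]/(\dim {:L}) adim_gt0.
by rewrite -(ler_nat R) natr_absz.
Qed.

(** The product of the [X - h (k x)] has rational coefficients and vanishes at [k x], so its image
    under [phi] vanishes at [s x]. *)
Lemma gal_conjugate (K : fieldExtType rat) (k : {rmorphism K -> L}) (s : {rmorphism K -> R[i]}) (x : K) :
  exists h, s x = phi (h (k x)).
Proof.
pose P := \prod_(h : G) ('X - (h (k x))%:P).
have /polyOver1P[p Ep] : P \is a polyOver 1%VS.
  rewrite -(galois_fixedField galL); apply/polyOverP => i; apply/fixedFieldP; first exact: memvf.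
  move=> g _; have E : map_poly g P = P.
    rewrite /P rmorph_prod [RHS](reindex_inj (mulIg g)) /=; apply: eq_bigr => h _.
    by rewrite rmorphB /= map_polyX map_polyC /= galM ?memvf.
  by rewrite -[LHS]/(g _) -coef_map E.
have rx : root (map_poly (in_alg K) p) x.
  rewrite -(fmorph_root k) -map_poly_comp.
  rewrite (eq_map_poly (g := in_alg L)); last by move=> c /=; rewrite fmorph_numZ rmorph1.
  rewrite -Ep /P (bigD1 1%g) //= gal_id rootM root_XsubC eqxx //.
have : root (\prod_(h : G) ('X - (phi (h (k x)))%:P)) (s x).
  have -> : \prod_(h : G) ('X - (phi (h (k x)))%:P) = map_poly phi P.
    by rewrite rmorph_prod; apply: eq_bigr => h _; rewrite rmorphB /= map_polyX map_polyC.
  move: rx; rewrite Ep -(fmorph_root s) -!map_poly_comp.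
  by congr root; apply: eq_map_poly => c /=; rewrite !rmorphZ_num !rmorph1.
by rewrite rootE horner_prod prodf_seq_eq0 => /hasP[h _] /=; rewrite !hornerE subr_eq0 => /eqP; exists h.
Qed.

Lemma gal_conj g : exists h, forall x, phi (h x) = conjc (phi (g x)).
Proof.
have [t gt] := primitive_exists L.
pose s : {rmorphism L -> R[i]} := conjc \o phi \o g.
have [h Eh] := gal_conjugate idfun s t.
exists h => x; have [p ->] := primitive_polyP gt x.
have E (f : {rmorphism L -> R[i]}) : f (map_poly (in_alg L) p).[t] = (map_poly ratr p).[f t].
  rewrite -horner_map -map_poly_comp; congr _.[_].
  by apply: eq_map_poly => c /=; rewrite rmorphZ_num rmorph1 mulr1.
by have := E (phi \o h); rewrite /= => ->; have := E s; rewrite /= => ->; rewrite -[X in _ = _.[X]]/(s t) Eh.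
Qed.

End GaloisField.

(** * Approximate roots of elements *)

Lemma rat_approx (R : realType) (r : R) (M : nat) : (0 < M)%N ->
  exists q : rat, `|ratr q - r| <= M%:R^-1.
Proof.
move=> M0; have M0' : 0 < M%:R :> R by rewrite ltr0n.
exists ((Num.floor (r * M%:R))%:~R / M%:R).
have /andP[lo hi] := mem_rg1_floor (r * M%:R).
rewrite fmorph_div /= ratr_int ratr_nat.
have E : (Num.floor (r * M%:R))%:~R / M%:R - r = ((Num.floor (r * M%:R))%:~R - r * M%:R) / M%:R.
  by rewrite mulrBl mulfK // lt0r_neq0.
rewrite E normrM [X in _ * X]gtr0_norm ?invr_gt0 // -[leRHS]mul1r ler_wpM2r ?invr_ge0 ?ler0n //.
rewrite ler_norml; apply/andP; split; move: lo hi; rewrite ?intrD; lra.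
Qed.

Section Approximation.
Variables (R : realType) (L : splittingFieldType rat).
Hypothesis galL : galois 1 {:L}.
Variable phi : {rmorphism L -> R[i]}.
Local Notation "'𝔬'" := (@ring_of_integers L).
Local Notation G := (gal_of {:L}).
Local Notation av := (av phi).
Local Notation N := (\dim {:L}).
Implicit Types (g h : G) (x y : L).

(** The absolute values of an element agree at complex conjugate embeddings, so only such families
    can be prescribed. *)
Definition conj_stable (T : G -> R) :=
  forall g h, (forall x, phi (h x) = conjc (phi (g x))) -> T h = T g.

(** Lagrange interpolation at the distinct conjugates of a generator gives complex coefficients. As
    [T] is stable, the conjugate coefficients interpolate the same values, and so do the real
    parts. *)
Lemma real_interpolation (T : G -> R) : conj_stable T ->
  exists (t : L) (n : nat) (r : 'I_n -> R), forall g,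
    \sum_k (r k)%:C%C * phi (g t) ^+ k = (T g)%:C%C.
Proof.
move=> Tconj; have [t gt] := primitive_exists L.
pose z g := phi (g t).
have zinj g h : z g = z h -> g = h.
  move=> /(fmorph_inj phi) E; apply/eqP/gal_eqP => x _.
  have [p ->] := primitive_polyP gt x.
  have E' (k : G) : k (map_poly (in_alg L) p).[t] = (map_poly (in_alg L) p).[k t].
    rewrite -horner_map -map_poly_comp; congr _.[_].
    by apply: eq_map_poly => c /=; rewrite fmorph_numZ rmorph1.
  by rewrite !E' E.
pose C := \sum_g ((T g)%:C%C / \prod_(h | h != g) (z g - z h)) *: \prod_(h | h != g) ('X - (z h)%:P).
have Cz g : C.[z g] = (T g)%:C%C.
  rewrite horner_sum (bigD1 g) //= [X in _ + X]big1 ?addr0 => [|h hg].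
    rewrite hornerZ horner_prod.
    have -> : \prod_(h | h != g) ('X - (z h)%:P).[z g] = \prod_(h | h != g) (z g - z h).
      by apply: eq_bigr => h _; rewrite hornerXsubC.
    rewrite divfK //; apply/prodf_neq0 => h hg; rewrite subr_eq0; apply: contra hg => /eqP/zinj ->.
    exact: eqxx.
  rewrite hornerZ horner_prod; have -> : \prod_(i | i != h) ('X - (z i)%:P).[z g] = 0.
    by rewrite (bigD1 g) 1?eq_sym //= hornerXsubC subrr mul0r.
  by rewrite mulr0.
exists t, (size C), (fun k => complex.Re C`_k) => g.
have [h hE] := gal_conj galL phi g.
have Ch : \sum_(k < size C) conjc (C`_k) * z g ^+ k = (T g)%:C%C.
  have := Cz h; rewrite horner_coef => /(congr1 conjc); rewrite (Tconj _ _ hE).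
  have -> : conjc (T g)%:C%C = (T g)%:C%C by rewrite /conjc /= oppr0.
  move=> <-; rewrite rmorph_sum; apply: eq_bigr => k _.
  by rewrite rmorphM rmorphXn /= /z hE conjcK.
have Cg := Cz g; rewrite horner_coef in Cg.
have two : (2%:R : R[i]) != 0 by rewrite pnatr_eq0.
apply: (mulfI two); have -> : 2%:R * (T g)%:C%C = \sum_(k < size C) C`_k * z g ^+ k +
    \sum_(k < size C) conjc (C`_k) * z g ^+ k by rewrite Cg Ch mulr_natl mulr2n.
rewrite mulr_sumr -big_split /=; apply: eq_bigr => k _.
rewrite mulrA -mulrDl; congr (_ * _); rewrite mulr_natl mulr2n.
case: (C`_k) => a b; apply/eqP; rewrite eq_complex /=.
by rewrite addr0 subrr !eqxx.
Qed.

(** The real coefficients of the interpolation are replaced by rational ones close to them. *)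
Lemma element_approximation (T : G -> R) : conj_stable T -> (forall g, 0 < T g) ->
  exists w : L, forall g, T g / 2 <= av g w <= 2 * T g.
Proof.
move=> Tconj T0; have [t [n [r rE]]] := real_interpolation Tconj.
pose B := \sum_g \sum_(k < n) av g t ^+ k / T g.
have B0 : 0 <= B.
  apply: sumr_ge0 => g _; apply: sumr_ge0 => k _.
  by rewrite mulr_ge0 ?invr_ge0 ?(ltW (T0 _)) // exprn_ge0 // absval_ge0 //; apply: avP.
have [M M0 BM] : exists2 M : nat, (0 < M)%N & 2 * B <= M%:R.
  have lt : 2 * B < (Num.bound (2 * B))%:R by apply: archi_boundP; lra.
  exists (Num.bound (2 * B)); last exact: ltW.
  by rewrite -(ltr_nat R); lra.
pose q k := sval (cid (rat_approx (r k) M0)).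
have qP k : `|ratr (q k) - r k| <= M%:R^-1 by rewrite /q; case: cid.
exists (\sum_(k < n) (q k)%:A * t ^+ k) => g.
have E : phi (g (\sum_(k < n) (q k)%:A * t ^+ k)) - (T g)%:C%C =
   \sum_(k < n) (ratr (q k) - r k)%:C%C * phi (g t) ^+ k.
  rewrite !rmorph_sum -rE -sumrB; apply: eq_bigr => k _.
  rewrite !rmorphM !rmorphXn /= fmorph_numZ rmorph1 rmorphZ_num rmorph1 mulr1.
  by rewrite -mulrBl rmorphB /= fmorph_rat.
have vP := normc_absval R.
have vr (a : R) : Normc.normc (a%:C)%C = `|a| by rewrite /Normc.normc /= expr0n addr0 sqrtr_sqr.
have close : Normc.normc (phi (g (\sum_(k < n) (q k)%:A * t ^+ k)) - (T g)%:C%C) <= T g / 2.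
  rewrite E; apply: le_trans (absval_sum vP _ _ _) _.
  have S : \sum_(k < n) av g t ^+ k / T g <= B.
    rewrite /B (bigD1 g) //= lerDl; apply: sumr_ge0 => h _; apply: sumr_ge0 => k _.
    by rewrite mulr_ge0 ?invr_ge0 ?(ltW (T0 _)) // exprn_ge0 // absval_ge0 //; apply: avP.
  apply: (@le_trans _ _ (\sum_(k < n) M%:R^-1 * av g t ^+ k)).
    apply: ler_sum => k _; rewrite (absvalM vP) (absvalX vP) vr ler_wpM2r //.
    by rewrite exprn_ge0 // absval_ge0.
  rewrite -mulr_suml ler_pdivrMr // in S; rewrite -mulr_sumr.
  have M0' : 0 < M%:R :> R by rewrite ltr0n.
  rewrite ler_pdivrMl //; apply: le_trans S _.
  have : 2 * B * T g <= M%:R * T g by rewrite ler_wpM2r // ltW.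
  lra.
have := absval_distl vP (phi (g (\sum_(k < n) (q k)%:A * t ^+ k))) (T g)%:C%C.
have := absval_distl vP (T g)%:C%C (phi (g (\sum_(k < n) (q k)%:A * t ^+ k))).
rewrite -[X in _ <= X -> _](absvalN vP) opprB vr gtr0_norm // /av => H1 H2.
have T0g := T0 g; apply/andP; split; lra.
Qed.

(* Pigeonhole in the box of the [sum_i f_i e_i] with [0 <= f_i <= X]. *)
Lemma small_element (e : 'I_N -> L) (E : R) I :
  (forall i, 𝔬 (e i)) -> (forall c : 'I_N -> rat, \sum_i c i *: e i = 0 -> forall i, c i = 0) ->
  (forall i g, av g (e i) <= E) -> nonzero_ideal I ->
  exists x, [/\ I x, x != 0 & forall g, av g x ^+ N <= (N%:R * E) ^+ N * (nm I)%:R].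
Proof.
move=> Oe free eE nI; set a := nm I.
have N0 : (0 < N)%N by rewrite adim_gt0.
(* [X] is the integral part of the [N]-th root of the index [a], so that the box has more than [a]
   points. *)
have [X [Xle Xlt]] : exists X, (X ^ N <= a)%N /\ (a < X.+1 ^ N)%N.
  have exP : exists X, (X ^ N <= a)%N by exists 0%N; rewrite exp0n.
  have bd X : (X ^ N <= a)%N -> (X <= a)%N.
    move=> H; apply: leq_trans H; case: X => // X.
    by rewrite -{1}[X.+1]expn1 leq_pexp2l.
  case: (ex_maxnP exP bd) => X Xle max; exists X; split=> //.
  by rewrite ltnNge; apply/negP => /max; rewrite ltnn.
pose f (c : {ffun 'I_N -> 'I_X.+1}) : L := \sum_i (c i : nat)%:R * e i.
have [c [d [cd Icd]]] : exists c d, c <> d /\ I (f c - f d).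
  apply: contrapT => nex; have [le _] := nmP nI.
  have := le _ f; rewrite card_ffun !card_ord -/a leqNgt Xlt => H.
  suff: false by []; apply: H; split=> [c|c d Icd].
    by apply: rint_sum => i; apply: rintM => //; apply: rint_nat.
  by apply: contrapT => cd; apply: nex; exists c, d.
have fE : f c - f d = \sum_i ((c i : nat)%:R - (d i : nat)%:R : rat) *: e i.
  rewrite /f -sumrB; apply: eq_bigr => i _.
  by rewrite scalerBl !scaler_nat !mulr_natl.
exists (f c - f d); split=> // [|g].
  apply/eqP => f0; apply: cd; apply/ffunP => i; apply/val_inj/eqP.
  by rewrite -(eqr_nat rat) -subr_eq0; apply/eqP/(free (fun i => (c i : nat)%:R - (d i : nat)%:R)); rewrite -fE.
have vP := avP phi g.
have E0 : 0 <= E by apply: le_trans (eE (Ordinal N0) g); apply: absval_ge0.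
have le1 : av g (f c - f d) <= X%:R * (N%:R * E).
  have -> : f c - f d = \sum_i ((c i)%:Z - (d i)%:Z)%:~R * e i.
    by rewrite /f -sumrB; apply: eq_bigr => i _; rewrite intrB mulrBl.
  apply: le_trans (absval_sum vP _ _ _) _.
  apply: (@le_trans _ _ (\sum_(i < N) X%:R * E)); last first.
    by rewrite sumr_const card_ord -[leLHS]mulr_natl; lra.
  apply: ler_sum => i _; rewrite (absvalM vP) ler_pM ?absval_ge0 //.
  apply: le_trans (absval_int_le vP _) _.
  rewrite -[X%:R]/(X%:Z%:~R) ler_int; have := ltn_ord (c i); have := ltn_ord (d i); lia.
apply: (@le_trans _ _ ((X%:R * (N%:R * E)) ^+ N)).
  have B0 : 0 <= X%:R * (N%:R * E) by rewrite !mulr_ge0.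
  by apply: lerXn2r le1; rewrite nnegrE // absval_ge0.
rewrite exprMn mulrC ler_wpM2l //; first by rewrite exprn_ge0 // mulr_ge0.
by rewrite -natrX ler_nat.
Qed.

Variables (e : 'I_N -> L) (E : R).
Hypotheses (Oe : forall i, 𝔬 (e i))
  (free_e : forall c : 'I_N -> rat, \sum_i c i *: e i = 0 -> forall i, c i = 0)
  (eE : forall i g, av g (e i) <= E).

(** The ideal [I] of [root_ideal] is an approximate [N0]-th root of [(y^q)]. It is shown to contain
    an [x] whose conjugates have at most the sizes [T g = |g y|^(q / N0)] of the root, up to a
    factor which depends on [N], [E] and [H] but not on [n], [q] or [N0]. *)
Lemma root_approximation y s (n N0 q : nat) (H : R) :
  𝔬 y -> y != 0 -> 𝔬 s -> s != 0 -> principal_ideal y (s ^+ n) -> (0 < N0)%N ->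
  (forall g, av g s <= H) ->
  exists x b, [/\ 𝔬 x, x != 0, 𝔬 b, x ^+ N0 = y ^+ q * b
    & forall g, av g b <= (4 * N%:R * E * H) ^+ N0].
Proof.
move=> Oy y0 Os s0 ys N00 sH.
have dN0 : (0 < N)%N by rewrite adim_gt0.
have [I [nI Iroot nmI]] := root_ideal q Oy y0 Os s0 N00 ys.
pose T g := av g y `^ (q%:R / N0%:R).
have av0 g x : x != 0 -> 0 < av g x by move=> x0; apply: absval_gt0 => //; apply: avP.
have T0 g : 0 < T g by rewrite powR_gt0 // av0.
have TN g : T g ^+ N0 = av g y ^+ q.
  rewrite -powR_mulrn ?ltW // -powRrM divfK ?powR_mulrn ?ltW ?av0 //.
  by rewrite pnatr_eq0 -lt0n.
have Tc : conj_stable T.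
  move=> g h gh; rewrite /T /av gh; congr (_ `^ _).
  by case: (phi (g y)) => a b; rewrite /Normc.normc /= sqrrN.
have [w wP] := element_approximation Tc T0.
have w0 : w != 0.
  apply/eqP => w0; have /andP[] := wP 1%g; rewrite w0 (absval0 (avP _ _)).
  by have := T0 1%g; lra.
(* At each [g] the size of [a] is about [m / T g], so an element of [a I] whose conjugates have
   equal bounds is [a] times an element of [I] with bounds proportional to [T g]. *)
have [m m0 Om] := rint_scale w^-1; set a := m%:R * w^-1 in Om.
have m0' : m%:R != 0 :> L by rewrite natr_numfield_eq0 -lt0n.
have a0 : a != 0 by rewrite mulf_neq0 ?invr_eq0.
have na := nonzero_ideal_principal Om a0.
have [x' [Ax' x'0 x'le]] := small_element Oe free_e eE (nonzero_ideal_mul na nI).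
rewrite nm_mul // in x'le.
rewrite principal_ideal_mul in Ax'; last by case: nI.
case: Ax' => x Ix Ex'.
have x0 : x != 0 by apply: contraNneq x'0 => x0; rewrite -Ex' x0 mulr0.
have [b Ob Eb] := Iroot _ Ix.
exists x, b; split=> //; first by apply: (ideal_sub nI.1).
pose PT := \prod_(g : G) T g.
have PT0 : 0 < PT by apply: prodr_gt0 => g _.
have H0 : 0 <= H by apply: le_trans (sH 1%g); apply/ltW/av0.
have E0 : 0 <= E by apply: le_trans (eE (Ordinal dN0) 1%g); apply: absval_ge0; apply: avP.
have cG : #|{: G}| = N by apply: card_gal.
have nmI' : (nm I)%:R <= PT * H ^+ N.
  have nms : (nm (principal_ideal s))%:R <= H ^+ N.
    apply: le_trans (nm_principal_le galL phi Os s0) _.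
    rewrite -cG -prodr_const; apply: ler_prod => g _.
    by rewrite sH andbT ltW // av0.
  have nmy : (nm (principal_ideal y))%:R ^+ q <= PT ^+ N0.
    rewrite /PT -prodrXl (eq_bigr (fun g => av g y ^+ q)) // prodrXl.
    by rewrite lerXn2r ?nnegrE ?nm_principal_le // prodr_ge0 // => g _; rewrite ltW // av0.
  have H0' : 0 <= PT * H ^+ N by rewrite mulr_ge0 ?exprn_ge0 ?(ltW PT0).
  rewrite -(ler_pXn2r N00) ?nnegrE // -natrX.
  apply: le_trans (_ : (nm (principal_ideal y) ^ q * nm (principal_ideal s) ^ N0)%N%:R <= _).
    by rewrite ler_nat.
  rewrite natrM !natrX exprMn ler_pM ?exprn_ge0 //.
  by rewrite lerXn2r ?nnegrE // exprn_ge0.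
have key g : av g x <= 4 * N%:R * E * H * T g.
  have vP h := avP phi h.
  have avm h : av h m%:R = m%:R.
    by rewrite /av !rmorph_nat -[m%:R]/((m%:Z)%:~R) normc_int.
  have avaw h : av h a * av h w = m%:R by rewrite -(absvalM (vP h)) /a divfK // avm.
  have m0R : 0 < m%:R :> R by rewrite ltr0n.
  have avT h : av h a * T h <= 2 * m%:R.
    have /andP[w1 w2] := wP h; have a1 := av0 h a a0; rewrite -(avaw h).
    have : av h a * (T h / 2) <= av h a * av h w by rewrite ler_wpM2l // ltW.
    by clear; lra.
  have avT2 h : m%:R <= 2 * T h * av h a.
    have /andP[w1 w2] := wP h; have a1 := av0 h a a0; rewrite -(avaw h).
    have : av h a * av h w <= av h a * (2 * T h) by rewrite ler_wpM2l // ltW.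
    by clear; lra.
  have prodT : (\prod_(h : G) av h a) * PT <= (2 * m%:R) ^+ N.
    rewrite /PT -big_split /= -cG -prodr_const; apply: ler_prod => h _.
    by rewrite avT andbT mulr_ge0 ?(ltW (T0 _)) ?(ltW (av0 _ _ _)).
  have NEH0 : 0 <= N%:R * E * H by rewrite !mulr_ge0.
  have le1 : av g x' ^+ N <= (N%:R * E * H * (2 * m%:R)) ^+ N.
    apply: le_trans (x'le g) _.
    have D0 : 0 <= \prod_(h : G) av h a by apply: prodr_ge0 => h _; apply/ltW/av0.
    have -> : (N%:R * E * H * (2 * m%:R)) ^+ N = (N%:R * E) ^+ N * ((2 * m%:R) ^+ N * H ^+ N).
      by rewrite [N%:R * E * H * _]mulrAC -[N%:R * E * _ * _]mulrA !exprMn.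
    rewrite natrM ler_wpM2l //; first by rewrite exprn_ge0 ?mulr_ge0.
    apply: le_trans (ler_pM _ _ (nm_principal_le galL phi Om a0) nmI') _ => //.
    by rewrite mulrA ler_wpM2r // exprn_ge0.
  have le2 : av g x' <= N%:R * E * H * (2 * m%:R).
    have B1 : 0 <= N%:R * E * H * (2 * m%:R) by rewrite mulr_ge0 // mulr_ge0.
    have B2 : 0 <= av g x' by apply: absval_ge0.
    by rewrite ler_pXn2r ?nnegrE in le1.
  rewrite -Ex' (absvalM (vP g)) in le2.
  have x1 := av0 g x x0; have a1 := av0 g a a0; have := avT2 g; have := T0 g => t0 le3.
  have : av g x * m%:R <= av g x * (2 * T g * av g a) by rewrite ler_wpM2l // ltW.
  have : 2 * T g * (av g a * av g x) <= 2 * T g * (N%:R * E * H * (2 * m%:R)) by rewrite ler_wpM2l // mulr_ge0 // ltW.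
  move=> le4 le5; rewrite -(ler_pM2r m0R); move: le4 le5; clear; lra.
move=> g; have vP := avP phi g.
have -> : av g b = (av g x / T g) ^+ N0.
  rewrite expr_div_n TN -(absvalX vP x) Eb (absvalM vP) (absvalX vP) mulrC mulKf //.
  by rewrite expf_neq0 // lt0r_neq0 // av0.
have B1 : 0 <= 4 * N%:R * E * H by rewrite mulr_ge0 // mulr_ge0 // mulr_ge0.
have B2 : 0 <= av g x / T g by rewrite divr_ge0 ?(ltW (T0 _)) // absval_ge0.
by rewrite lerXn2r ?nnegrE // ler_pdivrMr.
Qed.

End Approximation.

(** * Siegel's lemma *)

(** Pigeonhole on the vectors with entries between [0] and [X]. The assumption on the sizes makes
    the usual exponent [|I| / (|J| - |I|)] at most [3]. *)
Lemma siegel (I J : finType) (A : I -> J -> int) (B : nat) :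
  (0 < #|J|)%N -> (0 < B)%N -> (4 * #|I| <= 3 * #|J|)%N -> (forall i j, (absz (A i j) <= B)%N) ->
  exists x : J -> int, [/\ exists j, x j != 0, forall j, (absz (x j) <= (2 * #|J| * B) ^ 3)%N
    & forall i, \sum_j A i j * x j = 0].
Proof.
move=> J0 B0 IJ AB; set C := (2 * #|J| * B)%N; set X := (C ^ 3)%N.
have C0 : (0 < C)%N by rewrite !muln_gt0 J0.
pose Z := (#|J| * (B * X))%N.
pose val (f : {ffun J -> 'I_X.+1}) i : int := \sum_j A i j * (f j : nat)%:Z.
have valle f i : (absz (val f i) <= Z)%N.
  rewrite -lez_nat abszE; apply: le_trans (ler_norm_sum _ _ _) _.
  have -> : Z%:Z = \sum_(j : J) (B * X)%N%:Z.
    by rewrite sumr_const /Z mulnC PoszM -mulr_natr natz.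
  apply: ler_sum => j _; rewrite normrM PoszM; apply: ler_pM => //.
    by rewrite -abszE lez_nat.
  by rewrite ger0_norm // lez_nat -ltnS.
have ltP f i : (absz (val f i + Z%:Z)%R < (2 * Z).+1)%N by have := valle f i; lia.
pose g f : {ffun I -> 'I_(2 * Z).+1} := [ffun i => Ordinal (ltP f i)].
have [f [h [fh gfh]]] : exists f h, f <> h /\ g f = g h.
  apply: contrapT => nex; have : (#|{ffun J -> 'I_X.+1}| <= #|{ffun I -> 'I_(2 * Z).+1}|)%N.
    apply: (leq_card g) => f h gfh; apply: contrapT => fh; apply: nex; by exists f, h.
  rewrite !card_ffun !card_ord leqNgt => /negP; apply.
  apply: (@leq_ltn_trans ((C * X.+1) ^ #|I|)%N).
    have le : ((2 * Z).+1 <= C * X.+1)%N by rewrite /Z mulnS /C; nia.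
    by elim: #|I| => // k IH; rewrite !expnS leq_mul.
  have IJ' : (#|I| < #|J|)%N by lia.
  rewrite expnMn -(subnKC (ltnW IJ')) expnD mulnC ltn_pmul2l ?expn_gt0 //.
  apply: (@leq_ltn_trans (C ^ (3 * (#|J| - #|I|)))%N).
    by rewrite leq_pexp2l //; lia.
  by rewrite expnM ltn_exp2r //; lia.
exists (fun j => (f j : nat)%:Z - (h j : nat)%:Z); split.
- apply: contrapT => nex; apply: fh; apply/ffunP => j; apply/val_inj.
  apply: contrapT => ne; apply: nex; exists j; apply/eqP => /= E; apply: ne.
  have EE : (f j : nat) = h j by lia.
  exact: EE.
- by move=> j; have := ltn_ord (f j); have := ltn_ord (h j); lia.
- move=> i; have := congr1 (fun k : {ffun I -> 'I_(2 * Z).+1} => nat_of_ord (k i)) gfh.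
  rewrite /= !ffunE /= => E; have := valle f i; have := valle h i => vf vh.
  have Evv : val f i = val h i by lia.
  rewrite (eq_bigr (fun j => A i j * (f j : nat)%:Z - A i j * (h j : nat)%:Z)); last first.
    by move=> j _; rewrite mulrBr.
  by rewrite sumrB -/(val f i) -/(val h i) Evv subrr.
Qed.

(** * Wronskians and the zero estimate *)

Section Wronskian.
Variable F : numClosedFieldType.
Implicit Types (p : {poly F}) (x : F).

Lemma dvdp_exp_XsubC p x T : (forall a, (a < T)%N -> (p^`N(a)).[x] = 0) -> ('X - x%:P) ^+ T %| p.
Proof.
move=> H; have E : p = \sum_(i < size p) ((p^`N(i)).[x])%:P * ('X - x%:P) ^+ i.
  rewrite -{1}(comp_polyXr p) /comp_poly.
  have EX : 'X = x%:P + ('X - x%:P) :> {poly F} by rewrite addrC subrK.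
  rewrite {1}EX nderiv_taylor; last exact: mulrC.
  rewrite size_map_polyC; apply: eq_bigr => i _.
  by rewrite nderivn_map horner_map.
rewrite E; apply: (big_ind (fun q => ('X - x%:P) ^+ T %| q)); [exact: dvdp0 | exact: dvdp_add |].
move=> i _; have [lt|le] := ltnP i T; first by rewrite H // mul0r dvdp0.
by rewrite dvdp_mull // dvdp_exp2l.
Qed.

(** The sum in the hypothesis is [x^a] times the [a]-th normalized derivative at [x]. *)
Lemma dvdp_exp_sum_Xn (I : finType) (q : I -> F) (n : I -> nat) x T : x != 0 ->
  (forall a, (a < T)%N -> \sum_i q i * ('C(n i, a))%:R * x ^+ n i = 0) ->
  ('X - x%:P) ^+ T %| \sum_i q i *: 'X^(n i).
Proof.
move=> x0 H; apply: dvdp_exp_XsubC => a /H Ha; rewrite linear_sum horner_sum /=.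
apply: (mulfI (expf_neq0 a x0)); rewrite mulr0 -[RHS]Ha mulr_sumr; apply: eq_bigr => i _.
rewrite linearZ /= nderivnXn hornerZ hornerMn hornerXn -[_ *+ 'C(_, _)]mulr_natl.
have [le|lt] := leqP a (n i); last by rewrite bin_small // !(mul0r, mulr0).
have -> : x ^+ n i = x ^+ a * x ^+ (n i - a) by rewrite -exprD subnKC.
by ring.
Qed.

(** This operator is diagonal on the monomials, which turns the top coefficient of a Wronskian into
    a Vandermonde determinant in the degrees. *)
Definition euler p := 'X * p^`().

Lemma euler_dvdp p x T : ('X - x%:P) ^+ T %| p -> ('X - x%:P) ^+ T.-1 %| euler p.
Proof.
move=> /dvdpP[q ->]; rewrite /euler dvdp_mull // derivM dvdp_add //.
  by rewrite dvdp_mull // dvdp_exp2l // leq_pred.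
by rewrite deriv_exp derivXsubC mul1r dvdp_mull // -mulr_natl dvdp_mull.
Qed.

Lemma iter_euler_dvdp p x T a : ('X - x%:P) ^+ T %| p -> ('X - x%:P) ^+ (T - a) %| iter a euler p.
Proof.
by move=> H; elim: a => [|a IH]; rewrite ?subn0 // subnS iterS; apply: euler_dvdp.
Qed.

Lemma iter_euler_sum (I : finType) (w : I -> F) (P : I -> {poly F}) a :
  iter a euler (\sum_i w i *: P i) = \sum_i w i *: iter a euler (P i).
Proof.
elim: a => [|a IH] //; rewrite iterS IH /euler raddf_sum mulr_sumr.
by apply: eq_bigr => i _; rewrite iterS /= derivZ scalerAr.
Qed.

Lemma coef_euler p i : (euler p)`_i = p`_i * i%:R.
Proof.
by rewrite coefXM coef_deriv; case: i => [|i] /=; rewrite ?mulr0 // mulr_natr.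
Qed.

Lemma coef_iter_euler p a i : (iter a euler p)`_i = p`_i * i%:R ^+ a.
Proof.
elim: a => [|a IH]; first by rewrite mulr1.
by rewrite iterS coef_euler IH exprSr mulrA.
Qed.

Lemma coef_prod_top (I : Type) (s : seq I) (p : I -> {poly F}) (d : I -> nat) :
  (forall i, size (p i) <= (d i).+1)%N ->
  (\prod_(i <- s) p i)`_(\sum_(i <- s) d i) = \prod_(i <- s) (p i)`_(d i) /\
  (size (\prod_(i <- s) p i)%R <= (\sum_(i <- s) d i).+1)%N.
Proof.
move=> H; elim: s => [|i s [IH1 IH2]]; first by rewrite !big_nil coef1 size_poly1.
rewrite !big_cons; split; last first.
  by apply: leq_trans (size_polyMleq _ _) _; have := H i; lia.
rewrite coefM (bigD1 (Ordinal (leq_addr _ _ : d i < (d i + \sum_(j <- s) d j).+1)%N)) //=.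
rewrite addKn IH1 [X in _ + X]big1 ?addr0 // => k ki.
have [lt|gt|E] := ltngtP k (d i); last by case/eqP: ki; apply/val_inj.
  by rewrite [X in _ * X]nth_default ?mulr0 //; apply: leq_trans IH2 _; have := ltn_ord k; lia.
by rewrite [X in X * _]nth_default ?mul0r //; apply: leq_trans (H i) _.
Qed.

Variables (m : nat) (P : 'I_m -> {poly F}).
Definition wronskian := \det (\matrix_(a < m, k < m) iter a euler (P k)).

Lemma size_iter_euler p a : (size (iter a euler p) <= size p)%N.
Proof.
apply/leq_sizeP => i /(nth_default 0) pi.
by rewrite coef_iter_euler pi mul0r.
Qed.

Lemma size_wronskian d : (forall k, size (P k) <= d.+1)%N -> (size wronskian <= (m * d).+1)%N.
Proof.
move=> H; rewrite /wronskian /determinant; apply: leq_trans (size_sum _ _ _) _.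
apply/bigmax_leqP => s _; rewrite size_Msign.
apply: leq_trans (_ : (\sum_(i < m) d).+1 <= _)%N; last by rewrite sum_nat_const card_ord.
have [] // := @coef_prod_top _ (index_enum 'I_m) (fun i => (\matrix_(a < m, k < m) iter a euler (P k)) i (s i)) (fun=> d).
by move=> i; rewrite mxE (leq_trans (size_iter_euler _ _)).
Qed.

(** The coefficient whose degree is the sum of the degrees of the [P k] is the product of their
    leading coefficients and of the Vandermonde determinant of the degrees. *)
Lemma wronskian_neq0 : (forall k, P k != 0) -> injective (fun k => size (P k)) -> wronskian != 0.
Proof.
move=> P0 Pinj; pose d k := (size (P k)).-1.
have sd k : size (P k) = (d k).+1 by rewrite prednK // size_poly_gt0.
suff : wronskian`_(\sum_k d k) != 0 by apply: contraNneq => ->; rewrite coef0.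
have -> : wronskian`_(\sum_k d k) = \det (\matrix_(a < m, k < m) ((P k)`_(d k) * (d k)%:R ^+ a)).
  rewrite /wronskian /determinant coef_sum; apply: eq_bigr => s _.
  have [//|top _] := @coef_prod_top _ (index_enum 'I_m) (fun i => iter i euler (P (s i))) (fun i => d (s i)).
    by move=> i; rewrite -sd size_iter_euler.
  have -> : (\sum_k d k = \sum_i d (s i))%N by rewrite (reindex_perm s).
  have E1 : \prod_i (\matrix_(a, k) iter a euler (P k)) i (s i) = \prod_(i < m) iter i euler (P (s i)).
    by apply: eq_bigr => i _; rewrite mxE.
  have E2 : \prod_i (\matrix_(a, k) ((P k)`_(d k) * (d k)%:R ^+ a)) i (s i) = \prod_(i < m) (iter i euler (P (s i)))`_(d (s i)).
    by apply: eq_bigr => i _; rewrite mxE coef_iter_euler.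
  rewrite E1 E2 -top; case: (odd_perm s); last by rewrite !expr0 !mul1r.
  by rewrite !expr1 !mulN1r coefN.
rewrite (_ : \matrix_(a, k) _ = Vandermonde m (\row_k (d k)%:R) *m diag_mx (\row_k (P k)`_(d k))).
  rewrite det_mulmx det_diag det_Vandermonde mulf_neq0 //.
    apply/prodf_neq0 => i _; apply/prodf_neq0 => j ij; rewrite !mxE subr_eq0 eqr_nat.
    apply: contraTneq ij => dij; rewrite (Pinj i j) ?ltnn // !sd dij //.
  by apply/prodf_neq0 => k _; rewrite mxE -lead_coefE lead_coef_eq0.
by apply/matrixP => a k; rewrite mul_mx_diag !mxE mulrC.
Qed.

(* [W w = adj(M) (M w)], and the entries of [M w] are the [iter a euler (sum_k w_k P_k)]. *)
Lemma wronskian_dvdp (w : 'I_m -> F) (k : 'I_m) x T : w k != 0 ->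
  ('X - x%:P) ^+ T %| \sum_k w k *: P k -> ('X - x%:P) ^+ (T - m.-1) %| wronskian.
Proof.
move=> wk H; set M := \matrix_(a < m, k < m) iter a euler (P k).
pose v : 'cV[{poly F}]_m := \col_k (w k)%:P.
have : (\adj M *m (M *m v)) k 0 = wronskian * (w k)%:P.
  by rewrite mulmxA mul_adj_mx mul_scalar_mx !mxE.
rewrite mxE => E; rewrite -(dvdpZr _ _ wk) -mul_polyC mulrC -E.
apply: (big_ind (fun q => ('X - x%:P) ^+ (T - m.-1) %| q)); [exact: dvdp0 | exact: dvdp_add |].
move=> a _; rewrite dvdp_mull //.
have -> : (M *m v) a 0 = iter a euler (\sum_k w k *: P k).
  rewrite iter_euler_sum mxE; apply: eq_bigr => j _.
  by rewrite !mxE mulrC mul_polyC.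
apply: dvdp_trans (iter_euler_dvdp a H); apply: dvdp_exp2l.
by have := ltn_ord a; lia.
Qed.

End Wronskian.

Lemma prod_exp_XsubC_dvdp (F : fieldType) (s : seq F) (k : F -> nat) (p : {poly F}) : uniq s ->
  (forall x, x \in s -> ('X - x%:P) ^+ k x %| p) -> \prod_(x <- s) ('X - x%:P) ^+ k x %| p.
Proof.
elim: s => [|x s IH] /=; first by rewrite big_nil dvd1p.
move=> /andP[xs us] H; rewrite big_cons Gauss_dvdp.
  by rewrite H ?mem_head // IH // => y ys; apply: H; rewrite inE ys orbT.
apply: coprimep_expl; rewrite coprimep_sym coprimep_XsubC rootE horner_prod.
rewrite prodf_seq_neq0; apply/allP => y ys /=.
by rewrite horner_exp hornerXsubC expf_neq0 // subr_eq0; apply: contraNneq xs => ->.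
Qed.

(** The roots of [X^r - y] are simple, because [(X^r - y) - (X / r) (X^r - y)'] is the constant
    [- y]. *)
Lemma closed_field_roots (F : numClosedFieldType) (r : nat) (y : F) : (0 < r)%N -> y != 0 ->
  exists s : seq F, [/\ uniq s, size s = r & forall x, x \in s -> x ^+ r = y].
Proof.
move=> r0 y0; have [s Es] := closed_field_poly_normal ('X^r - y%:P : {poly F}).
have sz : size ('X^r - y%:P : {poly F}) = r.+1 by rewrite size_XnsubC.
rewrite lead_coefDl ?size_polyXn ?size_opp ?(leq_ltn_trans (size_polyC_leq1 _)) // lead_coefXn scale1r in Es.
exists s; split.
- rewrite -separable_prod_XsubC -Es separable_poly.unlock.
  apply/Bezout_coprimepP; exists (1, - (r%:R^-1)%:P * 'X) => /=.
  have -> : 1 * ('X^r - y%:P) + - (r%:R^-1)%:P * 'X * ('X^r - y%:P)^`() = (- y)%:P.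
    have E : 'X * ('X^(r.-1) *+ r) = (r%:R : F)%:P * 'X^r :> {poly F}.
      by rewrite mulrnAr -exprS prednK // polyC_natr mulr_natl.
    rewrite derivB derivC derivXn subr0 mul1r -mulrA E mulNr mulrA -polyCM mulVf ?pnatr_eq0 -?lt0n //.
    by rewrite mul1r polyCN addrAC subrr add0r.
  by rewrite polyC_eqp1 oppr_eq0.
- by apply: succn_inj; rewrite -sz Es size_prod_XsubC.
- move=> x; rewrite -root_prod_XsubC -Es rootE !hornerE subr_eq0 => /eqP //.
Qed.

Lemma expo_inj (r a b i j : nat) : (i < r)%N -> (j < r)%N ->
  (r * a.+1 - i = r * b.+1 - j)%N -> i = j.
Proof.
move=> ir jr E; have [ab|ba|ab] := ltngtP a b; last by rewrite ab in E; nia.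
  have : (r * a.+1 + r <= r * b.+1)%N by rewrite -mulnSr leq_mul2l ltnS ab orbT.
  have : (r <= r * a.+1)%N by rewrite leq_pmulr.
  lia.
have : (r * b.+1 + r <= r * a.+1)%N by rewrite -mulnSr leq_mul2l ltnS ba orbT.
have : (r <= r * b.+1)%N by rewrite leq_pmulr.
lia.
Qed.

(** Collect in [P j] the terms with exponents [r (l + 1) - j]. The nonzero [P j] have degrees
    distinct modulo [r], so their Wronskian is not zero. For [x^r = 1] the sum of the [x^j P j]
    vanishes at [x] as the sum of the [P j] does at [1], which spreads the zero at [1] over all
    [r]-th roots of unity; the second condition is spread in the same way over the [r]-th roots of
    [c^r / u]. If [m] of the [P j] are nonzero, the Wronskian vanishes to the orders [T - (m - 1)]
    and [tau - (m - 1)] at these points, while its degree is at most [m r La]; the factor [r]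
    cancels. *)
Lemma zero_estimate (F : numClosedFieldType) (r La e T tau : nat) (q : 'I_La -> 'I_e -> F) (u c : F) :
  (0 < r)%N -> (e <= r)%N -> u != 0 -> c != 0 -> c ^+ r != u -> (exists l j, q l j != 0) ->
  (forall a, (a < T)%N -> \sum_l \sum_j q l j * ('C(r * l.+1 - j, a))%:R = 0) ->
  (forall a, (a < tau)%N ->
     \sum_l \sum_j q l j * ('C(r * l.+1 - j, a))%:R * (c ^+ (r * l.+1 - j) / u ^+ l.+1) = 0) ->
  (T + tau <= e * La + 2 * e)%N.
Proof.
move=> r0 er u0 c0 cru [l0 [j0 q0]] HT Htau.
pose P j := \sum_l q l j *: 'X^(r * l.+1 - j) : {poly F}.
have jr (j : 'I_e) : (j < r)%N by apply: leq_trans er.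
have cf (l : 'I_La) j : (P j)`_(r * l.+1 - j) = q l j.
  rewrite coef_sum (bigD1 l) //= coefZ coefXn eqxx mulr1 big1 ?addr0 // => l' l'l.
  rewrite coefZ coefXn; case: eqP => [E|]; last by rewrite mulr0.
  case/eqP: l'l; apply/val_inj.
  have lr k : (j <= r * k.+1)%N by apply: leq_trans (ltnW (jr j)) _; rewrite leq_pmulr.
  have : (r * l.+1 = r * l'.+1)%N by have := lr l; have := lr l'; lia.
  by move/eqP; rewrite eqn_pmul2l // eqSS => /eqP.
have szP j : (size (P j) <= (r * La).+1)%N.
  apply: leq_trans (size_sum _ _ _) _; apply/bigmax_leqP => l _.
  apply: leq_trans (size_scale_leq _ _) _; rewrite size_polyXn ltnS.
  by apply: leq_trans (leq_subr _ _) _; rewrite leq_mul2l ltn_ord orbT.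
pose J := [set j | P j != 0]%SET.
pose Q (k : 'I_#|J|) := P (enum_val k).
have Q0 k : Q k != 0 by have := enum_valP k; rewrite inE.
have szinj : injective (fun k => size (Q k)).
  move=> k k' E; apply: enum_val_inj; apply/val_inj.
  have deg j : P j != 0 -> exists l : 'I_La, (size (P j)).-1 = (r * l.+1 - j)%N.
    move=> Pj0; apply: contrapT => nex; have := lead_coef_eq0 (P j); rewrite (negPf Pj0).
    move/negbT/eqP; apply; rewrite lead_coefE coef_sum big1 // => l _; rewrite coefZ coefXn.
    by case: eqP => [E'|]; [case: nex; exists l | rewrite mulr0].
  have [l El] := deg _ (Q0 k); have [l' El'] := deg _ (Q0 k').
  have E' : (r * l.+1 - enum_val k = r * l'.+1 - enum_val k')%N.
    by have := congr1 predn E; rewrite /Q El El'.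
  exact: expo_inj (jr _) (jr _) E'.
have Jj : j0 \in J.
  by rewrite inE; apply: contraNneq q0 => Pj; rewrite -(cf l0 j0) Pj coef0.
have m0 : (0 < #|J|)%N by apply/card_gt0P; exists j0.
have me : (#|J| <= e)%N by rewrite -[X in (_ <= X)%N]card_ord max_card.
have W0 := wronskian_neq0 Q0 szinj.
have szW : (size (wronskian Q) <= (#|J| * (r * La)).+1)%N.
  by apply: size_wronskian => k; apply: szP.
(* The values [u' = c' = 1] give the roots of unity. *)
have vanish (u' c' x0 : F) t : u' != 0 -> c' != 0 -> x0 ^+ r = c' ^+ r / u' ->
    (forall a, (a < t)%N ->
     \sum_l \sum_j q l j * ('C(r * l.+1 - j, a))%:R * (c' ^+ (r * l.+1 - j) / u' ^+ l.+1) = 0) ->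
    ('X - x0%:P) ^+ (t - #|J|.-1) %| wronskian Q.
  move=> u'0 c'0 Ex H.
  have x00 : x0 != 0.
    have : x0 ^+ r != 0 by rewrite Ex mulf_neq0 ?expf_neq0 ?invr_eq0.
    by apply: contraNneq => ->; rewrite expr0n eqn0Ngt r0.
  have w0 : x0 / c' != 0 by rewrite mulf_neq0 ?invr_eq0.
  apply: (@wronskian_dvdp F _ Q (fun k => (x0 / c') ^+ (enum_val k)) (Ordinal m0)).
    by rewrite expf_neq0.
  have -> : \sum_(k < #|J|) (x0 / c') ^+ (enum_val k) *: Q k = \sum_(p : 'I_La * 'I_e) (q p.1 p.2 * (x0 / c') ^+ p.2) *: 'X^(r * p.1.+1 - p.2).
    have -> : \sum_(k < #|J|) (x0 / c') ^+ (enum_val k) *: Q k = \sum_(j in J) (x0 / c') ^+ j *: P j.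
      by rewrite (big_enum_val (fun j : 'I_e => (x0 / c') ^+ j *: P j)).
    have -> : \sum_(j in J) (x0 / c') ^+ j *: P j = \sum_(j < e) (x0 / c') ^+ j *: P j.
      rewrite big_mkcond; apply: eq_bigr => j _; rewrite inE; case: eqP => //= ->; rewrite scaler0 //.
    rewrite -(pair_bigA _ (fun (l : 'I_La) (j : 'I_e) => (q l j * (x0 / c') ^+ j) *: 'X^(r * l.+1 - j))) /= exchange_big /=.
    apply: eq_bigr => j _; rewrite scaler_sumr; apply: eq_bigr => l _.
    by rewrite scalerA mulrC.
  apply: dvdp_exp_sum_Xn => // a /H Ha; rewrite -[RHS]Ha pair_bigA /=; apply: eq_bigr => -[l j] _ /=.
  have lr : (j <= r * l.+1)%N by apply: leq_trans (ltnW (jr j)) _; rewrite leq_pmulr.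
  have E1 : x0 ^+ j * x0 ^+ (r * l.+1 - j) = (c' ^+ r / u') ^+ l.+1 by rewrite -exprD subnKC // exprM Ex.
  have E2 : c' ^+ j * c' ^+ (r * l.+1 - j) = (c' ^+ r) ^+ l.+1 by rewrite -exprD subnKC // exprM.
  have E3 : (x0 / c') ^+ j * x0 ^+ (r * l.+1 - j) = c' ^+ (r * l.+1 - j) / u' ^+ l.+1.
    rewrite expr_div_n; apply: (mulfI (expf_neq0 j c'0)).
    by rewrite mulrA [c' ^+ j * _]mulrC divfK ?expf_neq0 // E1 expr_div_n -E2 mulrA.
  by rewrite -E3 [RHS]mulrA; congr (_ * _); exact: mulrAC.
(* This keeps the two sets of [r] points disjoint. *)
have y1 : c ^+ r / u != 1 by apply: contraNneq cru => E; rewrite -[c ^+ r](divfK u0) E mul1r.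
have [s1 [us1 ss1 Hs1]] := closed_field_roots r0 (oner_neq0 F).
have y0 : c ^+ r / u != 0 by rewrite mulf_neq0 ?expf_neq0 ?invr_eq0.
have [s2 [us2 ss2 Hs2]] := closed_field_roots r0 y0.
pose k x := if x \in s1 then (T - #|J|.-1)%N else (tau - #|J|.-1)%N.
have s12 x : x \in s2 -> x \notin s1.
  by move=> /Hs2 E; apply: contra y1 => /Hs1; rewrite E => ->.
have us : uniq (s1 ++ s2).
  by rewrite cat_uniq us1 us2 andbT; apply/hasPn => x /s12.
have dv : \prod_(x <- s1 ++ s2) ('X - x%:P) ^+ k x %| wronskian Q.
  apply: prod_exp_XsubC_dvdp => // x; rewrite mem_cat /k; case: ifP => [xs1 _|_ /= /Hs2 Ex].
    apply: (vanish 1 1) => //; rewrite ?oner_neq0 ?expr1n ?divr1 ?Hs1 //.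
    move=> a /HT Ha; rewrite -[RHS]Ha; apply: eq_bigr => l _; apply: eq_bigr => j _.
    by rewrite !expr1n divr1 mulr1.
  exact: (vanish u c).
have := dvdp_leq W0 dv; rewrite big_cat /=.
have sprod (s : seq F) n : (forall x, x \in s -> k x = n) -> \prod_(x <- s) ('X - x%:P) ^+ k x = (\prod_(x <- s) ('X - x%:P)) ^+ n.
  by move=> H; rewrite -prodrXl big_seq [RHS]big_seq; apply: eq_bigr => x /H ->.
rewrite (sprod s1 (T - #|J|.-1)%N); last by move=> x; rewrite /k => ->.
rewrite (sprod s2 (tau - #|J|.-1)%N); last by move=> x /s12; rewrite /k => /negPf->.
have mon (s : seq F) : \prod_(x <- s) ('X - x%:P) \is monic by apply: monic_prod_XsubC.
have size_pow (s : seq F) n : size s = r -> (size ((\prod_(x <- s) ('X - x%:P)) ^+ n) = (r * n).+1)%N.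
  by move=> <-; rewrite -[LHS]prednK ?size_poly_gt0 ?monic_neq0 ?monic_exp // size_exp size_prod_XsubC.
rewrite size_monicM ?monic_exp ?monic_neq0 ?monic_exp // !size_pow // => le1.
have : (r * ((T - #|J|.-1) + (tau - #|J|.-1)) <= r * (#|J| * La))%N.
  have := leq_trans le1 szW; rewrite addnS addSn /= ltnS => le2.
  by rewrite mulnDr (mulnCA r).
rewrite leq_pmul2l // => le2.
have le3 : (#|J| * La <= e * La)%N by rewrite leq_mul2r me orbT.
by move: le2 le3 me m0; clear; lia.
Qed.

(** * Estimates for integral combinations *)

Section Combinations.
Variables (R : realType) (F : fieldType) (v : F -> R).
Hypothesis vP : absval v.
Variable I : finType.
Implicit Types (a : I -> int) (n : I -> nat).

Lemma absval_intr_comb a (t : I -> F) (w : F) (k : nat) (X : R) : (0 < k)%N ->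
  (forall i, v (t i) ^+ k * v w <= X) ->
  v (\sum_i (a i)%:~R * t i) ^+ k * v w <= (\sum_i `|a i|%:~R) ^+ k * X.
Proof.
move=> k0 H; have v0 := absval_ge0 vP; case: (pickP (@predT I)) => [i0 _|no]; last first.
  by rewrite !big_pred0 // (absval0 vP) expr0n eqn0Ngt k0 !mul0r.
have [i _ iM] := arg_maxP (fun i => v (t i)) (isT : predT i0).
apply: le_trans (_ : ((\sum_i `|a i|%:~R) * v (t i)) ^+ k * v w <= _).
  rewrite ler_wpM2r //; have S0 : 0 <= \sum_i (`|a i|%:~R : R).
    by apply: sumr_ge0 => j _; rewrite ler0z.
  apply: lerXn2r; rewrite ?nnegrE ?v0 ?mulr_ge0 //.
  apply: le_trans (absval_sum vP _ _ _) _; rewrite mulr_suml; apply: ler_sum => j _.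
  by rewrite (absvalM vP) ler_pM ?absval_int_le //; apply: iM.
by rewrite exprMn -mulrA ler_wpM2l // exprn_ge0 // sumr_ge0.
Qed.

Lemma mul_bin_bin (n0 b c : nat) : ('C(n0, b) * 'C(n0 - b, c) = 'C(n0, b + c) * 'C(b + c, b))%N.
Proof.
have [le|lt] := leqP (b + c) n0; last first.
  rewrite [in RHS]bin_small // mul0n; have [lb|lb] := leqP b n0; last by rewrite bin_small.
  by rewrite [X in (_ * X)%N]bin_small ?muln0 //; lia.
have bn : (b <= n0)%N by lia.
have E1 := bin_fact bn; have E2 := @bin_fact (n0 - b) c; have E3 := bin_fact le.
have E4 := @bin_fact (b + c) b (leq_addr _ _).
have {}E2 : ('C(n0 - b, c) * (c`! * (n0 - (b + c))`!) = (n0 - b)`!)%N by rewrite subnDA E2 //; lia.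
rewrite addKn in E4.
apply/eqP; rewrite -(@eqn_pmul2r (b`! * c`! * (n0 - (b + c))`!)); last by rewrite !muln_gt0 !fact_gt0.
apply/eqP.
have -> : ('C(n0, b) * 'C(n0 - b, c) * (b`! * c`! * (n0 - (b + c))`!) = 'C(n0, b) * (b`! * ('C(n0 - b, c) * (c`! * (n0 - (b + c))`!))))%N by ring.
rewrite E2 E1.
have -> : ('C(n0, b + c) * 'C(b + c, b) * (b`! * c`! * (n0 - (b + c))`!) = 'C(n0, b + c) * (('C(b + c, b) * (b`! * c`!)) * (n0 - (b + c))`!))%N by ring.
by rewrite E4 E3.
Qed.

(** The sum is [c^k] times the [k]-th normalized derivative at [c] of a polynomial that vanishes to
    order [T] at [1]; expanded in powers of [c - 1], it has no term of exponent below [T - k]. One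
    factor [2^d] comes from [c^k], the other from the binomial coefficients. *)
Lemma taylor_bound a n d T k (c : F) (eps : R) :
  (forall i, (n i <= d)%N) -> (k <= d)%N ->
  (forall j, (j < T)%N -> \sum_i a i * ('C(n i, j))%:Z = 0) ->
  v (c - 1) <= eps -> eps <= 1 -> v c <= 2 ->
  v (\sum_i (a i * ('C(n i, k))%:Z)%:~R * c ^+ n i) <=
    (\sum_i `|a i * ('C(n i, k))%:Z|%:~R) * 4 ^+ d * eps ^+ (T - k).
Proof.
move=> nd kd HT ce e1 c2; have v0 := absval_ge0 vP.
have e0 : 0 <= eps by apply: le_trans ce.
have -> : \sum_i (a i * ('C(n i, k))%:Z)%:~R * c ^+ n i =
    c ^+ k * \sum_(b < d.+1 | (T - k <= b)%N) \sum_i (a i * ('C(n i, k))%:Z * ('C(n i - k, b))%:Z)%:~R * (c - 1) ^+ b.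
  rewrite mulr_sumr [RHS]big_mkcond /=.
  have -> : \sum_i (a i * ('C(n i, k))%:Z)%:~R * c ^+ n i =
      \sum_i \sum_(b < d.+1) c ^+ k * ((a i * ('C(n i, k))%:Z * ('C(n i - k, b))%:Z)%:~R * (c - 1) ^+ b).
    apply: eq_bigr => i _; have [le|lt] := leqP k (n i); last first.
      by rewrite bin_small // mulr0 mul0r big1 // => b _; rewrite !mul0r mulr0.
    have -> : c ^+ n i = c ^+ k * \sum_(b < d.+1) ('C(n i - k, b))%:R * (c - 1) ^+ b.
      rewrite -{1}(subnKC le) exprD; congr (_ * _).
      have {1}-> : c = (c - 1) + 1 by rewrite subrK.
      rewrite addrC exprDn; have le1 : ((n i - k).+1 <= d.+1)%N by have := nd i; lia.
      rewrite (big_ord_widen _ (fun b => 1 ^+ (n i - k - b) * (c - 1) ^+ b *+ 'C(n i - k, b)) le1) big_mkcond /=.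
      apply: eq_bigr => b _; case: ltnP => [_|lt]; first by rewrite expr1n mul1r mulr_natl.
      by rewrite bin_small ?mul0r.
    rewrite -[RHS]mulr_sumr mulrCA; congr (_ * _); rewrite mulr_sumr; apply: eq_bigr => b _.
    by rewrite [in RHS]intrM mulrA.
  rewrite exchange_big /=; apply: eq_bigr => b _; rewrite -mulr_sumr; case: leqP => // lt.
  rewrite -mulr_suml -raddf_sum /=.
  have -> : \sum_i a i * ('C(n i, k))%:Z * ('C(n i - k, b))%:Z = 0.
    have -> : \sum_i a i * ('C(n i, k))%:Z * ('C(n i - k, b))%:Z = (\sum_i a i * ('C(n i, k + b))%:Z) * ('C(k + b, k))%:Z.
      by rewrite mulr_suml; apply: eq_bigr => i _; rewrite -!mulrA -!PoszM mul_bin_bin.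
    by rewrite HT ?mul0r //; lia.
  by rewrite rmorph0 mul0r mulr0.
rewrite (absvalM vP) (absvalX vP).
have le4 : v c ^+ k * 2 ^+ d <= 4 ^+ d.
  have -> : (4 : R) = 2 * 2 by ring.
  rewrite exprMn ler_wpM2r ?exprn_ge0 //; apply: le_trans (_ : 2 ^+ k <= _).
    by apply: lerXn2r c2; rewrite nnegrE.
  by rewrite ler_weXn2l // ler1n.
set S := \sum_i `|_|%:~R.
have S0 : 0 <= S by apply: sumr_ge0 => i _; rewrite ler0z.
apply: le_trans (_ : v c ^+ k * (S * 2 ^+ d * eps ^+ (T - k)) <= _); last first.
  have -> : v c ^+ k * (S * 2 ^+ d * eps ^+ (T - k)) = S * (v c ^+ k * 2 ^+ d) * eps ^+ (T - k) by ring.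
  by rewrite ler_wpM2r ?exprn_ge0 // ler_wpM2l.
rewrite ler_wpM2l ?exprn_ge0 //; apply: le_trans (absval_sum vP _ _ _) _.
apply: le_trans (_ : \sum_(b < d.+1) \sum_i `|a i * ('C(n i, k))%:Z|%:~R * ('C(n i - k, b))%:R * eps ^+ (T - k) <= _).
  rewrite big_mkcond /=; apply: ler_sum => b _.
  case: leqP => [le|_]; last first.
    by apply: sumr_ge0 => i _; rewrite !mulr_ge0 ?exprn_ge0 ?ler0z.
  apply: le_trans (absval_sum vP _ _ _) _; apply: ler_sum => i _.
  rewrite (absvalM vP) (absvalX vP) ler_pM ?exprn_ge0 //.
    by apply: le_trans (absval_int_le vP _) _; rewrite normrM intrM.
  apply: le_trans (_ : eps ^+ b <= _); first by apply: lerXn2r ce; rewrite nnegrE.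
  by rewrite ler_wiXn2l.
rewrite exchange_big /= /S !mulr_suml; apply: ler_sum => i _.
rewrite -mulr_suml ler_wpM2r ?exprn_ge0 // -mulr_sumr ler_wpM2l ?ler0z //.
rewrite -natr_sum -natrX ler_nat; apply: leq_trans (_ : 2 ^ (n i - k) <= _)%N; last first.
  by rewrite leq_pexp2l //; have := nd i; lia.
have -> : (2 ^ (n i - k) = \sum_(b < (n i - k).+1) 'C(n i - k, b))%N.
  by rewrite -[2%N]/(1 + 1)%N Pascal; apply: eq_bigr => b _; rewrite !exp1n !muln1.
have le : ((n i - k).+1 <= d.+1)%N by have := nd i; lia.
rewrite [X in (_ <= X)%N](big_ord_widen _ (fun b => 'C(n i - k, b)) le) [X in (_ <= X)%N]big_mkcond /=.
apply: leq_sum => b _; case: ltnP => // lt; by rewrite bin_small.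
Qed.

End Combinations.

Section PowerClosure.
Variable K : fieldExtType rat.
Local Notation "'𝔬'" := (@ring_of_integers K).

Lemma rint_root x k : (0 < k)%N -> 𝔬 (x ^+ k) -> 𝔬 x.
Proof.
move=> k0 Ox; apply: (@rint_root_monic _ ('X^k - (x ^+ k)%:P)).
- by rewrite monicXnsubC.
- by rewrite rootE !hornerE subrr.
- by move=> i; rewrite coefB coefXn coefC; apply: rintB; [apply: rint_nat | case: eqP => // _; apply: rint0].
Qed.

(* Each term of [(x + y)^k w] has an integral [k]-th power. *)
Lemma rint_powD x y w k : (0 < k)%N -> 𝔬 (x ^+ k * w) -> 𝔬 (y ^+ k * w) -> 𝔬 ((x + y) ^+ k * w).
Proof.
move=> k0 Ox Oy; rewrite exprDn mulr_suml; apply: rint_sum => i.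
rewrite mulrnAl -mulr_natl; apply: rintM; first exact: rint_nat.
apply: (rint_root k0); have le : (i <= k)%N by rewrite -ltnS.
have -> : (x ^+ (k - i) * y ^+ i * w) ^+ k = (x ^+ k * w) ^+ (k - i) * (y ^+ k * w) ^+ i.
  have -> : (x ^+ (k - i) * y ^+ i * w) ^+ k = (x ^+ (k - i) * y ^+ i) ^+ k * w ^+ (k - i + i) by rewrite exprMn subnK.
  by rewrite exprD !exprMn -!exprM [((k - i) * k)%N]mulnC [(i * k)%N]mulnC; ring.
by apply: rintM; apply: rintX.
Qed.

(** This is the ultrametric inequality at all finite places at once, with integral closedness in
    place of valuations; the [t i] themselves need not be integral. *)
Lemma rint_pow_comb (I : finType) (a : I -> int) (t : I -> K) w k : (0 < k)%N ->
  (forall i, 𝔬 (t i ^+ k * w)) -> 𝔬 ((\sum_i (a i)%:~R * t i) ^+ k * w).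
Proof.
move=> k0 H; apply: (big_ind (fun z => 𝔬 (z ^+ k * w))).
- by rewrite expr0n eqn0Ngt k0 mul0r; apply: rint0.
- by move=> x y; apply: rint_powD.
- by move=> i _; rewrite exprMn -mulrA; apply: rintM; rewrite // -rmorphXn; apply: rint_int.
Qed.

End PowerClosure.

(** The square of side [2 B] is cut into cells of side [2 B / M]. Counting the cells of the upper
    boundary there are [(M + 1)^2] of them, for one more point. *)
Lemma complex_pigeonhole (R : realType) (B : R) (M : nat) (z : nat -> R[i]) : (0 < M)%N -> 0 < B ->
  (forall q, (q <= M.+1 ^ 2)%N -> Normc.normc (z q) <= B) ->
  exists q q', [/\ (q < q')%N, (q' <= M.+1 ^ 2)%N & Normc.normc (z q' - z q) * M%:R <= 4 * B].
Proof.
move=> M0 B0 zB; have M0' : 0 < M%:R :> R by rewrite ltr0n.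
pose cell (x : R) := Num.truncn ((x + B) * (M%:R / (2 * B))).
have B2 : 0 < M%:R / (2 * B) by rewrite divr_gt0 // mulr_gt0.
have EB : M%:R / (2 * B) * (2 * B) = M%:R by rewrite divfK // lt0r_neq0 // mulr_gt0.
have cellP (x : R) : `|x| <= B -> (cell x < M.+1)%N /\ ((cell x)%:R <= (x + B) * (M%:R / (2 * B)) < (cell x).+1%:R).
  rewrite ler_norml => /andP[x1 x2].
  have p0 : 0 <= (x + B) * (M%:R / (2 * B)) by rewrite mulr_ge0 ?(ltW B2) //; lra.
  have itv := truncn_itv p0; split=> //; rewrite ltnS -(ler_nat R).
  case/andP: itv => lo _; apply: le_trans lo _; rewrite -[leRHS]EB mulrC ler_wpM2l ?(ltW B2) //; lra.
have cell_eq (x y : R) : `|x| <= B -> `|y| <= B -> cell x = cell y -> `|x - y| * M%:R <= 2 * B.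
  move=> /cellP[_ /andP[x1 x2]] /cellP[_ /andP[y1 y2]] xy; rewrite -xy in y1 y2.
  have : `|(x - y) * (M%:R / (2 * B))| <= 1.
    have -> : (x - y) * (M%:R / (2 * B)) = (x + B) * (M%:R / (2 * B)) - (y + B) * (M%:R / (2 * B)) by ring.
    rewrite -natr1 in x2 y2; move: x1 x2 y1 y2; rewrite ler_norml; set X := (x + B) * _; set Y := (y + B) * _.
    by clear; lra.
  rewrite normrM [X in _ * X]gtr0_norm // -{2}EB => H.
  have -> : `|x - y| * (M%:R / (2 * B) * (2 * B)) = (`|x - y| * (M%:R / (2 * B))) * (2 * B) by ring.
  by rewrite -[leRHS]mul1r ler_wpM2r // mulr_ge0 // ltW.
have reim (w : R[i]) : `|complex.Re w| <= Normc.normc w /\ `|complex.Im w| <= Normc.normc w.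
  case: w => x y /=; rewrite -!sqrtr_sqr; split; rewrite ler_wsqrtr ?lerDl ?lerDr ?sqr_ge0 //.
have normc_le (w : R[i]) : Normc.normc w <= `|complex.Re w| + `|complex.Im w|.
  case: w => x y; rewrite /Normc.normc /= -[leRHS]ger0_norm ?addr_ge0 // -sqrtr_sqr ler_wsqrtr //.
  have := normr_ge0 x; have := normr_ge0 y; rewrite -[x ^+ 2]real_normK ?num_real // -[y ^+ 2]real_normK ?num_real //.
  set X := `|x|; set Y := `|y|; move=> Y0 X0; have := mulr_ge0 X0 Y0; nra.
have cl q : (q <= M.+1 ^ 2)%N -> (cell (complex.Re (z q)) < M.+1)%N /\ (cell (complex.Im (z q)) < M.+1)%N.
  move=> /zB qB; have [h1 h2] := reim (z q).
  by split; [apply: (cellP _ (le_trans h1 qB)).1 | apply: (cellP _ (le_trans h2 qB)).1].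
pose f (q : 'I_(M.+1 ^ 2).+1) : 'I_M.+1 * 'I_M.+1 :=
  (inord (cell (complex.Re (z q))), inord (cell (complex.Im (z q)))).
have [q [q' [qq' fq]]] : exists q q', q <> q' /\ f q = f q'.
  apply: contrapT => nex; have : (#|'I_(M.+1 ^ 2).+1| <= #|{: 'I_M.+1 * 'I_M.+1}|)%N.
    apply: (leq_card f) => q q' E; apply: contrapT => ne; apply: nex; by exists q, q'.
  by rewrite card_prod !card_ord mulnn ltnn.
wlog lt : q q' qq' fq / (q < q')%N.
  move=> W; have [lt|gt|E] := ltngtP q q'; first exact: (W q q'); last by case: qq'; apply/val_inj.
  by apply: (W q' q) => //; apply: nesym.
exists q, q'; split=> //; first by rewrite -ltnS.
have qle : (q <= M.+1 ^ 2)%N by rewrite -ltnS.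
have qle' : (q' <= M.+1 ^ 2)%N by rewrite -ltnS.
case: fq => /(congr1 val) /= E1 /(congr1 val) /= E2.
rewrite !inordK ?(cl _ qle).1 ?(cl _ qle').1 // in E1.
rewrite !inordK ?(cl _ qle).2 ?(cl _ qle').2 // in E2.
have [r1 i1] := reim (z q); have [r2 i2] := reim (z q').
have H1 := cell_eq _ _ (le_trans r2 (zB _ qle')) (le_trans r1 (zB _ qle)) (esym E1).
have H2 := cell_eq _ _ (le_trans i2 (zB _ qle')) (le_trans i1 (zB _ qle)) (esym E2).
apply: le_trans (_ : (`|complex.Re (z q' - z q)| + `|complex.Im (z q' - z q)|) * M%:R <= _).
  by rewrite ler_wpM2r // ltW.
have -> : complex.Re (z q' - z q) = complex.Re (z q') - complex.Re (z q) by case: (z q') => ? ?; case: (z q).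
have -> : complex.Im (z q' - z q) = complex.Im (z q') - complex.Im (z q) by case: (z q') => ? ?; case: (z q).
by rewrite mulrDl; move: H1 H2; clear; lra.
Qed.

Lemma bin_le_exp2 n k : ('C(n, k) <= 2 ^ n)%N.
Proof.
elim: n k => [|n IH] [|k] //; first by rewrite bin0 expn_gt0.
by rewrite binS expnS mul2n -addnn leq_add.
Qed.

Lemma product_le1 (R : realType) (x y k n m : R) : 0 < k -> 0 < n -> 0 < m -> 0 <= x ->
  x * (16 * (n * n * (m * m) * k)) <= 4 * (2 * (n * m)) -> y <= 2 * (n * m) -> x * y * k <= 1.
Proof.
move=> k0 n0 m0 x0 H1 H2; have p0 : 0 < n * m by rewrite mulr_gt0.
apply: le_trans (_ : x * (2 * (n * m)) * k <= _).
  by rewrite ler_wpM2r ?(ltW k0) // ler_wpM2l.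
have p8 : 0 < 4 * (2 * (n * m)) by rewrite !mulr_gt0.
rewrite -(ler_pM2r p8) mul1r; apply: le_trans H1; rewrite le_eqVlt; apply/orP; left; apply/eqP; ring.
Qed.

Lemma collect_powers (R : comNzRingType) (Y m th : R) (A D N0 N : nat) :
  (m ^+ (6 * D) * m ^+ D * th) ^+ N0 * (Y ^+ A * m ^+ (2 * N0 * D)) *
    ((m ^+ (6 * D)) ^+ N0 * (Y ^+ A * m ^+ (2 * N0 * D))) ^+ N =
  Y ^+ (A * N.+1) * (m ^+ (6 * D * N.+1 + D + 2 * D * N.+1) * th) ^+ N0.
Proof.
have E : (m ^+ (6 * D * N.+1 + D + 2 * D * N.+1)) ^+ N0 =
    ((m ^+ (6 * D)) ^+ N0) ^+ N.+1 * (m ^+ D) ^+ N0 * (m ^+ (2 * N0 * D)) ^+ N.+1.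
  by rewrite -!exprM -!exprD; congr (_ ^+ _); ring.
rewrite [in RHS]exprMn E [Y ^+ (_ * _)]exprM ![_ ^+ N.+1]exprS; set p := m ^+ (6 * D); set w := m ^+ (2 * N0 * D).
set v := m ^+ D; rewrite !exprMn.
move: (_ ^+ N) (_ ^+ N) (_ ^+ N) => a b c; ring.
Qed.

Lemma fmorph_exp_div (F1 F2 : fieldType) (f : {rmorphism F1 -> F2}) x y n k :
  f (x ^+ n / y ^+ k) = f x ^+ n / f y ^+ k.
Proof. by rewrite fmorph_div !rmorphXn. Qed.

Lemma ler_mix (R : realType) (y y' b b' Y M : R) (A k D i : nat) : (k <= A)%N -> (i <= D)%N ->
  0 <= y -> 0 <= y' -> 0 <= b -> 0 <= b' -> y <= Y -> y' <= Y -> b <= M -> b' <= M ->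
  y ^+ (A - k) * y' ^+ k * (b ^+ (D - i) * b' ^+ i) <= Y ^+ A * M ^+ D.
Proof.
move=> kA iD y0 y'0 b0 b'0 yY y'Y bM b'M.
have -> : Y ^+ A = Y ^+ (A - k) * Y ^+ k by rewrite -exprD subnK.
have -> : M ^+ D = M ^+ (D - i) * M ^+ i by rewrite -exprD subnK.
have pow (x x' : R) n : 0 <= x -> x <= x' -> x ^+ n <= x' ^+ n.
  by move=> x0 xx'; apply: lerXn2r (xx'); rewrite nnegrE // (le_trans x0 xx').
by rewrite ler_pM ?mulr_ge0 ?exprn_ge0 // ler_pM ?exprn_ge0 ?pow.
Qed.

(** After raising to the power [8], the factor [Y^(8 a)] may be replaced by [Y^n], and the [n]-th
    root can be taken. *)
Lemma ge1_root (R : realType) (Y X : R) (a n : nat) : (0 < n)%N -> (8 * a <= n)%N -> 1 <= Y -> 0 <= X ->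
  1 <= Y ^+ a * X ^+ n -> 1 <= Y * X ^+ 8.
Proof.
move=> n0 an Y1 X0 H; have Y0 : 0 <= Y by apply: le_trans Y1.
have YX0 : 0 <= Y * X ^+ 8 by rewrite mulr_ge0 ?exprn_ge0.
rewrite -(ler_pXn2r n0) ?nnegrE // expr1n.
apply: le_trans (_ : (Y ^+ a * X ^+ n) ^+ 8 <= _); first by rewrite exprn_ege1.
have -> : (Y * X ^+ 8) ^+ n = Y ^+ n * X ^+ (8 * n) by rewrite [LHS]exprMn -exprM.
have -> : (Y ^+ a * X ^+ n) ^+ 8 = Y ^+ (8 * a) * X ^+ (8 * n).
  by rewrite [LHS]exprMn -!exprM ![(_ * 8)%N]mulnC.
by rewrite ler_wpM2r ?exprn_ge0 // ler_weXn2l.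
Qed.

Lemma square_lt_bounds (R : realType) (C Y : R) : 1 <= C -> (4 * C) ^+ 2 < Y -> 2 * C <= Y /\ 1 <= Y.
Proof. by rewrite expr2 => H1 H2; split; nra. Qed.

(** If the first summand dominates, the expression is at most [p^144 (2 p^-19)^8 = 256 p^-8 < 1]. If
    the second does, it is at most [p^72 (4 C)^8 / Y^7], which is less than [Y Y^4 / Y^7]. *)
Lemma no_large_value (R : realType) (p Y C : R) : 4 <= p -> 1 <= C -> p ^+ 72 <= Y -> Y <= p ^+ 144 ->
  (4 * C) ^+ 2 < Y -> 1 <= Y * (p ^+ 9 * ((p ^+ 28)^-1 + 2 * C / Y)) ^+ 8 -> False.
Proof.
move=> p4 C1 pY Yp CY; have p0 : 0 < p by apply: lt_le_trans p4.
have Y0 : 0 < Y by apply: lt_le_trans pY; rewrite exprn_gt0.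
have C0 : 0 <= 2 * C / Y by rewrite divr_ge0 ?(ltW Y0) // mulr_ge0 // (le_trans _ C1).
have q0 : 0 < (p ^+ 28)^-1 by rewrite invr_gt0 exprn_gt0.
apply/negP; rewrite -ltNge.
have bound (x : R) : (p ^+ 28)^-1 <= x -> 2 * C / Y <= x ->
    Y * (p ^+ 9 * ((p ^+ 28)^-1 + 2 * C / Y)) ^+ 8 <= Y * (p ^+ 9 * (x + x)) ^+ 8.
  move=> h1 h2; have x0 : 0 < x by apply: lt_le_trans h1.
  rewrite ler_wpM2l ?(ltW Y0) //; apply: lerXn2r; rewrite ?nnegrE ?mulr_ge0 ?exprn_ge0 ?addr_ge0 ?(ltW p0) ?(ltW q0) ?(ltW x0) //.
  by rewrite ler_wpM2l ?exprn_ge0 ?(ltW p0) // lerD.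
have [le|gt] := leP (2 * C / Y) (p ^+ 28)^-1.
  apply: le_lt_trans (bound _ (lexx _) le) _.
  apply: le_lt_trans (_ : p ^+ 144 * (p ^+ 9 * ((p ^+ 28)^-1 + (p ^+ 28)^-1)) ^+ 8 < _).
    by rewrite ler_wpM2r // exprn_ge0 // mulr_ge0 ?exprn_ge0 ?addr_ge0 ?(ltW p0) ?(ltW q0).
  have -> : p ^+ 144 * (p ^+ 9 * ((p ^+ 28)^-1 + (p ^+ 28)^-1)) ^+ 8 = 256 / p ^+ 8.
    by field; rewrite lt0r_neq0.
  rewrite ltr_pdivrMr ?exprn_gt0 // mul1r; apply: lt_le_trans (_ : 4 ^+ 8 <= _).
    by rewrite -natrX ltr_nat.
  by apply: lerXn2r p4; rewrite nnegrE ?(ltW p0).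
apply: le_lt_trans (bound _ (ltW gt) (lexx _)) _.
have -> : Y * (p ^+ 9 * (2 * C / Y + 2 * C / Y)) ^+ 8 = p ^+ 72 * ((4 * C) ^+ 2) ^+ 4 / Y ^+ 7.
  by field; rewrite lt0r_neq0.
rewrite ltr_pdivrMr ?exprn_gt0 // mul1r; apply: le_lt_trans (_ : Y * ((4 * C) ^+ 2) ^+ 4 < _).
  by rewrite ler_wpM2r // exprn_ge0 // sqr_ge0.
have Y1 : 1 < Y by apply: lt_le_trans pY; rewrite exprn_egt1 // (lt_le_trans _ p4) // ltr1n.
apply: lt_le_trans (_ : Y * Y ^+ 4 <= _).
  by rewrite ltr_pM2l // ltrXn2r // ?nnegrE ?sqr_ge0 ?(ltW Y0).
by rewrite -exprS ler_weXn2l // ltW.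
Qed.

(** * The Thue-Siegel inequality *)

Section MainInequality.
Variables (R : realType) (L : splittingFieldType rat).
Hypothesis galL : galois 1 {:L}.
Variable phi : {rmorphism L -> R[i]}.
Local Notation "'𝔬'" := (@ring_of_integers L).
Local Notation G := (gal_of {:L}).
Local Notation av := (av phi).
Local Notation N := (\dim {:L}).
Implicit Types (g h : G) (x y : L).

(** Liouville's inequality: the product of all conjugates has absolute value at least [1]. *)
Lemma av_lower g0 x (B : R) : 𝔬 x -> x != 0 -> 1 <= B -> (forall g, av g x <= B) ->
  1 <= av g0 x * B ^+ N.
Proof.
move=> Ox x0 B1 xB; have := prod_av_ge1 galL phi Ox x0; rewrite (bigD1 g0) //= => H.
have v0 := absval_ge0 (avP phi _); apply: le_trans H _; rewrite ler_wpM2l ?v0 //.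
rewrite -(card_gal galL) -prodr_const [leRHS](bigD1 g0) //=.
rewrite -[leLHS]mul1r; apply: ler_pM => //; first by apply: prodr_ge0.
by apply: ler_prod => i _; rewrite v0 xB.
Qed.

Variables (mu : nat) (s : L).
Hypothesis mu4 : (4 <= mu)%N.
Local Notation m := (mu%:R : R).
Hypothesis roots : forall y n N0 q, 𝔬 y -> y != 0 -> principal_ideal y (s ^+ n) -> (0 < N0)%N ->
  exists x b, [/\ 𝔬 x, x != 0, 𝔬 b, x ^+ N0 = y ^+ q * b & forall g, av g b <= m ^+ N0].

Lemma mu_gt1 : 1 < m. Proof. by rewrite ltr1n; apply: leq_trans mu4. Qed.
Lemma mu_ge1 : 1 <= m. Proof. exact/ltW/mu_gt1. Qed.
Lemma mu_gt0 : 0 < m. Proof. exact: lt_trans mu_gt1. Qed.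

(** Divide the approximate [N0]-th root of [y1^q] by that of [y2^q]. As [y1] and [y2] are comparable
    at [g0], these quotients and their inverses are bounded there, so two of the first [Qn + 1] are
    close; [c] is the ratio of these two and [d] the difference of their indices. It matters that
    [Qn] does not depend on [N0]. *)
Lemma close_units y1 y2 n1 n2 N0 g0 kappa (Qn := ((16 * mu ^ (2 * N + 2 + kappa)).+1 ^ 2)%N) :
  𝔬 y1 -> y1 != 0 -> principal_ideal y1 (s ^+ n1) ->
  𝔬 y2 -> y2 != 0 -> principal_ideal y2 (s ^+ n2) -> (0 < N0)%N -> (Qn <= N0)%N ->
  av g0 y1 <= 2 * av g0 y2 -> av g0 y2 <= 2 * av g0 y1 ->
  exists d c B W, [/\ (0 < d)%N, (d <= Qn)%N, c != 0, 𝔬 B & 𝔬 W] /\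
   [/\ W != 0, c ^+ N0 * W * y2 ^+ d = y1 ^+ d * B, av g0 (c - 1) * m ^+ kappa <= 1,
      forall g, av g B <= m ^+ (2 * N0) & forall g, av g W <= m ^+ (2 * N0)].
Proof.
move=> O1 y10 dv1 O2 y20 dv2 N00 QN a12 a21; have m0 := mu_gt0; have m1 := mu_ge1.
have vP := avP phi; have v0 g x : 0 <= av g x := absval_ge0 (vP g) x.
have vpos g x : x != 0 -> 0 < av g x := @absval_gt0 _ _ _ (vP g) x.
have mX0 k : 0 < m ^+ k by rewrite exprn_gt0.
have mX1 k : 1 <= m ^+ k by rewrite exprn_ege1.
have /choice[xb1 P1] : forall q, exists xb : L * L, [/\ 𝔬 xb.1, xb.1 != 0, 𝔬 xb.2, xb.1 ^+ N0 = y1 ^+ q * xb.2 & forall g, av g xb.2 <= m ^+ N0].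
  by move=> q; have [x [b P]] := roots q O1 y10 dv1 N00; exists (x, b).
have /choice[xb2 P2] : forall q, exists xb : L * L, [/\ 𝔬 xb.1, xb.1 != 0, 𝔬 xb.2, xb.1 ^+ N0 = y2 ^+ q * xb.2 & forall g, av g xb.2 <= m ^+ N0].
  by move=> q; have [x [b P]] := roots q O2 y20 dv2 N00; exists (x, b).
have nz (x b : L) (n : nat) y : x != 0 -> x ^+ N0 = y ^+ n * b -> b != 0.
  by move=> x0'; apply: contra_eq_neq => ->; rewrite mulr0 expf_neq0.
have half (y y' b b' x x' : L) q : (q <= N0)%N -> y != 0 -> y' != 0 -> av g0 y <= 2 * av g0 y' ->
    𝔬 b' -> x != 0 -> x' != 0 -> x ^+ N0 = y ^+ q * b -> x' ^+ N0 = y' ^+ q * b' ->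
    (forall g, av g b <= m ^+ N0) -> (forall g, av g b' <= m ^+ N0) ->
    av g0 (x / x') <= 2 * m ^+ N.+1.
  move=> qN y0 y'0 yy' Ob' x0 x'0 Ex Ex' bm bm'.
  have b'0 : b' != 0 by exact: nz x'0 Ex'.
  have lo := av_lower g0 Ob' b'0 (mX1 N0) bm'.
  have B0 : 0 <= 2 * m ^+ N.+1 by rewrite mulr_ge0 // ltW.
  rewrite -(ler_pXn2r N00) ?nnegrE // -(absvalX (vP g0)) expr_div_n Ex Ex'.
  rewrite (absval_div (vP g0)) ler_pdivrMr; last by rewrite vpos // mulf_neq0 // expf_neq0.
  rewrite !(absvalM (vP g0)) !(absvalX (vP g0)).
  have H1 : av g0 y ^+ q <= 2 ^+ N0 * av g0 y' ^+ q.
    apply: le_trans (_ : (2 * av g0 y') ^+ q <= _).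
      by apply: lerXn2r yy'; rewrite nnegrE // mulr_ge0.
    by rewrite exprMn ler_wpM2r ?exprn_ge0 // ler_weXn2l // ler1n.
  have H2 : av g0 b <= (m ^+ N.+1) ^+ N0 * av g0 b'.
    apply: le_trans (bm g0) _; rewrite -exprM mulSn exprD -mulrA -[leLHS]mulr1.
    by rewrite ler_wpM2l ?(ltW (mX0 _)) // mulrC [(N * N0)%N]mulnC exprM.
  rewrite exprMn; have -> : 2 ^+ N0 * (m ^+ N.+1) ^+ N0 * (av g0 y' ^+ q * av g0 b') = (2 ^+ N0 * av g0 y' ^+ q) * ((m ^+ N.+1) ^+ N0 * av g0 b') by ring.
  by rewrite ler_pM // exprn_ge0.
pose M := (16 * mu ^ (2 * N + 2 + kappa))%N.
have M0 : (0 < M)%N by rewrite muln_gt0 expn_gt0 (leq_trans _ mu4).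
pose c q := (xb1 q).1 / (xb2 q).1.
have c0 q : c q != 0 by have [_ ? _ _ _] := P1 q; have [_ ? _ _ _] := P2 q; rewrite mulf_neq0 ?invr_eq0.
have cle q : (q <= Qn)%N -> av g0 (c q) <= 2 * m ^+ N.+1.
  move=> qQ; have [_ ? _ ? ?] := P1 q; have [_ ? ? ? ?] := P2 q.
  by apply: (half y1 y2 (xb1 q).2 (xb2 q).2 _ _ q) => //; apply: leq_trans QN.
have cge q : (q <= Qn)%N -> av g0 (c q)^-1 <= 2 * m ^+ N.+1.
  move=> qQ; have [_ ? ? ? ?] := P1 q; have [_ ? ? ? ?] := P2 q; rewrite invfM invrK mulrC.
  by apply: (half y2 y1 (xb2 q).2 (xb1 q).2 _ _ q) => //; apply: leq_trans QN.
have B0 : 0 < 2 * m ^+ N.+1 by rewrite mulr_gt0.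
have [q [q' [qq' q'Q close]]] := complex_pigeonhole M0 B0 cle.
have qQ : (q <= Qn)%N by apply: ltnW; apply: leq_trans q'Q.
have [Ox x0 Ob Ex bm] := P1 q; have [Oz z0 Oe Ez em] := P2 q.
have [Ox' x'0 Ob' Ex' bm'] := P1 q'; have [Oz' z'0 Oe' Ez' em'] := P2 q'.
exists (q' - q)%N, (c q' / c q), ((xb1 q').2 * (xb2 q).2), ((xb2 q').2 * (xb1 q).2).
split; first by split; rewrite ?subn_gt0 ?(leq_trans (leq_subr _ _)) // ?mulf_neq0 ?invr_eq0 //; apply: rintM.
split.
- by rewrite mulf_neq0 ?(nz _ _ _ _ z'0 Ez') ?(nz _ _ _ _ x0 Ex).
- have E1 : y1 ^+ q' = y1 ^+ (q' - q) * y1 ^+ q by rewrite -exprD subnK // ltnW.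
  have E2 : y2 ^+ q' = y2 ^+ (q' - q) * y2 ^+ q by rewrite -exprD subnK // ltnW.
  rewrite /c !expr_div_n Ex Ex' Ez Ez' E1 E2; field.
  by rewrite !expf_neq0 // ?(nz _ _ _ _ z'0 Ez') ?(nz _ _ _ _ x0 Ex) ?(nz _ _ _ _ z0 Ez).
- have -> : c q' / c q - 1 = (c q' - c q) * (c q)^-1 by rewrite mulrBl mulfV.
  have := cge _ qQ; rewrite (absvalM (vP g0)) -/(av g0 (c q' - c q)).
  have : av g0 (c q' - c q) * M%:R <= 4 * (2 * m ^+ N.+1) by rewrite /av !rmorphB.
  have -> : M%:R = 16 * (m ^+ N * m ^+ N * (m * m) * m ^+ kappa) :> R.
    rewrite /M natrM natrX; have -> : (2 * N + 2 + kappa = N + N + (1 + 1) + kappa)%N by ring.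
    by rewrite !exprD !expr1.
  rewrite exprSr => H1 H2; exact: (product_le1 (mX0 _) (mX0 _) m0 (v0 _ _) H1 H2).
- move=> g; rewrite (absvalM (vP g)) mulnC exprM expr2 ler_pM //.
- move=> g; rewrite (absvalM (vP g)) mulnC exprM expr2 ler_pM //.
Qed.

(** Siegel's lemma, with [4 e La] unknowns, gives a polynomial with terms [q p X^(i_ p)] that
    vanishes to order [T = 3 e La] at [1]. In [Gs a], essentially its [a]-th derivative at [c], each
    term is divided by [u^(l + 1)]; this changes it little at [g0], where [u] is close to [1], so
    [Gs a] is small there. Since [c^N0 = u^d B / W] and [N0 (l + 1) = d (i_ p) + k_ p], the [N0]-th
    power of a term is [u^(- k_ p) (B / W)^(i_ p)], of small height. Liouville's inequality is
    applied to the integer [V]. *)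
Lemma auxiliary_bound (y1 y2 : L) g0 (C1 Y : R) (d r s0 e La N0 kappa : nat) (c B W : L)
    (D := (r * (4 * La))%N) (A := (d * e + s0 * (4 * La))%N) :
  𝔬 y1 -> y1 != 0 -> 𝔬 y2 -> y2 != 0 -> 1 <= Y -> (forall g, av g y1 <= Y) -> (forall g, av g y2 <= Y) ->
  Y <= 2 * av g0 y1 -> av g0 (y1 - y2) <= C1 -> 2 * C1 <= Y ->
  N0 = (d * r + s0)%N -> (0 < N0)%N -> (0 < e)%N -> (16 * e <= r)%N -> (1 < La)%N ->
  c ^+ r != y1 / y2 -> c != 0 -> 𝔬 B -> 𝔬 W -> W != 0 ->
  c ^+ N0 * W * y2 ^+ d = y1 ^+ d * B -> av g0 (c - 1) * m ^+ kappa <= 1 ->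
  (forall g, av g B <= m ^+ (2 * N0)) -> (forall g, av g W <= m ^+ (2 * N0)) ->
  1 <= Y ^+ (A * N.+1) * (m ^+ (9 * N.+1 * D) * ((m ^+ (kappa * (e * La)))^-1 + 2 * C1 / Y)) ^+ N0.
Proof.
move=> O1 y10 O2 y20 Y1 Yy1 Yy2 Yg C1P C1Y N0E N00 e0 er La1 cr c0 OB OW W0 cE c1 Bm Wm.
have m0 := mu_gt0; have m1 := mu_ge1.
have vP := avP phi; have v0 g x : 0 <= av g x := absval_ge0 (vP g) x.
have vpos g x : x != 0 -> 0 < av g x := @absval_gt0 _ _ _ (vP g) x.
have mX0 k : 0 < m ^+ k by rewrite exprn_gt0.
have mX1 k : 1 <= m ^+ k by rewrite exprn_ege1.
have r0 : (0 < r)%N by move: e0 er; clear; lia.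
have er' : (e <= r)%N by move: e0 er; clear; lia.
pose J := ('I_(4 * La) * 'I_e)%type.
pose i_ (p : J) := (r * p.1.+1 - p.2)%N.
have i_D p : (i_ p <= D)%N.
  by apply: leq_trans (leq_subr _ _) _; rewrite leq_mul2l ltn_ord orbT.
pose T := (3 * (e * La))%N.
have cJ : #|{: J}| = (4 * La * e)%N by rewrite card_prod !card_ord.
have J0 : (0 < #|{: J}|)%N by rewrite cJ !muln_gt0 e0 andbT /=; move: La1; clear; lia.
have [q [[p0 q0] qle qT]] := @siegel 'I_T J (fun a p => ('C(i_ p, a))%:Z) (2 ^ D)%N J0
  ltac:(by rewrite expn_gt0) ltac:(by rewrite card_ord cJ /T; clear; lia)
  ltac:(by move=> a p; rewrite absz_nat (leq_trans (bin_le_exp2 _ _)) // leq_pexp2l).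
have {}qT a : (a < T)%N -> \sum_p q p * ('C(i_ p, a))%:Z = 0.
  move=> aT; rewrite -[RHS](qT (Ordinal aT)); apply: eq_bigr => p _; exact: mulrC.
pose u := y1 / y2; have u0 : u != 0 by rewrite mulf_neq0 ?invr_eq0.
pose t (p : J) := c ^+ i_ p / u ^+ p.1.+1.
pose Gs a := \sum_p (q p * ('C(i_ p, a))%:Z)%:~R * t p.
(* Together with [T = 3 e La], the order [e La + 2 e + 1] would exceed by one the bound
   [4 e La + 2 e] of the zero estimate. *)
have [a aT Ga] : exists2 a, (a < e * La + 2 * e + 1)%N & Gs a != 0.
  apply: contrapT => nex; pose f : {rmorphism L -> R[i]} := phi \o g0.
  have := @zero_estimate _ r (4 * La) e T (e * La + 2 * e + 1) (fun l j => (q (l, j))%:~R) (f u) (f c) r0 er'.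
  rewrite !fmorph_eq0 -rmorphXn /= -/u in cr *; move=> /(_ u0 c0).
  rewrite (inj_eq (fmorph_inj f)) => /(_ cr) H; have : (T + (e * La + 2 * e + 1) <= e * (4 * La) + 2 * e)%N.
    apply: H.
    - by exists p0.1, p0.2; rewrite intr_eq0 -surjective_pairing.
    - move=> a aT; have E0 : (\sum_p q p * ('C(i_ p, a))%:Z)%:~R = 0 :> R[i] by rewrite qT.
      rewrite pair_bigA -[RHS]E0 rmorph_sum; apply: eq_bigr => -[l j] _; by rewrite /= intrM.
    - move=> a aT; have G0 : f (Gs a) = 0.
        by apply/eqP; rewrite fmorph_eq0; apply: contrapT => /negP ne; apply: nex; exists a.
      rewrite pair_bigA -[RHS]G0 rmorph_sum; apply: eq_bigr => -[l j] _.
      have fz (z : int) x : f (z%:~R * x) = z%:~R * f x by rewrite !mulrzl; exact: raddfMz.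
      by rewrite fz intrM; congr (_ * _); rewrite /t (fmorph_exp_div f).
  by rewrite /T; clear; nia.
(* A common denominator for the [N0]-th powers of all [t p]. *)
pose w := y1 ^+ A * W ^+ D.
pose k_ (p : J) := (d * p.2 + s0 * p.1.+1)%N.
have kA p : (k_ p <= A)%N by apply: leq_add; rewrite leq_mul2l ?ltn_ord ?orbT // ltnW ?ltn_ord ?orbT.
have tw p : t p ^+ N0 * w = y1 ^+ (A - k_ p) * y2 ^+ k_ p * (W ^+ (D - i_ p) * B ^+ i_ p).
  have pr : (p.2 <= r * p.1.+1)%N by have := ltn_ord p.2; move: er'; clear; nia.
  have EN : (p.1.+1 * N0 = d * i_ p + k_ p)%N.
    by rewrite N0E /k_ addnA -mulnDr /i_ subnK // mulnDr; ring.
  have EcN : c ^+ N0 = u ^+ d * (B / W).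
    rewrite /u expr_div_n; apply: (mulIf W0); apply: (mulIf (expf_neq0 d y20)); rewrite cE.
    by field; rewrite W0 expf_neq0.
  have Et : t p ^+ N0 * (y1 ^+ k_ p * W ^+ i_ p) = y2 ^+ k_ p * B ^+ i_ p.
    rewrite /t expr_div_n -exprM [(i_ p * _)%N]mulnC exprM EcN exprMn -!exprM EN exprD /u !expr_div_n.
    by field; rewrite ?expf_neq0 ?W0 //.
  have -> : w = y1 ^+ (A - k_ p) * y1 ^+ k_ p * (W ^+ (D - i_ p) * W ^+ i_ p) by rewrite -!exprD !subnK.
  have -> : t p ^+ N0 * (y1 ^+ (A - k_ p) * y1 ^+ k_ p * (W ^+ (D - i_ p) * W ^+ i_ p)) = y1 ^+ (A - k_ p) * W ^+ (D - i_ p) * (t p ^+ N0 * (y1 ^+ k_ p * W ^+ i_ p)) by ring.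
  by rewrite Et; ring.
pose V := Gs a ^+ N0 * w.
have w0 : w != 0 by rewrite mulf_neq0 // expf_neq0.
have V0 : V != 0 by rewrite mulf_neq0 // expf_neq0.
have OV : 𝔬 V.
  by apply: rint_pow_comb => // p; rewrite tw; do ![apply: rintM | apply: rintX].
pose S := \sum_p (`|q p * ('C(i_ p, a))%:Z|%:~R : R).
have S0 : 0 <= S by apply: sumr_ge0 => p _; rewrite ler0z.
have De : (4 * La * e <= D)%N by rewrite /D mulnC leq_mul2r er' orbT.
have D0 : (0 < D)%N by apply: leq_trans De; rewrite -cJ.
have Sle : S <= m ^+ (6 * D).
  apply: le_trans (_ : (2 ^ (11 * D))%N%:R <= _); last first.
    rewrite -natrX ler_nat; apply: leq_trans (_ : 4 ^ (6 * D) <= _)%N; last by rewrite leq_exp2r // muln_gt0.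
    by rewrite -[4%N]/(2 ^ 2)%N -expnM leq_pexp2l //; clear; lia.
  apply: le_trans (_ : \sum_(p : J) (2 ^ (10 * D))%N%:R <= _).
    apply: ler_sum => p _; rewrite -[leRHS]/(((2 ^ (10 * D))%N : int)%:~R) ler_int -abszE lez_nat abszM absz_nat.
    have -> : (10 * D = 9 * D + D)%N by ring.
    rewrite expnD leq_mul //; last by apply: leq_trans (bin_le_exp2 _ _) _; rewrite leq_pexp2l.
    apply: leq_trans (qle p) _; have -> : (9 * D = (3 * D) * 3)%N by ring.
    rewrite [X in (_ <= X)%N]expnM leq_exp2r //.
    have -> : (3 * D = D + D + D)%N by ring.
    rewrite !expnD leq_mul // cJ; apply: leq_mul; first by case: (D) D0 => // D' _; rewrite expnS leq_pmulr // expn_gt0.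
    exact: leq_trans De (ltnW (ltn_expl _ _)).
  rewrite sumr_const cJ; have -> : (2 ^ (10 * D))%N%:R *+ (4 * La * e) = (2 ^ (10 * D) * (4 * La * e))%N%:R :> R by rewrite natrM mulr_natr.
  rewrite ler_nat; have -> : (11 * D = D + 10 * D)%N by ring.
  rewrite expnD mulnC leq_mul2r; apply/orP; right.
  exact: leq_trans De (ltnW (ltn_expl _ _)).
set X0 := Y ^+ A * m ^+ (2 * N0 * D).
have YA0 : 0 < Y by apply: lt_le_trans Y1.
have X01 : 1 <= X0 by rewrite mulr_ege1 // ?exprn_ege1.
have mix (y y' b b' : L) (k i : nat) g : (k <= A)%N -> (i <= D)%N -> av g y <= Y -> av g y' <= Y ->
    av g b <= m ^+ (2 * N0) -> av g b' <= m ^+ (2 * N0) ->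
    av g (y ^+ (A - k) * y' ^+ k * (b ^+ (D - i) * b' ^+ i)) <= X0.
  move=> kA' iD hy hy' hb hb'; rewrite !(absvalM (vP g)) !(absvalX (vP g)) /X0 exprM.
  by apply: ler_mix; rewrite ?v0.
have Vg g : av g V <= (m ^+ (6 * D)) ^+ N0 * X0.
  rewrite /V (absvalM (vP g)) (absvalX (vP g)).
  apply: le_trans (absval_intr_comb (vP g) (fun p => q p * ('C(i_ p, a))%:Z) N00 (X := X0) _) _ => [p|].
    by rewrite -(absvalX (vP g)) -(absvalM (vP g)) tw; apply: mix.
  by rewrite ler_wpM2r ?(le_trans _ X01) //; apply: lerXn2r Sle; rewrite nnegrE // ltW.
have B1 : 1 <= (m ^+ (6 * D)) ^+ N0 * X0 by rewrite mulr_ege1 // exprn_ege1.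
have low := av_lower g0 OV V0 B1 Vg.
(* The first term is the error due to [c], as [T - a] is at least [e La]; the second is the error
   due to [u]. *)
set th := (m ^+ (kappa * (e * La)))^-1 + 2 * C1 / Y.
have C10 : 0 <= C1 by apply: le_trans C1P; apply: v0.
have th0 : 0 <= th by rewrite addr_ge0 ?invr_ge0 ?(ltW (mX0 _)) // divr_ge0 ?mulr_ge0 // ltW.
have Gle : av g0 (Gs a) <= m ^+ (6 * D) * m ^+ D * th.
  have eps1 : (m ^+ kappa)^-1 <= 1 by rewrite invf_le1.
  have ceps : av g0 (c - 1) <= (m ^+ kappa)^-1 by rewrite -[leRHS]mul1r ler_pdivlMr.
  have c2 : av g0 c <= 2.
    have := absvalD (vP g0) (c - 1) 1; rewrite subrK (absval1 (vP g0)); move: ceps eps1; clear; lra.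
  have aD : (a <= D)%N.
    have : (16 * e * (4 * La) <= D)%N by rewrite leq_mul2r er orbT.
    by move: aT La1; clear; nia.
  have four : (4 : R) ^+ D <= m ^+ D by apply: lerXn2r; rewrite ?nnegrE ?ler0n ?ler_nat.
  have H1 := taylor_bound (vP g0) i_D aD qT ceps eps1 c2.
  pose eta := 2 * C1 / Y; have eta0 : 0 <= eta by rewrite divr_ge0 ?mulr_ge0 // ltW.
  have eta1 : eta <= 1 by rewrite ler_pdivrMr // mul1r.
  have uV : av g0 (u^-1 - 1) <= eta.
    have -> : u^-1 - 1 = (y2 - y1) / y1 by rewrite /u invf_div mulrBl mulfV.
    rewrite (absval_div (vP g0)) ler_pdivrMr ?vpos // -(absvalN (vP g0)) opprB.
    apply: le_trans C1P _; rewrite /eta mulrAC ler_pdivlMr //.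
    have -> : 2 * C1 * av g0 y1 = C1 * (2 * av g0 y1) by ring.
    by rewrite ler_wpM2l.
  have uVn' n : av g0 (u^-1 ^+ n - 1) <= (2 ^+ n - 1) * eta.
    elim: n => [|n IH]; first by rewrite expr0 !subrr (absval0 (vP g0)) mul0r.
    have -> : u^-1 ^+ n.+1 - 1 = (u^-1 ^+ n - 1) * (u^-1 - 1 + 1) + (u^-1 - 1) by rewrite subrK exprSr mulrBl mul1r addrA subrK.
    apply: le_trans (absvalD (vP g0) _ _) _; rewrite (absvalM (vP g0)) exprS.
    have u2 : av g0 (u^-1 - 1 + 1) <= 2.
      apply: le_trans (absvalD (vP g0) _ _) _; rewrite (absval1 (vP g0)).
      by move: uV eta1; clear; lra.
    have H : av g0 (u^-1 ^+ n - 1) * av g0 (u^-1 - 1 + 1) <= (2 ^+ n - 1) * eta * 2 by rewrite ler_pM.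
    by move: H uV; clear; lra.
  have uVn n : av g0 (u^-1 ^+ n - 1) <= 2 ^+ n * eta.
    by apply: le_trans (uVn' n) _; rewrite ler_wpM2r // gerBl.
  have Esplit : Gs a = \sum_p (q p * ('C(i_ p, a))%:Z)%:~R * c ^+ i_ p +
     \sum_p (q p * ('C(i_ p, a))%:Z)%:~R * (c ^+ i_ p * (u^-1 ^+ p.1.+1 - 1)).
    by rewrite -big_split /=; apply: eq_bigr => p _; rewrite /t exprVn; ring.
  have H2 : av g0 (\sum_p (q p * ('C(i_ p, a))%:Z)%:~R * (c ^+ i_ p * (u^-1 ^+ p.1.+1 - 1))) <= S * 4 ^+ D * eta.
    apply: le_trans (absval_sum (vP g0) _ _ _) _; rewrite -mulrA mulr_suml; apply: ler_sum => p _.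
    rewrite !(absvalM (vP g0)) (absvalX (vP g0)).
    apply: ler_pM; rewrite ?mulr_ge0 ?exprn_ge0 //; first exact: absval_int_le.
    have -> : (4 : R) ^+ D = 2 ^+ D * 2 ^+ D by rewrite -exprMn; congr (_ ^+ _); ring.
    rewrite -mulrA; apply: ler_pM; rewrite ?exprn_ge0 //.
      apply: le_trans (_ : 2 ^+ i_ p <= _); first by apply: lerXn2r c2; rewrite nnegrE.
      by rewrite ler_weXn2l // ler1n.
    apply: le_trans (uVn _) _; by rewrite ler_wpM2r // ler_weXn2l ?ler1n // (leq_trans (ltn_ord p.1)) // leq_pmull.
  rewrite Esplit; apply: le_trans (absvalD (vP g0) _ _) _; apply: le_trans (lerD H1 H2) _.
  rewrite -/S -mulrDr; apply: ler_pM => //; rewrite ?mulr_ge0 ?addr_ge0 ?exprn_ge0 ?invr_ge0 ?(ltW (mX0 _)) //.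
    by rewrite ler_pM // exprn_ge0.
  rewrite lerD2r exprVn -exprM lef_pV2 ?posrE // ler_weXn2l // leq_mul2l; apply/orP; right.
  by move: aT La1; rewrite /T; clear; nia.
have V0le : av g0 V <= (m ^+ (6 * D) * m ^+ D * th) ^+ N0 * X0.
  rewrite /V (absvalM (vP g0)) (absvalX (vP g0)); apply: ler_pM; rewrite ?exprn_ge0 //.
    by apply: lerXn2r Gle; rewrite nnegrE // !mulr_ge0 // ltW.
  have := @mix y1 y1 W W 0 0 g0; rewrite !subn0 !expr0 !mulr1; apply => //.
apply: le_trans low _; apply: le_trans (_ : ((m ^+ (6 * D) * m ^+ D * th) ^+ N0 * X0) * ((m ^+ (6 * D)) ^+ N0 * X0) ^+ N <= _).
  by rewrite ler_wpM2r // exprn_ge0 // (le_trans _ B1).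
rewrite /X0 collect_powers.
rewrite ler_wpM2l ?exprn_ge0 ?(ltW YA0) //; apply: lerXn2r; rewrite ?nnegrE ?mulr_ge0 ?(ltW (mX0 _)) //.
by rewrite ler_wpM2r // ler_weXn2l //; move: (D) (N) => D' N'; clear; nia.
Qed.

Lemma log_floor (x : R) : 1 <= x -> exists k : nat, m ^+ k <= x < m ^+ k.+1.
Proof.
move=> x1; have ex : exists n, x < m ^+ n.
  exists (Num.bound x); apply: lt_le_trans (archi_boundP (le_trans ler01 x1)) _.
  by rewrite -natrX ler_nat ltnW // ltn_expl // (leq_trans _ mu4).
case: (ex_minnP ex) => -[|h] lt minh; first by move: lt; rewrite expr0 ltNge x1.
by exists h; rewrite lt andbT leNgt; apply/negP => /minh; rewrite ltnn.
Qed.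

(** Let [m^h] be about [Y]. The orders of magnitude are [M^2] for [h], [N0 = Qn M], [N0 / d] for
    [r], [r / (16 N1)] for [e] and [h / (288 N1 r)] for [La]. With [D = 4 r La] and [p = m^(N1 D)],
    this places [Y] between [p^72] and [p^144] and keeps the exponent of [Y] in the auxiliary bound
    below [N0 / 8]; the choice [kappa = 28 * 128 * N1^2] brings the error due to [c] below [p^-28].
    The threshold for [Y] ensures [La >= 2]: as [r] is at most [Qn M], [h] has to exceed a multiple
    of [N1 Qn] times its own square root. *)
Lemma main_inequality (y1 y2 : L) n1 n2 g0 (C1 Y : R) (N1 := N.+1)
    (kappa := (3584 * N1 ^ 2)%N) (Qn := ((16 * mu ^ (2 * N + 2 + kappa)).+1 ^ 2)%N) :
  𝔬 y1 -> y1 != 0 -> principal_ideal y1 (s ^+ n1) ->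
  𝔬 y2 -> y2 != 0 -> principal_ideal y2 (s ^+ n2) -> y1 != y2 ->
  1 <= C1 -> (forall g, av g y1 <= Y) -> (forall g, av g y2 <= Y) ->
  Y <= 2 * av g0 y1 -> Y <= 2 * av g0 y2 -> av g0 (y1 - y2) <= C1 ->
  (4 * C1) ^+ 2 < Y -> Y < m ^+ ((1152 * N1 * Qn) ^ 2).
Proof.
move=> O1 y10 dv1 O2 y20 dv2 y12 C11 Yy1 Yy2 Yg1 Yg2 C1P C1Y.
rewrite ltNge; apply/negP => big.
have [CY Y1] : 2 * C1 <= Y /\ 1 <= Y.
  exact: square_lt_bounds.
have [h /andP[hY Yh]] := log_floor Y1.
have N10 : (0 < N1)%N by [].
have Q0 : (0 < Qn)%N by rewrite expn_gt0.
have hH : ((1152 * N1 * Qn) ^ 2 <= h)%N.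
  rewrite -ltnS ltnNge; apply/negP => le; have := lt_le_trans Yh (le_trans (ler_weXn2l mu_ge1 le) big).
  by rewrite ltxx.
have [M [hM M1]] : exists M, (h <= M ^ 2)%N /\ (M.-1 ^ 2 < h)%N.
  have ex : exists M, (h <= M ^ 2)%N by exists h; rewrite -mulnn; case: (h) => // h'; rewrite leq_pmulr.
  case: (ex_minnP ex) => M lM min; exists M; split=> //; rewrite ltnNge; apply/negP => /min.
  case: M lM {min} => [|M] /=; last by rewrite ltnn.
  by move=> le; have := leq_trans hH le; rewrite leqNgt expn_gt0 muln_gt0 Q0 muln_gt0 N10.
have [N0 N0E] : exists N0, N0 = (Qn * M)%N by exists (Qn * M)%N.
have M0 : (1 < M)%N.
  have : (1 < h)%N by apply: leq_trans hH; rewrite -mulnn; move: N10 Q0; clear; nia.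
  by move: hM M1; clear; nia.
have N00 : (0 < N0)%N by rewrite N0E muln_gt0 Q0 ltnW.
have QN0 : (Qn <= N0)%N by rewrite N0E leq_pmulr // ltnW.
have [d [c [B [W [[d0 dQ c0 OB OW] [W0 cE c1 Bm Wm]]]]]] :=
  close_units O1 y10 dv1 O2 y20 dv2 N00 QN0 (le_trans (Yy1 g0) Yg2) (le_trans (Yy2 g0) Yg1).
have u1 : y1 / y2 != 1.
  by apply: contraNneq y12 => E; rewrite -[y1](divfK y20) E mul1r.
have u0 : y1 / y2 != 0 by rewrite mulf_neq0 ?invr_eq0.
(* If the quotient of [N0] by [d] fails, its predecessor serves: equality for both would give
   [c = 1], hence [y1 = y2]. *)
have [r [cr drN Ndr]] : exists r, [/\ c ^+ r != y1 / y2, (d * r <= N0)%N & (N0 < d * r + 2 * d)%N].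
  have q1 : (d * (N0 %/ d) <= N0)%N by rewrite mulnC leq_divM.
  have q2 : (N0 < d * (N0 %/ d) + d)%N by rewrite mulnC -mulSnr ltn_ceil.
  have [cr|cr] := eqVneq (c ^+ (N0 %/ d)) (y1 / y2); last first.
    by exists (N0 %/ d)%N; split=> //; move: q2; clear; lia.
  have q0 : (0 < N0 %/ d)%N by rewrite divn_gt0 // (leq_trans dQ).
  exists (N0 %/ d).-1; split.
  - apply: contra u1 => /eqP E; move: cr; rewrite -(prednK q0) exprS E.
    move/(congr1 (fun x => x / (y1 / y2))); rewrite mulfK // mulfV // => c1E.
    by rewrite -E c1E expr1n.
  - by apply: leq_trans q1; rewrite leq_mul2l leq_pred orbT.
  - by rewrite -(prednK q0) mulnS in q2; move: q2; clear; lia.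
pose s0 := (N0 - d * r)%N.
have N0E2 : N0 = (d * r + s0)%N by rewrite subnKC.
have s02 : (s0 < 2 * d)%N by rewrite /s0; move: Ndr drN; clear; lia.
have Mr : (M <= r.+1)%N.
  have : (d * M < d * r.+2)%N.
    apply: leq_ltn_trans (_ : N0 < _)%N; last by rewrite !mulnS; move: Ndr; clear; lia.
    by rewrite N0E leq_mul2r dQ orbT.
  by rewrite ltn_pmul2l // ltnS.
have rN : (r <= N0)%N by apply: leq_trans drN; rewrite leq_pmull.
have Mbig : (1152 * N1 < M.+1)%N.
  rewrite ltnS -(@leq_exp2r _ _ 2) //; apply: leq_trans hM; apply: leq_trans hH.
  by rewrite leq_exp2r // leq_pmulr.
pose e := (r %/ (16 * N1))%N.
have er1 : (16 * N1 * e <= r)%N by rewrite mulnC leq_divM.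
have er2 : (r < 16 * N1 * e + 16 * N1)%N by rewrite [(16 * N1 * e)%N]mulnC -mulSnr ltn_ceil // muln_gt0.
have rbig : (1151 * N1 <= r)%N by move: Mbig Mr N10; clear; lia.
have e0 : (0 < e)%N by rewrite /e divn_gt0 ?muln_gt0 //; move: rbig N10; clear; lia.
have er3 : (r <= 32 * N1 * e)%N.
  by apply: leq_trans (ltnW er2) _; move: e0 N10; clear; move: (e) (N1) => e' n'; nia.
have r0 : (0 < r)%N by move: rbig N10; clear; lia.
pose La := (h %/ (288 * N1 * r))%N.
have P0 : (0 < 288 * N1 * r)%N by rewrite !muln_gt0 N10 r0.
have La1 : (La * (288 * N1 * r) <= h)%N by exact: leq_divM.
have La2 : (h < La * (288 * N1 * r) + 288 * N1 * r)%N by rewrite -mulSnr ltn_ceil.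
have La0 : (1 < La)%N.
  rewrite leq_divRL //; apply: leq_trans (_ : 1152 * N1 * Qn * M.-1 <= _)%N.
    have : (r <= Qn * M)%N by rewrite -N0E.
    move: M0; clear; move: (N1) (Qn) => n q; case: M => // M; rewrite /= => M0 le.
    by apply: leq_trans (_ : 2 * (288 * n * (q * M.+1)) <= _)%N; [rewrite leq_mul2l leq_mul2l le orbT | nia].
  move: hH M1; clear; set a := (1152 * _ * _)%N; rewrite -!mulnn => h1 h2; nia.
pose D := (r * (4 * La))%N; pose A := (d * e + s0 * (4 * La))%N.
have D72 : (72 * N1 * D <= h)%N by apply: leq_trans La1; rewrite /D; clear; move: (La) (N1) => a b; lia.
have D144 : (h.+1 <= 144 * N1 * D)%N.
  apply: leq_trans La2 _; rewrite /D; move: La0; clear; move: (La) (N1) => a b; nia.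
have er16 : (16 * e <= r)%N by apply: leq_trans er1; rewrite mulnAC leq_pmulr.
have AN : (8 * (A * N1) <= N0)%N.
  have h1 : (16 * N1 * (d * e) <= N0)%N.
    by apply: leq_trans drN; rewrite mulnCA leq_mul2l er1 orbT.
  have h2 : (128 * N1 * (d * La) <= N0)%N.
    rewrite -(@leq_pmul2l r) //.
    have t1 : (d * (La * (288 * N1 * r)) <= d * (M * M))%N by rewrite leq_mul2l mulnn (leq_trans La1) // orbT.
    have t2 : (d * (M * M) <= N0 * M)%N by rewrite mulnA leq_mul2r N0E leq_mul2r dQ !orbT.
    have t3 : (N0 * M <= N0 * (2 * r))%N by rewrite leq_mul2l; apply/orP; right; move: Mr r0; clear; lia.
    move: t1 t2 t3; clear; move: (La) (N1) => a b; nia.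
  have h3 : (s0 * (4 * La) * N1 <= 2 * d * (4 * La) * N1)%N by rewrite !leq_mul2r (ltnW s02) !orbT.
  rewrite /A mulnDl; move: h1 h2 h3; clear; move: (La) (N1) (e) => a b e'; nia.
have aux := @auxiliary_bound y1 y2 g0 C1 Y d r s0 e La N0 kappa c B W O1 y10 O2 y20 Y1 Yy1 Yy2 Yg1 C1P CY N0E2 N00 e0 er16 La0 cr c0 OB OW W0 cE c1 Bm Wm.
rewrite -/D -/A -/N1 in aux.
have kap : (28 * N1 * D <= kappa * (e * La))%N.
  rewrite /D /kappa -mulnn; move: er3; clear; move: (La) (N1) (e) => a b e' H.
  apply: leq_trans (_ : 28 * b * (32 * b * e' * (4 * a)) <= _)%N; last by nia.
  by rewrite leq_mul2l leq_mul2r H !orbT.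
have D0 : (0 < N1 * D)%N by rewrite !muln_gt0 N10 r0 /= ltnW.
set p := m ^+ (N1 * D).
have m1 := mu_ge1; have m0 := mu_gt0.
have p4 : 4 <= p.
  apply: le_trans (_ : m ^+ 1 <= _); first by rewrite expr1 ler_nat.
  by rewrite ler_weXn2l.
have mp k : m ^+ (k * N1 * D) = p ^+ k by rewrite -mulnA mulnC exprM.
have YA0 : 0 < Y by apply: lt_le_trans Y1.
apply: (@no_large_value R p Y C1) => //.
- by rewrite -mp; apply: le_trans hY; rewrite ler_weXn2l.
- by rewrite -mp; apply: le_trans (ltW Yh) _; rewrite ler_weXn2l.
set X' := p ^+ 9 * _; set X := m ^+ (9 * N1 * D) * _ in aux.
have X0 : 0 <= X.
  rewrite /X mulr_ge0 ?exprn_ge0 ?(ltW m0) // addr_ge0 ?invr_ge0 ?exprn_ge0 ?(ltW m0) // divr_ge0 ?(ltW YA0) // mulr_ge0 //.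
  exact: le_trans C11.
have XX' : X <= X'.
  rewrite /X /X' mp ler_wpM2l ?exprn_ge0 ?(le_trans _ p4) // lerD2r -mp lef_pV2 ?posrE ?exprn_gt0 //.
  by rewrite ler_weXn2l.
apply: le_trans (_ : Y * X ^+ 8 <= _); last first.
  by rewrite ler_wpM2l ?(ltW YA0) //; apply: lerXn2r (XX'); rewrite nnegrE // (le_trans X0 XX').
exact: (ge1_root N00 AN).
Qed.

End MainInequality.

(** * Splitting fields and bounded bases *)

Lemma splitting_field_exists (p : {poly rat}) : p \is monic ->
  exists (L : splittingFieldType rat) (f : {rmorphism L -> algC}) (rs : seq L),
  [/\ galois 1 {:L}, <<1 & rs>>%VS = fullv
    & map_poly (in_alg L) p = \prod_(r <- rs) ('X - r%:P)].
Proof.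
move=> mp; have [zs Ezs] := closed_field_poly_normal (map_poly ratr p : {poly algC}).
rewrite lead_coef_map (monicP mp) rmorph1 scale1r in Ezs.
have [L [f [rs Ers gen]]] := num_field_exists zs.
have Ep : map_poly (in_alg L) p = \prod_(r <- rs) ('X - r%:P).
  apply: (map_poly_inj f); rewrite -map_poly_comp rmorph_prod /=.
  have -> : map_poly (f \o in_alg L) p = map_poly ratr p.
    by apply: eq_map_poly => c /=; rewrite rmorphZ_num rmorph1 mulr1.
  rewrite Ezs -Ers big_map; apply: eq_bigr => r _.
  by rewrite rmorphB /= map_polyX map_polyC.
have pol : map_poly (in_alg L) p \is a polyOver 1%VS by apply/polyOver1P; exists p.
have split : splittingFieldFor 1 (map_poly (in_alg L) p) {:L}.
  by exists rs; rewrite // Ep eqpxx.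
have Lax : FieldExt_isSplittingField _ L by constructor; exists (map_poly (in_alg L) p).
pose L' : splittingFieldType rat := HB.pack_for (splittingFieldType rat) L Lax.
exists L', f, rs; split=> //.
rewrite /galois sub1v normalFieldf andbT /=.
apply/separableP => x _; apply: pcharf0_separable; by move=> q; rewrite pchar_lalg pchar_num.
Qed.

Lemma free_subset (F : fieldType) (V : vectType F) (S : seq V) :
  exists T : seq V, [/\ {subset T <= S}, free T & <<T>>%VS = <<S>>%VS].
Proof.
elim: S => [|x S [T [TS fT ET]]]; first by exists [::]; rewrite nil_free.
have [xT|xT] := boolP (x \in <<T>>%VS).
  exists T; split=> //; first by move=> y /TS yS; rewrite inE yS orbT.
  by rewrite span_cons -ET; symmetry; apply/addv_idPr; rewrite -memvE.
exists (x :: T); split; last by rewrite !span_cons ET.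
  by move=> y; rewrite !inE => /orP[->//|/TS->]; rewrite orbT.
by rewrite free_cons xT.
Qed.

Section BoundedBasis.
Variables (R : realType) (L : splittingFieldType rat).
Hypothesis galL : galois 1 {:L}.
Variable phi : {rmorphism L -> R[i]}.
Local Notation "'𝔬'" := (@ring_of_integers L).
Local Notation G := (gal_of {:L}).
Local Notation av := (av phi).

Lemma gal_orbit (z r : L) :
  (forall q : {poly rat}, root (map_poly (in_alg L) q) z -> root (map_poly (in_alg L) q) r) ->
  exists h : G, r = h z.
Proof.
move=> H; pose P := \prod_(h : G) ('X - (h z)%:P).
have [q Eq] : exists q : {poly rat}, P = map_poly (in_alg L) q.
  apply/polyOver1P/polyOverP => i; have /galois_fixedField <- := galL.
  apply/fixedFieldP; first exact: memvf.
  move=> g _; have E : map_poly g P = P.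
    rewrite /P rmorph_prod [RHS](reindex_inj (mulIg g)) /=; apply: eq_bigr => h _.
    by rewrite rmorphB /= map_polyX map_polyC /= galM ?memvf.
  by rewrite -[LHS]/(g _) -coef_map E.
have /H : root (map_poly (in_alg L) q) z.
  by rewrite -Eq /P (bigD1 1%g) //= gal_id rootM root_XsubC eqxx.
by rewrite -Eq rootE horner_prod prodf_seq_eq0 => /hasP[h _] /=; rewrite hornerXsubC subr_eq0 => /eqP; exists h.
Qed.

(** [S] consists of the monomials in the generators with all exponents below [d]. *)
Lemma monomial_span (rs : seq L) (d : nat) (X : R) : 1 <= X -> (0 < d)%N ->
  (forall r, r \in rs -> [/\ 𝔬 r, (adjoin_degree 1 r <= d)%N & forall g, av g r <= X]) ->
  exists S : seq L, [/\ (size S <= d ^ size rs)%N, (<<1 & rs>> <= <<S>>)%VS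
    & forall z, z \in S -> 𝔬 z /\ forall g, av g z <= X ^+ (d * size rs)].
Proof.
move=> X1 d0; elim/last_ind: rs => [|rs x IH] H.
  exists [:: 1]; split; rewrite ?adjoin_nil ?span_seq1 ?subfield_closed ?subvv //.
  move=> z; rewrite inE => /eqP ->; split; first exact: rint1.
  by move=> g; rewrite (absval1 (avP phi g)) muln0.
have [|S [sS spS PS]] := IH; first by move=> r rr; apply: H; rewrite mem_rcons inE rr orbT.
have [Ox dx xX] := H x ltac:(by rewrite mem_rcons inE eqxx).
pose S' := [seq z * x ^+ i | z <- S, i <- iota 0 d]; exists S'; split.
- by rewrite size_allpairs size_iota size_rcons expnSr leq_mul2r sS orbT.
- rewrite adjoin_rcons; apply/subvP => v /Fadjoin_poly_eq <-.
  rewrite horner_coef; apply: memv_suml => i _.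
  have ci : (Fadjoin_poly <<1 & rs>>%AS x v)`_i \in <<S>>%VS.
    by apply: (subvP spS); apply: (polyOverP (Fadjoin_polyOver _ _ _)).
  have id : (i < d)%N.
    apply: leq_trans (ltn_ord i) _; apply: leq_trans (size_Fadjoin_poly _ _ _) _.
    apply: leq_trans dx; rewrite -ltnS -!size_minPoly.
    apply: dvdp_leq; first exact/monic_neq0/monic_minPoly.
    by apply: minPolyS; apply: sub1v.
  suff /subvP/(_ _ ci) : (<<S>> <= amulr (x ^+ i) @^-1: <<S'>>)%VS.
    by rewrite -memv_preim lfunE.
  apply/span_subvP => z zS; rewrite -memv_preim lfunE /=; apply: memv_span.
  by apply/allpairsP; exists (z, val i); split; rewrite // mem_iota.
- move=> z /allpairsP[[y i] /= [/PS[Oy yX] + ->]]; rewrite mem_iota /= => id; split.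
    by apply: rintM => //; apply: rintX.
  move=> g; have vP := avP phi g; rewrite (absvalM vP) (absvalX vP) size_rcons mulnS addnC exprD.
  apply: ler_pM; rewrite ?exprn_ge0 ?(absval_ge0 vP) //.
  apply: le_trans (_ : X ^+ i <= _); last by rewrite ler_weXn2l // ltnW.
  by apply: lerXn2r (xX g); rewrite nnegrE ?(absval_ge0 vP) // (le_trans ler01).
Qed.

Lemma bounded_basis (rs : seq L) (d : nat) (X : R) : 1 <= X -> (0 < d)%N ->
  <<1 & rs>>%VS = fullv ->
  (forall r, r \in rs -> [/\ 𝔬 r, (adjoin_degree 1 r <= d)%N & forall g, av g r <= X]) ->
  (\dim {:L} <= d ^ size rs)%N /\
  exists e : 'I_(\dim {:L}) -> L, [/\ forall i, 𝔬 (e i),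
    forall c : 'I_(\dim {:L}) -> rat, \sum_i c i *: e i = 0 -> forall i, c i = 0
    & forall i g, av g (e i) <= X ^+ (d * size rs)].
Proof.
move=> X1 d0 gen H; have [S [sS spS PS]] := monomial_span X1 d0 H.
have spf : <<S>>%VS = fullv by apply/eqP; rewrite eqEsubv subvf -gen spS.
split; first by rewrite -spf; apply: leq_trans (dim_span S) sS.
have [T [TS fT ET]] := free_subset S.
have sT : size T == \dim {:L} by rewrite -spf -ET (eqnP fT).
have PT i : (i < \dim {:L})%N -> T`_i \in S by move=> iN; apply/TS/mem_nth; rewrite (eqP sT).
exists (fun i => T`_i); split.
- by move=> i; have [] := PS _ (PT _ (ltn_ord i)).
- by move=> c; apply/(@freeP _ _ _ (Tuple sT)).
- by move=> i g; have [_] := PS _ (PT _ (ltn_ord i)); apply.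
Qed.

End BoundedBasis.

(** * Bounded data and a Galois model *)

(** One number bounds degree and coefficients. Multiplying by a power of [X] raises the degree, so
    prescribing it exactly leaves the property monotone in [b] and lets a search run over [b]
    coefficients. *)
Definition annihilated (K : fieldExtType rat) (x : K) (b : nat) :=
  exists r : {poly int}, [/\ r \is monic, size r = b.+1,
    forall i, (absz (r`_i)%R <= b.+1)%N & root (map_poly intr r) x].

Definition bounded_data (K : fieldExtType rat) (f : {poly K}) (b : nat) :=
  [/\ (\dim {:K} <= b)%N, (size f <= b)%N,
    exists s : K, <<1; s>>%VS = fullv /\ annihilated s b & forall i, annihilated f`_i b].

Lemma annihilated_rint (K : fieldExtType rat) (x : K) b : annihilated x b -> ring_of_integers x.
Proof. by move=> [r [mr _ _ rx]]; exists r. Qed.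

Lemma annihilated_le (R : realType) (K : fieldExtType rat) (F : fieldType) (io : {rmorphism K -> F})
  (v : F -> R) x b : absval v -> annihilated x b -> v (io x) <= b.+2%:R.
Proof.
move=> vP [r [mr _ rb rx]]; rewrite -[b.+2]/(1 + b.+1)%N natrD.
apply: (@absval_root_le _ _ _ vP (map_poly intr r)); first exact: monic_map.
  by move: rx; rewrite -(fmorph_root io) -map_poly_comp; congr root; apply: eq_map_poly => c /=; rewrite rmorph_int.
move=> i; rewrite coef_map; apply: le_trans (absval_int_le vP _) _.
by rewrite -[b.+1%:R]/((b.+1%:Z)%:~R) ler_int -abszE lez_nat.
Qed.

(** Cauchy's bound for the monicized polynomial. *)
Lemma lead_root_le (R : realType) (F : fieldType) (v : F -> R) (f : {poly F}) (x : F) (B : R) :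
  absval v -> f != 0 -> 1 <= B -> (forall i, v f`_i <= B) -> root f x ->
  v (lead_coef f * x) <= 1 + B ^+ (size f).-1.
Proof.
move=> vP f0 B1 fB rx; have s1 := root_size_gt1 f0 rx; have B0 : 0 <= B by apply: le_trans B1.
have [->|a0] := eqVneq (lead_coef f * x) 0.
  by rewrite (absval0 vP) addr_ge0 // exprn_ge0.
pose F1 := \poly_(i < size f) (if i == (size f).-1 then 1 else f`_i * lead_coef f ^+ ((size f).-2 - i)).
have szF1 : size F1 = size f by apply: size_poly_eq; rewrite eqxx oner_neq0.
apply: (@absval_root_le _ _ _ vP F1).
- by rewrite monicE lead_coefE szF1 coef_poly eqxx prednK ?leqnn // ltnW.
- rewrite rootE; suff -> : F1.[lead_coef f * x] = lead_coef f ^+ (size f).-2 * f.[x] by rewrite (rootP rx) mulr0.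
  rewrite /F1; move sf: (size f) s1 => n; case: n sf => [|[|n]] // sf _ /=.
  rewrite horner_poly horner_coef sf mulr_sumr; apply: eq_bigr => i _.
  case: eqP => [->|/eqP ni]; first by rewrite mul1r exprMn lead_coefE sf /= exprSr; ring.
  have le : (i <= n)%N by have := ltn_ord i; rewrite ltnS leq_eqVlt (negPf ni).
  have -> : lead_coef f ^+ n = lead_coef f ^+ (n - i) * lead_coef f ^+ i by rewrite -exprD subnK.
  by rewrite exprMn; ring.
move=> i; rewrite coef_poly; case: ifP => [lt|_]; last by rewrite (absval0 vP) exprn_ge0.
case: ifP => [_|ni]; first by rewrite (absval1 vP) exprn_ege1.
rewrite (absvalM vP) (absvalX vP); apply: le_trans (_ : B ^+ ((size f).-2 - i).+1 <= _); last first.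
  by rewrite ler_weXn2l //; move: s1 lt (negbT ni); clear; lia.
rewrite exprS; apply: ler_pM; rewrite ?exprn_ge0 ?(absval_ge0 vP) //.
by apply: lerXn2r; rewrite ?nnegrE ?(absval_ge0 vP) // lead_coefE fB.
Qed.

Lemma adjoin_degree_le (L : fieldExtType rat) (z : L) (q : {poly rat}) :
  q \is monic -> root (map_poly (in_alg L) q) z -> (adjoin_degree 1 z <= (size q).-1)%N.
Proof.
move=> mq rz; rewrite -ltnS -size_minPoly prednK ?size_poly_gt0 ?monic_neq0 //.
rewrite -(size_map_poly (in_alg L)); apply: dvdp_leq; first by rewrite map_poly_eq0 monic_neq0.
by apply: minPoly_dvdp => //; apply/polyOver1P; exists q.
Qed.

Lemma dim_adjoin1 (L : fieldExtType rat) (z : L) : \dim <<1; z>> = adjoin_degree 1 z.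
Proof. by rewrite dim_Fadjoin dimv1 muln1. Qed.

(** The tower law, for the extension of [io K], generated by [io t], by [z]. *)
Lemma compositum_degree (K L : fieldExtType rat) (io : {rmorphism K -> L}) (f : {poly K}) (z : L) :
  f \is monic -> root (map_poly io f) z -> (adjoin_degree 1 z <= (size f).-1 * \dim {:K})%N.
Proof.
move=> mf rz; have [t gt] := primitive_exists K.
have ioE (p : {poly rat}) : io (map_poly (in_alg K) p).[t] = (map_poly (in_alg L) p).[io t].
  rewrite -horner_map -map_poly_comp; congr _.[_].
  by apply: eq_map_poly => c /=; rewrite fmorph_numZ rmorph1.
have ioK x : io x \in <<1; io t>>%VS.
  have [p ->] := primitive_polyP gt x; rewrite ioE; apply/Fadjoin1_polyP; by exists p.
have [p [Ep mp rp]] := minPoly_ratP t.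
have dt : (\dim <<1; io t>> <= \dim {:K})%N.
  rewrite dim_adjoin1 -gt dim_adjoin1.
  have -> : adjoin_degree 1 t = (size p).-1 by rewrite -(size_map_poly (in_alg K)) -Ep size_minPoly.
  apply: adjoin_degree_le => //; rewrite rootE -ioE.
  have : root (map_poly (in_alg K) p) t by rewrite rp dvdpp.
  by move/rootP => ->; rewrite rmorph0.
rewrite -dim_adjoin1; apply: leq_trans (_ : \dim <<<<1; io t>>; z>> <= _)%N.
  by apply: dimvS; apply: adjoinSl; apply: sub1v.
rewrite dim_Fadjoin leq_mul // -ltnS -size_minPoly prednK ?size_poly_gt0 ?monic_neq0 //.
rewrite -(size_map_poly io); apply: dvdp_leq; first by rewrite map_poly_eq0 monic_neq0.
apply: minPoly_dvdp => //; apply/polyOverP => i; rewrite coef_map; exact: ioK.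
Qed.

Section Model.
Variables (R : realType) (K : fieldExtType rat) (f : {poly K}) (b : nat).
Hypothesis bf : bounded_data f b.

(** [L] is the splitting field of the product of the minimal polynomials of three integers: a
    generator [s] of [K], and the products of two roots of [f] by the leading coefficient. Each has
    degree at most [b^2] and conjugates at most [(b + 2)^b], so [L] is generated by at most [3 b^2]
    integers satisfying the same bounds. *)
Lemma galois_model : f != 0 -> at_least_n_distinct_roots 3 f ->
  exists (L : splittingFieldType rat) (phi : {rmorphism L -> R[i]}) (io : {rmorphism K -> L}) (x1 x2 : L),
  galois 1 {:L} /\
  [/\ x1 != x2, root (map_poly io f) x1, root (map_poly io f) x2,
    (\dim {:L} <= (b ^ 2) ^ (3 * b ^ 2))%N &
   exists e : 'I_(\dim {:L}) -> L, [/\ forall i, ring_of_integers (e i),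
    forall c : 'I_(\dim {:L}) -> rat, \sum_i c i *: e i = 0 -> forall i, c i = 0
    & forall i g, av phi g (e i) <= (b.+2%:R ^+ b) ^+ (b ^ 2 * (3 * b ^ 2))]].
Proof.
have [Kb fb [s [gs sb]] cb] := bf.
have b0 : (0 < b)%N by apply: leq_trans Kb; rewrite adim_gt0.
have Of : integral_coefs f by move=> i; apply: annihilated_rint (cb i).
move=> f0 [M [th [uth sth rth]]].
case: th uth sth rth => [|th1 [|th2 th]] //= /andP[th12 _] _ /andP[r1 /andP[r2 _]].
have {th12} th12 : th1 != th2 by apply: contraNneq th12 => ->; rewrite mem_head.
have [g _] := embedding_exists (baseFieldType M) algC.
pose gM : {rmorphism M -> algC} := g.
pose ka : {rmorphism K -> algC} := gM \o in_alg M.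
have toC (M' : fieldExtType rat) (h : {rmorphism M' -> algC}) (c : rat) : h c%:A = ratr c.
  by rewrite rmorphZ_num rmorph1 mulr1.
have kaq := toC K ka.
pose a := lead_coef f.
pose zs := [:: ka s; ka a * gM th1; ka a * gM th2].
pose pz z := sval (minCpolyP z).
have pzm z : pz z \is monic by rewrite /pz; case: minCpolyP => q [].
have pzr z (q : {poly rat}) : root (map_poly ratr q) z = (pz z %| q) by rewrite /pz; case: minCpolyP => q' [_ ? ?] /=.
pose p := \prod_(z <- zs) pz z.
have mp : p \is monic by apply: monic_prod => z _.
have [L [f1 [rs [galL gen Ep]]]] := splitting_field_exists mp.
have rat1 (q : {poly rat}) : map_poly f1 (map_poly (in_alg L) q) = map_poly ratr q.
  by rewrite -map_poly_comp; apply: eq_map_poly => c /=; rewrite rmorphZ_num rmorph1 mulr1.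
have root1 (q : {poly rat}) z : root (map_poly (in_alg L) q) z = root (map_poly ratr q) (f1 z).
  by rewrite -rat1 fmorph_root.
have pre z : z \in zs -> exists2 r, r \in rs & f1 r = z.
  move=> zzs; have : root (map_poly ratr p) z by rewrite pzr /p (big_rem z zzs) /= dvdp_mulIl.
  rewrite -rat1 Ep rmorph_prod rootE horner_prod prodf_seq_eq0 => /hasP[r rrs].
  by rewrite /= rmorphB /= map_polyX map_polyC hornerXsubC subr_eq0 => /eqP ->; exists r.
have [sL sLrs EsL] := pre _ (mem_head _ _).
have [z1 z1rs Ez1] : exists2 r, r \in rs & f1 r = ka a * gM th1 by apply: pre; rewrite !inE eqxx orbT.
have [z2 z2rs Ez2] : exists2 r, r \in rs & f1 r = ka a * gM th2 by apply: pre; rewrite !inE eqxx !orbT.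
have [io Eio] : exists io : {rmorphism K -> L}, io s = sL.
  apply: (@embedding_root _ L (in_alg L)) => // q rq; rewrite root1 EsL.
  move: rq; rewrite -(fmorph_root ka) -map_poly_comp; congr root.
  by apply: eq_map_poly => c; apply: kaq.
have fio x : f1 (io x) = ka x.
  have [q ->] := primitive_polyP gs x.
  rewrite -!horner_map Eio EsL; congr _.[_]; rewrite -!map_poly_comp.
  by apply: eq_map_poly => c; apply: etrans (toC _ (f1 \o io : {rmorphism K -> algC}) c) (esym (kaq c)).
have a0 : io a != 0 by rewrite fmorph_eq0 lead_coef_eq0.
have [phi _] := embedding_exists L R[i].
have rootL (z : L) (th' : M) : f1 z = ka a * gM th' -> root (map_poly (in_alg M) f) th' ->
    root (map_poly io f) (z / io a).
  move=> Ez; rewrite -(fmorph_root gM) -(fmorph_root f1) -!map_poly_comp.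
  rewrite fmorph_div Ez fio mulrC mulKf ?fmorph_eq0 ?lead_coef_eq0 //.
  by congr root; apply: eq_map_poly => c /=; rewrite fio.
have rt1 := rootL _ _ Ez1 r1; have rt2 := rootL _ _ Ez2 r2.
exists L, phi, io, (z1 / io a), (z2 / io a); split=> //.
have B1 : 1 <= (b.+2%:R : R) by rewrite ler1n.
have sf2 : (1 < size f)%N by have := root_size_gt1 _ rt1; rewrite size_map_poly map_poly_eq0; apply.
have b2 : (1 < b)%N by apply: leq_trans sf2 fb.
have zle (z : L) g0 : root (map_poly io f) (z / io a) -> av phi g0 z <= b.+2%:R ^+ b.
  move=> rz; have -> : z = lead_coef (map_poly io f) * (z / io a) by rewrite lead_coef_map mulrC divfK.
  apply: le_trans (lead_root_le (avP phi g0) _ B1 _ rz) _; rewrite ?map_poly_eq0 //.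
    by move=> i; rewrite coef_map; apply: annihilated_le (avP phi g0) (cb i).
  rewrite size_map_poly; apply: le_trans (_ : b.+2%:R ^+ b.-1 + b.+2%:R ^+ b.-1 <= _).
    by apply: lerD; rewrite ?exprn_ege1 // ler_weXn2l // -!subn1 leq_sub2r.
  have -> : b.+2%:R ^+ b = b.+2%:R * b.+2%:R ^+ b.-1 :> R by rewrite -exprS prednK.
  by rewrite -mulr2n -[leLHS]mulr_natl ler_wpM2r ?exprn_ge0 // ler_nat.
have zdeg (z : L) : root (map_poly io f) (z / io a) -> (adjoin_degree 1 z <= b ^ 2)%N.
  move=> rz; apply: leq_trans (@compositum_degree K L io (monicized f) z _ _) _.
  - by apply: monicized_monic; apply: ltnW.
  - have -> : z = io a * (z / io a) by rewrite mulrC divfK.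
    have mE : map_poly io (monicized f) = monicized (map_poly io f).
      apply/polyP => i; rewrite coef_map [in LHS]/monicized [in RHS]/monicized 2!coef_poly size_map_poly /=.
      case: (i < size f)%N; last by rewrite rmorph0.
      by case: (i == _); rewrite ?rmorph1 // rmorphM rmorphXn coef_map lead_coef_map.
    have := @horner_monicized L (map_poly io f) (z / io a); rewrite size_map_poly lead_coef_map => /(_ sf2) Eh.
    by rewrite mE rootE Eh (rootP rz) mulr0.
  - by rewrite size_monicized ?(ltnW sf2) // -mulnn leq_mul // (leq_trans _ fb) // leq_pred.
have sLb : (adjoin_degree 1 sL <= b)%N.
  have [q [Eq mq rq]] := minPoly_ratP s.
  apply: leq_trans (@adjoin_degree_le L sL q mq _) _.
    rewrite -Eio; have : root (map_poly (in_alg K) q) s by rewrite rq dvdpp.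
    rewrite -(fmorph_root io) -map_poly_comp; congr root.
    by apply: eq_map_poly => c /=; rewrite fmorph_numZ rmorph1.
  by rewrite -(size_map_poly (in_alg K)) -Eq size_minPoly /= -dim_adjoin1 gs.
have good z : z \in zs -> exists2 zL : L, f1 zL = z &
   [/\ ring_of_integers zL, (adjoin_degree 1 zL <= b ^ 2)%N & forall g, av phi g zL <= b.+2%:R ^+ b].
  have bb : (b <= b ^ 2)%N by rewrite -mulnn leq_pmulr.
  have OzL zL : root (map_poly io f) (zL / io a) -> ring_of_integers zL.
    move=> rz; have -> : zL = lead_coef (map_poly io f) * (zL / io a) by rewrite lead_coef_map mulrC divfK.
    by apply: rint_lead_root rz => [|i]; rewrite ?map_poly_eq0 // coef_map; apply/rint_rmorph/Of.
  rewrite !inE => /or3P[] /eqP ->.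
  - exists sL => //; split; first by rewrite -Eio; apply/rint_rmorph/annihilated_rint/sb.
      exact: leq_trans bb.
    move=> h; rewrite -Eio; apply: le_trans (annihilated_le io (avP phi h) sb) _.
    by rewrite -{1}[b.+2%:R]expr1 ler_weXn2l.
  - by exists z1 => //; split=> [||h]; [apply: OzL | apply: zdeg | apply: zle].
  - by exists z2 => //; split=> [||h]; [apply: OzL | apply: zdeg | apply: zle].
have size_pz z : z \in zs -> ((size (pz z)).-1 <= b ^ 2)%N.
  move=> /good[zL EzL [_ dz _]]; apply: leq_trans dz; rewrite -ltnS -size_minPoly.
  have [q [Eq mq rq]] := minPoly_ratP zL; rewrite Eq size_map_poly.
  rewrite prednK ?size_poly_gt0 ?monic_neq0 //; apply: dvdp_leq; first exact: monic_neq0.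
  by rewrite -pzr -EzL -root1 rq dvdpp.
have srs : (size rs <= 3 * b ^ 2)%N.
  have : size (map_poly (in_alg L) p) = (size rs).+1 by rewrite Ep size_prod_XsubC.
  rewrite size_map_poly => sp; rewrite -ltnS -sp.
  have [|_] := @coef_prod_top algC _ zs (fun z => map_poly ratr (pz z)) (fun z => (size (pz z)).-1).
    by move=> z; rewrite size_map_poly prednK // size_poly_gt0 monic_neq0.
  rewrite -rmorph_prod size_map_poly => H; apply: leq_trans H _; rewrite ltnS.
  have -> : (3 * b ^ 2 = \sum_(z <- zs) b ^ 2)%N by rewrite big_const_seq count_predT iter_addn addn0 mulnC.
  by rewrite big_seq [X in (_ <= X)%N]big_seq; apply: leq_sum => z /size_pz.
have B1b : 1 <= (b.+2%:R : R) ^+ b by rewrite exprn_ege1.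
have b20 : (0 < b ^ 2)%N by rewrite expn_gt0 b0.
have Hrs r : r \in rs -> [/\ ring_of_integers r, (adjoin_degree 1 r <= b ^ 2)%N & forall g, av phi g r <= b.+2%:R ^+ b].
  move=> rrs; have : root (map_poly (in_alg L) p) r by rewrite Ep root_prod_XsubC.
  rewrite root1 /p rmorph_prod rootE horner_prod prodf_seq_eq0 => /hasP[z zzs /= rz].
  have [zL EzL [Oz dz hz]] := good z zzs.
  have [h Eh] : exists h : gal_of {:L}, r = h zL.
    apply: (gal_orbit galL) => q; rewrite !root1 EzL pzr => dq.
    by apply: root_dvdp _ rz; rewrite dvdp_map.
  split; first by rewrite Eh; apply/rint_gal.
  - have [q [Eq mq rq]] := minPoly_ratP zL.
    apply: leq_trans dz; rewrite -(ltnS _ (adjoin_degree 1 zL)) -(size_minPoly 1 zL) Eq size_map_poly.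
    rewrite -[X in (_ < X)%N]prednK ?size_poly_gt0 ?monic_neq0 // ltnS; apply: adjoin_degree_le => //.
    rewrite Eh; have : root (map_poly (in_alg L) q) zL by rewrite rq dvdpp.
    rewrite -(fmorph_root h) -map_poly_comp; congr root.
    by apply: eq_map_poly => c /=; rewrite fmorph_numZ rmorph1.
  - move=> g1; rewrite Eh; have -> : av phi g1 (h zL) = av phi (h * g1)%g zL by rewrite /av galM ?memvf.
    exact: hz.
have [dN [e [Oe fe ee]]] := @bounded_basis R L phi rs _ _ B1b b20 gen Hrs.
split=> //.
- apply: contraNneq th12 => E.
  have : z1 = z2 by rewrite -[z1](divfK a0) E divfK.
  move/(congr1 f1); rewrite Ez1 Ez2 => /(mulfI _) E'; apply/eqP/(fmorph_inj gM)/E'.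
  by rewrite fmorph_eq0 lead_coef_eq0.
- by apply: leq_trans dN _; rewrite leq_pexp2l.
- exists e; split=> // i h; apply: le_trans (ee i h) _.
  by rewrite ler_weXn2l // leq_mul2l srs orbT.
Qed.
End Model.

(** * The height of an integer *)

Lemma absval_horner_le (R : realType) (F : fieldType) (v : F -> R) (p : {poly F}) (x : F) (A W : R) (n : nat) :
  absval v -> (size p <= n)%N -> 0 <= A -> 1 <= W -> (forall i, v p`_i <= A) -> v x <= W ->
  v p.[x] <= n%:R * A * W ^+ n.
Proof.
move=> vP sp A0 W1 pA xW; have W0 : 0 <= W by apply: le_trans W1.
rewrite horner_coef; apply: le_trans (absval_sum vP _ _ _) _.
apply: le_trans (_ : \sum_(i < size p) A * W ^+ n <= _); last first.
  rewrite sumr_const card_ord -[leLHS]mulr_natl mulrA.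
  by rewrite !ler_wpM2r ?exprn_ge0 // ler_nat.
apply: ler_sum => i _; rewrite (absvalM vP) (absvalX vP).
apply: ler_pM; rewrite ?exprn_ge0 ?(absval_ge0 vP) //.
apply: le_trans (_ : W ^+ i <= _); first by apply: lerXn2r (xW); rewrite nnegrE ?(absval_ge0 vP).
by rewrite ler_weXn2l // ltnW // (leq_trans (ltn_ord i)).
Qed.

Section IntegralHeight.
Variables (R : realType) (K : fieldExtType rat).
Local Notation "'𝔬'" := (@ring_of_integers K).
Implicit Types (P : set K) (x : K).

Lemma is_ideal_exp P n : is_ideal P -> is_ideal (ideal_exp P n).
Proof. by move=> iP; elim: n => [|n IH]; [exact: ideal_rint | exact: is_ideal_mul]. Qed.

Lemma ideal_exp_sub P i j : is_ideal P -> (i <= j)%N -> ideal_exp P j `<=` ideal_exp P i.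
Proof.
move=> iP /subnK <-; elim: (j - i)%N => [//|n IH]; rewrite addSn.
apply: subset_trans IH; apply: ideal_mul_subr; first exact: is_ideal_exp.
by move=> x; apply: ideal_sub.
Qed.

(** If [P^i] and [P^j] exactly divide [a] and [b], where [x = a / b], then [a = x b] lies in [P^j],
    whence [j <= i]. *)
Lemma padic_abs_le1 P x : is_ideal P -> 𝔬 x -> padic_abs R P x <= 1.
Proof.
move=> iP Ox; rewrite /padic_abs; case: eqP => // /eqP x0.
suff : (0 <= valuation P x).
  case: (valuation P x) => // n _; rewrite -exprnN.
  have [->|n0] := posnP (ideal_norm P); first by case: n => [|n]; rewrite ?expr0z ?expr0 ?invr1 // exprS mul0r invr0.
  by rewrite invf_le1 ?exprn_gt0 ?ltr0n // exprn_ege1 // ler1n.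
rewrite /valuation; case: xgetP => [v _ [a [b [i [j [[Oa Ob b0 Ex] [[Pa Pa1] [Pb _] ->]]]]]]|//].
rewrite subr_ge0 lez_nat leqNgt; apply/negP => ij; apply: Pa1.
apply: (ideal_exp_sub iP ij); have -> : a = x * b by rewrite Ex divfK.
by case: (is_ideal_exp j iP) => _ _ _; apply.
Qed.

Variables (L : splittingFieldType rat).
Hypothesis galL : galois 1 {:L}.
Variables (phi : {rmorphism L -> R[i]}) (io : {rmorphism K -> L}).

Lemma embeddings_gal : @embeddings K R `<=` [set (fun x => phi ((h : gal_of {:L}) (io x))) | h in setT].
Proof.
move=> s [g ->]; have [t gt] := primitive_exists K.
have [h Eh] := gal_conjugate galL phi io g t; exists h => //; apply/funext => x.
have [p ->] := primitive_polyP gt x; rewrite -!horner_map Eh; congr _.[_].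
rewrite -!map_poly_comp; apply: eq_map_poly => c.
have toC (u : {rmorphism K -> R[i]}) : u c%:A = ratr c by rewrite rmorphZ_num rmorph1 mulr1.
exact: etrans (toC (phi \o h \o io : {rmorphism K -> R[i]})) (esym (toC g)).
Qed.

(** Only the Archimedean places contribute. There are at most as many embeddings of [K] as elements
    in the Galois group, and the factor [1 / [K : Q]] is estimated by [1]. *)
Lemma height_le x (W : R) : 𝔬 x -> 1 <= W -> (forall g, av phi g (io x) <= W) ->
  height R x <= (\dim {:L})%:R * ln W.
Proof.
move=> Ox W1 xW; rewrite /height.
have -> : \sum_(P \in @prime_ideal K) ln (Num.max 1 (padic_abs R P x)) = 0.
  apply: fsbig1 => P [iP _ _ _]; have := padic_abs_le1 iP Ox.
  by rewrite /Num.max; case: ltgtP => //= _ _; rewrite ln1.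
rewrite addr0.
have lW : 0 <= ln W by rewrite ln_ge0.
have fin : finite_set (@embeddings K R).
  by apply: sub_finite_set embeddings_gal _; apply: finite_image; apply: finite_finset.
rewrite fsbig_finite //=.
have mem_emb s : s \in finmap.enum_fset (fset_set (@embeddings K R)) -> embeddings s.
  by move=> sA; have Es := in_fset_set fin s; apply/set_mem; rewrite -Es.
have le1 : \sum_(s <- finmap.enum_fset (fset_set (@embeddings K R))) ln (Num.max 1 (Normc.normc (s x))) <= (\dim {:L})%:R * ln W.
  apply: le_trans (_ : \sum_(s <- finmap.enum_fset (fset_set (@embeddings K R))) ln W <= _).
    rewrite big_seq [leRHS]big_seq; apply: ler_sum => s /mem_emb/embeddings_gal[h _ <-].
    have mW : Num.max 1 (Normc.normc (phi (h (io x)))) <= W by rewrite ge_max W1 xW.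
    rewrite ler_ln // posrE; first by rewrite lt_max ltr01.
    exact: lt_le_trans W1.
  rewrite big_const_seq count_predT iter_addr addr0 -[leLHS]mulr_natl ler_wpM2r // ler_nat.
  pose s2 := [seq (fun x => phi ((h : gal_of {:L}) (io x))) | h <- enum {: gal_of {:L}}].
  have -> : \dim {:L} = size s2 by rewrite size_map -cardE card_gal.
  apply: uniq_leq_size; first exact: finmap.fset_uniq.
  move=> s /mem_emb/embeddings_gal[h _ <-].
  by apply/mapP; exists h; rewrite ?mem_enum.
have S0 : 0 <= \sum_(s <- finmap.enum_fset (fset_set (@embeddings K R))) ln (Num.max 1 (Normc.normc (s x))).
  by apply: sumr_ge0 => s _; rewrite ln_ge0 // le_max lexx.
apply: le_trans le1; rewrite -[leRHS]mul1r ler_wpM2r //.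
by rewrite invf_le1 ?ltr0n ?adim_gt0 // ler1n adim_gt0.
Qed.

End IntegralHeight.

(** Two logarithms bring a doubly exponential bound down to a linear one; [ln B] is estimated by [B]
    each time. *)
Lemma ln_log_star_le (R : realType) (h : R) (B q e : nat) : (1 < B)%N -> h <= (B ^ e)%N%:R ->
  (e * B <= B ^ q)%N -> ln (log_star h) <= (q * B)%N%:R.
Proof.
move=> B1 hB eB; have B0 : 0 < B%:R :> R by rewrite ltr0n ltnW.
have lB : ln (B%:R : R) <= B%:R by apply/ltW/ln_sublinear.
have H : log_star h <= (B ^ q)%N%:R.
  rewrite /log_star ge_max ler1n expn_gt0 (ltnW B1) andbT.
  have [h0|h0] := leP h 0; first by rewrite ln0.
  apply: le_trans (_ : ln ((B ^ e)%N%:R : R) <= _); first by rewrite ler_ln ?posrE ?ltr0n ?expn_gt0 ?(ltnW B1).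
  rewrite natrX lnXn // -[leLHS]mulr_natl; apply: le_trans (_ : (e * B)%N%:R <= _); last by rewrite ler_nat.
  by rewrite natrM ler_wpM2l.
have p0 : 0 < log_star h by rewrite /log_star lt_max ltr01 orbT.
apply: le_trans (_ : ln ((B ^ q)%N%:R : R) <= _); first by rewrite ler_ln ?posrE ?(lt_le_trans p0).
by rewrite natrX lnXn // -[leLHS]mulr_natl natrM ler_wpM2l.
Qed.

(** * Explicit constants *)

Section Bookkeeping.
Variables (b k N : nat).
Local Notation B := b.+2.
Hypotheses (b1 : (1 < b)%N) (k0 : (0 < k)%N) (Nle : (N <= (b ^ 2) ^ (3 * b ^ 2))%N).
(** Dominates the factor [4 N E H] of [root_approximation]; its double exponent is due to [H], a
    bound for the conjugates of [s]. *)
Definition mu_of := (B ^ (B ^ (7 * k)))%N.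
(** [Qn_of] is the [Qn] of [main_inequality] and [X_of] the exponent of its conclusion. *)
Definition Qn_of := ((16 * mu_of ^ (2 * N + 2 + 3584 * N.+1 ^ 2)).+1 ^ 2)%N.
Definition X_of := ((1152 * N.+1 * Qn_of) ^ 2)%N.

Lemma leq_mul_pow c x y i j : (x <= c ^ i -> y <= c ^ j -> x * y <= c ^ (i + j))%N.
Proof. by rewrite expnD; apply: leq_mul. Qed.

Lemma pow4_le n : (4 ^ n <= B ^ n)%N.
Proof. by case: n => // n; rewrite leq_exp2r. Qed.

Lemma b_le n : (b ^ n <= B ^ n)%N.
Proof. by case: n => // n; rewrite leq_exp2r // -addn2 leq_addr. Qed.

Lemma powB_le i j : (i <= j)%N -> (B ^ i <= B ^ j)%N.
Proof. by move=> ij; rewrite leq_pexp2l. Qed.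

Lemma N_le : (N <= B ^ (6 * b ^ 2))%N.
Proof.
apply: leq_trans Nle _; have -> : (6 * b ^ 2 = 2 * (3 * b ^ 2))%N by rewrite mulnA.
  by rewrite -expnM; apply: b_le. Qed.

Lemma six_b2 : (6 * b ^ 2 <= B ^ 4)%N.
Proof. by apply: (@leq_mul_pow B 6 _ 2 2); [exact: leq_trans (pow4_le 2) | exact: b_le]. Qed.

Lemma sum_exponents : (1 + (6 * b ^ 2 + (3 * b ^ 5 + B ^ (3 * k))) <= B ^ (7 * k))%N.
Proof.
have e2 : (3 * b ^ 5 <= B ^ 6)%N.
  by apply: (@leq_mul_pow B 3 _ 1 5); [exact: leq_trans (pow4_le 1) | exact: b_le].
have top i : (i <= 6 * k)%N -> (B ^ i <= B ^ (6 * k))%N by apply: powB_le.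
have t1 : (1 <= B ^ (6 * k))%N by rewrite expn_gt0.
have t2 : (B ^ 4 <= B ^ (6 * k))%N by apply: top; move: k0; clear; lia.
have t3 : (B ^ 6 <= B ^ (6 * k))%N by apply: top; move: k0; clear; lia.
have t4 : (B ^ (3 * k) <= B ^ (6 * k))%N by apply: top; clear; lia.
apply: leq_trans (_ : B * B ^ (6 * k) <= _)%N; last by rewrite -expnS; apply: powB_le; move: k0; clear; lia.
apply: leq_trans (_ : 4 * B ^ (6 * k) <= _)%N; last by rewrite leq_mul.
have := six_b2; move: e2 t1 t2 t3 t4; clear; move: (B ^ (6 * k))%N (B ^ (3 * k))%N (B ^ 6)%N (B ^ 4)%N => x y z w.
lia.
Qed.

Lemma mu_bound (E : nat) : (E <= (B ^ b) ^ (b ^ 2 * (3 * b ^ 2)))%N ->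
  (4 * N * E * B ^ (B ^ (3 * k)) <= mu_of)%N.
Proof.
move=> EB; have EB' : (E <= B ^ (3 * b ^ 5))%N.
  by apply: leq_trans EB _; rewrite -expnM; apply: powB_le; have -> : (b * (b ^ 2 * (3 * b ^ 2)) = 3 * b ^ 5)%N by ring.
have := leq_mul_pow (leq_mul_pow (leq_mul_pow (pow4_le 1) N_le) EB') (leqnn (B ^ (B ^ (3 * k)))%N).
move=> H; apply: leq_trans H _; by apply: powB_le; have := sum_exponents; rewrite !addnA.
Qed.

Lemma powB_le_mu i : (i <= B ^ 7)%N -> (B ^ i <= mu_of)%N.
Proof. by move=> le; apply: powB_le; apply: leq_trans le _; apply: powB_le; rewrite leq_pmulr. Qed.

Lemma mu_big : (4096 <= mu_of)%N.
Proof. by apply: leq_trans (powB_le_mu (i := 6) _); [exact: leq_trans (pow4_le 6) | exact: leq_trans (pow4_le 7)]. Qed.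

Lemma b_le_pow7 : (b.+2 <= B ^ 7)%N.
Proof. by rewrite -{1}[b.+2]expn1 leq_pexp2l. Qed.

Lemma N1_le : (N.+1 <= B ^ (6 * b ^ 2 + 1))%N.
Proof.
rewrite addn1 expnS; have := N_le; have : (0 < B ^ (6 * b ^ 2))%N by rewrite expn_gt0.
by clear; move: (B ^ (6 * b ^ 2))%N => x x0 Nx; nia.
Qed.

Lemma N1_le_mu : (N.+1 <= mu_of)%N.
Proof.
apply: leq_trans N1_le _; apply: powB_le_mu.
apply: leq_trans (_ : B ^ 5 <= _)%N; last exact: powB_le.
rewrite expnS; have := six_b2; have : (0 < B ^ 4)%N by rewrite expn_gt0.
by clear; move: (B ^ 4)%N => x x0 le; nia.
Qed.

Lemma X_bound : (X_of <= mu_of ^ (4 * (2 * N + 2 + 3584 * N.+1 ^ 2) + 8))%N.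
Proof.
set x := (2 * N + 2 + _)%N; have m1 : (1 < mu_of)%N by apply: leq_trans mu_big.
have mu0 i : (0 < mu_of ^ i)%N by rewrite expn_gt0 ltnW.
have s1 : ((16 * mu_of ^ x).+1 <= mu_of ^ x.+1)%N.
  rewrite expnS; have := mu_big; have := mu0 x; clear; move: (mu_of ^ x)%N mu_of => y m; nia.
have s2 : (Qn_of <= mu_of ^ (2 * x + 2))%N.
  by rewrite /Qn_of -/x; apply: leq_trans (_ : (mu_of ^ x.+1) ^ 2 <= _)%N; rewrite ?leq_exp2r // -expnM leq_pexp2l ?(ltnW m1) //; lia.
have s3 : (1152 * N.+1 * Qn_of <= mu_of ^ (1 + 1 + (2 * x + 2)))%N.
  apply: leq_mul_pow s2; apply: leq_mul_pow; rewrite expn1; last exact: N1_le_mu.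
  exact: leq_trans mu_big.
rewrite /X_of; apply: leq_trans (_ : (mu_of ^ (1 + 1 + (2 * x + 2))) ^ 2 <= _)%N; first by rewrite leq_exp2r.
by rewrite -expnM leq_pexp2l ?(ltnW m1) //; clear; lia.
Qed.

(** The left side bounds the height of [f(beta)], with [mu] in place of [ln mu]. What counts is that
    [e] is simply exponential in [k]. *)
Lemma final_exponent : exists e, (N * (2 + (X_of + 1 + N) * b) * mu_of <= B ^ e)%N /\
  (e * B <= B ^ (12 * b ^ 2 + 10 + 7 * k))%N.
Proof.
set x := (2 * N + 2 + 3584 * N.+1 ^ 2)%N; exists (B ^ (7 * k) * (4 * x + 13))%N.
have m1 : (1 < mu_of)%N by apply: leq_trans mu_big.
split.
  rewrite expnM -/mu_of; have -> : (4 * x + 13 = 1 + (4 * x + 11) + 1)%N by lia.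
  apply: leq_mul_pow; last by rewrite expn1.
  apply: leq_mul_pow; first by rewrite expn1; apply: ltnW; exact: N1_le_mu.
  have bm : (b <= mu_of)%N.
    apply: leq_trans (_ : B ^ 1 <= _)%N; first by rewrite expn1 -addn2 leq_addr.
    by apply: powB_le_mu; rewrite expn_gt0.
  have -> : (4 * x + 11 = (4 * x + 8).+3)%N by lia.
  have := X_bound; rewrite -/x !expnS; have := mu_big; have := N1_le_mu; move: bm.
  have : (0 < mu_of ^ (4 * x + 8))%N by rewrite expn_gt0 ltnW.
  clear; move: mu_of X_of (mu_of ^ (4 * x + 8))%N => m z y y0 bm Nm mb zy.
  have h1 : (z + 1 + N <= 3 * (m * y))%N by nia.
  have h2 : ((z + 1 + N) * b <= 3 * (m * y) * m)%N by apply: leq_mul.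
  by apply: leq_trans (leq_add (leqnn 2) h2) _; nia.
have e3 : (4 * x + 13 <= B ^ (7 + 2 * (6 * b ^ 2 + 1)))%N.
  apply: leq_trans (_ : 4 ^ 7 * N.+1 ^ 2 <= _)%N.
    have : (N.+1 <= N.+1 ^ 2)%N by rewrite -mulnn leq_pmulr.
    rewrite /x -[(4 ^ 7)%N]/(4 * 4096)%N -mulnA; clear; move: (N.+1 ^ 2)%N => z; lia.
  apply: leq_mul_pow; first exact: pow4_le.
  by rewrite mulnC expnM leq_exp2r // N1_le.
have -> : (12 * b ^ 2 + 10 + 7 * k = 7 * k + (7 + 2 * (6 * b ^ 2 + 1)) + 1)%N by lia.
by apply: leq_mul_pow; [apply: leq_mul_pow e3 | rewrite expn1].
Qed.

(** The exponent of the bound for [s]: one factor [B] for the leading coefficient, and [k] iterates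
    at [0], each at most [B^(2 (b + 1)^k)]. *)
Lemma house_exponent : (1 + k * (2 * b.+1 ^ k) <= B ^ (3 * k))%N.
Proof.
have h1 : (k <= B ^ k)%N by apply/ltnW/ltn_expl.
have h2 : (b.+1 ^ k <= B ^ k)%N by rewrite leq_exp2r.
have h3 : (4 <= B ^ k)%N by apply: leq_trans (_ : B ^ 1 <= _)%N; [rewrite expn1; exact: b1 | rewrite leq_pexp2l].
have -> : (3 * k = k + (k + k))%N by lia.
rewrite !expnD; move: h1 h2 h3; clear; move: (b.+1 ^ k)%N (B ^ k)%N => x y.
move=> h1 h2 h3; have : (k * (2 * x) <= y * (2 * y))%N by rewrite leq_mul // leq_mul2l.
by nia.
Qed.

End Bookkeeping.

(** * From prime divisors to heights *)

Section IntegralEvaluation.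
Variable K : fieldExtType rat.
Local Notation "'𝔬'" := (@ring_of_integers K).
Implicit Types (p : {poly K}) (x y : K).

Lemma rint_eval p x : integral_coefs p -> 𝔬 x -> 𝔬 p.[x].
Proof. by move=> Op Ox; rewrite horner_coef; apply: rint_sum => i; apply: rintM; [apply: Op | apply: rintX]. Qed.

Lemma rint_eval_sub p x y : integral_coefs p -> 𝔬 x -> 𝔬 y ->
  exists2 w, 𝔬 w & p.[x] - p.[y] = (x - y) * w.
Proof.
move=> Op Ox Oy; exists (\sum_(i < size p) p`_i * \sum_(j < i) x ^+ (i.-1 - j) * y ^+ j).
  apply: rint_sum => i; apply: rintM; first exact: Op.
  by apply: rint_sum => j; apply: rintM; apply: rintX.
rewrite !horner_coef -sumrB mulr_sumr; apply: eq_bigr => i _.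
by rewrite -mulrBr subrXX mulrCA.
Qed.

End IntegralEvaluation.

(** For [k > 0] the exponent [12 b^2 + 10 + 7 k] of [final_exponent] is at most [(12 b^2 + 17) k].
    The factor [b + 2] comes from [ln_log_star_le], and the successor makes the final inequality
    strict. *)
Definition denominator (b : nat) : nat := ((12 * b ^ 2 + 17) * b.+2).+1.

Lemma near_max (R : realType) (y1 y2 d1 d2 C Y : R) : 2 * C <= Y -> d1 <= C -> d2 <= C ->
  y1 - y2 <= d1 -> y2 - y1 <= d2 -> y1 <= Y -> y2 <= Y -> 0 <= y1 -> 0 <= y2 ->
  Y = y1 \/ Y = y2 -> Y <= 2 * y1 /\ Y <= 2 * y2.
Proof. by move=> h1 h2 h3 h4 h5 h6 h7 h8 h9 [E|E]; split; lra. Qed.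

Section Core.
Variables (R : realType) (K : fieldExtType rat) (f : {poly K}) (b : nat).
Hypotheses (bf : bounded_data f b) (roots3 : at_least_n_distinct_roots 3 f) (np : zero_not_periodic f).
Local Notation "'𝔬'" := (@ring_of_integers K).
Local Notation B := b.+2.

Lemma f_neq0 : f != 0.
Proof. by apply/eqP => f0; have := np (ltn0Sn 0); rewrite /poly_iter /= f0 comp_poly0 horner0. Qed.

Lemma rint_f : integral_coefs f.
Proof. by move=> i; case: bf => _ _ _ /(_ i)/annihilated_rint. Qed.

Lemma poly_iterS n x : (poly_iter f n.+1).[x] = f.[(poly_iter f n).[x]].
Proof. exact: horner_comp. Qed.

Lemma rint_poly_iter n x : 𝔬 x -> 𝔬 (poly_iter f n).[x].
Proof.
move=> Ox; elim: n => [|n IH]; first by rewrite hornerX.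
by rewrite poly_iterS; apply: rint_eval => //; apply: rint_f.
Qed.

Lemma poly_iterD n k x : (poly_iter f (n + k)).[x] = (poly_iter f n).[(poly_iter f k).[x]].
Proof. by elim: n => [|n IH]; rewrite ?hornerX // addSn !poly_iterS IH. Qed.

Definition obstruction k := \prod_(i < k) (poly_iter f i.+1).[0].

Lemma obstruction_neq0 k : obstruction k != 0.
Proof. by apply/prodf_neq0 => i _; apply/eqP/np. Qed.

Lemma rint_obstruction k : 𝔬 (obstruction k).
Proof. by apply: rint_prod => i; apply: rint_poly_iter; apply: rint0. Qed.

(** The differences of [beta] with two roots are multiplied by the leading coefficient [a] to become
    the integers [y x1] and [y x2]; the factor [a] in [s] absorbs the powers of [a] that appear.
    Once [main_inequality] bounds their conjugates, those of [beta] and of [f(beta)] follow. *)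
Lemma height_of_divisor k e beta : (0 < k)%N -> 𝔬 beta -> f.[beta] != 0 ->
  principal_ideal f.[beta] (obstruction k ^+ e) ->
  ln (lambda R f.[beta]) < (denominator b * k)%N%:R.
Proof.
move=> k0 Ob fb0 dv; have Of := rint_f; have f0 := f_neq0.
have [Kb fb _ cb] := bf.
have [L [phi [io [x1 [x2 [galL [x12 r1 r2 Nb [E [Oe fe ee]]]]]]]]] := galois_model R bf f0 roots3.
set N := \dim {:L} in Nb E Oe fe ee.
have s1 : (1 < size f)%N by rewrite -(size_map_poly io); apply: root_size_gt1 r1; rewrite map_poly_eq0.
have b1 : (1 < b)%N by apply: leq_trans fb.
have vP g := avP phi g; have v0 g x : 0 <= av phi g x := absval_ge0 (vP g) x.
have fB g i : av phi g (io f`_i) <= B%:R by apply: annihilated_le (vP g) (cb i).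
have B1 : 1 <= (B%:R : R) by rewrite ler1n.
set F := map_poly io f; have FB g i : av phi g F`_i <= B%:R by rewrite coef_map; apply: fB.
have F0 : F != 0 by rewrite map_poly_eq0.
have sF : size F = size f by rewrite size_map_poly.
set a := io (lead_coef f); have aE : lead_coef F = a by rewrite lead_coef_map.
have a0 : a != 0 by rewrite fmorph_eq0 lead_coef_eq0.
have Oa : ring_of_integers a by apply/rint_rmorph; rewrite lead_coefE; apply: Of.
have thB x g : root F x -> av phi g (a * x) <= B%:R ^+ b.
  move=> rx; rewrite -aE; apply: le_trans (lead_root_le (vP g) F0 B1 (FB g) rx) _.
  rewrite sF; apply: le_trans (_ : B%:R ^+ b.-1 + B%:R ^+ b.-1 <= _).
    by apply: lerD; rewrite ?exprn_ege1 // ler_weXn2l // -!subn1 leq_sub2r.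
  have -> : B%:R ^+ b = B%:R * B%:R ^+ b.-1 :> R by rewrite -exprS prednK // ltnW.
  by rewrite -mulr2n -[leLHS]mulr_natl ler_wpM2r ?exprn_ge0 // ler_nat.
have Oth x : root F x -> ring_of_integers (a * x).
  by move=> rx; rewrite -aE; apply: rint_lead_root rx => // i; rewrite coef_map; apply/rint_rmorph/Of.
pose bt := a * io beta.
have Obt : ring_of_integers bt by apply: rintM => //; apply/rint_rmorph.
pose y x := bt - a * x.
pose s := a * io (obstruction k).
have Os : ring_of_integers s by apply: rintM => //; apply/rint_rmorph/rint_obstruction.
have s0 : s != 0 by rewrite mulf_neq0 // fmorph_eq0 obstruction_neq0.
have Fb : F.[io beta] = io f.[beta] by rewrite horner_map.
have Oy x : root F x -> ring_of_integers (y x) by move=> rx; apply: rintB => //; apply: Oth.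
have y0 x : root F x -> y x != 0.
  move=> rx; rewrite /y /bt -mulrBr mulf_neq0 // subr_eq0; apply: contraNneq fb0 => E'.
  by rewrite -(fmorph_eq0 io) -Fb E' (rootP rx).
(* [y x] divides the difference of the values at [a beta] and [a x] of the monicized polynomial,
   which is [a^(deg f - 1) f(beta)]. *)
have ydv x : root F x -> principal_ideal (y x) (s ^+ (b + e)).
  move=> rx; case: dv => c Oc Ec.
  have OmF : integral_coefs (monicized F).
    by apply: rint_monicized => j; rewrite coef_map; apply/rint_rmorph/Of.
  have root0 : (monicized F).[a * x] = 0 by rewrite -aE horner_monicized ?sF // (rootP rx) mulr0.
  have [q Oq Eq] := rint_eval_sub OmF Obt (Oth _ rx).
  have E1 : a ^+ (size f).-2 * io f.[beta] = q * y x.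
    rewrite [RHS]mulrC /y -Eq root0 subr0 /bt -Fb -sF -aE horner_monicized ?sF //.
  have sE : s ^+ (b + e) = (a ^+ (b + e - (size f).-2) * io (obstruction k) ^+ b * io c) * (a ^+ (size f).-2 * io f.[beta]).
    have le : ((size f).-2 <= b + e)%N by apply: leq_trans (leq_addr _ _); apply: leq_trans fb; rewrite -subn2 leq_subr.
    have -> : a ^+ (b + e - (size f).-2) * io (obstruction k) ^+ b * io c * (a ^+ (size f).-2 * io f.[beta])
       = (a ^+ (b + e - (size f).-2) * a ^+ (size f).-2) * (io (obstruction k) ^+ b * (io c * io f.[beta])) by ring.
    by rewrite -exprD subnK // -rmorphM Ec rmorphXn -exprD exprMn.
  rewrite sE E1 mulrA; exists (a ^+ (b + e - (size f).-2) * io (obstruction k) ^+ b * io c * q) => //.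
  apply: rintM => //.
  apply: rintM; last exact/rint_rmorph.
  by apply: rintM; apply: rintX => //; apply/rint_rmorph/rint_obstruction.
(* The value of [f] at a number of size [W >= 1] is at most [b B W^b], and
   [2 + 2 (b + 1)^i b <= 2 (b + 1)^(i + 1)]. *)
have Tb g i : av phi g (io (poly_iter f i).[0]) <= (B ^ (2 * b.+1 ^ i))%N%:R.
  elim: i => [|i IH]; first by rewrite hornerX rmorph0 (absval0 (vP g)).
  rewrite poly_iterS -horner_map.
  apply: le_trans (absval_horner_le (vP g) (n := b) (A := B%:R) (W := (B ^ (2 * b.+1 ^ i))%N%:R) _ _ _ _ IH) _ => //.
  - by rewrite size_map_poly.
  - by rewrite ler1n expn_gt0.
  rewrite -natrM -natrX -natrM ler_nat -expnM.
  apply: leq_trans (_ : B ^ (1 + 1 + 2 * b.+1 ^ i * b) <= _)%N.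
    by apply: leq_mul_pow; [apply: leq_mul_pow; rewrite expn1 // -addn2 leq_addr | ].
  rewrite leq_pexp2l // expnS; have : (0 < b.+1 ^ i)%N by rewrite expn_gt0.
  by clear; move: (b.+1 ^ i)%N => z z0; nia.
have Sb g : av phi g s <= (B ^ (B ^ (3 * k)))%N%:R.
  apply: le_trans (_ : (B ^ (1 + k * (2 * b.+1 ^ k)))%N%:R <= _); last by rewrite ler_nat leq_pexp2l //; apply: (house_exponent b1 k0 Nb).
  rewrite /s (absvalM (vP g)) expnD natrM expn1 ler_pM //; first by rewrite -aE lead_coefE FB.
  rewrite /obstruction rmorph_prod (absval_prod (vP g)) mulnC expnM natrX.
  apply: le_trans (_ : \prod_(i < k) (B ^ (2 * b.+1 ^ k))%N%:R <= _); last by rewrite prodr_const card_ord.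
  apply: ler_prod => i _; rewrite v0 /=; apply: le_trans (Tb g i.+1) _.
  by rewrite ler_nat !leq_pexp2l // leq_mul2l leq_pexp2l ?orbT.
pose mu := mu_of b k.
have mu4 : (4 <= mu)%N by apply: leq_trans (mu_big b1 k0).
have B1b : (B ^ b <= mu)%N.
  apply: powB_le_mu => //; apply: leq_trans (_ : B ^ 1 <= _)%N; first by rewrite expn1 -addn2 leq_addr.
  by rewrite leq_pexp2l.
have rts y' n N0 q : ring_of_integers y' -> y' != 0 -> principal_ideal y' (s ^+ n) -> (0 < N0)%N ->
    exists x b', [/\ ring_of_integers x, x != 0, ring_of_integers b', x ^+ N0 = y' ^+ q * b' & forall g, av phi g b' <= (mu%:R : R) ^+ N0].
  move=> Oy' y'0 dv' N00.
  have [x [b' [Ox xn0 Ob' Ex bb']]] := root_approximation galL Oe fe ee q Oy' y'0 Os s0 dv' N00 Sb.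
  exists x, b'; split=> // g; apply: le_trans (bb' g) _.
  rewrite -!natrX -!natrM -natrX ler_nat leq_exp2r // mu_bound //.
have muR1 : 1 <= (mu%:R : R) by rewrite ler1n ltnW // (leq_trans _ mu4).
pose X := X_of b k N.
have X1 : (1 < X)%N.
  rewrite /X /X_of -mulnn; apply: (@leq_mul 2 1); rewrite ?muln_gt0 ?expn_gt0 //.
  by rewrite -[2%N]/(2 * 1 * 1)%N; apply: leq_mul; rewrite ?expn_gt0 // leq_mul.
have Yb g : av phi g (y x1) <= (mu%:R : R) ^+ X.
  pose y_ (p : gal_of {:L} * bool) := av phi p.1 (if p.2 then y x1 else y x2).
  (* The place [g0] is where the largest conjugate of both numbers is attained; as their difference
     is bounded, both are large there. *)
  have [[g0 c0] _ gM] := arg_maxP y_ (isT : predT (1%g, true)).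
  set Y := y_ _ in gM.
  have Y1 h : av phi h (y x1) <= Y by apply: (gM (h, true)).
  have Y2 h : av phi h (y x2) <= Y by apply: (gM (h, false)).
  apply: le_trans (Y1 g) _; pose C1 : R := 2 * B%:R ^+ b.
  have [le|lt] := leP Y ((4 * C1) ^+ 2).
    apply: le_trans le _; apply: le_trans (_ : (mu%:R ^+ 1) ^+ 2 <= _); last by rewrite -exprM ler_weXn2l.
    apply: lerXn2r; rewrite ?nnegrE ?exprn_ge0 // ?mulr_ge0 ?exprn_ge0 //.
    have -> : 4 * C1 = (8 * B ^ b)%N%:R by rewrite /C1 natrM natrX; ring.
    rewrite expr1 ler_nat; apply: leq_trans (_ : B ^ (2 + b) <= _)%N.
      by apply: leq_mul_pow => //; apply: leq_trans (pow4_le b1 2).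
    apply: powB_le_mu => //; exact: b_le_pow7.
  have C11 : 1 <= C1 by rewrite mulr_ege1 ?exprn_ege1 // ler1n.
  have diff h : av phi h (y x1 - y x2) <= C1.
    have -> : y x1 - y x2 = a * x2 - a * x1 by rewrite /y; ring.
    by apply: le_trans (absvalB (vP h) _ _) _; rewrite /C1 mulr2n mulrDl mul1r lerD ?thB.
  have [CY _] := square_lt_bounds C11 lt.
  have [Yg1 Yg2] : Y <= 2 * av phi g0 (y x1) /\ Y <= 2 * av phi g0 (y x2).
    have d1 := diff g0; have d2 : av phi g0 (y x2 - y x1) <= C1 by rewrite -(absvalN (vP g0)) opprB.
    have t1 := absval_distl (vP g0) (y x1) (y x2); have t2 := absval_distl (vP g0) (y x2) (y x1).
    have u1 := Y1 g0; have u2 := Y2 g0; have w1 := v0 g0 (y x1); have w2 := v0 g0 (y x2).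
    have : Y = av phi g0 (y x1) \/ Y = av phi g0 (y x2) by rewrite /Y /y_ /=; case: (c0); [left | right].
    exact: (near_max CY d1 d2 t1 t2 u1 u2 w1 w2).
  have y12 : y x1 != y x2.
    apply: contraNneq x12 => E'; have : a * x1 = a * x2 by apply: (subrI bt).
    by move/(mulfI a0) ->.
  apply: ltW; exact: (main_inequality galL mu4 rts (Oy _ r1) (y0 _ r1) (ydv _ r1) (Oy _ r2) (y0 _ r2) (ydv _ r2) y12 C11 Y1 Y2 Yg1 Yg2 (diff g0) lt).
(* A lower bound for the conjugates of [a], to pass from [a beta] to [beta]. *)
have aN g : 1 <= av phi g a * (B%:R : R) ^+ N.
  by apply: av_lower => // h; rewrite -aE lead_coefE FB.
have btb g : av phi g (io beta) <= (mu%:R : R) ^+ (X + 1 + N).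
  have bte : av phi g bt <= mu%:R ^+ (X + 1).
    have -> : bt = y x1 + a * x1 by rewrite /y subrK.
    apply: le_trans (absvalD (vP g) _ _) _; apply: le_trans (lerD (Yb g) (thB _ g r1)) _.
    apply: le_trans (_ : mu%:R ^+ X + mu%:R ^+ X <= _).
      rewrite lerD2l; apply: le_trans (_ : mu%:R ^+ 1 <= _); first by rewrite expr1 -natrX ler_nat.
      by rewrite ler_weXn2l // ltnW.
    by rewrite addn1 exprS -mulr2n -[leLHS]mulr_natl ler_wpM2r ?exprn_ge0 // ler_nat (leq_trans _ mu4).
  have muN : (B%:R : R) ^+ N <= mu%:R ^+ N.
    apply: lerXn2r; rewrite ?nnegrE // ler_nat; apply: leq_trans B1b.
    by rewrite -{1}[B]expn1 leq_pexp2l // ltnW.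
  have : av phi g bt = av phi g a * av phi g (io beta) by rewrite (absvalM (vP g)).
  move=> E'; rewrite exprD; apply: le_trans (_ : (av phi g a * av phi g (io beta)) * B%:R ^+ N <= _).
    rewrite mulrAC -[leLHS]mul1r ler_wpM2r //.
  by rewrite -E' ler_pM // exprn_ge0.
have W1 : 1 <= (mu%:R : R) ^+ (2 + (X + 1 + N) * b) by rewrite exprn_ege1.
have gb g : av phi g (io f.[beta]) <= mu%:R ^+ (2 + (X + 1 + N) * b).
  rewrite -Fb; apply: le_trans (absval_horner_le (vP g) (n := b) (A := B%:R) (W := mu%:R ^+ (X + 1 + N)) _ _ _ (FB g) (btb g)) _ => //.
  - by rewrite sF.
  - by rewrite exprn_ege1.
  rewrite -exprM -natrX -!natrM -natrX ler_nat expnD leq_mul2r; apply/orP; right.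
  apply: (@leq_mul_pow mu b B 1 1); rewrite expn1 -[X in (X <= _)%N]expn1; last by apply: powB_le_mu => //; rewrite expn_gt0.
  apply: leq_trans (powB_le_mu (i := 1) k0 _); rewrite ?expn_gt0 // !expn1 -addn2 leq_addr //.
have hle := height_le galL (rint_eval Of Ob) W1 gb.
have [e' [H1 H2]] := final_exponent b1 k0 Nb.
have hB : height R f.[beta] <= (B ^ e')%N%:R.
  apply: le_trans hle _; rewrite lnXn; last by rewrite (lt_le_trans ltr01).
  rewrite -[X in _ * X]mulr_natl; apply: le_trans (_ : N%:R * ((2 + (X + 1 + N) * b)%N%:R * mu%:R) <= _).
    by rewrite !ler_wpM2l //; apply/ltW/ln_sublinear; rewrite (lt_le_trans ltr01).
  by rewrite -!natrM ler_nat mulnA.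
have := ln_log_star_le (B := B) isT hB H2; rewrite -/(lambda R f.[beta]) => lb.
apply: le_lt_trans lb _; rewrite ltr_nat /denominator (mulSn ((12 * b ^ 2 + 17) * B)).
apply: leq_ltn_trans (_ : (12 * b ^ 2 + 17) * B * k < _)%N; last by rewrite -{1}[(_ * _ * k)%N]add0n ltn_add2r.
rewrite mulnAC leq_mul2r; apply/orP; right.
by move: k0; clear; move: (12 * b ^ 2)%N => z k0; nia.
Qed.

(** Serves when the iterate is [0], which every prime divides. A prime containing [2] exists because
    [1/2] is not integral. *)
Lemma prime_ideal_exists : exists P : set K, prime_ideal P.
Proof.
have two : (2%:R : K) != 0 by rewrite natr_numfield_eq0.
have [|e|P [pP _ _]] := @prime_avoiding K (principal_ideal 2%:R) 1 _ (rint1 K); last by exists P.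
  by apply: nonzero_ideal_principal => //; apply: rint_nat.
rewrite expr1n => -[c Oc Ec].
have : ring_of_integers ((2%:R^-1 : rat)%:A : K).
  have -> : (2%:R^-1 : rat)%:A = c; last by [].
  by apply: (mulIf two); rewrite Ec -(rmorph_nat (in_alg K)) -[_%:A]/(in_alg K _) -rmorphM mulVf ?rmorph1.
move=> /rint_rat[z /(congr1 (fun q => q * 2%:R))]; rewrite mulVf // -[2%:R]/((2 : int)%:~R) -intrM => /esym/eqP.
rewrite -[1]/((1 : int)%:~R) eqr_int => /eqP; lia.
Qed.

(** Two cases are degenerate. For [k = 0] the obstruction is the empty product, and dividing a power
    of it would make the iterate a unit. If the iterate is [0], then [k = 0] and there is no [j] to
    consider. *)
Lemma new_prime_divisor k m alpha : (0 < m)%N -> 𝔬 alpha -> ~ is_unit (poly_iter f m).[alpha] ->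
  ((0 < k)%N -> (denominator b * k)%N%:R <= ln (lambda R (poly_iter f m).[alpha])) ->
  ((poly_iter f m).[alpha] = 0 -> k = 0%N) ->
  exists P, [/\ prime_ideal P, ideal_divides P (poly_iter f m).[alpha]
    & forall j : nat, (m <= j + k)%N -> (j < m)%N -> ~ ideal_divides P (poly_iter f j).[alpha]].
Proof.
move=> m0 Oal nu hk h0; set ga := (poly_iter f m).[alpha] in nu hk h0 *.
have Oga : 𝔬 ga by apply: rint_poly_iter.
have [ga0|ga0] := eqVneq ga 0.
  have [P pP] := prime_ideal_exists; exists P; split=> //.
    by apply: mem_ideal_divides; rewrite // ga0; apply: ideal0; apply: prime_ideal_mem.
  by move=> j; rewrite h0 // addn0 leqNgt => /negP.
have [[e dv]|nodv] := pselect (exists e, principal_ideal ga (obstruction k ^+ e)).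
  exfalso; have [k0|kpos] := posnP k.
    move: dv; rewrite k0 /obstruction big_ord0 expr1n => -[c Oc Ec]; apply: nu.
    by split=> //; exists c; rewrite // mulrC.
  have gaE : ga = f.[(poly_iter f m.-1).[alpha]] by rewrite /ga -(prednK m0) poly_iterS.
  have := @height_of_divisor k e (poly_iter f m.-1).[alpha] kpos (rint_poly_iter _ Oal).
  by rewrite -gaE => /(_ ga0 dv); rewrite ltNge hk.
have [|P [pP gaP nP]] := @prime_avoiding K (principal_ideal ga) (obstruction k) (nonzero_ideal_principal Oga ga0) (rint_obstruction k).
  by move=> e dv; apply: nodv; exists e.
have iP := prime_ideal_mem pP.
have Pga : P ga by apply/gaP/principal_ideal_self.
exists P; split=> //; first exact: mem_ideal_divides.
move=> j mjk jm /(ideal_divides_mem iP) Pj; apply: nP.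
have ik : ((m - j).-1 < k)%N by move: mjk jm; clear; lia.
have E : ga = (poly_iter f (m - j)).[(poly_iter f j).[alpha]] by rewrite -poly_iterD subnK // ltnW.
(* [P] contains the iterates of order [m] and [j], hence also [f^(m - j)(0)], one of the factors of
   the obstruction. *)
have Pi : P (poly_iter f (m - j)).[0].
  have Opi : integral_coefs (poly_iter f (m - j)).
    elim: (m - j)%N => [|n IH] i; first by rewrite coefX; apply: rint_nat.
    rewrite /poly_iter iterS -/(poly_iter f n) /comp_poly horner_coef coef_sum.
    apply: rint_sum => l; rewrite coef_map /= coefCM; apply: rintM; first exact: rint_f.
    elim: (l : nat) i => [|l' IH'] i; first by rewrite expr0 coef1; apply: rint_nat.
    by rewrite exprS coefM; apply: rint_sum => t; apply: rintM.
  have [w Ow Ew] := rint_eval_sub Opi (rint_poly_iter j Oal) (rint0 K).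
  have -> : (poly_iter f (m - j)).[0] = ga - (poly_iter f j).[alpha] * w.
    by rewrite E -[_ * w]/(_ * w) -{2}[(poly_iter f j).[alpha]]subr0 -Ew opprB addrC subrK.
  by apply: idealB => //; apply: idealMr.
have mj : (0 < m - j)%N by rewrite subn_gt0.
have -> : obstruction k = (poly_iter f (m - j)).[0] * \prod_(i < k | i != Ordinal ik) (poly_iter f i.+1).[0].
  have E1 : (Ordinal ik).+1 = (m - j)%N by exact: prednK mj.
  by rewrite /obstruction (bigD1 (Ordinal ik)) // E1.
apply: idealMr => //; rewrite big_mkcond; apply: rint_prod => i; case: ifP => _; last exact: rint1.
by apply: rint_poly_iter; apply: rint0.
Qed.

End Core.

Lemma sum_ord_lt m n : (m <= n)%N -> (\sum_(i < n | (i < m)%N) 1 = m)%N.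
Proof. by move=> mn; rewrite -(big_ord_widen n (fun=> 1%N) mn) sum1_card card_ord. Qed.

(** * Computable functions *)

Section Computability.
Implicit Types (v w : seq nat) (k : nat).

(** Programs take lists of any length; [k] records on which lists the program has to be right. *)
Definition comp k (F : seq nat -> nat) := exists e, forall v, size v = k -> mr_eval e v (F v).

Lemma comp_ext k F G : (forall v, size v = k -> F v = G v) -> comp k F -> comp k G.
Proof. by move=> FG [e He]; exists e => v sv; rewrite -FG //; apply: He. Qed.

(** Variables are read after some [behead], the form in which they occur in the bodies of sums and
    iterations. *)
Lemma comp_nth k j i : comp k (fun v => nth 0%N (iter j behead v) i).
Proof.
exists (mr_proj (j + i)) => v _; have -> : nth 0%N (iter j behead v) i = nth 0%N v (j + i).
  by elim: j i => [|j IH] i //; rewrite iterS nth_behead IH addnS addSn.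
exact: ev_proj.
Qed.

Lemma comp_head k j : comp k (fun v => head 0%N (iter j behead v)).
Proof. by apply: comp_ext (comp_nth k j 0) => v _; rewrite nth0. Qed.

Lemma comp_const k n : comp k (fun=> n).
Proof.
elim: n => [|n [e He]]; first by exists mr_zero => v _; apply: ev_zero.
exists (mr_comp mr_succ [:: e]) => v sv; apply: (@ev_comp _ _ _ [:: n]); last exact: (ev_succ [:: n]).
by apply: evs_cons; [apply: He | apply: evs_nil].
Qed.

Lemma comps_eval k (Gs : seq (seq nat -> nat)) : (forall i, (i < size Gs)%N -> comp k (nth (fun=> 0%N) Gs i)) ->
  exists es, forall v, size v = k -> mr_evals es v [seq G v | G <- Gs].
Proof.
elim: Gs => [|G Gs IH] H; first by exists [::] => v _; apply: evs_nil.
have [e He] := H 0%N isT; have [es Hes] := IH (fun i => H i.+1).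
by exists (e :: es) => v sv; apply: evs_cons; [apply: He | apply: Hes].
Qed.

Lemma comp_app k (Gs : seq (seq nat -> nat)) F : comp (size Gs) F ->
  (forall i, (i < size Gs)%N -> comp k (nth (fun=> 0%N) Gs i)) -> comp k (fun v => F [seq G v | G <- Gs]).
Proof.
move=> [e He] /comps_eval[es Hes]; exists (mr_comp e es) => v sv.
by apply: ev_comp (Hes v sv) _; apply: He; rewrite size_map.
Qed.

Lemma comp_rec k K G H : comp k K -> comp k G -> comp k.+2 H ->
  comp k (fun v => nat_rect (fun=> nat) (G v) (fun i z => H [:: i, z & v]) (K v)).
Proof.
move=> [eK HK] [eG HG] [eH HH].
have [es Hes] : exists es, forall v, size v = k -> mr_evals es v v.
  have [|es Hes] := @comps_eval k [seq (fun v => nth 0%N v i) | i <- iota 0 k].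
    move=> i; rewrite size_map size_iota => ik; rewrite (nth_map 0%N) ?size_iota // nth_iota //.
    exact: (comp_nth k 0 i).
  exists es => v sv; move: (Hes v sv); rewrite -map_comp /=.
  have -> // : map ((@^~ v) \o (fun i v => nth 0%N v i)) (iota 0 k) = v.
  by rewrite -[RHS](mkseq_nth 0%N) /mkseq sv; apply: eq_map.
exists (mr_comp (mr_rec eG eH) (eK :: es)) => v sv.
apply: (@ev_comp _ _ _ (K v :: v)); first by apply: evs_cons; [apply: HK | apply: Hes].
elim: (K v) => [|n IH] /=; first by apply: ev_rec0; apply: HG.
by apply: ev_recS IH _; apply: HH; rewrite /= sv.
Qed.

(** Inserts [n] dummy arguments after the first one, such as the accumulator of a recursion. *)
Lemma comp_lift k n G : comp k.+1 (fun w => G (head 0%N w) (behead w)) ->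
  comp (n + k).+1 (fun w => G (head 0%N w) (drop n (behead w))).
Proof.
move=> cG; pose Gs := [seq (fun w : seq nat => nth 0%N w i) | i <- 0%N :: iota n.+1 k].
have sGs : size Gs = k.+1 by rewrite size_map /= size_iota.
have H : comp (n + k).+1 (fun v => (fun w => G (head 0%N w) (behead w)) [seq g v | g <- Gs]).
  refine (comp_app (F := fun w => G (head 0%N w) (behead w)) _ _); rewrite sGs // => i ik.
  rewrite (nth_map 0%N) /= ?size_iota //; exact: (comp_nth _ 0).
apply: comp_ext H => w sw.
case: w sw => [//|x w] [sw]; rewrite /Gs -map_comp /=; congr (G x _).
apply: (@eq_from_nth _ 0%N); first by rewrite size_map size_iota size_drop sw addKn.
move=> i; rewrite size_map size_iota => ik; rewrite (nth_map 0%N) ?size_iota // nth_iota //=.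
by rewrite nth_drop.
Qed.

Lemma comp_iter k K G (H : nat -> seq nat -> nat) : comp k K -> comp k G ->
  comp k.+1 (fun w => H (head 0%N w) (behead w)) ->
  comp k (fun v => iter (K v) (fun z => H z v) (G v)).
Proof.
move=> cK cG cH; have cH' : comp k.+2 (fun w => H (head 0%N (behead w)) (behead (behead w))).
  have [e He] := cH.
  have [es Hes] : exists es, forall w, size w = k.+2 -> mr_evals es w (behead w).
    have [|es Hes] := @comps_eval k.+2 [seq (fun v => nth 0%N v i) | i <- iota 1 k.+1].
      move=> i; rewrite size_map size_iota => ik; rewrite (nth_map 0%N) ?size_iota // nth_iota //.
      exact: (comp_nth _ 0).
    exists es => w sw; move: (Hes w sw); rewrite -map_comp.
    have -> // : map ((@^~ w) \o (fun i v => nth 0%N v i)) (iota 1 k.+1) = behead w.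
    apply: (@eq_from_nth _ 0%N); first by rewrite size_map size_iota size_behead sw.
    move=> i; rewrite size_map size_iota => ik; rewrite (nth_map 0%N) ?size_iota // nth_iota //=.
    by rewrite nth_behead.
  exists (mr_comp e es) => w sw; apply: ev_comp (Hes w sw) _.
  by have := He (behead w); rewrite size_behead sw; apply.
apply: comp_ext (comp_rec cK cG cH') => v _.
by elim: (K v) => //= n ->.
Qed.

Lemma comp_comp1 k (f : nat -> nat) F : comp 1 (fun v => f (nth 0%N v 0)) -> comp k F -> comp k (fun v => f (F v)).
Proof. by move=> cf cF; apply: (@comp_app k [:: F] _ cf) => -[|i] //. Qed.

Lemma comp_comp2 k (f : nat -> nat -> nat) F G : comp 2 (fun v => f (nth 0%N v 0) (nth 0%N v 1)) ->
  comp k F -> comp k G -> comp k (fun v => f (F v) (G v)).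
Proof. by move=> cf cF cG; apply: (@comp_app k [:: F; G] _ cf) => -[|[|i]] //. Qed.

Lemma comp_succ k F : comp k F -> comp k (fun v => (F v).+1).
Proof.
apply: comp_comp1; exists mr_succ => v sv; rewrite nth0; exact: ev_succ.
Qed.

Lemma comp_pred k F : comp k F -> comp k (fun v => (F v).-1).
Proof.
apply: comp_comp1; apply: comp_ext (comp_rec (comp_nth 1 0 0) (comp_const 1 0) (comp_nth 3 0 0)) => v _ /=.
by case: (nth _ _ _).
Qed.

Lemma comp_add k F G : comp k F -> comp k G -> comp k (fun v => F v + G v)%N.
Proof.
move=> cF cG; apply: comp_ext (comp_iter (H := fun z _ => z.+1) cF cG _) => [v _|]; last exact/comp_succ/(comp_head _ 0).
by rewrite -[LHS]/(iter (F v) succn (G v)) iter_succn addnC.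
Qed.

Lemma comp_sub k F G : comp k F -> comp k G -> comp k (fun v => F v - G v)%N.
Proof.
move=> cF cG; apply: comp_ext (comp_iter (H := fun z _ => z.-1) cG cF _) => [v _|]; last exact/comp_pred/(comp_head _ 0).
by rewrite -[LHS]/(iter (G v) predn (F v)) iter_predn.
Qed.

Lemma comp_sum k K (F : nat -> seq nat -> nat) : comp k K -> comp k.+1 (fun w => F (head 0%N w) (behead w)) ->
  comp k (fun v => \sum_(i < K v) F i v)%N.
Proof.
move=> cK cF; have cH := comp_add (comp_nth k.+2 0 1) (comp_lift 1 cF).
apply: comp_ext (comp_rec cK (comp_const k 0) cH) => v _.
elim: (K v) => [|n /= IH]; first by rewrite big_ord0.
by rewrite big_ord_recr /= -IH drop0.
Qed.

Lemma comp_mul k F G : comp k F -> comp k G -> comp k (fun v => F v * G v)%N.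
Proof.
apply: (comp_comp2 (f := muln)).
apply: comp_ext (comp_sum (F := fun _ v => nth 0%N v 1) (comp_nth 2 0 0) (comp_nth 3 1 1)) => v _.
by rewrite sum_nat_const card_ord.
Qed.

Lemma comp_exp k F G : comp k F -> comp k G -> comp k (fun v => F v ^ G v)%N.
Proof.
apply: (comp_comp2 (f := expn)).
apply: comp_ext (comp_iter (H := fun z v => (nth 0 v 0 * z)%N) (comp_nth 2 0 1) (comp_const 2 1) _) => [v _|].
  by elim: (nth 0%N v 1) => //= n ->; rewrite expnS.
by apply: comp_mul; [exact: (comp_nth _ 1 0) | exact: (comp_head _ 0)].
Qed.

Lemma comp_leq k F G : comp k F -> comp k G -> comp k (fun v => nat_of_bool (F v <= G v)%N).
Proof.
move=> cF cG; apply: comp_ext (comp_sub (comp_const k 1) (comp_sub cF cG)) => v _.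
by rewrite -subn_eq0; case: (F v - G v)%N.
Qed.

(** The quotient counts the positive multiples of the divisor up to the dividend; the first factor
    of the summand takes care of the divisor [0]. *)
Lemma comp_divn k F G : comp k F -> comp k G -> comp k (fun v => F v %/ G v)%N.
Proof.
apply: (comp_comp2 (f := divn)).
have c1 : comp 3 (fun w => (nat_of_bool (1 <= nth 0 (behead w) 1) * nat_of_bool ((head 0 w).+1 * nth 0 (behead w) 1 <= nth 0 (behead w) 0))%N).
  apply: comp_mul; apply: comp_leq; rewrite ?(comp_const, comp_nth 3 1) //; try exact: comp_const; try exact: (comp_nth 3 1).
  by apply: comp_mul; [exact/comp_succ/(comp_head 3 0) | exact: (comp_nth 3 1)].
apply: comp_ext (comp_sum (F := fun i v => (nat_of_bool (1 <= nth 0 v 1) * nat_of_bool (i.+1 * nth 0 v 1 <= nth 0 v 0))%N) (comp_nth 2 0 0) c1) => v _.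
move: (nth 0%N v 0) (nth 0%N v 1) => a d; have [->|d0] := posnP d; first by rewrite divn0 big1.
transitivity (\sum_(i < a | (i < a %/ d)%N) 1)%N.
  by rewrite [RHS]big_mkcond; apply: eq_bigr => i _; rewrite mul1n -leq_divRL //; case: (_ <= _)%N.
by rewrite sum_ord_lt // leq_div.
Qed.

Lemma comp_modn k F G : comp k F -> comp k G -> comp k (fun v => F v %% G v)%N.
Proof.
move=> cF cG; apply: comp_ext (comp_sub cF (comp_mul (comp_divn cF cG) cG)) => v _.
by rewrite {1}(divn_eq (F v) (G v)) addKn.
Qed.

Lemma comp_fact k F : comp k F -> comp k (fun v => (F v)`!).
Proof.
apply: (comp_comp1 (f := factorial)).
have c1 : comp 3 (fun w => ((nth 0 w 0).+1 * nth 0 w 1)%N).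
  by apply: comp_mul; [exact/comp_succ/(comp_nth 3 0) | exact: (comp_nth 3 0)].
apply: comp_ext (comp_rec (comp_nth 1 0 0) (comp_const 1 1) c1) => v _ /=.
by elim: (nth 0%N v 0) => //= n ->; rewrite factS.
Qed.

(** A nonempty list has the code [2^a (2 c + 1)], with [a] its head and [c] the code of its tail; so
    the head is a 2-adic valuation. *)
Definition code_head c := (\sum_(a < c) (c %% 2 ^ a.+1 <= 0))%N.
Definition code_tail c := (c %/ 2 ^ code_head c %/ 2)%N.
Definition code_nth i c := code_head (iter i code_tail c).
Definition code_size c := (\sum_(i < c) (1 <= iter i code_tail c))%N.

Lemma code_head_cons a s : code_head (CodeSeq.code (a :: s)) = a.
Proof.
rewrite /code_head /=; set c := (2 ^ a * _)%N.
have c0 : (0 < c)%N by rewrite muln_gt0 expn_gt0.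
have ac : (a < c)%N by apply: leq_trans (ltn_expl a (ltnSn 1)) _; rewrite leq_pmulr.
transitivity (\sum_(i < c | (i < a)%N) 1)%N.
  rewrite [RHS]big_mkcond; apply: eq_bigr => i _; rewrite leqn0 -/(_ %| c)%N.
  have -> : (2 ^ i.+1 %| c)%N = (i < a)%N; last by case: ltnP.
  rewrite /c; case: ltnP => [ia|ai]; first by rewrite dvdn_mulr // dvdn_exp2l.
  apply/negP => /(dvdn_trans (dvdn_exp2l 2 (ai : (a.+1 <= i.+1)%N))).
  by rewrite expnS mulnC dvdn_pmul2l ?expn_gt0 // dvdn2 /= odd_double.
by rewrite sum_ord_lt // ltnW.
Qed.

Lemma code_tail_cons a s : code_tail (CodeSeq.code (a :: s)) = CodeSeq.code s.
Proof.
rewrite /code_tail code_head_cons /= mulKn ?expn_gt0 // divn2 /= uphalf_double //.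
Qed.

Lemma code_nthE i s : code_nth i (CodeSeq.code s) = nth 0%N s i.
Proof.
rewrite /code_nth; elim: i s => [|i IH] [|a s] //=.
- by rewrite /code_head big_ord0.
- exact: code_head_cons.
- rewrite -iterS iterSr; have -> : code_tail 0 = 0%N by rewrite /code_tail div0n div0n.
  by have := IH [::]; rewrite nth_nil.
- by rewrite -iterS iterSr code_tail_cons IH.
Qed.

Lemma size_code_le s : (size s <= CodeSeq.code s)%N.
Proof.
elim: s => //= a s IH; apply: leq_trans (_ : (CodeSeq.code s).*2.+1 <= _)%N; last by rewrite leq_pmull // expn_gt0.
by rewrite ltnS -addnn (leq_trans IH) // leq_addr.
Qed.

Lemma code_sizeE s : code_size (CodeSeq.code s) = size s.
Proof.
have E i : (1 <= iter i code_tail (CodeSeq.code s))%N = (i < size s)%N.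
  elim: i s => [|i IH] [|a s] //; first by rewrite /= muln_gt0 expn_gt0.
    rewrite iterSr; have -> : code_tail (CodeSeq.code [::]) = CodeSeq.code [::] by rewrite /code_tail div0n div0n.
    by rewrite IH.
  by rewrite iterSr code_tail_cons IH.
rewrite /code_size; transitivity (\sum_(i < CodeSeq.code s | (i < size s)%N) 1)%N.
  by rewrite [RHS]big_mkcond; apply: eq_bigr => i _; rewrite E; case: ltnP.
by rewrite sum_ord_lt // size_code_le.
Qed.

Lemma comp_code_head k F : comp k F -> comp k (fun v => code_head (F v)).
Proof.
apply: comp_comp1; apply: (comp_sum (F := fun a v => nat_of_bool (nth 0 v 0 %% 2 ^ a.+1 <= 0)%N) (comp_nth 1 0 0)).
apply: comp_leq; last exact: comp_const.
apply: comp_modn; first exact: (comp_nth 2 1).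
by apply: comp_exp; [exact: comp_const | exact/comp_succ/(comp_head 2 0)].
Qed.

Lemma comp_code_tail k F : comp k F -> comp k (fun v => code_tail (F v)).
Proof.
move=> cF; apply: comp_divn (comp_const _ _); apply: comp_divn => //.
by apply: comp_exp; [exact: comp_const | exact: comp_code_head].
Qed.

Lemma comp_code_iter k F G : comp k F -> comp k G -> comp k (fun v => iter (F v) code_tail (G v)).
Proof.
by move=> cF cG; apply: (comp_iter (H := fun z _ => code_tail z)) => //; apply/comp_code_tail/(comp_head _ 0).
Qed.

Lemma comp_code_nth k F G : comp k F -> comp k G -> comp k (fun v => code_nth (F v) (G v)).
Proof. by move=> cF cG; apply/comp_code_head/comp_code_iter. Qed.

Lemma comp_code_size k F : comp k F -> comp k (fun v => code_size (F v)).
Proof.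
apply: comp_comp1; apply: (comp_sum (F := fun i v => nat_of_bool (1 <= iter i code_tail (nth 0 v 0))%N) (comp_nth 1 0 0)).
by apply: comp_leq; [exact: comp_const | apply: comp_code_iter; [exact: (comp_head 2 0) | exact: (comp_nth 2 1)]].
Qed.

End Computability.

(** * Tests modulo an integer *)

Definition bsum n (F : nat -> nat) := (\sum_(i < n) F i)%N.

Lemma comp_bsum k K (F : nat -> seq nat -> nat) : comp k K -> comp k.+1 (fun w => F (head 0%N w) (behead w)) ->
  comp k (fun v => bsum (K v) (fun i => F i v)).
Proof. exact: comp_sum. Qed.

Ltac comp_tac := repeat first
  [ exact: comp_const | exact: (comp_head _ 0) | exact: (comp_nth _ 0) | exact: (comp_nth _ 1)
  | exact: (comp_nth _ 2) | exact: (comp_nth _ 3) | exact: (comp_nth _ 4)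
  | exact: (comp_head _ 1) | exact: (comp_head _ 2) | exact: (comp_head _ 3)
  | apply: comp_succ | apply: comp_add | apply: comp_sub | apply: comp_mul | apply: comp_exp | apply: comp_leq
  | apply: comp_modn | apply: comp_divn | apply: comp_fact | apply: comp_code_nth | apply: comp_code_size
  | apply: comp_code_iter ].

(** The residue modulo [m] of [A] times the rational coded by [c], for [A] a multiple of its
    denominator. The parity of the code of the numerator gives the sign, and [1 + (m - 2)] stands
    for [- 1]. *)
Definition coef_of (A m c : nat) : nat :=
  ((code_nth 0 c).+1 %/ 2 * A %/ (code_nth 1 c %/ 2) * (1 + (code_nth 0 c %% 2) * (m - 2)))%N.

(* The code of the [j]-th entry of a list of codes is [code_nth j]. *)
Definition eval_of (A B m c : nat) : nat :=
  (bsum (code_size c) (fun j => coef_of A m (code_nth j c) * A ^ (code_size c - j.+1) * B ^ j))%N.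

Definition deriv_of (A B m c : nat) : nat :=
  (bsum (code_size c) (fun j => j * coef_of A m (code_nth j c) * A ^ (code_size c - j.+1) * B ^ (j - 1)))%N.

(* The base [2 off + 1] digits of [r], shifted by [- off], are arbitrary
   integer coefficients of absolute value at most [off]. *)
Definition digits_of (m r off N X Y : nat) : nat :=
  (bsum (N) (fun j => (r %/ (2 * off + 1) ^ j %% (2 * off + 1) + (m - 1) * off) * X ^ j * Y ^ (N - j)))%N.

(** Asks whether [X / Y] is, modulo [m], a root of some monic polynomial of degree [N] with
    coefficients at most [off]; the equation is homogenized to avoid the division. *)
Definition annihilated_of (m off N X Y : nat) : nat :=
  (1 <= bsum ((2 * off + 1) ^ N) (fun r => ((digits_of m r off N X Y + X ^ N) %% m <= 0)))%N.

Lemma comp_coef_of k F1 F2 F3 : comp k F1 -> comp k F2 -> comp k F3 ->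
  comp k (fun v => coef_of (F1 v) (F2 v) (F3 v)).
Proof. by move=> *; rewrite /coef_of; comp_tac. Qed.

Lemma comp_eval_of k F1 F2 F3 F4 : comp k F1 -> comp k F2 -> comp k F3 -> comp k F4 ->
  comp k (fun v => eval_of (F1 v) (F2 v) (F3 v) (F4 v)).
Proof.
move=> c1 c2 c3 c4.
have H : comp 4 (fun v => eval_of (nth 0 v 0) (nth 0 v 1) (nth 0 v 2) (nth 0 v 3))%N.
  rewrite /eval_of; apply: comp_bsum; first by comp_tac.
  by comp_tac; apply: comp_coef_of; comp_tac.
by apply: (@comp_app k [:: F1; F2; F3; F4] _ H) => -[|[|[|[|i]]]].
Qed.

Lemma comp_deriv_of k F1 F2 F3 F4 : comp k F1 -> comp k F2 -> comp k F3 -> comp k F4 ->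
  comp k (fun v => deriv_of (F1 v) (F2 v) (F3 v) (F4 v)).
Proof.
move=> c1 c2 c3 c4.
have H : comp 4 (fun v => deriv_of (nth 0 v 0) (nth 0 v 1) (nth 0 v 2) (nth 0 v 3))%N.
  rewrite /deriv_of; apply: comp_bsum; first by comp_tac.
  by comp_tac; apply: comp_coef_of; comp_tac.
by apply: (@comp_app k [:: F1; F2; F3; F4] _ H) => -[|[|[|[|i]]]].
Qed.

Lemma comp_digits_of k F1 F2 F3 F4 F5 F6 : comp k F1 -> comp k F2 -> comp k F3 -> comp k F4 ->
  comp k F5 -> comp k F6 -> comp k (fun v => digits_of (F1 v) (F2 v) (F3 v) (F4 v) (F5 v) (F6 v)).
Proof.
move=> c1 c2 c3 c4 c5 c6.
have H : comp 6 (fun v => digits_of (nth 0 v 0) (nth 0 v 1) (nth 0 v 2) (nth 0 v 3) (nth 0 v 4) (nth 0 v 5))%N.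
  by rewrite /digits_of; apply: comp_bsum; comp_tac.
by apply: (@comp_app k [:: F1; F2; F3; F4; F5; F6] _ H) => -[|[|[|[|[|[|i]]]]]].
Qed.

Lemma comp_annihilated_of k F1 F2 F3 F4 F5 : comp k F1 -> comp k F2 -> comp k F3 -> comp k F4 ->
  comp k F5 -> comp k (fun v => annihilated_of (F1 v) (F2 v) (F3 v) (F4 v) (F5 v)).
Proof.
move=> c1 c2 c3 c4 c5.
have H : comp 5 (fun v => annihilated_of (nth 0 v 0) (nth 0 v 1) (nth 0 v 2) (nth 0 v 3) (nth 0 v 4))%N.
  rewrite /annihilated_of; apply: comp_leq; first by comp_tac.
  apply: comp_bsum; first by comp_tac.
  by comp_tac; apply: comp_digits_of; comp_tac.
by apply: (@comp_app k [:: F1; F2; F3; F4; F5] _ H) => -[|[|[|[|[|i]]]]].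
Qed.

Lemma algC_cauchy (p : {poly algC}) (z M : algC) : p \is monic -> root p z -> 0 <= M ->
  (forall i, `|p`_i| <= M) -> `|z| <= 1 + M.
Proof.
move=> mp /rootP rz M0 pM; have zr : `|z| \is Num.real by apply: normr_real.
have Mr : 1 + M \is Num.real by rewrite realD ?real1 ?ger0_real.
rewrite real_leNgt //; apply/negP => lt.
have [n sp] : exists n, size p = n.+1.
  by exists (size p).-1; rewrite prednK // lt0n size_poly_eq0 monic_neq0.
have pn : p`_n = 1 by have /monicP := mp; rewrite lead_coefE sp.
have E : z ^+ n = - \sum_(i < n) p`_i * z ^+ i.
  by apply/eqP; move: rz; rewrite horner_coef sp big_ord_recr /= pn mul1r addrC => /eqP; rewrite addr_eq0.
have le : `|z| ^+ n <= M * \sum_(i < n) `|z| ^+ i.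
  rewrite -normrX E normrN; apply: le_trans (ler_norm_sum _ _ _) _; rewrite mulr_sumr.
  by apply: ler_sum => i _; rewrite normrM normrX ler_wpM2r // exprn_ge0.
have geo := subrX1 `|z| n; set S := \sum_(i < n) _ in geo le.
have S0 : 0 <= S by apply: sumr_ge0 => i _; rewrite exprn_ge0.
have : `|z| ^+ n - 1 < `|z| ^+ n by rewrite ltrBlDr ltrDl ltr01.
rewrite geo => lt2; have := lt_le_trans lt2 le; apply/negP; rewrite -real_leNgt ?realM ?ger0_real //; last first.
  by rewrite subr_ge0 (le_trans _ (ltW lt)) // lerDl.
by rewrite ler_wpM2r // lerBrDl ltW.
Qed.

Lemma monic_horner_gt0 (p : {poly int}) (C B : nat) : p \is monic -> (forall i, (absz (p`_i)%R <= C)%N) ->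
  (C < B)%N -> 0 < p.[B%:Z].
Proof.
move=> mp pC CB; have [n sp] : exists n, size p = n.+1.
  by exists (size p).-1; rewrite prednK // lt0n size_poly_eq0 monic_neq0.
have pn : p`_n = 1 by have /monicP := mp; rewrite lead_coefE sp.
rewrite horner_coef sp big_ord_recr /= pn mul1r.
have geo := subrX1 (B%:Z) n; set S := \sum_(i < n) _ in geo.
have le : - (C%:Z * S) <= \sum_(i < n) p`_i * B%:Z ^+ i.
  rewrite /S mulr_sumr -sumrN; apply: ler_sum => i _.
  have q0 : 0 <= B%:Z ^+ i by rewrite exprn_ge0.
  have : - C%:Z <= p`_i by have := pC i; lia.
  by move=> h; rewrite -mulNr ler_wpM2r.
have S0 : 0 <= S by apply: sumr_ge0 => i _; rewrite exprn_ge0.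
have : C%:Z * S <= (B%:Z - 1) * S by rewrite ler_wpM2r //; lia.
by rewrite -geo; move: le; set X := B%:Z ^+ n; set Y := \sum_(_ < _) _; lia.
Qed.

Lemma digits_exist (base N : nat) (d : nat -> nat) : (forall j, (j < N)%N -> (d j < base)%N) ->
  exists2 r, (r < base ^ N)%N & forall j, (j < N)%N -> (r %/ base ^ j %% base = d j)%N.
Proof.
elim: N => [|N IH] H; first by exists 0%N.
have [|r rN rd] := IH; first by move=> j jN; apply: H; apply: ltnW.
have dN := H N (ltnSn N); have b0 : (0 < base)%N by apply: leq_trans dN.
exists (d N * base ^ N + r)%N.
  by rewrite expnS; apply: leq_trans (_ : (d N).+1 * base ^ N <= _)%N; [rewrite mulSn addnC ltn_add2r | rewrite leq_mul2r dN orbT].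
move=> j; rewrite ltnS leq_eqVlt => /orP[/eqP ->|jN].
  by rewrite divnMDl ?expn_gt0 ?b0 // divn_small // addn0 modn_small.
have -> : (d N * base ^ N = d N * base ^ (N - j).-1 * base * base ^ j)%N.
  have -> : (base ^ N = base ^ (N - j).-1 * base * base ^ j)%N by rewrite -expnSr prednK ?subn_gt0 // -expnD subnK // ltnW.
  by rewrite !mulnA.
by rewrite divnMDl ?expn_gt0 ?b0 // -modnDm modnMl add0n modn_mod rd.
Qed.

Lemma real_gap (R : realFieldType) (h u c w v : R) : h + u < c -> w <= u -> c - w <= v -> h < v.
Proof. by move=> ? ? ?; lra. Qed.

Lemma bsum_gt0P n (F : nat -> nat) : (0 < bsum n F)%N <-> exists2 i, (i < n)%N & (0 < F i)%N.
Proof.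
elim: n => [|n IH]; first by rewrite /bsum big_ord0; split=> [|[]].
have -> : bsum n.+1 F = (bsum n F + F n)%N by rewrite /bsum big_ord_recr.
rewrite addn_gt0; split=> [/orP[/IH[i lin Fi]|Fn]|[i iN Fi]]; first by exists i => //; apply: ltnW.
  by exists n.
move: iN; rewrite ltnS leq_eqVlt => /orP[/eqP En|lin]; first by rewrite -{2}En Fi orbT.
by apply/orP; left; apply/IH; exists i.
Qed.

Definition annihilated_by (K : fieldExtType rat) (x : K) (off N : nat) :=
  exists r : {poly int}, [/\ r \is monic, size r = N.+1,
    forall i, (absz (r`_i)%R <= off)%N & root (map_poly intr r) x].

Lemma natr_neq0 (K : fieldExtType rat) n : (0 < n)%N -> n%:R != 0 :> K.
Proof. by move=> n0; rewrite -(rmorph_nat (in_alg K)) fmorph_eq0 pnatr_eq0 -lt0n. Qed.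

Lemma root_algC_le (q : {poly int}) (C : nat) (z : algC) : q \is monic -> (forall i, (absz (q`_i)%R <= C)%N) ->
  root (map_poly intr q) z -> `|z| <= C.+1%:R.
Proof.
move=> mq qC rz; have -> : C.+1%:R = 1 + C%:R :> algC by rewrite -natr1 addrC.
apply: (@algC_cauchy (map_poly intr q)) => //; first exact: monic_map.
by move=> i; rewrite coef_map /= -intr_norm -abszE -pmulrn ler_nat.
Qed.

(** The conjugates of [s] are roots of the annihilating polynomial, hence at most [b + 2], and the
    minimal polynomial is the product of the corresponding linear factors. This makes the search for
    a relation of low degree finite. *)
Lemma annihilated_minPoly (K : fieldExtType rat) (s : K) b : annihilated s b ->
  exists r : {poly int}, [/\ r \is monic, minPoly 1 s = map_poly intr r
    & forall i, (absz (r`_i)%R <= (b + 3) ^ (size r).-1)%N].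
Proof.
move=> hs; have [r mr Er] := minPoly_rint (annihilated_rint hs); exists r; split=> // i.
have [q [mq sq qb rq]] := hs.
have E (F : fieldType) (g : {rmorphism rat -> F}) (u : {poly int}) : map_poly g (map_poly intr u) = map_poly intr u.
  by rewrite -map_poly_comp; apply: eq_map_poly => c /=; rewrite rmorph_int.
have dv : (map_poly intr r : {poly rat}) %| map_poly intr q.
  rewrite -(dvdp_map (in_alg K)) !E -Er; apply: minPoly_dvdp => //.
  by apply/polyOver1P; exists (map_poly intr q); rewrite E.
have rz (z : algC) : root (map_poly intr r) z -> `|z| <= (b + 2)%:R.
  rewrite addn2 => rz; apply: (root_algC_le mq qb); apply: root_dvdp rz.
  by rewrite -!(E _ (ratr : {rmorphism rat -> algC})) dvdp_map.
have [zs Ezs] := closed_field_poly_normal (map_poly intr r : {poly algC}).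
rewrite lead_coef_map_inj ?rmorph0 // in Ezs; last exact: intr_inj.
rewrite (monicP mr) scale1r in Ezs.
have sz : size zs = (size r).-1.
  by rewrite -(size_map_inj_poly (@intr_inj algC) (rmorph0 _) r) Ezs size_prod_XsubC.
have := @coef_prod_XsubC_le algC zs (b + 2)%:R i (ler0n _ _).
rewrite -Ezs coef_map /= -intr_norm -abszE -pmulrn -[1]/(1%:R) -natrD -natrX ler_nat sz.
have -> : (1 + (b + 2) = b + 3)%N by rewrite add1n -addnS.
by apply => z zz; apply: rz; rewrite Ezs root_prod_XsubC.
Qed.

(* [code_rat] doubles the numerator and stores its sign in the lowest bit. *)
Lemma code_intE (z : int) : ((code_int z).+1 %/ 2 = absz z)%N /\ (code_int z %% 2 = nat_of_bool (z < 0)%R)%N.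
Proof. by case: z => n /=; split; lia. Qed.

Lemma code_denE (x : rat) : (code_int (denq x) %/ 2 = absz (denq x))%N.
Proof. by have := denq_gt0 x; case: (denq x) => n //= _; lia. Qed.

Lemma code_poly_bound (q : {poly rat}) I : (code_poly q <= I)%N ->
  [/\ (size q <= I)%N, forall j, (absz (numq q`_j) <= I)%N & forall j, (absz (denq q`_j) %| I`!)%N].
Proof.
move=> qI; have bound j : (j < size q)%N -> (code_rat q`_j < I)%N.
  move=> jq; apply: leq_trans qI; have /allP := CodeSeq.ltn_code (map code_rat q); apply.
  by apply: map_f; apply: mem_nth.
have bz z x : z \in [:: code_int (numq x); code_int (denq x)] -> (z < code_rat x)%N.
  by move=> zi; have /allP := CodeSeq.ltn_code [:: code_int (numq x); code_int (denq x)]; apply.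
have az z : (absz z <= code_int z)%N by case: z => n /=; lia.
split=> [|j|j].
- by apply: leq_trans qI; rewrite -[size q](size_map code_rat); apply: size_code_le.
- have [jq|jq] := ltnP j (size q); last by rewrite nth_default.
  apply: leq_trans (az _) _; apply: ltnW; apply: ltn_trans (bound j jq); apply: bz; exact: mem_head.
- have [jq|jq] := ltnP j (size q); last by rewrite nth_default // dvd1n.
  apply: dvdn_fact; rewrite absz_gt0 denq_neq0 /=; apply: leq_trans (az _) _; apply: ltnW.
  by apply: ltn_trans (bound j jq); apply: bz; rewrite !inE eqxx orbT.
Qed.

(** The candidates are quotients by a derivative, the shape that Euler's formula gives to integers.
    A candidate generates [K] if no monic polynomial of degree [n - 1] with coefficients at most [E]
    kills it. *)
Definition generator_test (m B A D E n b P0 : nat) : nat :=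
  (1 <= bsum ((2 * D + 1) ^ n) (fun x =>
    annihilated_of m b.+1 b (digits_of m x D n B 1) (deriv_of A B m P0) *
    (annihilated_of m E n.-1 (digits_of m x D n B 1) (deriv_of A B m P0) <= 0)))%N.

(** The last factor asks that the coefficients of index at least [b] vanish, which amounts to
    [size f <= b]. *)
Definition coef_test (m B A b c i : nat) : nat :=
  (annihilated_of m b.+1 b (eval_of A B m c) (A ^ code_size c) * ((i.+1 <= b) + (eval_of A B m c %% m <= 0)))%N.

(** * Correctness of the tests *)

Section Representation.
Variables (R : realType) (K : fieldExtType rat) (L : splittingFieldType rat).
Hypothesis galL : galois 1 {:L}.
Variables (phi : {rmorphism L -> R[i]}) (io : {rmorphism K -> L}) (tt : K) (m B : nat).
Implicit Types (rho : {poly int}) (z H : nat).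
Local Notation ev rho := (map_poly intr rho).[tt].

(* [z] is the residue of [rho(B)] modulo [m], and [H] bounds the conjugates of [rho(tt)]. *)
Definition rep z rho H := (m%:Z %| z%:Z - rho.[B%:Z])%Z /\ forall g, av phi g (io (ev rho)) <= H%:R.

Lemma rep_le z rho H H' : (H <= H')%N -> rep z rho H -> rep z rho H'.
Proof. by move=> le [h1 h2]; split=> // g; apply: le_trans (h2 g) _; rewrite ler_nat. Qed.

Lemma rep_const z (c : int) H : (m%:Z %| z%:Z - c)%Z -> (absz c <= H)%N -> rep z c%:P H.
Proof.
move=> h1 h2; split=> [|g]; first by rewrite hornerC.
rewrite map_polyC hornerC /= rmorph_int; apply: le_trans (absval_int_le (avP phi g) _) _.
by rewrite -[H%:R]/((H%:Z)%:~R) ler_int -abszE lez_nat.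
Qed.

Lemma rep_nat c : rep c (c%:Z)%:P c.
Proof. by apply: rep_const; rewrite ?subrr ?dvdz0 // absz_nat. Qed.

Lemma rep_add z z' rho rho' H H' : rep z rho H -> rep z' rho' H' -> rep (z + z') (rho + rho') (H + H').
Proof.
move=> [h1 h2] [h1' h2']; split=> [|g].
  by rewrite hornerD PoszD opprD addrACA; apply: rpredD.
rewrite rmorphD hornerD rmorphD natrD; apply: le_trans (absvalD (avP phi g) _ _) _; exact: lerD.
Qed.

Lemma rep_mul z z' rho rho' H H' : rep z rho H -> rep z' rho' H' -> rep (z * z') (rho * rho') (H * H').
Proof.
move=> [h1 h2] [h1' h2']; split=> [|g].
  have -> : (z * z')%N%:Z - (rho * rho').[B%:Z] = (z%:Z - rho.[B%:Z]) * z'%:Z + rho.[B%:Z] * (z'%:Z - rho'.[B%:Z]).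
    by rewrite hornerM PoszM; ring.
  by apply: rpredD; [apply: dvdz_mulr | apply: dvdz_mull].
rewrite rmorphM hornerM rmorphM natrM (absvalM (avP phi g)); apply: ler_pM => //; exact: absval_ge0 (avP phi g) _.
Qed.

Lemma rep_exp z rho H n : rep z rho H -> rep (z ^ n) (rho ^+ n) (H ^ n).
Proof.
move=> hz; elim: n => [|n IH]; last by rewrite !expnS exprS; apply: rep_mul.
by rewrite expr0 -polyC1; apply: (rep_nat 1).
Qed.

Lemma rep_sum n (z : nat -> nat) (rho : nat -> {poly int}) H :
  (forall j, (j < n)%N -> rep (z j) (rho j) H) -> rep (bsum n z) (\sum_(j < n) rho j) (n * H).
Proof.
rewrite /bsum; elim: n => [|n IH] h; first by rewrite !big_ord0 -polyC0; apply: (rep_nat 0).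
rewrite !big_ord_recr /= (mulSn n H) [(H + _)%N]addnC; apply: rep_add; last exact: h.
by apply: IH => j jn; apply: h; apply: ltnW.
Qed.

Lemma rep_X U : (forall g, av phi g (io tt) <= U%:R) -> rep B 'X U.
Proof. by move=> h; split=> [|g]; rewrite ?hornerX ?subrr ?dvdz0 // map_polyX hornerX. Qed.

Definition digit (r off j : nat) := (r %/ (2 * off + 1) ^ j %% (2 * off + 1))%N.
Definition homogenized (d : nat -> int) N (rX rY : {poly int}) : {poly int} :=
  \sum_(j < N) (d j)%:P * rX ^+ j * rY ^+ (N - j).

Lemma rep_digits r off N zX zY rX rY H : (0 < m)%N -> rep zX rX H -> rep zY rY H ->
  rep (digits_of m r off N zX zY) (homogenized (fun j => (digit r off j)%:Z - off%:Z) N rX rY) (N * (off * H ^ N)).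
Proof.
move=> m0 hX hY; apply: (@rep_sum N _ (fun j => ((digit r off j)%:Z - off%:Z)%:P * rX ^+ j * rY ^+ (N - j))) => j jN.
have -> : (off * H ^ N = off * H ^ j * H ^ (N - j))%N by rewrite -mulnA -expnD subnKC // ltnW.
apply: rep_mul (rep_exp _ hY); apply: rep_mul (rep_exp _ hX); apply: rep_const.
  rewrite -/(digit r off j) PoszD PoszM -subzn //.
  have -> : (digit r off j)%:Z + (m%:Z - 1%:Z) * off%:Z - ((digit r off j)%:Z - off%:Z) = m%:Z * off%:Z by ring.
  exact: dvdz_mulr.
have : (digit r off j < 2 * off + 1)%N by rewrite ltn_mod addn1.
by clear; lia.
Qed.

Lemma homogenizedE d N rX rY : (ev rY != 0) ->
  ev (homogenized d N rX rY) = ev rY ^+ N * (\sum_(j < N) (d j)%:~R * (ev rX / ev rY) ^+ j).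
Proof.
move=> y0; rewrite rmorph_sum horner_sum mulr_sumr; apply: eq_bigr => j _.
rewrite !rmorphM !rmorphXn /= map_polyC !hornerM hornerC !horner_exp /=.
have -> : ev rY ^+ N = ev rY ^+ (N - j) * ev rY ^+ j by rewrite -exprD subnK // ltnW.
rewrite expr_div_n; have := expf_neq0 j y0; move: (ev rY ^+ j) (ev rX ^+ j) => u v u0; by field.
Qed.

Variables (pt : {poly int}) (U : nat).
Hypotheses (mpt : pt \is monic) (Ept : minPoly 1 tt = map_poly intr pt) (gtt : <<1; tt>>%VS = fullv)
  (mE : m%:Z = pt.[B%:Z]) (ttU : forall g, av phi g (io tt) <= U%:R).

Lemma rint_tt : ring_of_integers tt.
Proof. by exists pt => //; rewrite -Ept; apply: root_minPoly. Qed.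

Lemma ev_small_eq0 (r : {poly int}) : (size r < size pt)%N -> ev r = 0 -> r = 0.
Proof.
move=> sr r0; apply/eqP; apply: contraT => rn0.
have rK0 : (map_poly intr r : {poly K}) != 0 by rewrite map_intr_eq0.
have := @minPoly_dvdp _ _ 1%AS tt (map_poly intr r) _ (introT eqP r0).
have pol : (map_poly intr r : {poly K}) \is a polyOver 1%VS.
  apply/polyOver1P; exists (map_poly intr r); rewrite -map_poly_comp.
  by apply: eq_map_poly => c /=; rewrite scaler_int.
by move=> /(_ pol)/(dvdp_leq rK0); rewrite Ept !size_map_intr leqNgt sr.
Qed.

(* A nonzero algebraic integer divisible by [B - tt] has a conjugate of absolute value at least [B - U]. *)
Lemma rep_zero z rho H : rep z rho H -> (H + U < B)%N -> (m %| z)%N = (ev rho == 0).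
Proof.
move=> [h1 h2] HB.
have sub (r : {poly int}) : exists2 w, ring_of_integers w & (r.[B%:Z])%:~R - ev r = (B%:R - tt) * w.
  have Or : integral_coefs (map_poly intr r : {poly K}) by move=> i; rewrite coef_map; apply: rint_int.
  have [w Ow Ew] := rint_eval_sub Or (rint_nat K B) rint_tt; exists w => //.
  by rewrite -Ew -[B%:R]/((B%:Z)%:~R) horner_map.
have mm : (m %| z)%N = (m%:Z %| rho.[B%:Z])%Z.
  by rewrite -[(m %| z)%N]/(m%:Z %| z%:Z)%Z -[z%:Z](subrK rho.[B%:Z]) rpredDl.
rewrite mm; apply/idP/eqP => [|E0].
  move=> /dvdzP[q Eq]; apply/eqP; apply: contraT => x0.
  have [w Ow Ew] := sub rho; have [w' Ow' Ew'] := sub pt.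
  have pt0 : ev pt = 0 by rewrite -Ept minPolyxx.
  rewrite pt0 subr0 -mE in Ew'.
  pose y := w' * q%:~R - w.
  have Ey : ev rho = (B%:R - tt) * y.
    by rewrite /y mulrBr -Ew mulrA -Ew' Eq intrM mulrC; ring.
  have Oy : ring_of_integers y by apply: rintB => //; apply: rintM => //; apply: rint_int.
  have y0 : io y != 0 by rewrite fmorph_eq0; apply: contraNneq x0 => y0; rewrite Ey y0 mulr0.
  have ylt g : av phi g (io y) < 1.
    have vP := avP phi g.
    have Bt : H%:R < av phi g (io (B%:R - tt)).
      have := absval_distl vP (B%:R) (io tt); rewrite rmorphB rmorph_nat.
      have -> : av phi g B%:R = B%:R by rewrite /av !rmorph_nat -[B%:R]/((B%:Z)%:~R) normc_int.
      have := ttU g; have : (H%:R + U%:R < B%:R :> R) by rewrite -natrD ltr_nat.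
      exact: real_gap.
    have := h2 g; rewrite Ey rmorphM (absvalM vP) => h3.
    have H0 : 0 <= H%:R :> R by []; have Bt0 := le_lt_trans H0 Bt.
    by rewrite -(ltr_pM2l Bt0) mulr1; apply: le_lt_trans h3 Bt.
  have Oy' : ring_of_integers (io y) by apply/rint_rmorph.
  have := @av_lower R L galL phi 1%g (io y) 1 Oy' y0 (lexx 1) (fun g => ltW (ylt g)).
  by rewrite expr1n mulr1 leNgt ylt.
pose q := Pdiv.Ring.rdivp rho pt; pose r := Pdiv.Ring.rmodp rho pt.
have Er : rho = q * pt + r by apply: Pdiv.RingMonic.rdivp_eq.
have sr : (size r < size pt)%N by rewrite Pdiv.Ring.ltn_rmodp monic_neq0.
have pt0 : ev pt = 0 by rewrite -Ept minPolyxx.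
have r0 : ev r = 0 by move: E0; rewrite Er rmorphD rmorphM hornerD hornerM pt0 mulr0 add0r.
have -> : rho = q * pt.
  suff r00 : r = 0 by rewrite Er r00 addr0.
  exact: ev_small_eq0.
by rewrite hornerM -mE dvdz_mull.
Qed.

Definition digit_poly (r off N : nat) : {poly int} :=
  'X^N + \poly_(j < N) ((digit r off j)%:Z - off%:Z).

Lemma coef_digit_poly r off N i : (digit_poly r off N)`_i =
  if (i < N)%N then (digit r off i)%:Z - off%:Z else (i == N)%:R.
Proof.
rewrite coefD coefXn coef_poly; case: ltnP => iN; last by rewrite addr0.
by rewrite (ltn_eqF iN) add0r.
Qed.

Lemma size_digit_poly r off N : size (digit_poly r off N) = N.+1.
Proof. by rewrite size_polyDl size_polyXn // ltnS size_poly. Qed.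

Lemma monic_digit_poly r off N : digit_poly r off N \is monic.
Proof. by rewrite monicE lead_coefE size_digit_poly /= coef_digit_poly ltnn eqxx. Qed.

Lemma digit_zeroE r off N zX zY rX rY H : (0 < m)%N -> rep zX rX H -> rep zY rY H -> ev rY != 0 ->
  (N * (off * H ^ N) + H ^ N + U < B)%N ->
  (m %| digits_of m r off N zX zY + zX ^ N)%N = root (map_poly intr (digit_poly r off N)) (ev rX / ev rY).
Proof.
move=> m0 hX hY y0 HB; rewrite (rep_zero (rep_add (rep_digits r off N m0 hX hY) (rep_exp N hX)) HB).
rewrite rmorphD hornerD homogenizedE // rmorphXn horner_exp rootE /digit_poly rmorphD hornerD.
rewrite /= map_polyXn hornerXn.
have -> : (map_poly intr (\poly_(j < N) ((digit r off j)%:Z - off%:Z))).[ev rX / ev rY] =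
    \sum_(j < N) ((digit r off j)%:Z - off%:Z)%:~R * (ev rX / ev rY) ^+ j.
  rewrite poly_def rmorph_sum horner_sum; apply: eq_bigr => j _.
  by rewrite -mul_polyC rmorphM /= map_polyC map_polyXn hornerM hornerC hornerXn.
set S := \sum_(j < N) _; have -> : ev rX ^+ N = ev rY ^+ N * (ev rX / ev rY) ^+ N by rewrite -exprMn mulrC divfK.
by rewrite -mulrDr mulf_eq0 (negPf (expf_neq0 N y0)) addrC.
Qed.

(** The [digit_poly r off N] exhaust the monic polynomials of degree [N] with lower coefficients at
    most [off]; [rep_zero] turns their vanishing into a congruence. *)
Lemma annihilated_ofP off N zX zY rX rY H : (0 < m)%N -> (0 < off)%N ->
  rep zX rX H -> rep zY rY H -> ev rY != 0 -> (N * (off * H ^ N) + H ^ N + U < B)%N ->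
  (0 < annihilated_of m off N zX zY)%N <-> annihilated_by (ev rX / ev rY) off N.
Proof.
move=> m0 o0 hX hY y0 HB; rewrite /annihilated_of lt0b bsum_gt0P.
split=> [[r _]|[r [mr sr rb rr]]].
  rewrite lt0b leqn0 -/(dvdn _ _) (digit_zeroE r m0 hX hY y0 HB) => rr.
  exists (digit_poly r off N); split=> //; rewrite ?monic_digit_poly ?size_digit_poly // => i.
  rewrite coef_digit_poly; case: ifP => _; last by case: (i == N).
  by have : (digit r off i < 2 * off + 1)%N; [rewrite ltn_mod addn1 | clear; lia].
have dlt j : (absz (r`_j + off%:Z)%R < 2 * off + 1)%N by have := rb j; move: (r`_j); clear; lia.
have [x xN xd] := @digits_exist (2 * off + 1) N (fun j => absz (r`_j + off%:Z)%R) (fun j _ => dlt j).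
exists x => //; rewrite lt0b leqn0 -/(dvdn _ _) (digit_zeroE x m0 hX hY y0 HB).
suff -> : digit_poly x off N = r by [].
apply/polyP => i; rewrite coef_digit_poly; case: ltngtP => iN.
- by rewrite /digit xd //; have := rb i; move: (r`_i); clear; lia.
- by rewrite nth_default // sr.
- by have := monicP mr; rewrite lead_coefE sr iN => ->.
Qed.

Lemma rep_coef A I x : (1 < m)%N -> (absz (numq x) <= I)%N -> (absz (denq x) %| A)%N ->
  rep (coef_of A m (code_rat x)) (numq x * (A %/ absz (denq x))%:Z)%:P (I * A).
Proof.
move=> m1 nI dA; apply: rep_const; last by rewrite abszM absz_nat leq_mul // leq_div.
rewrite /coef_of !code_nthE /= code_denE; have [-> ->] := code_intE (numq x).
rewrite -muln_divA //; move: (A %/ _)%N => a; case: (numq x) => n /=.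
  by rewrite mul0n addn0 muln1 PoszM subrr dvdz0.
rewrite mul1n; have -> : (1 + (m - 2) = m - 1)%N by move: m1; clear; lia.
have -> : (n.+1 * a * (m - 1))%N%:Z - Negz n * a%:Z = m%:Z * (n.+1 * a)%N%:Z.
  by rewrite NegzE !PoszM -subzn ?(ltnW m1) //; ring.
exact: dvdz_mulr.
Qed.

(** This is [A^n q(X / A)], with [n] the size of [q], for [A] a multiple of the denominators; its
    value at [A t] is [A^n q(t)]. *)
Definition scaled (A : nat) (q : {poly rat}) : {poly int} :=
  \sum_(j < size q) (numq q`_j * (A %/ absz (denq q`_j))%:Z)%:P * (A ^ (size q - j.+1))%:Z%:P * 'X^j.

Section Scaled.
Variables (A I : nat) (q : {poly rat}).
Hypotheses (A0 : (0 < A)%N) (U0 : (0 < U)%N) (m1 : (1 < m)%N) (sq : (size q <= I)%N)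
  (nI : forall j, (absz (numq q`_j) <= I)%N) (dA : forall j, (absz (denq q`_j) %| A)%N).

Lemma size_code_poly : code_size (code_poly q) = size q.
Proof. by rewrite code_sizeE size_map. Qed.

Lemma code_nth_poly j : (j < size q)%N -> code_nth j (code_poly q) = code_rat q`_j.
Proof. by move=> jq; rewrite code_nthE (nth_map 0). Qed.

Lemma rep_eval : rep (eval_of A B m (code_poly q)) (scaled A q) (I * (I * A * A ^ I * U ^ I)).
Proof.
rewrite /eval_of size_code_poly.
apply: (@rep_le _ _ (size q * (I * A * A ^ I * U ^ I))); first by rewrite leq_mul2r sq orbT.
apply: (@rep_sum _ (fun j => coef_of A m (code_nth j (code_poly q)) * A ^ (size q - j.+1) * B ^ j)%N
  (fun j => (numq q`_j * (A %/ absz (denq q`_j))%:Z)%:P * (A ^ (size q - j.+1))%:Z%:P * 'X^j)).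
move=> j jq; rewrite (code_nth_poly jq).
apply: rep_le (rep_mul (rep_mul (rep_coef m1 (nI j) (dA j)) (rep_nat (A ^ (size q - j.+1)))) (rep_exp j (rep_X ttU))).
rewrite !leq_mul // leq_pexp2l // ?(leq_trans (leq_subr _ _)) //.
by apply: leq_trans sq; apply: ltnW.
Qed.

Lemma rep_deriv : rep (deriv_of A B m (code_poly q)) (scaled A q)^`() (I * (I * (I * A * A ^ I * U ^ I))).
Proof.
have -> : (scaled A q)^`() = \sum_(j < size q) (j%:Z)%:P * (numq q`_j * (A %/ absz (denq q`_j))%:Z)%:P
    * (A ^ (size q - j.+1))%:Z%:P * 'X^(j - 1).
  rewrite /scaled raddf_sum; apply: eq_bigr => j _.
  rewrite /= -polyCM derivM derivC mul0r add0r derivXn subn1 -['X^_ *+ _]mulr_natl.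
  by rewrite -[j%:Z]natz polyC_natr polyCM; ring.
rewrite /deriv_of size_code_poly.
apply: (@rep_le _ _ (size q * (I * (I * A * A ^ I * U ^ I)))); first by rewrite leq_mul2r sq orbT.
apply: (@rep_sum _ (fun j => j * coef_of A m (code_nth j (code_poly q)) * A ^ (size q - j.+1) * B ^ (j - 1))%N
  (fun j => (j%:Z)%:P * (numq q`_j * (A %/ absz (denq q`_j))%:Z)%:P * (A ^ (size q - j.+1))%:Z%:P * 'X^(j - 1))).
move=> j jq; rewrite (code_nth_poly jq).
apply: rep_le (rep_mul (rep_mul (rep_mul (rep_nat j) (rep_coef m1 (nI j) (dA j))) (rep_nat (A ^ (size q - j.+1)))) (rep_exp (j - 1) (rep_X ttU))).
have jI : (j <= I)%N by apply: leq_trans sq; apply: ltnW.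
rewrite -!mulnA !leq_mul // leq_pexp2l // (leq_trans (leq_subr _ _)) //.
Qed.

Lemma ev_scaled (t : K) : tt = A%:R * t -> ev (scaled A q) = A%:R ^+ size q * (map_poly (in_alg K) q).[t].
Proof.
move=> Et; rewrite [X in _ = _ * X]horner_coef size_map_poly mulr_sumr rmorph_sum horner_sum; apply: eq_bigr => j _.
rewrite !rmorphM /= !map_polyC map_polyXn !hornerM !hornerC hornerXn coef_map Et exprMn.
have AK := natr_neq0 K A0.
have -> : A%:R ^+ size q = A%:R * A%:R ^+ (size q - j.+1) * A%:R ^+ j :> K.
  by rewrite -exprS -exprD subnSK // subnK // ltnW.
have E1 : in_alg K q`_j = (numq q`_j)%:~R / (absz (denq q`_j))%:R.
  have -> : (absz (denq q`_j))%:R = (denq q`_j)%:~R :> K.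
    by rewrite -[in RHS](gez0_abs (ltW (denq_gt0 q`_j))).
  by rewrite -{1}[q`_j]divq_num_den rmorphM fmorphV !rmorph_int.
have d0 : (absz (denq q`_j))%:R != 0 :> K by apply: natr_neq0; rewrite absz_gt0 denq_neq0.
have EA : A%:R = (A %/ absz (denq q`_j))%N%:R * (absz (denq q`_j))%:R :> K by rewrite -natrM divnK.
rewrite [X in _ = _ * (X * _)]E1.
change ((numq q`_j)%:~R * (A %/ absz (denq q`_j))%N%:R * (A ^ (size q - j.+1))%N%:R * (A%:R ^+ j * t ^+ j) =
  A%:R * A%:R ^+ (size q - j.+1) * A%:R ^+ j * ((numq q`_j)%:~R / (absz (denq q`_j))%:R * t ^+ j) :> K).
rewrite natrX; move: (A%:R ^+ (size q - j.+1)) (A%:R ^+ j) (t ^+ j) => u v x; rewrite EA.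
by move: ((A %/ _)%N%:R) ((numq _)%:~R) (absz (denq q`_j))%:R d0 => w a d d0; field.
Qed.

End Scaled.
Section Tests.
Variables (A I D E b H : nat) (t : K) (p : {poly rat}).
Hypotheses (I0 : (0 < I)%N) (A0 : (0 < A)%N) (U0 : (0 < U)%N) (m1 : (1 < m)%N) (E0 : (0 < E)%N) (b0 : (0 < b)%N)
  (Et : tt = A%:R * t) (spt : size pt = size p) (Ep : scaled A p = A%:Z *: pt)
  (HB : forall N off, (N <= b + I)%N -> (off <= b.+1 + E)%N -> (N * (off * H ^ N) + H ^ N + U < B)%N)
  (H1 : (I * (I * (I * A * A ^ I * U ^ I)) <= H)%N) (H2 : (I * (D * U ^ I) <= H)%N)
  (H3 : (I * (I * A * A ^ I * U ^ I) <= H)%N) (H4 : (A ^ I <= H)%N).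
Local Notation bounded q := ((size q <= I)%N /\ ((forall j, (absz (numq q`_j) <= I)%N) /\
  (forall j, (absz (denq q`_j) %| A)%N))).

Lemma small_bound H' : (H' <= H)%N -> (H' + U < B)%N.
Proof.
move=> le; have h1 : (1 <= b + I)%N by rewrite addn_gt0 b0.
have h2 : (1 <= b.+1 + E)%N by [].
by apply: leq_ltn_trans (HB h1 h2); rewrite !mul1n expn1; move: le; clear; lia.
Qed.

Lemma coef_testP (q : {poly rat}) i : bounded q ->
  (0 < coef_test m B A b (code_poly q) i)%N <->
  annihilated (map_poly (in_alg K) q).[t] b /\ ((b <= i)%N -> (map_poly (in_alg K) q).[t] = 0).
Proof.
move=> [sq [nI dA]]; have hX := rep_le H3 (rep_eval A0 U0 m1 sq nI dA).
have hY : rep (A ^ size q) ((A ^ size q)%:Z)%:P H.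
  by apply: rep_le (rep_nat _); apply: leq_trans H4; rewrite leq_pexp2l.
have EX : ev (scaled A q) = A%:R ^+ size q * (map_poly (in_alg K) q).[t] by apply: ev_scaled.
have AK : A%:R ^+ size q != 0 :> K by rewrite expf_neq0 // natr_neq0.
have EY : ev ((A ^ size q)%:Z)%:P = A%:R ^+ size q by rewrite map_polyC hornerC /= -natrX.
have Y0 : ev ((A ^ size q)%:Z)%:P != 0 by rewrite EY.
have HB1 := HB (leq_addr I b) (leq_addr E b.+1).
have := annihilated_ofP (ltnW m1) (ltn0Sn b) hX hY Y0 HB1.
rewrite EX EY mulrC mulKf // -[annihilated_by _ _ _]/(annihilated _ b) => P.
have Z : (eval_of A B m (code_poly q) %% m <= 0)%N = ((map_poly (in_alg K) q).[t] == 0).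
  rewrite leqn0 -/(dvdn _ _) (rep_zero hX (small_bound (leqnn H))) EX mulf_eq0.
  by rewrite (negPf AK).
rewrite /coef_test size_code_poly Z muln_gt0 addn_gt0 (lt0b (i < b)%N) (lt0b (_ == _)).
split=> [/andP[/(proj1 P) h1 h2]|[/(proj2 P) h1 h2]].
  by split=> // bi; move: h2; rewrite ltnNge bi /= => /eqP.
by rewrite h1 /=; case: ltnP => // /h2 ->; rewrite eqxx.
Qed.

Lemma ev_deriv_neq0 : ev pt^`() != 0.
Proof.
have sp : (1 < size pt)%N by rewrite -(size_map_intr K) -Ept size_minPoly ltnS -dim_adjoin1 gtt adim_gt0.
apply: contraTneq isT => e0.
have := ev_small_eq0 (r := pt^`()) _ e0; rewrite lt_size_deriv ?monic_neq0 // => /(_ isT) d0.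
have := coef_deriv pt (size pt).-2; rewrite d0 coef0 prednK -?subn1 ?subn_gt0 // subn1.
have := monicP mpt; rewrite lead_coefE => -> /esym/eqP.
by rewrite -mulr_natr mul1r pnatr_eq0; case: (size pt) sp => [|[|k]].
Qed.

(** By [lagrange_rint], an integer killed with bound [b] is among the candidates. An element that
    does not generate [K] is detected through its minimal polynomial, multiplied by a power of [X]
    to reach degree [n - 1], with coefficients at most [E]. *)
Lemma generator_testP : bounded p -> (forall z : algC, root (map_poly intr pt) z -> `|z| <= U%:R) ->
  (A * (I * (b.+2 * (1 + U) ^ I)) <= D)%N -> ((b + 3) ^ b <= E)%N -> (\dim {:K} <= b)%N ->
  (0 < generator_test m B A D E (size p).-1 b (code_poly p))%N <->
  exists s : K, <<1; s>>%VS = fullv /\ annihilated s b.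
Proof.
move=> [sp [nI dA]] ptz leD leE nb.
have sn : (size p).-1 = \dim {:K}.
  by rewrite -spt -(size_map_intr K) -Ept size_minPoly /= -dim_adjoin1 gtt.
have n0 : (0 < (size p).-1)%N by rewrite sn adim_gt0.
set n := (size p).-1 in sn n0 *; have nI' : (n <= I)%N by apply: leq_trans (leq_pred _) sp.
have hY := rep_le H1 (rep_deriv A0 U0 m1 sp nI dA).
have EY : ev (scaled A p)^`() = A%:R * ev pt^`().
  by rewrite Ep derivZ -mul_polyC rmorphM /= map_polyC hornerM hornerC.
have Y0 : ev (scaled A p)^`() != 0 by rewrite EY mulf_neq0 ?natr_neq0 ?ev_deriv_neq0.
pose rX x := homogenized (fun j => (digit x D j)%:Z - D%:Z) n 'X (1%:Z)%:P.
have ev1 : ev (1%:Z)%:P = 1 by rewrite map_polyC hornerC.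
have hX x : rep (digits_of m x D n B 1) (rX x) H.
  apply: rep_le (rep_digits x D n (ltnW m1) (rep_X ttU) (rep_le U0 (rep_nat 1))).
  by apply: leq_trans H2; rewrite !leq_mul // leq_pexp2l.
have EX x : ev (rX x) = \sum_(j < n) ((digit x D j)%:Z - D%:Z)%:~R * tt ^+ j.
  rewrite homogenizedE ?ev1 ?oner_eq0 // expr1n mul1r; apply: eq_bigr => j _.
  by rewrite map_polyX hornerX divr1.
pose s x := ev (rX x) / ev (scaled A p)^`().
have P1 x := annihilated_ofP (ltnW m1) (ltn0Sn b) (hX x) hY Y0 (HB (leq_addr I b) (leq_addr E b.+1)).
have n1b : (n.-1 <= b + I)%N by apply: leq_trans (leq_pred _) _; apply: leq_trans nI' (leq_addl _ _).
have P2 x := annihilated_ofP (ltnW m1) E0 (hX x) hY Y0 (HB n1b (leq_addl b.+1 E)).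
have gen (x : K) : annihilated x b -> <<1; x>>%VS = fullv <-> ~ annihilated_by x E n.-1.
  move=> hx; have [r [mr Er rb]] := annihilated_minPoly hx.
  have sr : size r = (\dim <<1; x>>).+1 by rewrite -(size_map_intr K) -Er size_minPoly dim_adjoin1.
  split=> [gx [u [mu su _ ru]]|no].
    have rK0 : (map_poly intr u : {poly K}) != 0 by rewrite map_intr_eq0 monic_neq0.
    have pol : (map_poly intr u : {poly K}) \is a polyOver 1%VS.
      apply/polyOver1P; exists (map_poly intr u); rewrite -map_poly_comp.
      by apply: eq_map_poly => c /=; rewrite scaler_int.
    have := dvdp_leq rK0 (minPoly_dvdp pol ru); rewrite Er !size_map_intr sr su gx -sn prednK //.
    by rewrite ltnn.
  apply/eqP; rewrite -dimv_leqif_eq ?subvf //; apply: contraT => nd; case: no.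
  have lt : (\dim <<1; x>> < n)%N by rewrite sn ltn_neqAle nd dimvS ?subvf.
  exists (r * 'X^(n.-1 - \dim <<1; x>>)); split.
  - by rewrite monicMl ?monicXn.
  - rewrite size_monicM ?monicXn_neq0 ?monic_neq0 ?monicXn // size_polyXn sr addnS /= addSn subnKC //.
    by rewrite -ltnS prednK.
  - move=> i; rewrite coefMXn; case: ifP => // _; apply: leq_trans (rb _) _; rewrite sr /=.
    apply: leq_trans leE; rewrite leq_pexp2l ?addn3 //; apply: leq_trans (ltnW lt) _; by rewrite sn.
  - by rewrite rmorphM /= rootM -Er root_minPoly.
rewrite /generator_test lt0b bsum_gt0P; split=> [[x _]|[x [gx hx]]].
  rewrite muln_gt0 (lt0b (annihilated_of _ E _ _ _ <= 0)%N) (leqNgt (annihilated_of _ E _ _ _) 0) => /andP[/(proj1 (P1 x)) h1 /negP h2]; exists (s x); split=> //.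
  by apply: (gen _ h1).2 => h3; apply: h2; apply: (P2 x).2.
have [q [mq sq qb rq]] := hx.
have [S [sS ES Sb]] := @lagrange_rint K tt x pt q U%:R b.+2%:R gtt mpt Ept mq rq (ler0n _ _) (ler0n _ _) ptz
  (fun (w : algC) rw => root_algC_le mq qb rw).
(* The tested denominator is the derivative of [scaled A p = A pt], so the numerator has to be
   [A S]. *)
have Sb' i : (absz (A%:Z * S`_i)%R <= D)%N.
  apply: leq_trans leD; rewrite abszM absz_nat leq_mul2l; apply/orP; right.
  have := Sb i; rewrite -intr_norm -abszE -pmulrn -[1]/(1%:R) -natrD -natrX -!natrM ler_nat spt.
  move=> h; apply: leq_trans h _; rewrite leq_mul // leq_mul // leq_pexp2l //.
have dlt j : (absz (A%:Z * S`_j + D%:Z)%R < 2 * D + 1)%N by have := Sb' j; move: (A%:Z * _)%R; clear; lia.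
have [y yN yd] := @digits_exist (2 * D + 1) n (fun j => absz (A%:Z * S`_j + D%:Z)%R) (fun j _ => dlt j).
have Ex : s y = x.
  rewrite /s EY EX; have -> : \sum_(j < n) ((digit y D j)%:Z - D%:Z)%:~R * tt ^+ j = A%:R * ev S.
    have p1 : (0 < size p)%N by rewrite -spt; apply: leq_ltn_trans sS.
    have sSn : (size S <= n)%N by rewrite -ltnS /n prednK // -spt.
    rewrite (horner_coef_wide _ (n := n)) ?size_map_intr // mulr_sumr; apply: eq_bigr => j _.
    rewrite coef_map mulrA; congr (_ * _); rewrite /digit yd //.
    have -> : (absz (A%:Z * S`_j + D%:Z)%R)%:Z - D%:Z = A%:Z * S`_j.
      by have := Sb' j; move: (A%:Z * _)%R; clear; lia.
    by rewrite intrM.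
  rewrite -ES; have := natr_neq0 K A0; have := ev_deriv_neq0.
  by move: (ev _) (A%:R) => u a u0 a0; field; rewrite a0 u0.
exists y => //; rewrite muln_gt0 (lt0b (annihilated_of _ E _ _ _ <= 0)%N) (leqNgt (annihilated_of _ E _ _ _) 0); apply/andP; split.
  by apply: (P1 y).2; rewrite -[_ / _]/(s y) Ex.
apply/negP => /(proj1 (P2 y)); rewrite -[_ / _]/(s y) Ex; exact: (gen _ hx).1.
Qed.
End Tests.
End Representation.

(** * The decision procedure *)

Definition input_field (x : nat) := code_nth 0 x.
Definition input_coefs (x : nat) := code_nth 1 x.
(** The denominators in the input are positive and at most its code [x], so they divide this
    factorial. *)
Definition denom (x : nat) := (x`!)%N.
(** Cauchy's bound for the conjugates of the integral generator [tt]. *)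
Definition conj_bound (x : nat) := (x * denom x * denom x ^ x + 1)%N.
Definition digit_bound (b x : nat) := (denom x * (x * (b.+2 * (1 + conj_bound x) ^ x)))%N.
Definition minimal_bound (b : nat) := ((b + 3) ^ b)%N.
(** A sum, so as to dominate at once the bounds for all quantities represented in the tests. *)
Definition rep_bound (b x : nat) :=
  (x * (x * (x * denom x * denom x ^ x * conj_bound x ^ x)) + x * (digit_bound b x * conj_bound x ^ x)
   + x * (x * denom x * denom x ^ x * conj_bound x ^ x) + denom x ^ x)%N.
(** Large enough for [rep_zero] to apply to every relation that is tested. *)
Definition base_point (b x : nat) :=
  ((b + x) * ((b.+1 + minimal_bound b) * rep_bound b x ^ (b + x)) + rep_bound b x ^ (b + x) + conj_bound x + 1)%N.
(** Representing negative coefficients takes a modulus, but [m = pt(B)] is not known beforehand.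
    Therefore [A pt(B)] is computed modulo a number that exceeds it, and then divided by [A]. *)
Definition large_modulus (b x : nat) := (x * (x * denom x * denom x ^ x * base_point b x ^ x) + 2)%N.
Definition modulus (b x : nat) :=
  (eval_of (denom x) (base_point b x) (large_modulus b x) (input_field x) %% large_modulus b x %/ denom x)%N.
Definition all_coefs_test (b x : nat) : nat :=
  (bsum (code_size (input_coefs x)) (fun i =>
    coef_test (modulus b x) (base_point b x) (denom x) b (code_nth i (input_coefs x)) i <= 0) <= 0)%N.
Definition field_test (b x : nat) : nat :=
  generator_test (modulus b x) (base_point b x) (denom x) (digit_bound b x) (minimal_bound b)
    (code_size (input_field x) - 1) b (input_field x).
Definition bounded_test (b x : nat) : nat :=
  ((code_size (input_field x) - 1 <= b) * all_coefs_test b x * field_test b x)%N.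

Lemma comp_coef_test k F1 F2 F3 F4 F5 F6 : comp k F1 -> comp k F2 -> comp k F3 -> comp k F4 ->
  comp k F5 -> comp k F6 -> comp k (fun v => coef_test (F1 v) (F2 v) (F3 v) (F4 v) (F5 v) (F6 v)).
Proof.
move=> c1 c2 c3 c4 c5 c6.
have H : comp 6 (fun v => coef_test (nth 0 v 0) (nth 0 v 1) (nth 0 v 2) (nth 0 v 3) (nth 0 v 4) (nth 0 v 5))%N.
  have c0 i : comp 6 (fun v => nth 0%N v i) by exact: (comp_nth _ 0).
  have ce : comp 6 (fun v => eval_of (nth 0 v 2) (nth 0 v 1) (nth 0 v 0) (nth 0 v 4))%N by apply: comp_eval_of.
  rewrite /coef_test; apply: comp_mul.
    by apply: comp_annihilated_of => //; comp_tac.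
  by apply: comp_add; apply: comp_leq; comp_tac => //; apply: comp_modn.
by apply: (@comp_app k [:: F1; F2; F3; F4; F5; F6] _ H) => -[|[|[|[|[|[|i]]]]]].
Qed.

Lemma comp_bounded_test : comp 2 (fun v => bounded_test (nth 0 v 0) (nth 0 v 1))%N.
Proof.
have up F : comp 2 F -> comp 3 (fun w => F (behead w)).
  move=> c; apply: comp_ext (@comp_app 3 [:: (fun w => nth 0 w 1)%N; (fun w => nth 0 w 2)%N] F c _).
    by case=> [|a [|b [|d [|? ?]]]].
  by case=> [|[|i]] //= _; exact: (comp_nth _ 0 _).
have cx : comp 2 (fun v => nth 0 v 1)%N by exact: (comp_nth _ 0).
have cb : comp 2 (fun v => nth 0 v 0)%N by exact: (comp_nth _ 0).
have cp : comp 2 (fun v => input_field (nth 0 v 1))%N by rewrite /input_field; comp_tac.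
have cc : comp 2 (fun v => input_coefs (nth 0 v 1))%N by rewrite /input_coefs; comp_tac.
have cA : comp 2 (fun v => denom (nth 0 v 1))%N by rewrite /denom; comp_tac.
have cU : comp 2 (fun v => conj_bound (nth 0 v 1))%N.
  by rewrite /conj_bound; do !(exact: cA || exact: cx || comp_tac).
have cD : comp 2 (fun v => digit_bound (nth 0 v 0) (nth 0 v 1))%N.
  by rewrite /digit_bound; apply: comp_mul cA _; apply: comp_mul cx _; apply: comp_mul; comp_tac.
have cE : comp 2 (fun v => minimal_bound (nth 0 v 0))%N by rewrite /minimal_bound; comp_tac.
have cP F : comp 2 F -> comp 2 (fun v => nth 0 v 1 * denom (nth 0 v 1) * denom (nth 0 v 1) ^ nth 0 v 1 * F v ^ nth 0 v 1)%N.
  by move=> cF; repeat first [exact: cA | exact: cx | exact: cF | apply: comp_mul | apply: comp_exp].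
have cH : comp 2 (fun v => rep_bound (nth 0 v 0) (nth 0 v 1))%N.
  rewrite /rep_bound.
  by repeat first [exact: (cP _ cU) | exact: cA | exact: cx | exact: cD | exact: cU | apply: comp_add | apply: comp_mul | apply: comp_exp].
have cB : comp 2 (fun v => base_point (nth 0 v 0) (nth 0 v 1))%N.
  rewrite /base_point.
  by repeat first [exact: cH | exact: cE | exact: cU | exact: cx | exact: cb | exact: comp_const | apply: comp_add
    | apply: comp_mul | apply: comp_exp | apply: comp_succ].
have cM' : comp 2 (fun v => large_modulus (nth 0 v 0) (nth 0 v 1))%N.
  by rewrite /large_modulus; apply: comp_add _ (comp_const _ _); apply: comp_mul cx _; apply: cP cB.
have cM : comp 2 (fun v => modulus (nth 0 v 0) (nth 0 v 1))%N.
  by rewrite /modulus; apply: (comp_divn _ cA); apply: (comp_modn _ cM'); exact: (comp_eval_of cA cB cM' cp).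
have cn : comp 2 (fun v => code_size (input_field (nth 0 v 1)) - 1)%N.
  by apply: comp_sub _ (comp_const _ _); apply: comp_code_size.
have cn3 k F : comp k F -> comp k (fun v => nat_of_bool (F v <= 0)%N) by move=> c; apply: comp_leq c (comp_const _ _).
rewrite /bounded_test; apply: comp_mul; first apply: comp_mul; first exact: comp_leq.
- rewrite /all_coefs_test; apply: (@cn3 _ _); apply: comp_bsum; first exact: comp_code_size.
  apply: (@cn3 _ _); apply: comp_coef_test; [exact: (up _ cM) | exact: (up _ cB) | exact: (up _ cA) | exact: (up _ cb) | | exact: (comp_head _ 0)].
  by apply: comp_code_nth; [exact: (comp_head _ 0) | exact: (up _ cc)].
- rewrite /field_test /generator_test; apply: comp_leq (comp_const _ _) _; apply: comp_bsum.
    by apply: comp_exp _ cn; apply: comp_add _ (comp_const _ _); apply: comp_mul (comp_const _ _) cD.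
  have cX : comp 3 (fun w => digits_of (modulus (nth 0 (behead w) 0) (nth 0 (behead w) 1)) (head 0 w)
      (digit_bound (nth 0 (behead w) 0) (nth 0 (behead w) 1)) (code_size (input_field (nth 0 (behead w) 1)) - 1)
      (base_point (nth 0 (behead w) 0) (nth 0 (behead w) 1)) 1)%N.
    by apply: comp_digits_of; [exact: (up _ cM) | exact: (comp_head _ 0) | exact: (up _ cD) | exact: (up _ cn) | exact: (up _ cB) | exact: comp_const].
  have cY : comp 3 (fun w => deriv_of (denom (nth 0 (behead w) 1)) (base_point (nth 0 (behead w) 0) (nth 0 (behead w) 1))
      (modulus (nth 0 (behead w) 0) (nth 0 (behead w) 1)) (input_field (nth 0 (behead w) 1)))%N.
    by apply: comp_deriv_of; [exact: (up _ cA) | exact: (up _ cB) | exact: (up _ cM) | exact: (up _ cp)].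
  apply: comp_mul; first by apply: comp_annihilated_of _ _ _ cX cY; [exact: (up _ cM) | apply: comp_succ; exact: (up _ cb) | exact: (up _ cb)].
  by apply: (@cn3 _ _); apply: comp_annihilated_of _ _ _ cX cY; [exact: (up _ cM) | exact: (up _ cE) | apply: comp_pred; exact: (up _ cn)].
Qed.

Lemma scaledE A (q : {poly rat}) : scaled A q =
  \poly_(j < size q) (numq q`_j * (A %/ absz (denq q`_j))%:Z * (A ^ (size q - j.+1))%:Z).
Proof. by rewrite poly_def; apply: eq_bigr => j _; rewrite -mul_polyC !polyCM. Qed.

(** For a monic [q] of degree [n] this is [A^n q(X / A)]; if [q] is the minimal polynomial of [t],
    it is that of [A t]. *)
Definition integral_scaled (A : nat) (q : {poly rat}) : {poly int} :=
  \poly_(j < size q) (if (j < (size q).-1)%N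
    then numq q`_j * (A %/ absz (denq q`_j))%:Z * (A ^ ((size q).-1 - j.+1))%:Z else 1).

Section IntegralScaled.
Variables (A : nat) (q : {poly rat}).
Hypothesis mq : q \is monic.

Lemma size_integral_scaled : size (integral_scaled A q) = size q.
Proof. by apply: size_poly_eq; rewrite ltnn oner_eq0. Qed.

Lemma monic_integral_scaled : integral_scaled A q \is monic.
Proof.
have q0 : (0 < size q)%N by rewrite size_poly_gt0 monic_neq0.
by rewrite monicE lead_coefE size_integral_scaled coef_poly ltn_predL q0 ltnn.
Qed.

Lemma scaled_integral : scaled A q = A%:Z *: integral_scaled A q.
Proof.
have q0 : (0 < size q)%N by rewrite size_poly_gt0 monic_neq0.
apply/polyP => i; rewrite scaledE coefZ !coef_poly; case: (ltnP i (size q)) => iq; last by rewrite mulr0.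
case: ltnP => ip.
  have -> : (size q - i.+1 = ((size q).-1 - i.+1).+1)%N by rewrite -subSn // prednK.
  by rewrite expnS PoszM; ring.
have -> : i = (size q).-1 by apply/eqP; rewrite eqn_leq ip andbT -ltnS prednK.
have -> : q`_(size q).-1 = 1 by have := monicP mq; rewrite lead_coefE.
have -> : numq 1 = 1 by []. have -> : denq 1 = 1 by [].
by rewrite prednK // subnn expn0 divn1 mul1r !mulr1.
Qed.

Lemma integral_scaled_le I i : (0 < A)%N -> (size q <= I)%N -> (0 < I)%N -> (forall j, (absz (numq q`_j) <= I)%N) ->
  (absz ((integral_scaled A q)`_i)%R <= I * A * A ^ I)%N.
Proof.
move=> A0 sq I0 nI; rewrite coef_poly; case: ifP => // iq; case: ifP => ip; last by rewrite !muln_gt0 I0 A0 expn_gt0 A0.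
rewrite !abszM !absz_nat !leq_mul ?leq_div // leq_pexp2l // (leq_trans (leq_subr _ _)) //.
by apply: leq_trans (leq_pred _) sq.
Qed.
End IntegralScaled.

Lemma scaled_horner_le A I B (q : {poly rat}) : (0 < A)%N -> (0 < B)%N -> (size q <= I)%N ->
  (forall j, (absz (numq q`_j) <= I)%N) -> (absz ((scaled A q).[B%:Z])%R <= I * (I * A * A ^ I * B ^ I))%N.
Proof.
move=> A0 B0 sq nI; rewrite horner_sum; apply: leq_trans (_ : \sum_(j < size q) (I * A * A ^ I * B ^ I) <= _)%N; last first.
  by rewrite sum_nat_const card_ord leq_mul2r sq orbT.
rewrite -lez_nat abszE; apply: le_trans (ler_norm_sum _ _ _) _.
rewrite (big_morph Posz PoszD (erefl _)).
apply: ler_sum => j _; rewrite -abszE lez_nat !hornerM !hornerC hornerXn !abszM !absz_nat abszX absz_nat.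
have jI : (j <= I)%N by apply: leq_trans sq; apply: ltnW.
rewrite !leq_mul ?leq_div // leq_pexp2l // (leq_trans (leq_subr _ _)) //.
Qed.

Lemma base_pointP b I N off (H := rep_bound b I) : (0 < I)%N -> (N <= b + I)%N -> (off <= b.+1 + minimal_bound b)%N ->
  (N * (off * H ^ N) + H ^ N + conj_bound I < base_point b I)%N.
Proof.
move=> I0 NI oE; have H0 : (0 < H)%N by rewrite /H /rep_bound addn_gt0 expn_gt0 /denom fact_gt0 !orbT.
rewrite /base_point addn1 ltnS leq_add2r leq_add ?leq_mul ?leq_pexp2l //.
Qed.

(** The splitting field of [p] receives [K]; it serves to measure conjugates in the proof that the
    tests are correct. *)
Lemma presented_model (R : realType) (K : fieldExtType rat) (t : K) (p : {poly rat}) :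
  <<1; t>>%VS = fullv -> minPoly 1 t = map_poly (in_alg K) p ->
  exists (L : splittingFieldType rat) (phi : {rmorphism L -> R[i]}) (io : {rmorphism K -> L}), galois 1 {:L}.
Proof.
move=> gt Ep; have mp : p \is monic by rewrite -(map_monic (in_alg K)) -Ep monic_minPoly.
have [L [f1 [rs [galL _ Ers]]]] := splitting_field_exists mp.
have [phi _] := embedding_exists L R[i].
have rs0 : (0 < size rs)%N.
  by rewrite -ltnS -(size_prod_XsubC rs id) -Ers size_map_poly -(size_map_poly (in_alg K)) -Ep size_minPoly ltnS -dim_adjoin1 adim_gt0.
case: rs rs0 Ers => // r rs _ Ers.
have [io _] : exists io : {rmorphism K -> L}, io t = r.
  apply: (@embedding_root _ L (in_alg L)) => // q rq.
  have : p %| q.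
    rewrite -(dvdp_map (in_alg K)) -Ep; apply: minPoly_dvdp => //; by apply/polyOver1P; exists q.
  rewrite -(dvdp_map (in_alg L)) => /root_dvdp; apply.
  by rewrite Ers root_prod_XsubC mem_head.
by exists L, phi, io.
Qed.

Lemma bounded_testP (R : realType) (K : fieldExtType rat) (f : {poly K}) p cs b : presents f p cs ->
  (0 < bounded_test b (code_input p cs))%N <-> bounded_data f b.
Proof.
move=> [t [gt Ept Ef]].
have [L [phi [io galL]]] := presented_model R gt Ept.
have mp : p \is monic by rewrite -(map_monic (in_alg K)) -Ept monic_minPoly.
have spd : (size p).-1 = \dim {:K} by rewrite -(size_map_poly (in_alg K)) -Ept size_minPoly /= -dim_adjoin1 gt.
have [I EI] : exists I, I = code_input p cs by exists (code_input p cs).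
have fE : input_field I = code_poly p by rewrite EI /input_field code_nthE.
have cE : input_coefs I = CodeSeq.code (map code_poly cs) by rewrite EI /input_coefs code_nthE.
have inI x : x \in [:: code_poly p; CodeSeq.code (map code_poly cs)] -> (x < I)%N.
  by move=> xi; rewrite EI; have /allP := CodeSeq.ltn_code [:: code_poly p; CodeSeq.code (map code_poly cs)]; apply.
have cp : (code_poly p <= I)%N by apply/ltnW/inI/mem_head.
have I0 : (0 < I)%N by apply: leq_trans (inI _ (mem_head _ _)).
have cc c : c \in cs -> (code_poly c <= I)%N.
  move=> ccs; apply: ltnW; apply: ltn_trans (inI _ (mem_last _ [:: _])) => /=.
  by have /allP := CodeSeq.ltn_code (map code_poly cs); apply; apply: map_f.
have [b00|b0] := posnP b.
  rewrite -EI /bounded_test fE code_sizeE size_map subn1 spd b00.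
  have nd : (\dim {:K} <= 0)%N = false by rewrite leqNgt adim_gt0.
  by rewrite nd !mul0n; split=> // -[]; rewrite nd.
rewrite -EI /bounded_test /all_coefs_test /field_test fE cE !code_sizeE !size_map subn1 {1}spd.
have A0 : (0 < denom I)%N by apply: fact_gt0.
have HB := base_pointP (b := b) I0.
have [sp nI dA] := code_poly_bound cp; rewrite -/(denom I) in dA.
have bcs c : c \in cs -> (size c <= I)%N /\ ((forall j, (absz (numq c`_j) <= I)%N) /\ (forall j, (absz (denq c`_j) %| denom I)%N)).
  by move=> /cc /code_poly_bound[].
pose pt := integral_scaled (denom I) p.
have mpt : pt \is monic by apply: monic_integral_scaled.
have spt : size pt = size p by apply: size_integral_scaled.
have Ep : scaled (denom I) p = (denom I)%:Z *: pt by apply: scaled_integral.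
have ptC i : (absz (pt`_i)%R <= I * denom I * denom I ^ I)%N by apply: integral_scaled_le.
have EU : conj_bound I = (I * denom I * denom I ^ I).+1 by rewrite /conj_bound addn1.
have UB : (conj_bound I < base_point b I)%N by rewrite /base_point addn1 ltnS leq_addl.
have eM : modulus b I = (eval_of (denom I) (base_point b I) (large_modulus b I) (code_poly p) %% large_modulus b I %/ denom I)%N.
  by rewrite /modulus fE.
have EM : large_modulus b I = (I * (I * denom I * denom I ^ I * base_point b I ^ I) + 2)%N by [].
have hD : (denom I * (I * (b.+2 * (1 + conj_bound I) ^ I)) <= digit_bound b I)%N by [].
have hE : ((b + 3) ^ b <= minimal_bound b)%N by [].
have hE0 : (0 < minimal_bound b)%N by rewrite /minimal_bound expn_gt0 addn3.
have [H1 [H2 [H3 H4]]] : (I * (I * (I * denom I * denom I ^ I * conj_bound I ^ I)) <= rep_bound b I)%N /\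
    ((I * (digit_bound b I * conj_bound I ^ I) <= rep_bound b I)%N /\
    ((I * (I * denom I * denom I ^ I * conj_bound I ^ I) <= rep_bound b I)%N /\ (denom I ^ I <= rep_bound b I)%N)).
  rewrite /rep_bound; split; first by rewrite -!addnA leq_addr.
  split; first by rewrite -!addnA addnCA leq_addr.
  by split; [rewrite -addnA addnCA leq_addr | rewrite leq_addl].
(* From here on these numbers are only known through the relations collected above. *)
move: (modulus b I) (large_modulus b I) (base_point b I) (rep_bound b I) (digit_bound b I) (minimal_bound b) (conj_bound I)
  (denom I) @pt => m M' B H D E U A pt in A0 HB dA bcs mpt spt Ep ptC EU UB eM EM hD hE hE0 H1 H2 H3 H4 *.
have AK := natr_neq0 K A0.
pose tt := A%:R * t.
have gtt : <<1; tt>>%VS = fullv.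
  apply/eqP; rewrite eqEsubv subvf /= -gt; apply/FadjoinP; split; first exact: sub1v.
  have -> : t = (A%:R^-1 : rat) *: tt.
    have Ea : (A%:R^-1 : rat)%:A = A%:R^-1 :> K by rewrite -[LHS]/(in_alg K A%:R^-1) fmorphV rmorph_nat.
    by rewrite -mulr_algl Ea /tt mulKf.
  by apply: memvZ; apply: memv_adjoin.
have pt0 : (map_poly intr pt).[tt] = 0.
  have EX := @ev_scaled K tt A p A0 dA t erefl.
  have pr : (map_poly (in_alg K) p).[t] = 0 by rewrite -Ept minPolyxx.
  move: EX; rewrite pr mulr0 Ep -mul_polyC rmorphM /= map_polyC hornerM hornerC => /eqP.
  by rewrite mulf_eq0 (negPf AK) => /eqP.
have Eptt : minPoly 1 tt = map_poly intr pt.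
  have dv : minPoly 1 tt %| map_poly intr pt.
    apply: minPoly_dvdp; last by rewrite rootE pt0.
    apply/polyOver1P; exists (map_poly intr pt); rewrite -map_poly_comp.
    by apply: eq_map_poly => c /=; rewrite scaler_int.
  apply/eqP; rewrite -eqp_monic ?monic_minPoly ?monic_map // -dvdp_size_eqp // size_minPoly -dim_adjoin1 gtt.
  by rewrite size_map_intr spt -spd prednK // size_poly_gt0 monic_neq0.
have U0 : (0 < U)%N by rewrite EU.
have ttU g : av phi g (io tt) <= U%:R.
  rewrite EU -natr1 addrC; apply: (absval_root_le (avP phi g) (p := map_poly intr pt)); first exact: monic_map.
    have rt : root (map_poly intr pt) tt by rewrite rootE pt0.
    by move: rt; rewrite -(fmorph_root io) -map_poly_comp; congr root; apply: eq_map_poly => c /=; rewrite rmorph_int.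
  move=> i; rewrite coef_map; apply: le_trans (absval_int_le (avP phi g) _) _.
  by rewrite -abszE -pmulrn ler_nat.
(* [pt(B) > 1] because [pt - 1] is monic with small coefficients. As [A pt(B)] is below the large
   modulus, its residue is the number itself. *)
have [m1 mE] : (1 < m)%N /\ m%:Z = pt.[B%:Z].
  have B0 : (0 < B)%N by apply: leq_ltn_trans UB.
  have gt1 : 1 < pt.[B%:Z].
    have s2 : (1 < size pt)%N by rewrite spt -(prednK (_ : 0 < size p)%N) ?size_poly_gt0 ?monic_neq0 // ltnS spd adim_gt0.
    have mp1 : pt - 1%:P \is monic.
      by rewrite monicE lead_coefDl ?(monicP mpt) // size_polyN size_polyC oner_eq0.
    have := monic_horner_gt0 (p := pt - 1%:P) (C := U) mp1 _ UB; rewrite hornerD hornerN hornerC subr_gt0; apply.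
    move=> i; rewrite coefB coefC; have := ptC i; rewrite EU; move: (pt`_i) => c.
    by case: (i == 0%N); move: (_ * _)%N => w; clear; lia.
  have M1 : (1 < M')%N by rewrite EM addn2.
  have [h _] : @rep R K L phi io tt M' B (eval_of A B M' (code_poly p)) (scaled A p) (I * (I * A * A ^ I * U ^ I)).
    by eapply rep_eval; eassumption.
  have := scaled_horner_le A0 B0 sp nI; move: h gt1; rewrite Ep hornerZ.
  case: (pt.[B%:Z]) => // w; rewrite -PoszM absz_nat => h; rewrite ltz_nat => gt1 le.
  suff -> : m = w by [].
  rewrite eM; have -> : (eval_of A B M' (code_poly p) %% M' = A * w)%N.
    move: h; rewrite -eqz_mod_dvd !modz_nat eqz_nat => /eqP ->.
    by rewrite modn_small // EM addn2 ltnS leqW.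
  by rewrite mulKn.
have HB' N off : (N <= b + I)%N -> (off <= b.+1 + E)%N -> (N * (off * H ^ N) + H ^ N + U < B)%N by move=> *; apply: HB.
have ptz (z : algC) : root (map_poly intr pt) z -> `|z| <= U%:R.
  by rewrite EU; apply: root_algC_le.
have CT (c : {poly rat}) i : c \in cs -> (0 < coef_test m B A b (code_poly c) i)%N <->
    annihilated (map_poly (in_alg K) c).[t] b /\ ((b <= i)%N -> (map_poly (in_alg K) c).[t] = 0).
  by move=> /bcs bc; eapply coef_testP; try eassumption; reflexivity.
have GT : (\dim {:K} <= b)%N -> (0 < generator_test m B A D E (size p).-1 b (code_poly p))%N <->
    exists s : K, <<1; s>>%VS = fullv /\ annihilated s b.
  by move=> nb; eapply generator_testP; try eassumption; try reflexivity; split.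
have fi i : (i < size cs)%N -> f`_i = (map_poly (in_alg K) cs`_i).[t].
  by move=> ics; rewrite Ef coef_Poly (nth_map 0).
have fi0 i : (size cs <= i)%N -> f`_i = 0 by move=> ics; rewrite Ef coef_Poly nth_default // size_map.
have ann0 : annihilated (0 : K) b.
  exists 'X^b; split; rewrite ?monicXn ?size_polyXn //; last by rewrite map_polyXn rootE hornerXn expr0n (gtn_eqF b0).
  by move=> i; rewrite coefXn; case: eqP.
have coefsP : (0 < (bsum (size cs) (fun i => coef_test m B A b (code_nth i (CodeSeq.code (map code_poly cs))) i <= 0) <= 0))%N <->
    (size f <= b)%N /\ forall i, annihilated f`_i b.
  rewrite lt0b leqNgt; split=> [/negP no|[sf af]].
    have H0 i : (i < size cs)%N -> annihilated f`_i b /\ ((b <= i)%N -> f`_i = 0).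
      move=> ics; rewrite fi //; apply/CT; first exact: mem_nth.
      rewrite ltnNge; apply/negP => le; apply: no; apply/bsum_gt0P; exists i => //.
      by rewrite lt0b code_nthE (nth_map 0).
    split=> [|i]; last by have [/H0[]|/fi0 ->] := ltnP i (size cs).
    by apply/leq_sizeP => i bi; have [/H0[_]|/fi0] := ltnP i (size cs); last by []; apply.
  apply/negP => /bsum_gt0P[i ics]; rewrite lt0b code_nthE (nth_map 0) // leqNgt => /negP; apply.
  apply/CT; first exact: mem_nth.
  by rewrite -fi //; split=> // bi; apply: (leq_sizeP _ _ sf).
rewrite !muln_gt0 lt0b; split=> [/andP[/andP[nb /coefsP[sf af]] /(GT nb) gn]|[nb sf gn af]]; first by split.
by rewrite nb /=; apply/andP; split; [apply/coefsP | apply/(GT nb)].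
Qed.

(** * The least bound and the constant *)

Lemma annihilated_mulX (K : fieldExtType rat) (x : K) (r : {poly int}) d b : r \is monic -> size r = d.+1 ->
  (d <= b)%N -> (forall i, (absz (r`_i)%R <= b.+1)%N) -> root (map_poly intr r) x -> annihilated x b.
Proof.
move=> mr sr db rb rx; exists (r * 'X^(b - d)); split.
- by rewrite monicMl ?monicXn.
- rewrite size_monicM ?monic_neq0 ?monicXn // size_polyXn sr addnS /= addSn subnKC //.
- by move=> i; rewrite coefMXn; case: ifP.
- by rewrite rmorphM /= rootM rx.
Qed.

Lemma annihilated_mono (K : fieldExtType rat) (x : K) b b' : (b <= b')%N -> annihilated x b -> annihilated x b'.
Proof.
move=> le [r [mr sr rb rx]]; apply: (annihilated_mulX mr sr le _ rx) => i.
by apply: leq_trans (rb i) _; rewrite ltnS.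
Qed.

Lemma annihilated_exists (K : fieldExtType rat) (x : K) : ring_of_integers x -> exists b, annihilated x b.
Proof.
move=> [r mr rx]; have sr : size r = (size r).-1.+1 by rewrite prednK // size_poly_gt0 monic_neq0.
exists ((size r).-1 + \sum_(i < size r) absz (r`_i)%R)%N.
apply: (annihilated_mulX mr sr (leq_addr _ _) _ rx) => i.
have [ir|ir] := ltnP i (size r); last by rewrite nth_default.
apply: leqW; apply: leq_trans (leq_addl _ _); rewrite (bigD1 (Ordinal ir)) //=; exact: leq_addr.
Qed.

Lemma bounded_data_exists (K : fieldExtType rat) (f : {poly K}) : integral_coefs f -> exists b, bounded_data f b.
Proof.
move=> Of; have [s Os gs] := primitive_rint_exists K; have [b0 h0] := annihilated_exists Os.
have [b1 h1] : exists b1, forall i, (i < (size f).+1)%N -> annihilated f`_i b1.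
  elim: (size f).+1 => [|n [b1 h1]]; first by exists 0%N.
  have [b2 h2] := annihilated_exists (Of n); exists (b1 + b2)%N => i.
  rewrite ltnS leq_eqVlt => /orP[/eqP ->|/h1 h]; first exact: (annihilated_mono (leq_addl _ _) h2).
  exact: (annihilated_mono (leq_addr _ _) h).
exists (\dim {:K} + size f + b0 + b1)%N; split.
- by rewrite -!addnA leq_addr.
- by rewrite -!addnA addnCA leq_addr.
- by exists s; split=> //; apply: annihilated_mono h0; rewrite -addnA addnCA leq_addr.
- move=> i; apply: (annihilated_mono (leq_addl _ _)); have [le|lt] := leqP i (size f); first exact: h1.
  rewrite nth_default ?(ltnW lt) //; have := h1 (size f) (ltnSn _); by rewrite nth_default.
Qed.

Lemma least_exists (P : nat -> Prop) : (exists n, P n) -> exists n, P n /\ forall m, P m -> (n <= m)%N.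
Proof.
move=> [n Pn]; have ex : exists n, `[< P n >] by exists n; apply/asboolP.
by case: (ex_minnP ex) => m /asboolP Pm min; exists m; split=> // k Pk; apply: min; apply/asboolP.
Qed.

(** An invariant of [(K, f)], whichever presentation is given; minimization over [bounded_test]
    finds it. *)
Definition least_data (K : fieldExtType rat) (f : {poly K}) : nat :=
  xget 0%N [set b | bounded_data f b /\ forall b', bounded_data f b' -> (b <= b')%N].

Lemma least_dataP (K : fieldExtType rat) (f : {poly K}) : integral_coefs f ->
  bounded_data f (least_data f) /\ forall b', bounded_data f b' -> (least_data f <= b')%N.
Proof.
move=> Of; have [b hb] := least_exists (bounded_data_exists Of).
exact: (@xgetPex _ 0%N [set b | bounded_data f b /\ forall b', bounded_data f b' -> (b <= b')%N] (ex_intro _ b hb)).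
Qed.

Lemma dyadic_approximation (R : realType) Z n : (0 < Z)%N ->
  `|Z%:R^-1 - (2 ^ n %/ Z)%N%:R / 2 ^+ n| <= 2 ^- n :> R.
Proof.
move=> Z0; have e := divn_eq (2 ^ n) Z; have rZ := ltn_pmod (2 ^ n) Z0.
move: (2 ^ n %/ Z)%N (2 ^ n %% Z)%N e rZ => q r e rZ.
have eR : 2 ^+ n = q%:R * Z%:R + r%:R :> R by rewrite -natrX e natrD natrM.
have Zp : 0 < Z%:R :> R by rewrite ltr0n.
have Tp : 0 < 2 ^+ n :> R by rewrite exprn_gt0.
have -> : Z%:R^-1 - q%:R / 2 ^+ n = (r%:R / Z%:R) * 2 ^- n :> R.
  have -> : r%:R = 2 ^+ n - q%:R * Z%:R :> R by rewrite eR addrC addKr.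
  move: (2 ^+ n) (Z%:R) (q%:R) Tp Zp => T z x T0 z0; by field; rewrite !gt_eqF.
rewrite ger0_norm ?mulr_ge0 ?invr_ge0 ?ler0n ?(ltW Tp) //.
by rewrite ler_piMl ?invr_ge0 ?(ltW Tp) // ler_pdivrMr // mul1r ler_nat ltnW.
Qed.

Theorem theorem2p5 (R : realType) :
  exists c6 : (forall K : fieldExtType rat, {poly K} -> R),
    effectively_computable (@admissible) c6 /\
    forall (K : fieldExtType rat) (f : {poly K}),
      integral_coefs f ->
      at_least_n_distinct_roots 3 f ->
      zero_not_periodic f ->
      0 < c6 K f /\
      let k (m : nat) (alpha : K) : int :=
        Num.floor (c6 K f * ln (lambda R (poly_iter f m).[alpha])) in
      forall (m : nat) (alpha : K),
        (0 < m)%N ->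
        ring_of_integers alpha ->
        ~ is_unit (poly_iter f m).[alpha] ->
        exists P : set K,
          [/\ prime_ideal P,
              ideal_divides P (poly_iter f m).[alpha]
            & forall j : nat,
                Num.max 0 (m%:Z - k m alpha) <= j%:Z ->
                (j < m)%N ->
                ~ ideal_divides P (poly_iter f j).[alpha]].
Proof.
exists (fun K f => (denominator (least_data f))%:R^-1); split.
  have [eG hG] : comp 3 (fun v => nat_of_bool (bounded_test (nth 0 v 0) (nth 0 v 1) <= 0))%N.
    apply: comp_leq (comp_const _ _).
    by apply: (comp_comp2 comp_bounded_test); exact: (comp_nth _ 0).
  have [eF hF] : comp 2 (fun v => 2 ^ nth 0 v 1 %/ denominator (nth 0 v 0))%N by rewrite /denominator; comp_tac.
  (* [mr_min] looks for a zero, so [eG] computes the negation of the test. *)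
  exists (mr_comp eF [:: mr_min eG; mr_proj 1]) => K f [Of _ _] p cs pres n.
  have [bd min] := least_dataP Of; set b := least_data f in bd min *.
  have T b' := bounded_testP R b' pres; set I := code_input p cs in T *.
  exists (2 ^ n %/ denominator b)%N; last exact: dyadic_approximation.
  apply: (@ev_comp _ _ _ [:: b; n]); last exact: (hF [:: b; n]).
  apply: evs_cons; last by apply: evs_cons; [apply: ev_proj | apply: evs_nil].
  apply: ev_min => [|i ib].
    have := hG [:: b; I; n] erefl; rewrite /= leqNgt.
    by have -> : (0 < bounded_test b I)%N by apply/T.
  exists 0%N; have := hG [:: i; I; n] erefl; rewrite /= leqNgt.
  have -> : (0 < bounded_test i I)%N = false; last by [].
  by apply/negP => /T /min; rewrite leqNgt ib.
move=> K f Of roots3 np; have [bd _] := least_dataP Of; set b := least_data f in bd *.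
have Z0 : 0 < (denominator b)%:R :> R by rewrite ltr0n.
split; first by rewrite invr_gt0.
move=> k m alpha m0 Oa nu; set gamma := (poly_iter f m).[alpha] in nu *.
have lam1 : 1 <= lambda R gamma by rewrite /lambda /log_star le_max lexx orbT.
have lnl0 : 0 <= ln (lambda R gamma) by apply: ln_ge0.
have k0 : 0 <= k m alpha by rewrite /k floor_ge0 mulr_ge0 // invr_ge0 ltW.
have Ek : (absz (k m alpha))%:Z = k m alpha by rewrite gez0_abs.
have kle : (absz (k m alpha))%:R * (denominator b)%:R <= ln (lambda R gamma).
  have : (k m alpha)%:~R <= (denominator b)%:R^-1 * ln (lambda R gamma) by apply: floor_le_tmp.
  by rewrite mulrC ler_pdivlMr // -Ek.
have [|g0|P [prP dvP ndP]] := @new_prime_divisor R K f b bd roots3 np (absz (k m alpha)) m alpha m0 Oa nu.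
- by move=> _; rewrite natrM mulrC.
(* The height of [0] is [0], so [lambda] is [1] and its logarithm vanishes. *)
- have : k m alpha = 0.
    have h0 : height R gamma = 0.
      rewrite -/gamma in g0; rewrite g0 /height.
      have -> : \sum_(s \in @embeddings K R) ln (Num.max 1 (Normc.normc (s 0))) = 0 :> R.
        rewrite fsbig1 // => s [h ->]; rewrite rmorph0 Normc.normc0 max_l ?ler01 // ln1 //.
      have -> : \sum_(P \in prime_ideal (K:=K)) ln (Num.max 1 (padic_abs R P 0)) = 0 :> R.
        by rewrite fsbig1 // => P _; rewrite /padic_abs eqxx max_l ?ler01 // ln1.
      by rewrite addr0 mulr0.
    by rewrite /k -/gamma /lambda h0 /log_star (ln0 (lexx 0)) max_r ?ler01 // ln1 mulr0 floor0.
  by move=> ->.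
exists P; split=> // j; rewrite ge_max => /andP[_ hj] jm; apply: ndP => //.
by move: hj; rewrite -Ek; clear; lia.
Qed.
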